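(* Let $\varphi\colon R\to S$ be a homomorphism of commutative Noetherian rings and let $C,X$ be homologically degreewise finite $R$-complexes with $C$ semidualizing. If $\varphi$ is module-finite with $\operatorname{fd}_R(S)<\infty$ and $\mathrm{m\text{-}Spec}(R)\subseteq\operatorname{Im}(\varphi^* )$, then \begin{align*} \mathrm{G}_{\mathbf R\mathrm{Hom}_R(S,C)}\text{-}\dim_S(\mathbf R\mathrm{Hom}_R(S,X)) &\leq\mathrm{G}_{C}\text{-}\dim_R(X)\\ &\leq\mathrm{G}_{\mathbf R\mathrm{Hom}_R(S,C)}\text{-}\dim_S(\mathbf R\mathrm{Hom}_R(S,X))+\operatorname{pd}_R(S). \end{align*} Thus, $\mathbf R\mathrm{Hom}_R(S,X)$ is $\mathbf R\mathrm{Hom}_R(S,C)$-reflexive if and only if $X$ is $C$-reflexive. If either $R$ is local or $\operatorname{amp}(C)=0$, then the second inequality is an equality.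
   Context: Complexes are indexed homologically; $\mathsf D(R)$ is the derived category. $\inf(X)$ and $\sup(X)$ are the infimum and supremum of $\{i\mid\operatorname{H}_i(X)\neq0\}$, and $\operatorname{amp}(X)=\sup(X)-\inf(X)$. A complex is homologically finite (respectively, homologically degreewise finite) if its total homology (respectively, each homology module) is finitely generated; it is homologically bounded if $\operatorname{H}_i=0$ for all but finitely many $i$. $\varphi$ is module-finite if $S$ is a finitely generated $R$-module. $\varphi^*\colon\operatorname{Spec}(S)\to\operatorname{Spec}(R)$ is the induced map, $\mathrm{m\text{-}Spec}(R)$ the set of maximal ideals of $R$. $\operatorname{fd}_R$, $\operatorname{pd}_R$ denote flat and projective dimension. An $R$-complex $C$ is semidualizing if it is homologically finite and the homothety morphism $R\to\mathbf R\mathrm{Hom}_R(C,C)$ is an isomorphism in $\mathsf D(R)$. For $C$ semidualizing, an $R$-complex $X$ is $C$-reflexive if it is homologically finite, $\mathbf R\mathrm{Hom}_R(X,C)$ is homologically bounded, and the biduality morphism $X\to\mathbf R\mathrm{Hom}_R(\mathbf R\mathrm{Hom}_R(X,C),C)$ is an isomorphism in $\mathsf D(R)$. Set $\mathrm{G}_{C}\text{-}\dim_R(X)=\inf(C)-\inf(\mathbf R\mathrm{Hom}_R(X,C))$ if $X$ is $C$-reflexive, and $\infty$ otherwise. Under the hypotheses $\mathbf R\mathrm{Hom}_R(S,C)$, viewed as an $S$-complex, is semidualizing over $S$, so the dimension over $S$ is defined. *)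

(* Defs.v *)
From HB Require Import structures.
From mathcomp Require Export all_boot all_order all_algebra.
From mathcomp Require Export boolp classical_sets constructive_ereal.

Set Implicit Arguments.
Unset Strict Implicit.
Unset Printing Implicit Defensive.
Import Order.TTheory GRing.Theory Num.Theory.
Local Open Scope classical_set_scope.
Local Open Scope ring_scope.

Section Rings.
Variable R : comPzRingType.

Definition is_ideal (I : set R) : Prop :=
  [/\ I 0, forall x y, I x -> I y -> I (x + y) & forall a x, I x -> I (a * x)].

Definition prime_ideal (p : set R) : Prop :=
  [/\ is_ideal p, ~ p 1 & forall x y, p (x * y) -> p x \/ p y].

Definition maximal_ideal (m : set R) : Prop :=
  [/\ is_ideal m, ~ m 1 &
      forall J, is_ideal J -> ~ J 1 -> m `<=` J -> J = m].

Definition noetherian : Prop := forall I : set R, is_ideal I ->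
  exists (n : nat) (g : 'I_n -> R),
    I = [set x | exists a : 'I_n -> R, x = \sum_k a k * g k].

Definition local_ring : Prop := exists! m : set R, maximal_ideal m.
End Rings.

Section LinearMaps.
Variable R : comPzRingType.

Definition mklin (U V : lmodType R) (f : U -> V) (Hf : linear f) :
    {linear U -> V} :=
  HB.pack f (GRing.isLinear.Build R U V *:%R f Hf).

Lemma linear_eq (U V : lmodType R) (f g : {linear U -> V}) : f =1 g -> f = g.
Proof.
case: f g => [f [[af] [bf]]] [g [[ag] [bg]]] /= /funext fg.
move: af bf ag bg; rewrite /= in fg; rewrite fg => af bf ag bg.
by congr (GRing.Linear.Pack (GRing.Linear.Class _ _)); congr (_ _);
   apply: Prop_irrelevance.
Qed.
End LinearMaps.

Section Modules.
Variable R : comPzRingType.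

Definition bilinear (A M T : lmodType R) (b : A -> M -> T) : Prop :=
  (forall m, linear (b^~ m)) /\ (forall a, linear (b a)).

Definition is_tensor (A M T : lmodType R) (b : A -> M -> T) : Prop :=
  bilinear b /\
  forall (P : lmodType R) (c : A -> M -> P), bilinear c ->
    exists! h : {linear T -> P}, forall a m, h (b a m) = c a m.

(* Tensoring with M preserves injectivity; the tensor products A (x) M and
   B (x) M are given by their universal property, and w is u (x) M. *)
Definition flat (M : lmodType R) : Prop :=
  forall (A B : lmodType R) (u : {linear A -> B}), injective u ->
  forall (TA TB : lmodType R) (bA : A -> M -> TA) (bB : B -> M -> TB),
    is_tensor bA -> is_tensor bB ->
  forall w : {linear TA -> TB}, (forall a m, w (bA a m) = bB (u a) m) ->
  injective w.

Definition projective (P : lmodType R) : Prop :=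
  forall (A B : lmodType R) (p : {linear A -> B}) (f : {linear P -> B}),
    (forall y, exists x, p x = y) ->
  exists g : {linear P -> A}, forall x, p (g x) = f x.

Definition finitely_generated (M : lmodType R) : Prop :=
  exists (n : nat) (g : 'I_n -> M),
    forall x, exists a : 'I_n -> R, x = \sum_k a k *: g k.
End Modules.

(* The differential is a family indexed by all pairs (i, j), vanishing unless
   j = i - 1: this avoids transport along equalities between indices. *)
Record complex (R : comPzRingType) := Complex {
  cobj :> int -> lmodType R;
  cd : forall i j : int, {linear cobj i -> cobj j};
  cd_shape : forall i j, j + 1 != i -> forall x, cd i j x = 0;
  cdd : forall i j k x, cd j k (cd i j x) = 0
}.
Arguments cd {R} c i j.

Record chain_map (R : comPzRingType) (X Y : complex R) := ChainMap {
  cmap :> forall i, {linear X i -> Y i};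
  cmapd : forall i j x, cd Y i j (cmap i x) = cmap j (cd X i j x)
}.

Section Homology.
Variable R : comPzRingType.
Implicit Types X Y : complex R.

Definition cycle X i (z : X i) : Prop := cd X i (i - 1) z = 0.
Definition boundary X i (z : X i) : Prop :=
  exists y : X (i + 1), cd X (i + 1) i y = z.

(* H_i(X) is the quotient of the cycles by the boundaries; statements about it
   are written on representatives. *)
Definition H_nonzero X (i : int) : Prop :=
  exists z : X i, cycle z /\ ~ boundary z.

Definition H_fg X (i : int) : Prop :=
  exists (n : nat) (g : 'I_n -> X i), (forall k, cycle (g k)) /\
    forall z : X i, cycle z ->
      exists a : 'I_n -> R, boundary (z - \sum_k a k *: g k).

Definition acyclic X : Prop := forall i, ~ H_nonzero X i.

Definition quasi_iso X Y (f : chain_map X Y) : Prop := forall i : int,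
  (forall z : X i, cycle z -> boundary (f i z) -> boundary z) /\
  (forall w : Y i, cycle w -> exists2 z : X i, cycle z & boundary (w - f i z)).

Definition homologically_bounded X : Prop :=
  exists N : nat, forall i : int, (N < `|i|)%N -> ~ H_nonzero X i.

Definition homologically_degreewise_finite X : Prop := forall i, H_fg X i.

(* The total homology, i.e. the direct sum of all H_i(X), is finitely
   generated; its elements are represented by finitely supported families of
   cycles. *)
Definition fin_supp X (z : forall i, X i) : Prop :=
  exists N : nat, forall i : int, (N < `|i|)%N -> z i = 0.

Definition homologically_finite X : Prop :=
  exists (n : nat) (g : 'I_n -> forall i, X i),
    (forall k, fin_supp (g k) /\ forall i, cycle (g k i)) /\
    forall z : forall i, X i, fin_supp z -> (forall i, cycle (z i)) ->
      exists a : 'I_n -> R, forall i, boundary (z i - \sum_k a k *: g k i).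

Local Open Scope ereal_scope.
Definition hinf X : \bar int := infimum +oo [set i%:E | i in H_nonzero X].
Definition hsup X : \bar int := supremum -oo [set i%:E | i in H_nonzero X].
Definition hamp X : \bar int := hsup X - hinf X.
End Homology.

Section Concentrated.
Variables (R : comPzRingType) (M : lmodType R).

Definition conc_obj (i : int) : lmodType R :=
  if i is Posz 0 then M else 'rV[R]_0.

Definition conc_d (i j : int) : {linear conc_obj i -> conc_obj j} :=
  mklin (f := fun=> 0) (fun a x y => esym (etrans (addr0 _) (scaler0 _ a))).

Fact conc_shape i j : j + 1 != i -> forall x, conc_d i j x = 0.
Proof. by []. Qed.

Fact conc_dd i j k x : conc_d j k (conc_d i j x) = 0.
Proof. by []. Qed.

(* M in degree 0 *)
Definition conc : complex R := Complex conc_shape conc_dd.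

Definition from_conc_fun (Y : complex R) (g : {linear M -> Y 0}) (i : int) :
    {linear conc_obj i -> Y i} :=
  match i with
  | Posz 0 => g
  | i => mklin (f := fun=> 0) (fun a x y => esym (etrans (addr0 _) (scaler0 _ a)))
  end.

Fact from_conc_subproof (Y : complex R) (g : {linear M -> Y 0})
    (Hg : forall x, cycle (g x)) i j x :
  cd Y i j (from_conc_fun g i x) = from_conc_fun g j (cd conc i j x).
Proof.
rewrite /= linear0; case: i x => [[|n]|n] x /=; rewrite ?linear0 //.
have [->|ne] := eqVneq j (0 - 1); first exact: Hg.
by rewrite cd_shape // -(inj_eq (addIr (-1))) addrK.
Qed.

Definition from_conc (Y : complex R) (g : {linear M -> Y 0})
  (Hg : forall x, cycle (g x)) : chain_map conc Y :=
  @ChainMap R conc Y (from_conc_fun g) (from_conc_subproof Hg).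
End Concentrated.

Section Dimensions.
Variables (R : comPzRingType) (M : lmodType R).

(* M has a resolution 0 -> F_n -> ... -> F_0 -> M -> 0 with all F_i in Q.  For
   n < 0 this says that M = 0. *)
Definition has_resolution (Q : lmodType R -> Prop) (n : int) : Prop :=
  exists2 F : complex R,
    (forall i, Q (F i)) /\ (forall i, (i < 0) || (n < i) -> forall x : F i, x = 0)
    & exists e : chain_map F (conc M), quasi_iso e.

Definition flat_dim : \bar int :=
  infimum +oo%E [set (n%:E)%E | n in has_resolution (@flat R)].
Definition proj_dim : \bar int :=
  infimum +oo%E [set (n%:E)%E | n in has_resolution (@projective R)].
End Dimensions.

Lemma odd_abszS (m : int) : odd `|(m + 1)%R|%N = ~~ odd `|m|%N.
Proof.
case: m => [n|[|n]] //; first by rewrite -PoszD addn1.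
have -> : Negz n.+1 + 1 = Negz n by rewrite !NegzE -[n.+2]addn1 PoszD opprD addrNK.
by rewrite /= negbK.
Qed.

Section HomComplex.
Variables (R : comPzRingType) (X Y : complex R).

(* An element of degree n is a family of maps X_i -> Y_(i+n). *)
Record hom_deg (n : int) := HomDeg {
  hmap :> forall i j, {linear X i -> Y j};
  hmap_shape : forall i j, j != i + n -> forall x, hmap i j x = 0
}.

Lemma hom_deg_eq n (f g : hom_deg n) : (forall i j x, f i j x = g i j x) -> f = g.
Proof.
case: f g => f Hf [g Hg] /= fg.
have {}fg : f = g.
  apply: functional_extensionality_dep => i.
  by apply: functional_extensionality_dep => j; apply/linear_eq => x; exact: fg.
by move: Hf; rewrite fg => Hf; congr HomDeg; apply: Prop_irrelevance.
Qed.

Section Degree.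
Variable n : int.

HB.instance Definition _ := gen_eqMixin (hom_deg n).
HB.instance Definition _ := gen_choiceMixin (hom_deg n).

Definition hom0 : hom_deg n :=
  @HomDeg n (fun i j => \0 : {linear X i -> Y j}) (fun _ _ _ _ => erefl).

Definition homD (f g : hom_deg n) : hom_deg n.
Proof.
exists (fun i j => f i j \+ g i j : {linear X i -> Y j}).
by move=> i j ne x /=; rewrite !hmap_shape ?addr0.
Defined.

Definition homZ (a : R) (f : hom_deg n) : hom_deg n.
Proof.
exists (fun i j => a \*: f i j : {linear X i -> Y j}).
by move=> i j ne x /=; rewrite !hmap_shape ?scaler0.
Defined.

Definition homN (f : hom_deg n) : hom_deg n := homZ (-1) f.

Fact homDA : associative homD.
Proof. by move=> f g h; apply: hom_deg_eq => i j x /=; rewrite addrA. Qed.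
Fact homDC : commutative homD.
Proof. by move=> f g; apply: hom_deg_eq => i j x /=; rewrite addrC. Qed.
Fact hom0D : left_id hom0 homD.
Proof. by move=> f; apply: hom_deg_eq => i j x /=; rewrite add0r. Qed.
Fact homND : left_inverse hom0 homN homD.
Proof. by move=> f; apply: hom_deg_eq => i j x /=; rewrite scaleN1r addNr. Qed.
HB.instance Definition _ :=
  GRing.isZmodule.Build (hom_deg n) homDA homDC hom0D homND.

Fact homZA a b f : homZ a (homZ b f) = homZ (a * b) f.
Proof. by apply: hom_deg_eq => i j x /=; rewrite scalerA. Qed.
Fact hom1Z : left_id 1 homZ.
Proof. by move=> f; apply: hom_deg_eq => i j x /=; rewrite scale1r. Qed.
Fact homZDr : right_distributive homZ +%R.
Proof. by move=> a f g; apply: hom_deg_eq => i j x /=; rewrite scalerDr. Qed.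
Fact homZDl f : {morph homZ^~ f : a b / a + b}.
Proof. by move=> a b; apply: hom_deg_eq => i j x /=; rewrite scalerDl. Qed.
HB.instance Definition _ :=
  GRing.Zmodule_isLmodule.Build R (hom_deg n) homZA hom1Z homZDr homZDl.

Lemma hom_degP a (f g : hom_deg n) i j x :
  (a *: f + g) i j x = a *: f i j x + g i j x.
Proof. by []. Qed.
End Degree.

(* (d f)_i = d_Y f_i - (-1)^n f_(i-1) d_X for f of degree n *)
Definition homd_map (n m : int) (f : hom_deg n) (i j : int) (x : X i) : Y j :=
  if m + 1 == n then
    cd Y (j + 1) j (f i (j + 1) x)
    - (-1) ^+ `|n|%N *: f (i - 1) j (cd X i (i - 1) x)
  else 0.

Fact homd_map_linear (n m : int) (f : hom_deg n) (i j : int) : linear (@homd_map n m f i j).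
Proof.
move=> a x y; rewrite /homd_map; case: eqP => _; last by rewrite scaler0 addr0.
by rewrite !linearP addrACA -scalerDr.
Qed.

Fact homd_shape (n m : int) (f : hom_deg n) (i j : int) :
  j != i + m -> forall x, mklin (@homd_map_linear n m f i j) x = 0.
Proof.
move=> ne x; rewrite /= /homd_map; case: eqP => // mn.
have ne1 : j + 1 != i + n by rewrite -mn addrA (inj_eq (addIr 1)).
have ne2 : j != i - 1 + n by rewrite -mn [m + 1]addrC addrA subrK.
by rewrite (hmap_shape f ne1) (hmap_shape f ne2) linear0 scaler0 subr0.
Qed.

Definition homd_fun (n m : int) (f : hom_deg n) : hom_deg m := HomDeg (@homd_shape n m f).

Fact homd_linear (n m : int) : linear (@homd_fun n m).
Proof.
move=> a f g; apply: hom_deg_eq => i j x /=; rewrite /homd_map.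
case: eqP => _; last by rewrite scaler0 addr0.
by rewrite !hom_degP !linearP addrACA -scalerDr.
Qed.

Definition homd (n m : int) : {linear hom_deg n -> hom_deg m} := mklin (@homd_linear n m).

Fact homd_shape0 (n m : int) : m + 1 != n -> forall f, homd n m f = 0.
Proof.
by move=> ne f; apply: hom_deg_eq => i j x; rewrite /= /homd_map (negPf ne).
Qed.

Fact homdd (n m p : int) f : homd m p (homd n m f) = 0.
Proof.
apply: hom_deg_eq => i j x; rewrite /= /homd_map /=.
case: (p + 1 =P m) => // mp; rewrite /homd_map.
case: (m + 1 =P n) => [mn|_]; last by rewrite !linear0 addr0.
rewrite linearB /= !cdd [f _ _ 0]linear0 scaler0 subr0 sub0r linearZ /=.
by move: (cd Y (j + 1) j (f _ _ _)) => v; 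
  rewrite -mn -[X in X *: v]signr_odd odd_abszS signrN signr_odd scaleNr opprK
    subrr.
Qed.

Definition homc : complex R := Complex homd_shape0 homdd.
End HomComplex.

Section DerivedHom.
Variable R : comPzRingType.

Definition K_injective (I : complex R) : Prop :=
  forall A : complex R, acyclic A -> acyclic (homc A I).

(* RHom_R(X, Y) is represented by homc X I for any resolution Y -> I. *)
Record injective_resolution (Y : complex R) := InjectiveResolution {
  ir_obj :> complex R;
  ir_map : chain_map Y ir_obj;
  ir_K_injective : K_injective ir_obj;
  ir_quasi_iso : quasi_iso ir_map
}.

Section Homothety.
Variables (X Y : complex R) (f : chain_map X Y).

(* The element a f of Hom(X, Y)_0; the diagonal component at (i, j) with i = j
   is transported along that equality. *)
Definition diag_map (i j : int) : {linear X i -> Y j} :=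
  match i =P j with
  | ReflectT e => ecast k {linear X i -> Y k} e (f i)
  | ReflectF _ => \0
  end.

Fact diag_shape i j : j != i + 0 -> forall x, diag_map i j x = 0.
Proof.
by rewrite addr0 /diag_map => /eqP ne x; case: eqP => // e; case: ne.
Qed.

Lemma diag_mapE i x : diag_map i i x = f i x.
Proof. by rewrite /diag_map; case: eqP => // e; rewrite eq_axiomK. Qed.

Definition homothety_fun (a : R^o) : hom_deg X Y 0 := (a : R) *: HomDeg diag_shape.

Fact homothety_linear : linear homothety_fun.
Proof. by move=> a x y; rewrite /homothety_fun scalerDl scalerA. Qed.

Fact homothety_cycle a :
  @cycle R (homc X Y) 0 (mklin homothety_linear a).
Proof.
have diagd i j k x : k = j -> diag_map k j (cd X i k x) = f j (cd X i j x).
  by move=> ->; apply: diag_mapE.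
apply: hom_deg_eq => i j x; rewrite /= /homd_map /= expr0 scale1r linearZ /=.
rewrite -scalerBr; have [ij|ne] := eqVneq (j + 1) i; last first.
  have ne1 : j + 1 != i + 0 by rewrite addr0.
  have ne2 : j != i - 1 + 0 by rewrite addr0 -(inj_eq (addIr 1)) subrK.
  by rewrite (diag_shape ne1) (diag_shape ne2) linear0 subr0 scaler0.
rewrite (diagd _ _ (i - 1)) -?cmapd; last by rewrite -ij addrK.
by case: i / ij x => x; rewrite diag_mapE subrr scaler0.
Qed.

(* R -> Hom(X, Y), a |-> a f *)
Definition homothety : chain_map (conc R^o) (homc X Y) :=
  @from_conc R R^o (homc X Y) (mklin homothety_linear) homothety_cycle.
End Homothety.

Section Biduality.
Variables X I : complex R.

Section Eval.
Variables (p : int) (x : X p).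

Definition ev_map (n j : int) (f : homc X I n) : I j :=
  (-1) ^+ (`|p| * `|n|)%N *: (f : hom_deg X I n) p j x.

Fact ev_map_linear n j : linear (@ev_map n j).
Proof.
move=> a f g; rewrite /ev_map (hom_degP a f g) scalerDr.
by rewrite !scalerA mulrC.
Qed.

Fact ev_shape n j : j != n + p -> forall f, mklin (@ev_map_linear n j) f = 0.
Proof.
by move=> ne f; rewrite /= /ev_map hmap_shape ?scaler0 // addrC.
Qed.

Definition ev : hom_deg (homc X I) I p := HomDeg ev_shape.
End Eval.

Fact ev_linear p : linear (@ev p).
Proof.
move=> a x y; apply: hom_deg_eq => n j f; rewrite /= /ev_map linearP scalerDr.
by rewrite !scalerA mulrC.
Qed.

Fact evd p q (x : X p) :
  homd (homc X I) I p q (ev x) = ev (cd X p q x).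
Proof.
have [qp|ne] := eqVneq (q + 1) p; last first.
  rewrite homd_shape0 // cd_shape //; apply/esym.
  exact: (linear0 (mklin (@ev_linear q))).
apply: hom_deg_eq => n j g; rewrite /= /homd_map qp eqxx /= /ev_map /=.
rewrite /homd_map subrK eqxx.
have -> : g (p - 1) j (cd X p (p - 1) x) = g q j (cd X p q x).
  by have -> : p - 1 = q by rewrite -qp addrK.
rewrite linearZ /=; move: (cd I _ _ _) (g q j _) => A B.
have hn : odd `|n|%N = ~~ odd `|(n - 1)%R|%N by rewrite -odd_abszS subrK.
have hp : odd `|p|%N = ~~ odd `|q|%N by rewrite -qp odd_abszS.
rewrite -(signr_odd _ (`|p| * _)) -(signr_odd _ `|p|).
rewrite -(signr_odd _ (_ * `|n - 1|)).
rewrite -(signr_odd _ `|n|) -(signr_odd _ (`|q| * _)) !oddM hn hp.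
by case: (odd `|q|%N); case: (odd `|(n - 1)%R|%N);
  rewrite /= ?expr1 ?expr0 ?scaleN1r ?scale1r ?opprK ?opprD ?opprK ?addNKr
    ?addKr ?addrA ?subrr ?addNr ?add0r ?sub0r ?opprK.
Qed.

(* X -> Hom(Hom(X, I), I), x |-> (f |-> (-1)^(|x||f|) f x) *)
Definition biduality : chain_map X (homc (homc X I) I) :=
  @ChainMap R X (homc (homc X I) I) (fun p => mklin (@ev_linear p)) evd.
End Biduality.

Definition semidualizing (C : complex R) : Prop :=
  homologically_finite C /\
  exists I : injective_resolution C, quasi_iso (homothety (ir_map I)).

Definition reflexive_via (C : complex R) (I : injective_resolution C)
    (X : complex R) : Prop :=
  [/\ homologically_finite X, homologically_bounded (homc X I)
    & quasi_iso (biduality X I)].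

Definition reflexive (C X : complex R) : Prop :=
  exists I : injective_resolution C, reflexive_via I X.

(* By convention of \bar int, +oo - +oo = -oo: this only matters for C = 0, i.e.
   over the zero ring.  The value does not depend on the resolution picked. *)
Definition Gdim (C X : complex R) : \bar int :=
  match pselect (reflexive C X) with
  | left h => (hinf C - hinf (homc X (projT1 (cid h))))%E
  | right _ => +oo%E
  end.
End DerivedHom.

Section ChangeOfRings.
Variables (R S : comPzRingType) (phi : {rmorphism R -> S}).

(* S as an R-module *)
Definition restr : Type := let _ := phi in S.
HB.instance Definition _ := GRing.Zmodule.on restr.

Definition restr_scale (a : R) (s : restr) : restr := phi a * (s : S).
Fact restr_scaleA a b s : restr_scale a (restr_scale b s) = restr_scale (a * b) s.
Proof. by rewrite /restr_scale rmorphM mulrA. Qed.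
Fact restr_scale1 : left_id 1 restr_scale.
Proof. by move=> s; rewrite /restr_scale rmorph1 mul1r. Qed.
Fact restr_scaleDr : right_distributive restr_scale +%R.
Proof. by move=> a s t; rewrite /restr_scale mulrDr. Qed.
Fact restr_scaleDl s : {morph restr_scale^~ s : a b / a + b}.
Proof. by move=> a b; rewrite /restr_scale rmorphD mulrDl. Qed.
HB.instance Definition _ := GRing.Zmodule_isLmodule.Build R restr
  restr_scaleA restr_scale1 restr_scaleDr restr_scaleDl.

Definition module_finite : Prop := finitely_generated restr.

Definition mSpec_sub_image : Prop := forall m : set R, maximal_ideal m ->
  exists2 q : set S, prime_ideal q & m = phi @^-1` q.

Section CoInduced.
Variable M : lmodType R.

(* Hom_R(S, M), an S-module by (s f)(t) = f(t s) *)
Definition coind : Type := {linear restr -> M}.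
HB.instance Definition _ := gen_eqMixin coind.
HB.instance Definition _ := gen_choiceMixin coind.

Definition coind_fun (f : coind) : {linear restr -> M} := f.

Definition coind0 : coind := \0 : {linear restr -> M}.
Definition coindD (f g : coind) : coind :=
  coind_fun f \+ coind_fun g : {linear restr -> M}.
Definition coindN (f : coind) : coind :=
  (-1) \*: coind_fun f : {linear restr -> M}.

Fact coindZ_linear (s : S) (f : coind) :
  linear (fun t : restr => coind_fun f ((t : S) * s)).
Proof.
move=> a t u; rewrite -linearP; congr (coind_fun f _).
by rewrite [in LHS]mulrDl -mulrA.
Qed.
Definition coindZ (s : S) (f : coind) : coind := mklin (coindZ_linear s f).

Fact coindDA : associative coindD.
Proof. by move=> f g h; apply: linear_eq => t /=; rewrite addrA. Qed.
Fact coindDC : commutative coindD.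
Proof. by move=> f g; apply: linear_eq => t /=; rewrite addrC. Qed.
Fact coind0D : left_id coind0 coindD.
Proof. by move=> f; apply: linear_eq => t /=; rewrite add0r. Qed.
Fact coindND : left_inverse coind0 coindN coindD.
Proof. by move=> f; apply: linear_eq => t /=; rewrite scaleN1r addNr. Qed.
HB.instance Definition _ :=
  GRing.isZmodule.Build coind coindDA coindDC coind0D coindND.

Fact coindZA s t f : coindZ s (coindZ t f) = coindZ (s * t) f.
Proof. by apply: linear_eq => u /=; rewrite mulrA. Qed.
Fact coind1Z : left_id 1 coindZ.
Proof. by move=> f; apply: linear_eq => u /=; rewrite mulr1. Qed.
Fact coindZDr : right_distributive coindZ +%R.
Proof. by move=> s f g; apply: linear_eq. Qed.
Fact coindZDl f : {morph coindZ^~ f : s t / s + t}.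
Proof.
by move=> s t; apply: linear_eq => u /=; rewrite mulrDr [LHS]linearD.
Qed.
HB.instance Definition _ := GRing.Zmodule_isLmodule.Build S coind
  coindZA coind1Z coindZDr coindZDl.
End CoInduced.

Section CoInducedComplex.
Variable Y : complex R.

Definition coindc_fun (n m : int) (f : coind (Y n)) : coind (Y m) :=
  cd Y n m \o coind_fun f : {linear restr -> Y m}.

Fact coindc_linear n m : linear (@coindc_fun n m).
Proof. by move=> s f g; apply: linear_eq => t; apply: linearD. Qed.

Fact coindc_shape (n m : int) :
  m + 1 != n -> forall f, mklin (@coindc_linear n m) f = 0.
Proof. by move=> ne f; apply: linear_eq => t; apply: cd_shape. Qed.

Fact coindc_dd n m p f :
  mklin (@coindc_linear m p) (mklin (@coindc_linear n m) f) = 0.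
Proof. by apply: linear_eq => t; apply: cdd. Qed.

(* RHom_R(S, X) is represented, as an S-complex, by coindc I for any resolution
   X -> I over R. *)
Definition coindc : complex S := Complex coindc_shape coindc_dd.
End CoInducedComplex.
End ChangeOfRings.

(* Main.v *)
(* Let P be a resolution of S by finitely generated projective R-modules, of
   length pd S, and C -> I, X -> J K-injective resolutions.  Then Hom(P, J)
   represents RHom(S, X), the dual of Hom(P, J) is P (x) Hom(J, I), and the
   biduality of Hom(P, J) is Hom(P, -) applied to the biduality of J.

   The functors P (x) - and Hom(P, -) detect the vanishing in low degrees
   of degreewise finitely generated homology.  Indeed every maximal ideal m of
   R comes from a prime of S, so 1 is not in m S and H_0(P (x) R/m) <> 0; if
   P (x) Y has no homology below b, a cycle of degree below b in the Koszul
   complex of Y on generators of m can be pushed to higher and higher Koszul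
   weight, hence is a boundary, and Nakayama's lemma gives the vanishing of the
   homology of Y at m.  Hom(P, -) is P^v (x) -, and P is a direct summand of
   P (x) P (x) P^v.  Hence reflexivity ascends and descends, RHom(X, C) and its
   analogue over S have the same infimum, and
   inf C - pd S <= inf RHom(S, C) <= inf C.

   For the equality, minimality of the length of P yields a maximal ideal m and
   an element of the top module of P, not in m P, whose boundary is in m P.  If
   RHom(S, C) vanished in degree c - pd S, where c = inf C, then H_c(C) would be
   equal to m H_c(C) locally at m, hence be annihilated by some s outside m.  If
   R is local this makes H_c(C) = 0; if amp C = 0 the homothety of s is
   null-homotopic, so s = 0. *)

(* The obstacle is descent. Reflexivity of RHom(S, X) gives no direct bound on X, so the vanishing
   of the low homology of Y must be deduced from that of P (x) Y for a Y with no known lowest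
   homology, where Nakayama's lemma in the lowest degree cannot start. The weight filtration of the
   Koszul complex replaces the missing bound: it is finite, and its induction never refers to a
   lowest degree.

   Two encodings of complexes coexist. The indexed ones of the definitions serve for Hom and
   K-injective resolutions. Computations with P take place in graded modules [gcx]: P is a pair of
   matrices, an idempotent and a differential, and elements of P (x) Z are families of elements of Z
   rather than classes. [giso] carries homology from one encoding to the other. Isomorphisms of the
   derived category appear only as explicit quasi-isomorphisms, compared in commutative squares.

   Finite flat dimension yields P through the equational criterion of flatness: it passes to
   kernels, and over a Noetherian ring it provides dual bases of finitely generated modules. *)
Require Import Defs.
From HB Require Import structures.
From mathcomp Require Import ring zify.
Set Implicit Arguments.
Unset Strict Implicit.
Unset Printing Implicit Defensive.
Import Order.TTheory GRing.Theory Num.Theory.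
Local Open Scope ring_scope.

(** * Linear combinations *)

(* Both sides of an identity between linear combinations are reified; comparing
   coefficients leaves one ring identity per vector. *)
Section Reify.
Variables (R : comPzRingType) (V : lmodType R).

Inductive lexp : Type :=
  | LZero | LAtom of nat | LAdd of lexp & lexp | LOpp of lexp | LScale of R & lexp.

Fixpoint lval (env : seq V) e : V := match e with
  | LZero => 0
  | LAtom n => nth 0 env n
  | LAdd e1 e2 => lval env e1 + lval env e2
  | LOpp e1 => - lval env e1
  | LScale r e1 => r *: lval env e1
  end.

(** On numerals [PeanoNat.Nat.eqb] reduces under the [cbv] of [lincomb_over], which leaves pure ring
    identities. *)
Fixpoint lcoef e (n : nat) : R := match e with
  | LZero => 0
  | LAtom k => if PeanoNat.Nat.eqb k n then 1 else 0
  | LAdd e1 e2 => lcoef e1 n + lcoef e2 n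
  | LOpp e1 => - lcoef e1 n
  | LScale r e1 => r * lcoef e1 n
  end.

Fixpoint same_coef (e1 e2 : lexp) (n : nat) : Prop :=
  if n is k.+1 then lcoef e1 k = lcoef e2 k /\ same_coef e1 e2 k else True.

Lemma lvalE env e : lval env e = \sum_(i < size env) lcoef e i *: nth 0 env i.
Proof.
elim: e => [|k|e1 IH1 e2 IH2|e1 IH1|r e1 IH1] /=.
- by rewrite big1 // => i _; rewrite scale0r.
- have E (i : 'I_(size env)) : PeanoNat.Nat.eqb k i = (k == i) :> bool.
    by apply/idP/eqP => [/PeanoNat.Nat.eqb_eq|->]; rewrite ?PeanoNat.Nat.eqb_refl.
  have [lt|ge] := ltnP k (size env); last first.
    rewrite nth_default // big1 // => i _; rewrite E.
    by case: eqP => [ki|_]; rewrite ?scale0r //; move: ge; rewrite ki leqNgt ltn_ord.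
  rewrite (bigD1 (Ordinal lt)) //= PeanoNat.Nat.eqb_refl scale1r big1 ?addr0 // => i.
  by rewrite -val_eqE /= eq_sym E => /negPf ->; rewrite scale0r.
- by rewrite IH1 IH2 -big_split; apply: eq_bigr => i _; rewrite scalerDl.
- by rewrite IH1 -sumrN; apply: eq_bigr => i _; rewrite scaleNr.
- by rewrite IH1 scaler_sumr; apply: eq_bigr => i _; rewrite scalerA.
Qed.

Lemma lval_eq env e1 e2 : same_coef e1 e2 (size env) -> lval env e1 = lval env e2.
Proof.
move=> h; rewrite !lvalE; apply: eq_bigr => i _; congr (_ *: _).
elim: (size env) h i => [|k IHk] /=; first by move=> _ [].
case=> hk h i; have [lt|ge] := ltnP i k; first exact: (IHk h (Ordinal lt)).
by have -> : (i : nat) = k by apply/eqP; rewrite eqn_leq ge -ltnS ltn_ord.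
Qed.
End Reify.

(** Atoms are identified up to unification, so that convertible writings of a vector share one
    index. *)
Ltac lfind x env :=
  lazymatch env with
  | ?y :: ?env' => match constr:(tt) with
    | _ => let _ := match constr:(tt) with _ => first [constr_eq x y | unify x y] end in constr:(O)
    | _ => let n := lfind x env' in constr:(S n)
    end
  end.
Ltac latoms R t env :=
  lazymatch t with
  | (0)%R => env
  | (?x + ?y)%R => let env := latoms R x env in latoms R y env
  | (- ?x)%R => latoms R x env
  | (?r *: ?x)%R => latoms R x env
  | _ => match constr:(tt) with
    | _ => let n := lfind t env in env
    | _ => constr:(t :: env)
    end
  end.
Ltac lreify R t env :=
  lazymatch t with
  | (0)%R => constr:(@LZero R)
  | (?x + ?y)%R => let a := lreify R x env in let b := lreify R y env in
                   constr:(@LAdd R a b)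
  | (- ?x)%R => let a := lreify R x env in constr:(@LOpp R a)
  | (?r *: ?x)%R => let a := lreify R x env in constr:(@LScale R r a)
  | _ => let n := lfind t env in constr:(@LAtom R n)
  end.
Ltac lincomb_over R V :=
  lazymatch goal with
  | |- @eq _ ?x ?y =>
    let env := latoms R x constr:(@nil V) in let env := latoms R y env in
    let a := lreify R x env in let b := lreify R y env in
    refine (@lval_eq R V env a b _);
    cbv [same_coef lcoef size PeanoNat.Nat.eqb];
    repeat (split; [ring|]); exact I
  end.
Ltac lincomb R :=
  lazymatch goal with |- @eq ?T _ _ =>
    let V := open_constr:(_ : lmodType R) in
    let T := eval simpl in T in
    unify T (GRing.Lmodule.sort V); lincomb_over R V
  end.

(** * Ideals, submodules and Nakayama's lemma *)

Section Ideals.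
Variable R : comPzRingType.
Implicit Types (I J m : R -> Prop) (a b x y : R).

Lemma ideal0 I : is_ideal I -> I 0. Proof. by case. Qed.
Lemma idealD I x y : is_ideal I -> I x -> I y -> I (x + y).
Proof. by case=> _ + _; apply. Qed.
Lemma idealM I a x : is_ideal I -> I x -> I (a * x).
Proof. by case=> _ _; apply. Qed.
Lemma idealN I x : is_ideal I -> I x -> I (- x).
Proof. by move=> hI hx; rewrite -mulN1r; exact: idealM. Qed.
Lemma idealB I x y : is_ideal I -> I x -> I y -> I (x - y).
Proof. by move=> hI hx hy; apply: idealD hI hx (idealN hI hy). Qed.
Lemma ideal_sum I (T : finType) (P : pred T) (f : T -> R) :
  is_ideal I -> (forall t, P t -> I (f t)) -> I (\sum_(t | P t) f t).
Proof.
move=> hI hf; elim/big_rec: _ => [|t x Pt hx]; first exact: ideal0.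
exact: (idealD hI (hf t Pt) hx).
Qed.

Lemma exists_maximal I : is_ideal I -> ~ I 1 ->
  exists2 m, maximal_ideal m & forall x, I x -> m x.
Proof.
move=> hI I1.
pose T := {J : R -> Prop | [/\ is_ideal J, ~ J 1 & forall x, I x -> J x]}.
pose le (s t : T) := `[< forall x, sval s x -> sval t x >].
have hI' : [/\ is_ideal I, ~ I 1 & forall x, I x -> I x] by [].
have [|r s t /asboolP rs /asboolP st|s t /asboolP st /asboolP ts|A tot|t tmax]
    := @Zorn T le.
- by move=> t; apply/asboolP.
- by apply/asboolP => x /rs /st.
- case: s t st ts => s hs [t ht] /= st ts.
  have est : s = t by apply/funext => x; apply/propext; split=> [/st|/ts].
  by rewrite est in hs *; congr exist; apply: Prop_irrelevance.
(* The union of an empty chain would not contain 0; there [I] itself serves as a bound. *)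
- have [A0|/existsNP[s0 /contrapT As0]] := pselect (forall s, ~ A s).
    by exists (exist _ I hI') => s /A0.
  pose U x := exists2 s, A s & sval s x.
  have hU : [/\ is_ideal U, ~ U 1 & forall x, I x -> U x].
    split; last by move=> x Ix; exists s0 => //; case: (svalP s0) => _ _; apply.
      split.
      - by exists s0 => //; case: (svalP s0) => /ideal0.
      - move=> x y [s As sx] [t At ty].
        have [/asboolP st|/asboolP ts] := tot s t As At.
          by exists t => //; case: (svalP t) => ht _ _; apply: idealD => //; apply: st.
        by exists s => //; case: (svalP s) => hs _ _; apply: idealD => //; apply: ts.
      - by move=> a x [s As sx]; exists s => //; case: (svalP s) => hs _ _; apply: idealM.
    by move=> [s _]; case: (svalP s).
  by exists (exist _ U hU) => s As; apply/asboolP => x sx; exists s.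
exists (sval t); last by case: (svalP t).
case: (svalP t) => ht t1 It; split => // J hJ J1 tJ.
have hJ' : [/\ is_ideal J, ~ J 1 & forall x, I x -> J x] by split => // x /It /tJ.
have /tmax <- // : le t (exist _ J hJ') by apply/asboolP.
Qed.

Section Maximal.
Variables (m : R -> Prop) (hm : maximal_ideal m).

Lemma maximal_is_ideal : is_ideal m. Proof. by case: hm. Qed.

Lemma maximal_inv a : ~ m a -> exists u, m (1 - u * a).
Proof.
move=> ma; have hi := maximal_is_ideal.
pose J x := exists u y, m y /\ x = u * a + y.
have hJ : is_ideal J.
  split; first by exists 0, 0; rewrite mul0r addr0; split=> //; exact: ideal0.
    move=> _ _ [u [y [my ->]]] [v [z [mz ->]]]; exists (u + v), (y + z).
    by split; [exact: idealD | rewrite mulrDl addrACA].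
  move=> b _ [u [y [my ->]]]; exists (b * u), (b * y).
  by split; [exact: idealM | rewrite mulrDr mulrA].
have [J1|J1] := pselect (J 1).
  by case: J1 => u [y [my ->]]; exists u; rewrite addrC addKr.
case: hm => _ _ /(_ J hJ J1) eJ; case: ma; rewrite -eJ.
  by exists 1, 0; rewrite mul1r addr0; split=> //; exact: ideal0.
by move=> y my; exists 0, y; rewrite mul0r add0r.
Qed.

Lemma maximal_notin1 a : m (1 - a) -> ~ m a.
Proof.
move=> h ma; case: hm => hi m1 _; apply: m1.
by rewrite -(subrK a 1); apply: idealD.
Qed.
End Maximal.

Lemma ideal_full I : is_ideal I ->
  (forall m, maximal_ideal m -> exists2 s, I s & ~ m s) -> I 1.
Proof.
move=> hI h; apply: contrapT => /(exists_maximal hI)[m hm Im].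
by have [s /Im] := h m hm.
Qed.
End Ideals.

Section Submodules.
Variable R : comPzRingType.
Implicit Types V : lmodType R.

Definition submod V (W : V -> Prop) :=
  W 0 /\ forall a x y, W x -> W y -> W (a *: x + y).

Lemma submod0 V (W : V -> Prop) : submod W -> W 0. Proof. by case. Qed.
Lemma submodD V (W : V -> Prop) x y : submod W -> W x -> W y -> W (x + y).
Proof. by case=> _ h Wx Wy; rewrite -[x]scale1r; apply: h. Qed.
Lemma submodZ V (W : V -> Prop) a x : submod W -> W x -> W (a *: x).
Proof. by case=> h0 h Wx; rewrite -[_ *: _]addr0; apply: h. Qed.
Lemma submodN V (W : V -> Prop) x : submod W -> W x -> W (- x).
Proof. by move=> h Wx; rewrite -scaleN1r; apply: submodZ. Qed.
Lemma submodB V (W : V -> Prop) x y : submod W -> W x -> W y -> W (x - y).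
Proof. by move=> h Wx Wy; apply: submodD => //; apply: submodN. Qed.
Lemma submod_sum V (W : V -> Prop) (T : finType) (P : pred T) (f : T -> V) :
  submod W -> (forall t, P t -> W (f t)) -> W (\sum_(t | P t) f t).
Proof.
move=> hW hf; elim/big_rec: _ => [|t x Pt hx]; first exact: submod0.
exact: (submodD hW (hf t Pt) hx).
Qed.

(* [N / W] is finitely generated *)
Definition fgq V (N W : V -> Prop) := exists (T : finType) (g : T -> V),
  (forall k, N (g k)) /\
  forall z, N z -> exists a : T -> R, W (z - \sum_k a k *: g k).

Lemma fgq_ord V (N W : V -> Prop) : fgq N W -> exists n (g : 'I_n -> V),
  (forall k, N (g k)) /\
  forall z, N z -> exists a : 'I_n -> R, W (z - \sum_k a k *: g k).
Proof.
case=> T [g [gN h]]; exists #|T|, (fun k => g (enum_val k)); split=> // z /h[a ha].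
exists (fun k => a (enum_val k)).
suff -> : \sum_(k < #|T|) a (enum_val k) *: g (enum_val k) = \sum_k a k *: g k by [].
by rewrite [RHS](reindex _ (onW_bij _ (enum_val_bij T))).
Qed.

Lemma fgqW V (N W W' : V -> Prop) : (forall z, N z -> W z -> W' z) -> submod N ->
  fgq N W -> fgq N W'.
Proof.
move=> WW' hN [T [g [gN h]]]; exists T, g; split=> // z Nz; have [a ha] := h z Nz.
exists a; apply: WW' => //; apply: submodB => //; apply: submod_sum => // t _.
exact: submodZ.
Qed.

Lemma fgq_sum V (N N' W : V -> Prop) : fgq N W ->
  (forall z, N' z -> exists2 y, N y & W (z - y)) -> (forall z, N z -> N' z) -> submod W ->
  fgq N' W.
Proof.
move=> [T [g [gN h]]] hN' NN' hW; exists T, g; split=> [k|z /hN'[y /h[a ha] hzy]].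
  exact: NN'.
exists a; rewrite -(subrK y z) -addrA; exact: submodD.
Qed.

Section Noetherian.
Hypothesis noethR : noetherian R.

(** Hilbert's induction on the number of generators: the coefficients that elements of [N'] can have
    on the last one form a finitely generated ideal [I]. Lifts of generators of [I] reduce the
    question to the elements of [N'] involving only the first [n] generators. The [g k] may lie
    outside [N']. *)
Lemma noether_sub V n (g : 'I_n -> V) (N' W : V -> Prop) : submod N' -> submod W ->
  (forall z, N' z -> exists a : 'I_n -> R, W (z - \sum_k a k *: g k)) -> fgq N' W.
Proof.
elim: n g N' => [|n IHn] g N' hN' hW hg.
  exists void, (fun v : void => of_void V v); split=> [[]|z /hg[a]].
  rewrite big_ord0 subr0 => Wz; exists (fun=> 0).
  by rewrite big1 ?subr0 // => -[].
pose I c := exists2 z, N' z & exists a : 'I_n -> R,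
  W (z - \sum_k a k *: g (widen_ord (leqnSn n) k) - c *: g ord_max).
have hI : is_ideal I.
  split.
  - exists 0; first exact: submod0.
    exists (fun=> 0); rewrite scale0r !subr0 big1 ?subr0; first exact: submod0.
    by move=> k _; rewrite scale0r.
  - move=> c c' [z Nz [a Wz]] [z' Nz' [a' Wz']]; exists (z + z'); first exact: submodD.
    exists (fun k => a k + a' k).
    rewrite (eq_bigr (fun k => a k *: g (widen_ord (leqnSn n) k)
      + a' k *: g (widen_ord (leqnSn n) k))) ?big_split /=; last first.
      by move=> k _; rewrite scalerDl.
    set u := \sum_(_ < _) _; set v := \sum_(_ < _) _.
    have -> : z + z' - (u + v) - (c + c') *: g ord_max =
      (z - u - c *: g ord_max) + (z' - v - c' *: g ord_max) by lincomb R.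
    exact: submodD.
  - move=> b c [z Nz [a Wz]]; exists (b *: z); first exact: submodZ.
    exists (fun k => b * a k).
    rewrite (eq_bigr (fun k => b *: (a k *: g (widen_ord (leqnSn n) k)))) => [|k _].
      by rewrite -scaler_sumr -scalerA -!scalerBr; apply: submodZ.
    by rewrite scalerA.
have [t [c eI]] := noethR hI.
have cI k : I (c k).
  rewrite eI; exists (fun l => (l == k)%:R).
  rewrite (bigD1 k) //= eqxx mul1r big1 ?addr0 // => l /negPf ->.
  by rewrite mul0r.
have /choice[z hz] : forall k, exists z, N' z /\ exists a : 'I_n -> R,
    W (z - \sum_k a k *: g (widen_ord (leqnSn n) k) - c k *: g ord_max).
  by move=> k; have [z] := cI k; exists z.
have /choice[az haz] : forall k, exists a : 'I_n -> R,
    W (z k - \sum_l a l *: g (widen_ord (leqnSn n) l) - c k *: g ord_max).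
  by move=> k; case: (hz k).
pose N1 y := N' y /\ exists a : 'I_n -> R,
  W (y - \sum_k a k *: g (widen_ord (leqnSn n) k)).
have hN1 : submod N1.
  split.
    split; first exact: submod0.
    exists (fun=> 0); rewrite big1 ?subr0; first exact: submod0.
    by move=> k _; rewrite scale0r.
  move=> b x y [Nx [a hx]] [Ny [a' hy]]; split; first by apply: submodD => //; apply: submodZ.
  exists (fun k => b * a k + a' k).
  rewrite (eq_bigr (fun k => b *: (a k *: g (widen_ord (leqnSn n) k))
      + a' k *: g (widen_ord (leqnSn n) k))) => [|k _]; last by rewrite scalerDl scalerA.
  rewrite big_split /= -scaler_sumr opprD addrACA -scalerBr; apply: submodD => //.
  exact: submodZ.
have [T [g1 [Ng1 hg1]]] := IHn _ N1 hN1 hW (fun y => @proj2 _ _).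
exists ('I_t + T)%type, (fun k => match k with inl i => z i | inr j => g1 j end).
split=> [[i|j]|y Ny]; [by case: (hz i) | by case: (Ng1 j) |].
have [a ha] := hg y Ny.
have [b hb] : exists b : 'I_t -> R, a ord_max = \sum_k b k * c k.
  have : I (a ord_max) by exists y => //; exists (fun k => a (widen_ord (leqnSn n) k));
    move: ha; rewrite big_ord_recr /= opprD addrA.
  by rewrite eI.
pose y1 := y - \sum_k b k *: z k.
have N1y : N1 y1.
  split.
    by apply: submodB => //; apply: submod_sum => // k _; apply: submodZ => //; case: (hz k).
  exists (fun l => a (widen_ord (leqnSn n) l) - \sum_k b k * az k l).
  have -> : y1 - \sum_l (a (widen_ord (leqnSn n) l) - \sum_k b k * az k l) *:
       g (widen_ord (leqnSn n) l) =
     (y - \sum_k a k *: g k)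
     - \sum_k b k *: (z k - \sum_l az k l *: g (widen_ord (leqnSn n) l) - c k *: g ord_max).
    pose S k := \sum_l az k l *: g (widen_ord (leqnSn n) l).
    have -> : \sum_k b k *: (z k - S k - c k *: g ord_max) =
        \sum_k b k *: z k - \sum_k b k *: S k - (\sum_k b k * c k) *: g ord_max.
      rewrite scaler_suml -!sumrB; apply: eq_bigr => k _.
      by rewrite !scalerBr scalerA.
    have -> : \sum_l (a (widen_ord (leqnSn n) l) - \sum_k b k * az k l) *:
       g (widen_ord (leqnSn n) l) =
       \sum_l a (widen_ord (leqnSn n) l) *: g (widen_ord (leqnSn n) l) - \sum_k b k *: S k.
      under eq_bigr do rewrite scalerBl scaler_suml.
      rewrite sumrB exchange_big /=; congr (_ - _); apply: eq_bigr => k _.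
      by rewrite scaler_sumr; apply: eq_bigr => l _; rewrite scalerA.
    rewrite big_ord_recr /= hb /y1; lincomb R.
  apply: submodB => //; apply: submod_sum => // k _; exact: submodZ.
have [b1 hb1] := hg1 y1 N1y.
exists (fun k => match k with inl i => b i | inr j => b1 j end).
by rewrite big_sumType /= opprD addrA.
Qed.

Lemma fgq_sub V (N N' W : V -> Prop) : fgq N W -> (forall z, N' z -> N z) ->
  submod N' -> submod W -> fgq N' W.
Proof.
move=> /fgq_ord[n [g [_ hg]]] NN' hN' hW.
by apply: (@noether_sub _ n g) => // z /NN' /hg.
Qed.

(** The image of [N] is finitely generated modulo [W'] by Noetherianity, and lifts of its generators
    reduce the question to the part of [N] sent into [W']. In this form finiteness passes along long
    exact sequences. *)
Lemma fgq_ext V V' (pi : {linear V -> V'}) (N W : V -> Prop) (N' W' : V' -> Prop) :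
  submod N -> submod W -> submod W' -> (forall z, N z -> N' (pi z)) -> fgq N' W' ->
  fgq (fun z => N z /\ W' (pi z)) W -> fgq N W.
Proof.
move=> hN hW hW' piN fN' [T [g [gN hg]]].
have hpiN : submod (fun v => exists2 z, N z & v = pi z).
  split; first by exists 0; [exact: submod0 | rewrite linear0].
  move=> a _ _ [z Nz ->] [z' Nz' ->]; exists (a *: z + z'); last by rewrite linearP.
  by apply: submodD => //; apply: submodZ.
have [|T' [g' [gN' hg']]] := fgq_sub fN' _ hpiN hW'; first by move=> _ [z Nz ->]; apply: piN.
have /choice[l hl] : forall k, exists z, N z /\ g' k = pi z.
  by move=> k; case: (gN' k) => z; exists z.
exists (T' + T)%type, (fun k => match k with inl i => l i | inr j => g j end).
split=> [[i|j]|z Nz]; [by case: (hl i)|by case: (gN j)|].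
have [|a ha] := hg' (pi z); first by exists z.
have [|b hb] := hg (z - \sum_k a k *: l k).
  split.
    by apply: submodB => //; apply: submod_sum => // k _; apply: submodZ => //; case: (hl k).
  rewrite linearB linear_sum (eq_bigr (fun k => a k *: g' k)) // => k _.
  by rewrite linearZ /=; case: (hl k) => _ ->.
exists (fun k => match k with inl i => a i | inr j => b j end).
by rewrite big_sumType /= opprD addrA.
Qed.

End Noetherian.

(** Generators are eliminated one at a time instead of through a determinant: modulo the multiples
    of the last one, induction yields [s] in 1 + m annihilating the others, and substitution leaves
    a single relation on the last. *)
Lemma nakayama (m : R -> Prop) V n (g : 'I_n -> V) (W : V -> Prop) :
  is_ideal m -> submod W ->
  (forall k, exists2 a : 'I_n -> R, (forall l, m (a l)) & W (g k - \sum_l a l *: g l)) ->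
  exists2 s, m (1 - s) & forall k, W (s *: g k).
Proof.
move=> hm; elim: n g W => [|n IHn] g W hW hg.
  by exists 1 => [|[]//]; rewrite subrr; exact: ideal0.
pose wd := widen_ord (leqnSn n).
pose W' w := exists c, W (w - c *: g ord_max).
have hW' : submod W'.
  split; first by exists 0; rewrite scale0r subr0; exact: submod0.
  move=> a x y [c hx] [c' hy]; exists (a * c + c').
  rewrite scalerDl -scalerA opprD addrACA -scalerBr.
  by apply: submodD => //; apply: submodZ.
have [k|s ms hs] := IHn (g \o wd) W' hW'.
  have [a ma ha] := hg (wd k); exists (a \o wd) => [l|]; first exact: ma.
  exists (a ord_max).
  by move: ha; rewrite big_ord_recr /= opprD addrA.
have /choice[c hc] := hs.
have [a ma ha] := hg ord_max.
(* The relation of [g ord_max] times [s], each s g_k being replaced by the multiple [c k] of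
   [g ord_max]. *)
pose t := s - \sum_k a (wd k) * c k - s * a ord_max.
have ht : W (t *: g ord_max).
  have -> : t *: g ord_max = s *: (g ord_max - \sum_l a l *: g l)
      + \sum_k a (wd k) *: (s *: g (wd k) - c k *: g ord_max).
    have -> : \sum_k a (wd k) *: (s *: g (wd k) - c k *: g ord_max) =
       s *: \sum_k a (wd k) *: g (wd k) - (\sum_k a (wd k) * c k) *: g ord_max.
      rewrite scaler_sumr scaler_suml -sumrB; apply: eq_bigr => k _.
      by rewrite scalerBr !scalerA mulrC.
    rewrite big_ord_recr /= /t; lincomb R.
  apply: (submodD hW (submodZ _ hW ha)).
  by apply: submod_sum => // k _; apply: submodZ => //; apply: hc.
have mt : m (1 - t).
  have -> : 1 - t = (1 - s) + \sum_k a (wd k) * c k + s * a ord_max by rewrite /t; ring.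
  apply: idealD => //; last exact: idealM.
  apply: idealD => //; apply: ideal_sum => // k _; rewrite mulrC; exact: idealM.
exists (t * s) => [|k].
  have -> : 1 - t * s = (1 - t) + t * (1 - s) by ring.
  by apply: idealD => //; apply: idealM.
have [[j ->]|->] : (exists j, k = wd j) \/ k = ord_max.
  have [lt|ge] := ltnP k n; [left; exists (Ordinal lt) | right]; apply: val_inj => //=.
  by apply/eqP; rewrite eqn_leq ge -ltnS ltn_ord.
- have -> : (t * s) *: g (wd j) = t *: (s *: g (wd j) - c j *: g ord_max)
      + c j *: (t *: g ord_max).
    by rewrite scalerBr !scalerA [c j * t]mulrC subrK.
  by apply: submodD => //; apply: submodZ => //; apply: hc.
- by rewrite mulrC -scalerA; apply: submodZ.
Qed.

(** Nakayama's lemma for N/W localized at m, with denominators written out: the hypothesis gives N =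
    mN + W up to factors outside m. *)
Lemma local_nakayama (m : R -> Prop) V (N W : V -> Prop) :
  maximal_ideal m -> submod N -> submod W -> fgq N W ->
  (forall z, N z -> exists2 s, ~ m s & exists (T : finType) (c : T -> R) (y : T -> V),
     (forall i, m (c i) /\ N (y i)) /\ W (s *: z - \sum_i c i *: y i)) ->
  exists2 s, ~ m s & forall z, N z -> W (s *: z).
Proof.
move=> hm hN hW /fgq_ord[n [g [Ng hg]]] h; have hi := maximal_is_ideal hm.
have [k|s ms hs] := @nakayama m V n g W hi hW.
  have [s ms [T [c [y [hcy hz]]]]] := h _ (Ng k).
  have [u hu] := maximal_inv hm ms.
  have /choice[b hb] : forall i, exists a : 'I_n -> R, W (y i - \sum_l a l *: g l).
    by move=> i; apply: hg; case: (hcy i).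
  (* [u] inverts [s] modulo m; in g_k = (1 - u s) g_k + u s g_k both terms then have coefficients in
     m. *)
  exists (fun l => (1 - u * s) * (l == k)%:R + u * \sum_i c i * b i l) => [l|].
    apply: idealD => //; first by rewrite mulrC; apply: idealM.
    apply: idealM => //; apply: ideal_sum => // i _; rewrite mulrC.
    by apply: idealM => //; case: (hcy i).
  have -> : g k - \sum_l ((1 - u * s) * (l == k)%:R + u * \sum_i c i * b i l) *: g l =
     u *: (s *: g k - \sum_i c i *: y i) + u *: (\sum_i c i *: (y i - \sum_l b i l *: g l)).
    under eq_bigr do rewrite scalerDl.
    rewrite big_split /= (bigD1 k) //= eqxx mulr1 big1 ?addr0; last first.
      by move=> l /negPf ->; rewrite mulr0 scale0r.
    rewrite -scalerDr; under [X in _ = _ *: (_ + X)]eq_bigr do rewrite scalerBr.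
    rewrite sumrB addrA subrK scalerBr scalerBl scale1r scalerA.
    rewrite opprD opprB addrA [g k + _]addrC subrK; congr (_ - _).
    rewrite scaler_sumr.
    under eq_bigr do rewrite -scalerA scaler_suml.
    rewrite -!scaler_sumr exchange_big /=; congr (_ *: _); apply: eq_bigr => i _.
    by rewrite scaler_sumr; apply: eq_bigr => l _; rewrite scalerA.
  apply: submodD => //; apply: submodZ => //; apply: submod_sum => // i _.
  exact: submodZ.
exists s => [|z /hg[a ha]]; first exact: (maximal_notin1 hm ms).
rewrite -(subrK (\sum_k a k *: g k) z) scalerDr; apply: submodD => //.
  exact: submodZ.
rewrite scaler_sumr; apply: submod_sum => // k _.
by rewrite scalerA mulrC -scalerA; apply: submodZ.
Qed.

(** The scalars carrying [z] into [W] form an ideal contained in no maximal ideal; this stands in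
    for localization. *)
Lemma local_global V (W : V -> Prop) z : submod W ->
  (forall m : R -> Prop, maximal_ideal m -> exists2 s, ~ m s & W (s *: z)) -> W z.
Proof.
move=> hW h; rewrite -[z]scale1r.
apply: (@ideal_full R (fun s => W (s *: z))) => [|m /h[s]]; last by exists s.
split=> [|x y|a x]; rewrite ?scale0r ?scalerDl -?scalerA.
- exact: submod0.
- exact: submodD.
- exact: submodZ.
Qed.
End Submodules.

(** * Linear algebra over the residue field R/m, by congruences *)

Section ModMaximal.
Variables (R : comPzRingType) (m : R -> Prop) (hm : maximal_ideal m).
Let hi : is_ideal m := maximal_is_ideal hm.

(* Over the field R/m, the columns of M are either dependent or M has a left
   inverse. *)
Lemma mod_dichotomy (A : finType) n (M : A -> 'I_n -> R) :
  (exists2 p : 'I_n -> R, exists k, ~ m (p k) & forall a, m (\sum_k M a k * p k)) \/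
  exists r : 'I_n -> A -> R, forall k l, m (\sum_a r k a * M a l - (k == l)%:R).
Proof.
elim: n M => [|n IHn] M; first by right; exists (fun _ _ => 0) => -[].
pose wd := widen_ord (leqnSn n).
have wdM (j : 'I_n) : (wd j == ord_max) = false.
  by apply/negbTE; rewrite -val_eqE /= neq_ltn ltn_ord.
have wdI (j l : 'I_n) : (wd j == wd l) = (j == l) by [].
have ordE k : (exists j, k = wd j) \/ k = ord_max.
  have [lt|ge] := ltnP k n; [left; exists (Ordinal lt) | right]; apply: val_inj => //=.
  by apply/eqP; rewrite eqn_leq ge -ltnS ltn_ord.
have [[p [k mpk] hp]|[r hr]] := IHn (fun a k => M a (wd k)).
  left; exists (fun k => if insub (k : nat) is Some j then p j else 0).
    by exists (wd k); rewrite valK.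
  move=> a; rewrite big_ord_recr /= insubF ?ltnn // mulr0 addr0.
  by under eq_bigr do rewrite valK.
pose rc k := \sum_a r k a * M a ord_max.
pose c' a := M a ord_max - \sum_k rc k * M a (wd k).
have [hc|/existsNP[i mi]] := pselect (forall a, m (c' a)).
  left; exists (fun k => if insub (k : nat) is Some j then - rc j else 1).
    exists ord_max; rewrite insubF ?ltnn //; by case: hm.
  move=> a; rewrite big_ord_recr /= insubF ?ltnn // mulr1.
  under eq_bigr do rewrite valK mulrN mulrC.
  by rewrite sumrN addrC; apply: hc.
have [u hu] := maximal_inv hm mi.
(* [c'] is the last column minus its projection onto the previous ones. The row [rl] takes the
   [i]-th entry of a column minus that of its projection, scaled by [u]: modulo m it is 0 on the
   first [n] columns and 1 on the last. *)
pose rl a := u * ((a == i)%:R - \sum_k M i (wd k) * r k a).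
have rlE l : \sum_a rl a * M a l = u * (M i l - \sum_k M i (wd k) * \sum_a r k a * M a l).
  under eq_bigr do rewrite /rl -mulrA mulrBl.
  rewrite -mulr_sumr sumrB (bigD1 i) //= eqxx mul1r big1 ?addr0; last first.
    by move=> a /negPf ->; rewrite mul0r.
  congr (_ * (_ - _)).
  under eq_bigr do rewrite mulr_suml.
  rewrite exchange_big /=; apply: eq_bigr => k _.
  by rewrite mulr_sumr; apply: eq_bigr => a _; rewrite mulrA.
have rl_wd l : m (\sum_a rl a * M a (wd l)).
  rewrite rlE; apply: idealM => //.
  have -> : M i (wd l) - \sum_k M i (wd k) * \sum_a r k a * M a (wd l) =
     - \sum_k M i (wd k) * (\sum_a r k a * M a (wd l) - (k == l)%:R).
    under [in RHS]eq_bigr do rewrite mulrBr.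
    rewrite sumrB opprB; congr (_ - _).
    by rewrite (bigD1 l) //= eqxx mulr1 big1 ?addr0 // => k /negPf ->; rewrite mulr0.
  by apply: idealN => //; apply: ideal_sum => // k _; apply: idealM.
have rl_max : m (\sum_a rl a * M a ord_max - 1).
  rewrite rlE -opprB; apply: idealN => //; suff -> : \sum_k M i (wd k) *
     \sum_a r k a * M a ord_max = \sum_k rc k * M i (wd k) by [].
  by apply: eq_bigr => k _; rewrite mulrC.
right; exists (fun k a => if insub (k : nat) is Some j then r j a - rc j * rl a else rl a).
have rE j l : \sum_a (r j a - rc j * rl a) * M a l =
    \sum_a r j a * M a l - rc j * \sum_a rl a * M a l.
  by rewrite mulr_sumr -sumrB; apply: eq_bigr => a _; rewrite mulrBl mulrA.
move=> k l; have [[j ->]| ->] := ordE k.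
  under eq_bigr do rewrite valK.
  rewrite rE; have [[j' ->]| ->] := ordE l.
    by rewrite wdI addrAC; apply: idealB => //; apply: idealM.
  rewrite wdM subr0 -/(rc j) -{1}[rc j]mulr1 -mulrBr -opprB mulrN.
  by apply: idealN => //; apply: idealM.
under eq_bigr do rewrite insubF ?ltnn //.
have [[j' ->]| ->] := ordE l; last by rewrite eqxx.
by rewrite eq_sym wdM subr0.
Qed.

(* A vector outside a subspace of (R/m)^A is separated from it by a linear
   form. *)
Lemma mod_separation (A : finType) (W : {ffun A -> R^o} -> Prop) (p : {ffun A -> R^o}) :
  submod W -> (forall v : {ffun A -> R^o}, (forall a, m (v a)) -> W v) -> ~ W p ->
  exists s : A -> R, (forall v, W v -> m (\sum_a s a * v a)) /\ m (1 - \sum_a s a * p a).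
Proof.
move=> hW mW Wp.
pose WB (B : {set A}) (v : {ffun A -> R^o}) := exists c : {ffun A -> R^o},
  (forall a, a \notin B -> c a = 0) /\ W (v - c).
have hWB B : submod (WB B).
  split; first by exists 0; split=> [a _|]; rewrite ?ffunE // subr0; exact: submod0.
  move=> b x y [c [c0 hx]] [c' [c0' hy]]; exists (b *: c + c'); split.
    by move=> a aB; rewrite !ffunE c0 // c0' // scaler0 addr0.
  by rewrite opprD addrACA -scalerBr; apply: submodD => //; apply: submodZ.
have subW B v : W v -> WB B v.
  by exists 0; split=> [a _|]; rewrite ?ffunE // subr0.
have W0 : `[< ~ WB finset.set0 p >].
  apply/asboolP => -[c [c0 hc]]; apply: Wp.
  by move: hc; have -> : c = 0; rewrite ?subr0 //; apply/ffunP => a; rewrite c0 ?finset.inE ?ffunE.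
(* [B] is a largest set of coordinates whose span, added to [W], still misses [p]. By maximality
   every basis vector is a multiple of [p] modulo [WB B]; these multiples are the coefficients of
   the linear form sought. *)
have [B /maxsetP[/asboolP nB maxB] _] := maxset_exists (P := fun B => `[< ~ WB B p >]) W0.
pose E a : {ffun A -> R^o} := [ffun b => (a == b)%:R].
have hE a : exists s : R, (a \in B -> s = 0) /\ WB B (E a - s *: p).
  have [aB|aB] := boolP (a \in B).
    exists 0; split=> //; rewrite scale0r subr0; exists (E a); split.
      by move=> b bB; rewrite ffunE; case: eqP bB => // <-; rewrite aB.
    by rewrite subrr; exact: submod0.
  have [c [c0 hc]] : WB (a |: B)%SET p.
    apply: contrapT => h; move/negP: aB; apply.
    by rewrite -(maxB (a |: B)%SET) ?finset.setU11 ?finset.subsetUr //; apply/asboolP.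
  have mca : ~ m (c a).
    move=> mca; apply: nB; exists (c - c a *: E a); split=> [b bB|].
      rewrite !ffunE; have [<-|ab] := eqVneq a b; first by rewrite /= [X in _ - X]mulr1 subrr.
      by rewrite scaler0 subr0 c0 // finset.in_setU1 negb_or eq_sym ab.
    rewrite opprB addrA addrAC; apply: submodD => //; apply: mW => b; rewrite !ffunE.
    by rewrite [_ *: _]mulrC; apply: idealM.
  have [u hu] := maximal_inv hm mca.
  exists u; split=> //.
  exists (- (u *: (c - c a *: E a))); split=> [b bB|].
    rewrite !ffunE; have [<-|ab] := eqVneq a b.
      by rewrite /= [X in _ *: (_ - X)]mulr1 subrr scaler0 oppr0.
    by rewrite scaler0 subr0 c0 ?scaler0 ?oppr0 // finset.in_setU1 negb_or eq_sym ab.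
  have -> : E a - u *: p - - (u *: (c - c a *: E a)) =
     (1 - u * c a) *: E a - u *: (p - c).
    by lincomb R.
  apply: submodB => //; last exact: submodZ.
  by apply: mW => b; rewrite !ffunE [_ *: _]mulrC; apply: idealM.
have /choice[s hs] := hE.
have vE (v : {ffun A -> R^o}) : v = \sum_a v a *: E a.
  apply/ffunP => b; rewrite sum_ffunE (bigD1 b) //= big1 ?addr0 ?ffunE ?eqxx.
    by rewrite [RHS]mulr1.
  by move=> a /negPf ab; rewrite !ffunE ab scaler0.
have key (v : {ffun A -> R^o}) : WB B (v - (\sum_a s a * v a) *: p).
  rewrite {1}[v]vE scaler_suml -sumrB; apply: submod_sum => // a _.
  have -> : v a *: E a - (s a * v a) *: p = v a *: (E a - s a *: p).
    by rewrite scalerBr scalerA mulrC.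
  by apply: (submodZ _ (hWB B)); case: (hs a).
have scal (c : R) : WB B (c *: p) -> m c.
  move=> hc; apply: contrapT => /(maximal_inv hm)[u hu]; apply: nB.
  have -> : p = (1 - u * c) *: p + u *: (c *: p) by rewrite scalerA -scalerDl subrK scale1r.
  apply: submodD => //; last exact: submodZ.
  by apply: subW; apply: mW => a; rewrite ffunE [_ *: _]mulrC; apply: idealM.
exists s; split=> [v Wv|].
  apply: scal; rewrite -[X in WB B X](subKr v); apply: submodB => //; exact: subW.
by apply: scal; rewrite scalerBl scale1r.
Qed.
End ModMaximal.

(** * Signs, graded modules with a differential, and P (x) Z *)

Section Sign.
Variable R : comPzRingType.

Definition sg (i : int) : R := (-1) ^+ `|i|%N.

Lemma sg0 : sg 0 = 1. Proof. exact: expr0. Qed.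
Lemma sg1 : sg 1 = -1. Proof. exact: expr1. Qed.
Lemma sgSr i : sg (i + 1) = - sg i.
Proof. by rewrite /sg -signr_odd odd_abszS signrN signr_odd. Qed.
Lemma sgB1 i : sg (i - 1) = - sg i.
Proof. by rewrite -[in RHS](subrK 1 i) sgSr opprK. Qed.
Lemma sgN i : sg (- i) = sg i. Proof. by rewrite /sg abszN. Qed.
Lemma sgD i j : sg (i + j) = sg i * sg j.
Proof.
elim/int_rec: j => [|n IHn|n IHn]; first by rewrite addr0 sg0 mulr1.
  by rewrite -addn1 PoszD addrA !sgSr IHn mulrN.
by rewrite -addn1 PoszD opprD addrA !sgB1 IHn mulrN.
Qed.
Lemma sg_sqr i : sg (i * i) = sg i.
Proof. by rewrite /sg abszM -signr_odd oddM andbb signr_odd. Qed.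
Lemma sgK i : sg i * sg i = 1. Proof. by rewrite /sg -expr2 sqrr_sign. Qed.
Lemma sgMSr i j : sg (i * (j + 1)) = sg (i * j) * sg i.
Proof. by rewrite mulrDr mulr1 sgD. Qed.
End Sign.
Arguments sg {R} i.

(* A complex given as one module with a differential, the homogeneous elements
   of degree n being singled out by a predicate; this avoids dependent types. *)
Section Graded.
Variable R : comPzRingType.
Implicit Types n : int.

Record gcx := Gcx {
  gM :> lmodType R;
  gd : {linear gM -> gM};
  gr : int -> gM -> Prop;
  gr_sub : forall n, submod (gr n);
  gr_d : forall n z, gr n z -> gr (n - 1) (gd z);
  gdd : forall z, gd (gd z) = 0
}.

Arguments gd {g}.

Definition gcyc (Z : gcx) n (z : Z) := gr n z /\ gd z = 0.
Definition gbd (Z : gcx) n (z : Z) := exists2 y, gr (n + 1) y & gd y = z.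
Definition gvan (Z : gcx) n := forall z : Z, gcyc n z -> gbd n z.
Definition gfg (Z : gcx) n := fgq (@gcyc Z n) (@gbd Z n).

Lemma gcyc_sub (Z : gcx) n : submod (@gcyc Z n).
Proof.
split; first by split; [exact: (submod0 (@gr_sub _ _)) | exact: linear0].
move=> a x y [hx dx] [hy dy]; split; last by rewrite linearP dx dy scaler0 addr0.
have h := @gr_sub Z n.
by apply: submodD => //; apply: submodZ.
Qed.

Lemma gbd_sub (Z : gcx) n : submod (@gbd Z n).
Proof.
have h := @gr_sub Z (n + 1).
split; first by exists 0; [exact: submod0 | exact: linear0].
move=> a x y [x' hx dx] [y' hy dy]; exists (a *: x' + y').
  exact: (h.2 _ _ _ hx hy).
by rewrite linearP dx dy.
Qed.

Lemma gbd_gcyc (Z : gcx) n (z : Z) : gbd n z -> gcyc n z.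
Proof. by case=> y hy <-; split; [rewrite -(addrK 1 n); exact: gr_d|exact: gdd]. Qed.

(* A bounded complex of finitely generated projective modules: a finite graded
   basis, a differential pb and an idempotent pe cutting out the projective
   modules in the free ones. *)
Record pdat := Pdat {
  pix :> finType;
  pdeg : pix -> int;
  pe : pix -> pix -> R;
  pb : pix -> pix -> R;
  pe_deg : forall a b, pdeg a != pdeg b -> pe a b = 0;
  pb_deg : forall a b, pdeg a + 1 != pdeg b -> pb a b = 0;
  pee : forall a c, \sum_b pe a b * pe b c = pe a c;
  peb : forall a c, \sum_b pe a b * pb b c = pb a c;
  pbe : forall a c, \sum_b pb a b * pe b c = pb a c;
  pbb : forall a c, \sum_b pb a b * pb b c = 0
}.

Section Act.
Variables (A : finType) (V : lmodType R).
Implicit Types (M : A -> A -> R) (z : {ffun A -> V}).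

Definition act M z : {ffun A -> V} := [ffun a => \sum_b M a b *: z b].

Lemma act_linear M : linear (act M).
Proof.
move=> c x y; apply/ffunP => a; rewrite !ffunE scaler_sumr -big_split /=.
by apply: eq_bigr => b _; rewrite !ffunE scalerDr !scalerA mulrC.
Qed.

Lemma actD M x y : act M (x + y) = act M x + act M y.
Proof. by rewrite -[x in LHS]scale1r act_linear scale1r. Qed.

Lemma act0 M : act M 0 = 0.
Proof. exact: (linear0 (mklin (act_linear M))). Qed.

Lemma act_mul M N L z : (forall a c, \sum_b M a b * N b c = L a c) ->
  act M (act N z) = act L z.
Proof.
move=> h; apply/ffunP => a; rewrite !ffunE.
under eq_bigr do rewrite ffunE scaler_sumr.
rewrite exchange_big /=; apply: eq_bigr => c _.
by rewrite -h scaler_suml; apply: eq_bigr => b _; rewrite scalerA.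
Qed.
End Act.

Section Tensor.
Variables (P : pdat) (Z : gcx).

(* P (x) Z, an element sum_a x_a (x) z_a being written as the family z. *)
Definition tdf (z : {ffun P -> Z}) : {ffun P -> Z} :=
  [ffun a => sg (pdeg a) *: gd (z a) + \sum_b pb a b *: z b].

Lemma tdf_linear : linear tdf.
Proof.
move=> c x y; apply/ffunP => a; rewrite !ffunE linearP.
have -> : \sum_b pb a b *: (c *: x + y) b =
    c *: \sum_b pb a b *: x b + \sum_b pb a b *: y b.
  rewrite scaler_sumr -big_split; apply: eq_bigr => b _ /=.
  by rewrite !ffunE; lincomb R.
by lincomb R.
Qed.
Definition td : {linear {ffun P -> Z} -> {ffun P -> Z}} := mklin tdf_linear.

(** The free hull of P (x) Z, without the invariance under the idempotent that [tgr] adds. The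
    differential still squares to zero there, and a primitive found there is brought back by the
    idempotent, see [tbdfE]; filtrations by basis elements can thus be carried out in the hull. *)
Definition tgrf n (z : {ffun P -> Z}) := forall a, gr (n - pdeg a) (z a).
Definition tgr n (z : {ffun P -> Z}) := tgrf n z /\ act (@pe P) z = z.

Lemma tgrf_sub n : submod (tgrf n).
Proof.
split; first by move=> a; rewrite ffunE; exact: (submod0 (@gr_sub _ _)).
move=> c x y hx hy a; rewrite !ffunE; have h := @gr_sub Z (n - pdeg a).
by apply: submodD => //; apply: submodZ.
Qed.

Lemma tgr_sub n : submod (tgr n).
Proof.
split.
  by split; [exact: (submod0 (@tgrf_sub _)) | exact: act0].
move=> c x y [hx ex] [hy ey]; split; last by rewrite act_linear ex ey.
exact: ((@tgrf_sub n).2 _ _ _ hx hy).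
Qed.

Lemma tgrf_d n z : tgrf n z -> tgrf (n - 1) (td z).
Proof.
move=> hz a; rewrite ffunE; have h := @gr_sub Z (n - 1 - pdeg a).
apply: submodD => //.
  by apply: submodZ => //; rewrite addrAC; apply: gr_d.
apply: submod_sum => // b _; have [e|ne] := eqVneq (pdeg a + 1) (pdeg b).
  by apply: submodZ => //; have := hz b; rewrite -e opprD addrA addrAC.
by rewrite pb_deg // scale0r; exact: submod0.
Qed.

Lemma td_act z : td (act (@pe P) z) = act (@pe P) (td z).
Proof.
have E : [ffun a => sg (pdeg a) *: gd (act (@pe P) z a)] =
    act (@pe P) [ffun a => sg (pdeg a) *: gd (z a)].
  apply/ffunP => a; rewrite !ffunE linear_sum scaler_sumr; apply: eq_bigr => b _.
  rewrite ffunE linearZ /= !scalerA; have [->|ne] := eqVneq (pdeg a) (pdeg b).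
    by rewrite mulrC.
  by rewrite pe_deg // mulr0 mul0r.
have tdE y : td y = [ffun a => sg (pdeg a) *: gd (y a)] + act (@pb P) y.
  by apply/ffunP => a; rewrite !ffunE.
rewrite !tdE E (act_mul _ (@pbe P)).
by rewrite actD (act_mul _ (@peb P)).
Qed.

Lemma tgr_d n z : tgr n z -> tgr (n - 1) (td z).
Proof. by case=> hz ez; split; [exact: tgrf_d | rewrite -td_act ez]. Qed.

Lemma tdd z : td (td z) = 0.
Proof.
apply/ffunP => a; rewrite ffunE /=.
under eq_bigr do rewrite ffunE scalerDr.
rewrite ffunE linearD linearZ /= gdd scaler0 add0r linear_sum big_split /=.
have -> : \sum_b pb a b *: \sum_c pb b c *: z c = 0.
  under eq_bigr do rewrite scaler_sumr.
  rewrite exchange_big big1 //= => c _; under eq_bigr do rewrite scalerA.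
  by rewrite -scaler_suml pbb scale0r.
rewrite addr0 scaler_sumr -big_split big1 ?ffunE //= => b _.
rewrite linearZ /= !scalerA -scalerDl; have [<-|ne] := eqVneq (pdeg a + 1) (pdeg b).
  by rewrite sgSr mulrN mulrC subrr scale0r.
by rewrite pb_deg // mulr0 mul0r addr0 scale0r.
Qed.

Definition tcx := Gcx tgr_sub tgr_d tdd.

Lemma tgr_act n z : tgrf n z -> tgr n (act (@pe P) z).
Proof.
move=> hz; split; last exact: (act_mul _ (@pee P)).
move=> a; rewrite ffunE; have h := @gr_sub Z (n - pdeg a); apply: submod_sum => // b _.
have [e|ne] := eqVneq (pdeg a) (pdeg b); first by apply: submodZ; rewrite // e.
by rewrite pe_deg // scale0r; exact: submod0.
Qed.

Definition tbdf n (z : {ffun P -> Z}) := exists2 y, tgrf (n + 1) y & td y = z.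

Lemma tbdf_sub n : submod (tbdf n).
Proof.
have h := tgrf_sub (n + 1).
split; first by exists 0; [exact: submod0 | exact: linear0].
move=> a x y [x' hx dx] [y' hy dy]; exists (a *: x' + y').
  exact: (h.2 _ _ _ hx hy).
by rewrite linearP dx dy.
Qed.

Lemma tbdfE n (z : tcx) : gr n z -> tbdf n z -> gbd n z.
Proof.
move=> [_ ez] [y hy dy]; exists (act (@pe P) y); first exact: tgr_act.
by rewrite -[gd _]/(td _) td_act dy.
Qed.

(** As the differential of P lowers degrees, families supported on such a set form a subcomplex.
    Removing elements of top degree one by one filters the free hull of P (x) Z, with shifts of Z as
    successive quotients. *)
Definition dclosed (B : {set P}) :=
  forall b c : P, b \in B -> pdeg c < pdeg b -> c \in B.
Definition tsupp (B : {set P}) (z : {ffun P -> Z}) := forall a, a \notin B -> z a = 0.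
Definition tcyc n (B : {set P}) z := [/\ tgrf n z, td z = 0 & tsupp B z].

Lemma tcyc_sub n B : submod (tcyc n B).
Proof.
have h := tgrf_sub n.
split; first by split; [exact: submod0|exact: linear0|move=> a _; rewrite ffunE].
move=> c x y [hx dx sx] [hy dy sy]; split.
- exact: (h.2 _ _ _ hx hy).
- by rewrite linearP dx dy scaler0 addr0.
- by move=> a aB; rewrite !ffunE sx // sy // scaler0 addr0.
Qed.

Lemma dclosed_top (B : {set P}) a0 : dclosed B -> a0 \in B ->
  exists2 a, a \in B & dclosed (B :\ a) /\ forall b, b \in B -> pdeg b <= pdeg a.
Proof.
move=> hB a0B; pose a := [arg max_(a > a0 in B) pdeg a]%O.
have [aB amax] : a \in B /\ forall b, b \in B -> pdeg b <= pdeg a.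
  by rewrite /a; case: arg_maxP.
exists a => //; split=> // b c; rewrite !finset.in_setD1 => /andP[_ bB] lt.
rewrite (hB b) // andbT; apply: contraTneq lt => ->.
by rewrite -leNgt amax.
Qed.

Lemma tcyc_top n B a z : tcyc n B z -> (forall b, b \in B -> pdeg b <= pdeg a) ->
  gcyc (n - pdeg a) (z a).
Proof.
move=> [hz dz sz] amax; split; first exact: hz.
have := congr1 (fun f : {ffun P -> Z} => f a) dz; rewrite !ffunE big1 ?addr0 => [e|b _].
  by rewrite -[LHS]scale1r -(sgK R (pdeg a)) -scalerA e scaler0.
have [e|ne] := eqVneq (pdeg a + 1) (pdeg b); last by rewrite pb_deg // scale0r.
rewrite sz ?scaler0 //; apply: contraL (eqxx true) => /amax.
by rewrite -e gerDl ler10.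
Qed.

(** Subtracting the differential of the family with a primitive of [z a] at place [a], up to sign,
    clears that component and otherwise only alters components one degree lower, which belong to
    [B]. *)
Lemma tcyc_peel n B a z : tcyc n B z -> dclosed B -> a \in B ->
  gbd (n - pdeg a) (z a) -> exists2 z', tcyc n (B :\ a) z' & tbdf n (z - z').
Proof.
move=> [hz dz sz] hB aB [y hy dy].
pose Y : {ffun P -> Z} := [ffun b => if b == a then sg (pdeg a) *: y else 0].
have hY : tgrf (n + 1) Y.
  move=> b; rewrite ffunE; have h := @gr_sub Z (n + 1 - pdeg b).
  case: eqP => [->|_]; last exact: submod0.
  by apply: (submodZ _ (@gr_sub _ _)); rewrite addrAC.
exists (z - td Y); last by exists Y; rewrite // opprB addrC subrK.
split.
- apply: (submodB (@tgrf_sub n)) => //.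
  by have := tgrf_d hY; rewrite addrK.
- by rewrite linearB dz tdd subr0.
- move=> b; rewrite finset.in_setD1 negb_and negbK !ffunE.
  rewrite (bigD1 a) //= big1 ?addr0; last first.
    by move=> c /negPf ca; rewrite ffunE ca scaler0.
  rewrite ffunE eqxx => /orP[/eqP ->|bB].
    rewrite eqxx pb_deg ?scale0r ?addr0; last first.
      by rewrite -subr_eq0 addrAC subrr add0r oner_eq0.
    by rewrite [gd _]linearZ scalerA sgK scale1r dy subrr.
  have ba : (b == a) = false by apply: contraNF bB => /eqP ->.
  rewrite ba linear0 scaler0 add0r sz // sub0r.
  rewrite pb_deg ?scale0r ?oppr0 //; apply: contra bB => /eqP e.
  by apply: (hB a) => //; rewrite -e ltrDl.
Qed.

Lemma tvan_free n z : (forall a : P, gvan Z (n - pdeg a)) -> tgrf n z -> td z = 0 ->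
  tbdf n z.
Proof.
move=> hZ hz dz.
suff h k : forall (B : {set P}) z, #|B| = k -> dclosed B -> tcyc n B z -> tbdf n z.
  by apply: (h _ [set: P]%SET) => //; split=> // a; rewrite finset.inE.
elim: k => [|k IHk] B {hz dz}z cB hB hz.
  have -> : z = 0.
    case: hz => _ _ sz; apply/ffunP => a; rewrite sz ?ffunE //.
    by rewrite (cards0_eq cB) finset.inE.
  exact: (submod0 (tbdf_sub n)).
have [a0 a0B] : exists a0, a0 \in B by apply/set0Pn; rewrite -cards_eq0 cB.
have [a aB [hB' amax]] := dclosed_top hB a0B.
have [z' hz' hzz'] := tcyc_peel hz hB aB (hZ a _ (tcyc_top hz amax)).
rewrite -(subrK z' z); apply: (submodD (tbdf_sub n)) => //.
apply: (IHk (B :\ a)) => //; by move: cB; rewrite (cardsD1 a) aB => -[].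
Qed.

Lemma tvan n : (forall a : P, gvan Z (n - pdeg a)) -> gvan tcx n.
Proof. by move=> h z [hz dz]; apply: tbdfE => //; apply: tvan_free => //; case: hz. Qed.

Lemma tfg n : noetherian R -> (forall a : P, gfg Z (n - pdeg a)) -> gfg tcx n.
Proof.
move=> noeth hZ.
have h k : forall B : {set P}, #|B| = k -> dclosed B -> fgq (tcyc n B) (tbdf n).
  elim: k => [|k IHk] B cB hB.
    exists void, (fun v : void => of_void _ v); split=> [[]|z [_ _ sz]].
    exists (fun=> 0); have -> : z = 0.
      by apply/ffunP => a; rewrite sz ?ffunE // (cards0_eq cB) finset.inE.
    by rewrite big1 ?subr0 => [|[]//]; exact: (submod0 (tbdf_sub n)).
  have [a0 a0B] : exists a0, a0 \in B by apply/set0Pn; rewrite -cards_eq0 cB.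
  have [a aB [hB' amax]] := dclosed_top hB a0B.
  have pl : linear (fun z : {ffun P -> Z} => z a) by move=> c x y; rewrite !ffunE.
  apply: (fgq_ext noeth (pi := mklin pl) (N' := @gcyc Z (n - pdeg a))
    (W' := @gbd Z (n - pdeg a))) => //.
  - exact: tcyc_sub.
  - exact: tbdf_sub.
  - exact: gbd_sub.
  - by move=> z hz; apply: (tcyc_top hz amax).
  - exact: hZ.
  have : fgq (tcyc n (B :\ a)) (tbdf n).
    by apply: IHk => //; move: cB; rewrite (cardsD1 a) aB => -[].
  move=> /fgq_sum; apply; last exact: tbdf_sub.
    by move=> z [hz hza]; apply: tcyc_peel.
  move=> z [hz dz sz]; split.
    by split=> // b bB; apply: sz; rewrite finset.in_setD1 negb_and bB orbT.
  by rewrite /= sz ?finset.setD11 //; exact: (submod0 (@gbd_sub _ _)).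
have hsub := @gcyc_sub tcx n.
(* Back from the free hull: the cycles of P (x) Z form a submodule of the free ones, and those that
   bound in the hull are boundaries. *)
apply: (fgqW (W := tbdf n)) => //.
  by move=> z [hz _]; apply: tbdfE.
apply: (fgq_sub noeth (N := tcyc n [set: P]%SET)) => //.
- by apply: (h _ _ erefl) => b c; rewrite !finset.inE.
- by move=> z [[hz _] dz]; split=> // a; rewrite finset.inE.
- exact: tbdf_sub.
Qed.
End Tensor.
End Graded.
Arguments gd {R g}.

(** * Exchange of factors and duality for P *)

Section Perfect.
Variable R : comPzRingType.
Implicit Types (P Q : pdat R) (Z : gcx R) (n : int).

Lemma sum_scale_scale (V : lmodType R) (A : finType) (c : A -> R) (r : R) (z : A -> V) :
  r *: \sum_a c a *: z a = \sum_a (r * c a) *: z a.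
Proof. by rewrite scaler_sumr; apply: eq_bigr => a _; rewrite scalerA. Qed.

Section Swap.
Variables (P Q : pdat R) (Z : gcx R).

(** The sign (-1)^(|a||b|) of the exchange is what makes it commute with the differentials. *)
Definition swf (w : {ffun P -> {ffun Q -> Z}}) : {ffun Q -> {ffun P -> Z}} :=
  [ffun b => [ffun a => sg (pdeg a * pdeg b) *: w a b]].

Lemma swf_gr n (w : tcx P (tcx Q Z)) : gr n w -> @gr _ (tcx Q (tcx P Z)) n (swf w).
Proof.
move=> [hw ew]; split.
  move=> b; split.
    move=> a; rewrite !ffunE addrAC; apply: (submodZ _ (@gr_sub _ _ _)).
    by case: (hw a) => + _; apply.
  apply/ffunP => a; rewrite !ffunE.
  have -> : w a b = \sum_a' pe a a' *: w a' b.
    by rewrite -{1}ew ffunE sum_ffunE; apply: eq_bigr => a' _; rewrite ffunE.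
  rewrite scaler_sumr; apply: eq_bigr => a' _; rewrite !ffunE !scalerA.
  have [->|ne] := eqVneq (pdeg a) (pdeg a'); first by rewrite mulrC.
  by rewrite pe_deg // mulr0 mul0r.
apply/ffunP => b; apply/ffunP => a; rewrite !ffunE sum_ffunE.
have [_ ea] := hw a.
have -> : w a b = \sum_b' pe b b' *: w a b' by rewrite -{1}ea ffunE.
rewrite scaler_sumr; apply: eq_bigr => b' _; rewrite !ffunE !scalerA.
have [->|ne] := eqVneq (pdeg b) (pdeg b'); first by rewrite mulrC.
by rewrite pe_deg // mulr0 mul0r.
Qed.

Lemma swf_d (w : tcx P (tcx Q Z)) : @gd _ (tcx Q (tcx P Z)) (swf w) = swf (gd w).
Proof.
apply/ffunP => b; apply/ffunP => a; rewrite !ffunE !sum_ffunE.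
rewrite linearZ /= !scalerDr !scaler_sumr !scalerA.
rewrite -!addrA; congr (_ + _); first by congr (_ *: _); ring.
rewrite addrC; congr (_ + _); apply: eq_bigr => c _; rewrite !ffunE !scalerA.
  have [<-|ne] := eqVneq (pdeg b + 1) (pdeg c).
    by rewrite sgMSr; congr (_ *: _); ring.
  by rewrite (pb_deg ne) !(mul0r, mulr0) !scale0r.
have [<-|ne] := eqVneq (pdeg a + 1) (pdeg c).
  rewrite mulrC (mulrC _ (pdeg b)) sgMSr [pdeg b * _]mulrC.
  have E : sg (pdeg b) * sg (pdeg b) = 1 :> R by exact: sgK.
  by congr (_ *: _); ring: E.
by rewrite (pb_deg ne) !(mul0r, mulr0) !scale0r.
Qed.
End Swap.

Lemma swfK P Q Z (w : {ffun P -> {ffun Q -> Z}}) : swf (swf w) = w.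
Proof.
apply/ffunP => a; apply/ffunP => b; rewrite !ffunE scalerA mulrC [_ * pdeg b]mulrC sgK.
exact: scale1r.
Qed.

Lemma swap_van P Q Z n : gvan (tcx P (tcx Q Z)) n -> gvan (tcx Q (tcx P Z)) n.
Proof.
move=> h w [hw dw]; have [|y hy dy] := h (swf w).
  split; first exact: swf_gr.
  rewrite swf_d dw; apply/ffunP => a; apply/ffunP => b.
  by rewrite !ffunE scaler0.
by exists (swf y); [exact: swf_gr | rewrite swf_d dy swfK].
Qed.

Section Dual.
Variable P : pdat R.

Definition dual_e (a b : P) : R := pe b a.
(** The matrix of f |-> - (-1)^|f| f d on Hom(P, R), the form dual to [b] having degree
    [- pdeg b]. *)
Definition dual_b (a b : P) : R := - sg (pdeg b) * pb b a.

Lemma dual_e_deg a b : - pdeg a != - pdeg b -> dual_e a b = 0.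
Proof. by rewrite eqr_opp => ne; apply: pe_deg; rewrite eq_sym. Qed.
Lemma dual_b_deg a b : - pdeg a + 1 != - pdeg b -> dual_b a b = 0.
Proof.
move=> ne; rewrite /dual_b pb_deg ?mulr0 //; apply: contra ne => /eqP <-.
by rewrite opprD addrNK.
Qed.
Lemma dual_ee a c : \sum_b dual_e a b * dual_e b c = dual_e a c.
Proof. by rewrite -[RHS]pee; apply: eq_bigr => b _; rewrite mulrC. Qed.
Lemma dual_eb a c : \sum_b dual_e a b * dual_b b c = dual_b a c.
Proof.
rewrite /dual_b -[in RHS]pbe mulr_sumr; apply: eq_bigr => b _; rewrite /dual_e; ring.
Qed.
Lemma dual_be a c : \sum_b dual_b a b * dual_e b c = dual_b a c.
Proof.
rewrite /dual_b -[in RHS]peb mulr_sumr; apply: eq_bigr => b _; rewrite /dual_e.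
have [->|ne] := eqVneq (pdeg c) (pdeg b); first by ring.
by rewrite (pe_deg ne); ring.
Qed.
Lemma dual_bb a c : \sum_b dual_b a b * dual_b b c = 0.
Proof.
transitivity (- sg (pdeg c) * - sg (pdeg c + 1) * \sum_b pb c b * pb b a); last first.
  by rewrite pbb mulr0.
rewrite /dual_b mulr_sumr.
apply: eq_bigr => b _; have [->|ne] := eqVneq (pdeg c + 1) (pdeg b); first by ring.
by rewrite (pb_deg ne); ring.
Qed.

Definition pdual : pdat R :=
  @Pdat R P (fun a => - pdeg a) _ _ dual_e_deg dual_b_deg dual_ee dual_eb dual_be dual_bb.

(* P is a direct summand of P (x) P (x) P^v, through the coevaluation
   R -> P (x) P^v and the evaluation P (x) P^v -> R. *)
Section Retract.
Variable Y : gcx R.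
Let PPP := tcx P (tcx P (tcx pdual Y)).

Definition retr_in (h : {ffun P -> Y}) : {ffun P -> {ffun P -> {ffun pdual -> Y}}} :=
  [ffun a => [ffun b => [ffun c => pe b c *: h a]]].
(** The form is paired with the first factor, not with the one produced by the coevaluation, so that
    the composite with [retr_in] is the identity by the triangle identity. The sign moves [a] past
    [b] and then past its dual form. *)
Definition retr_out (H : {ffun P -> {ffun P -> {ffun pdual -> Y}}}) : {ffun P -> Y} :=
  [ffun b => \sum_a sg (pdeg a * pdeg b + pdeg a) *: H a b a].

Lemma retr_in_gr n (h : tcx P Y) : gr n h -> @gr _ PPP n (retr_in h).
Proof.
move=> [hh eh]; split; last first.
  apply/ffunP => a; apply/ffunP => b; apply/ffunP => c; rewrite !ffunE !sum_ffunE.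
  rewrite -{2}eh ffunE scaler_sumr.
  under eq_bigr do rewrite !ffunE.
  by apply: eq_bigr => a' _; lincomb R.
move=> a; split; last first.
  apply/ffunP => b; apply/ffunP => c; rewrite !ffunE sum_ffunE -pee scaler_suml.
  by apply: eq_bigr => b' _; rewrite !ffunE scalerA.
move=> b; split; last first.
  apply/ffunP => c; rewrite !ffunE -pee scaler_suml.
  by apply: eq_bigr => c' _; rewrite !ffunE scalerA mulrC.
move=> c; rewrite !ffunE; have [e|ne] := eqVneq (pdeg b) (@pdeg R P c); last first.
  by rewrite (pe_deg ne) scale0r; apply: (submod0 (@gr_sub _ _ _)).
by rewrite /= -addrA e opprK addNr addr0; apply: (submodZ _ (@gr_sub _ _ _)).
Qed.

Lemma retr_in_d (h : tcx P Y) : @gd _ PPP (retr_in h) = retr_in (gd h).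
Proof.
apply/ffunP => a; apply/ffunP => b; apply/ffunP => c; rewrite !ffunE !sum_ffunE.
rewrite linearZ /= !scalerDr.
rewrite [X in _ + _ *: (_ *: X) + _ + _](_ : _ = - sg (pdeg b) *: (pb b c *: h a)); last first.
  rewrite -[in RHS]peb scaler_suml scaler_sumr; apply: eq_bigr => c' _.
  rewrite !ffunE /= /dual_b !scalerA; have [->|ne] := eqVneq (pdeg b) (@pdeg R P c').
    by congr (_ *: _); ring.
  by rewrite (pe_deg ne); congr (_ *: _); ring.
rewrite [X in _ + _ + _ *: X + _](_ : _ = pb b c *: h a); last first.
  rewrite -[in RHS]pbe scaler_suml; apply: eq_bigr => c' _.
  by rewrite !ffunE scalerA.
rewrite [X in _ + _ + _ + X](_ : _ = pe b c *: \sum_b0 pb a b0 *: h b0); last first.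
  rewrite scaler_sumr; apply: eq_bigr => a' _.
  by rewrite !ffunE; lincomb R.
have E : pe b c * sg (pdeg b) = pe b c * sg (@pdeg R P c) :> R.
  have [->|ne] := eqVneq (pdeg b) (@pdeg R P c); last by rewrite (pe_deg ne); ring.
  by [].
have E1 : sg (pdeg b) * sg (pdeg b) = 1 :> R by exact: sgK.
have E2 : sg (@pdeg R P c) * sg (@pdeg R P c) = 1 :> R by exact: sgK.
rewrite sgN !scalerA.
have -> : sg (pdeg a) * sg (pdeg b) * sg (@pdeg R P c) * pe b c = pe b c * sg (pdeg a) :> R.
  transitivity (sg (pdeg a) * sg (@pdeg R P c) * (pe b c * sg (pdeg b)) : R); first by ring.
  by rewrite E; ring: E2.
have -> : sg (pdeg a) * sg (pdeg b) * - sg (pdeg b) = - sg (pdeg a) :> R by ring: E1.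
by lincomb R.
Qed.

Lemma retr_out_gr n (H : PPP) : gr n H -> @tgrf _ P Y n (retr_out H).
Proof.
move=> [hH _] b; rewrite ffunE; apply: (submod_sum (@gr_sub _ _ _)) => a _.
apply: (submodZ _ (@gr_sub _ _ _)); have [h _] := hH a; have [h' _] := h b.
by have := h' a; rewrite /= opprK addrAC subrK.
Qed.

Lemma retr_out_d (H : PPP) : retr_out (gd H) = @td _ P Y (retr_out H).
Proof.
apply/ffunP => b; rewrite [RHS]ffunE [in LHS]ffunE.
pose S1 := \sum_a (sg (pdeg b) * sg (pdeg a * pdeg b + pdeg a)) *: gd (H a b a).
pose S2 := \sum_a \sum_c
  (sg (pdeg a * pdeg b + pdeg a) * (sg (pdeg a) * sg (pdeg b)) * - sg (pdeg c) * pb c a)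
  *: H a b c.
pose S3 := \sum_a \sum_c (sg (pdeg a * pdeg b + pdeg a) * sg (pdeg a) * pb b c) *: H a c a.
pose S4 := \sum_a \sum_c (sg (pdeg a * pdeg b + pdeg a) * pb a c) *: H c b a.
have -> : \sum_a sg (pdeg a * pdeg b + pdeg a) *: (gd H) a b a = S1 + S2 + S3 + S4.
  rewrite -!big_split; apply: eq_bigr => a _ /=; rewrite !ffunE !sum_ffunE /=.
  rewrite [X in _ *: (_ *: (_ + X) + _)](_ : _ = \sum_c pb b c *: H a c a); last first.
    by apply: eq_bigr => c _; rewrite ffunE.
  rewrite [X in _ *: (_ + X)](_ : _ = \sum_c pb a c *: H c b a); last first.
    by apply: eq_bigr => c _; rewrite !ffunE.
  rewrite sgN !scalerDr !sum_scale_scale !scalerA; congr (_ *: _ + _ + _ + _).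
  - have E : sg (pdeg a) * sg (pdeg a) = 1 :> R by exact: sgK.
    by ring: E.
  - by apply: eq_bigr => c _; congr (_ *: _); rewrite /dual_b; ring.
  - by apply: eq_bigr => c _; congr (_ *: _); ring.
have -> : S4 = - S2.
  rewrite /S4 exchange_big -sumrN; apply: eq_bigr => a _.
  rewrite -sumrN; apply: eq_bigr => c _; rewrite -scaleNr; congr (_ *: _).
  have [<-|ne] := eqVneq (pdeg c + 1) (pdeg a); last by rewrite (pb_deg ne); ring.
  have E : sg (pdeg c) * sg (pdeg c) = 1 :> R by exact: sgK.
  have E' : sg (pdeg b) * sg (pdeg b) = 1 :> R by exact: sgK.
  rewrite mulrDl mul1r !sgD sg1.
  by ring: E E'.
rewrite addrAC [_ + S2 - S2]addrK; congr (_ + _).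
  rewrite /retr_out ffunE linear_sum scaler_sumr; apply: eq_bigr => a _.
  by rewrite linearZ /= scalerA.
rewrite /S3 exchange_big; apply: eq_bigr => c _; rewrite ffunE scaler_sumr.
apply: eq_bigr => a _; rewrite scalerA.
have [<-|ne] := eqVneq (pdeg b + 1) (pdeg c); last by rewrite (pb_deg ne) !(mulr0, mul0r).
by congr (_ *: _); rewrite mulrDr mulr1 !sgD; ring.
Qed.

Lemma retr_outK (h : tcx P Y) n : gr n h -> retr_out (retr_in h) = h.
Proof.
case=> _ eh; apply/ffunP => b; rewrite -[in RHS]eh !ffunE; apply: eq_bigr => a _.
rewrite !ffunE scalerA; have [->|ne] := eqVneq (pdeg b) (pdeg a).
  by rewrite sgD sg_sqr sgK mul1r.
by rewrite (pe_deg ne) mulr0.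
Qed.

Lemma retract_van n : gvan PPP n -> gvan (tcx P Y) n.
Proof.
move=> hv h [hh dh]; have [|y hy dy] := hv (retr_in h).
  split; first exact: retr_in_gr.
  rewrite retr_in_d dh; apply/ffunP => a; apply/ffunP => b; apply/ffunP => c.
  by rewrite !ffunE scaler0.
apply: tbdfE => //; exists (retr_out y); first exact: retr_out_gr.
by rewrite -retr_out_d dy; apply: (retr_outK hh).
Qed.
End Retract.
End Dual.

(** Since P lives in nonnegative degrees, the two extra factors P in P (x) P (x) P^v (x) Y preserve
    vanishing below [b]. *)
Lemma dual_van_tensor P Y b : (forall a : P, 0 <= pdeg a) ->
  (forall n, n < b -> gvan (tcx (pdual P) Y) n) -> forall n, n < b -> gvan (tcx P Y) n.
Proof.
move=> hP h n nb; apply: retract_van; apply: tvan => a; apply: tvan => a'.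
apply: h; apply: le_lt_trans nb; rewrite -addrA gerDl -opprD oppr_le0.
exact: addr_ge0.
Qed.
End Perfect.

(** * Koszul homotopies and the increase of weight *)

Section Koszul.
Variable R : comPzRingType.
Implicit Types (P : pdat R) (Z : gcx R) (n : int).

(* The quotient of P by its part of degree at most 1; the dead indices are given
   the degree 2. *)
Section Truncation.
Variable P : pdat R.
Definition t2 (a : P) := 2 <= pdeg a.
Definition tdeg2 (a : P) := if t2 a then pdeg a else 2.
Definition te2 (a b : P) : R := if t2 a then pe a b else 0.
Definition tb2 (a b : P) : R := if t2 a then pb a b else 0.

Lemma te2_deg a b : tdeg2 a != tdeg2 b -> te2 a b = 0.
Proof.
rewrite /tdeg2 /te2 /t2; case: ifP => // ha; case: ifP => hb; first exact: pe_deg.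
by move=> _; apply: pe_deg; apply: contraFneq hb => <-.
Qed.
Lemma tb2_deg a b : tdeg2 a + 1 != tdeg2 b -> tb2 a b = 0.
Proof.
rewrite /tdeg2 /tb2 /t2; case: ifP => // ha; case: ifP => hb; first exact: pb_deg.
move=> _; apply: pb_deg; apply: contraFneq hb => <-.
by rewrite ler_wpDr.
Qed.
Lemma te2_alive a b : t2 a -> ~~ t2 b -> pe a b = 0.
Proof. by move=> ha hb; apply: pe_deg; apply: contraNneq hb; rewrite /t2 => <-. Qed.
Lemma tb2_alive a b : t2 a -> ~~ t2 b -> pb a b = 0.
Proof.
move=> ha hb; apply: pb_deg; apply: contraNneq hb; rewrite /t2 => <-.
by rewrite ler_wpDr.
Qed.
Lemma te2e a c : \sum_b te2 a b * te2 b c = te2 a c.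
Proof.
rewrite /te2; have [ha|ha] := boolP (t2 a); last by rewrite big1 // => b _; rewrite mul0r.
rewrite -pee; apply: eq_bigr => b _; have [//|hb] := boolP (t2 b).
by rewrite (te2_alive ha hb) !mul0r.
Qed.
Lemma te2b a c : \sum_b te2 a b * tb2 b c = tb2 a c.
Proof.
rewrite /te2 /tb2; have [ha|ha] := boolP (t2 a); last by rewrite big1 // => b _; rewrite mul0r.
rewrite -peb; apply: eq_bigr => b _; have [//|hb] := boolP (t2 b).
by rewrite (te2_alive ha hb) !mul0r.
Qed.
Lemma tb2e a c : \sum_b tb2 a b * te2 b c = tb2 a c.
Proof.
rewrite /te2 /tb2; have [ha|ha] := boolP (t2 a); last by rewrite big1 // => b _; rewrite mul0r.
rewrite -pbe; apply: eq_bigr => b _; have [//|hb] := boolP (t2 b).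
by rewrite (tb2_alive ha hb) !mul0r.
Qed.
Lemma tb2b a c : \sum_b tb2 a b * tb2 b c = 0.
Proof.
rewrite /tb2; have [ha|ha] := boolP (t2 a); last by rewrite big1 // => b _; rewrite mul0r.
rewrite -[RHS](pbb a c); apply: eq_bigr => b _; have [//|hb] := boolP (t2 b).
by rewrite (tb2_alive ha hb) !mul0r.
Qed.
Definition ptrunc : pdat R := Pdat te2_deg tb2_deg te2e te2b tb2e tb2b.
End Truncation.

(* Homotopies e_i for the multiplication by x_i, raising a weight filtration. *)
Record kstr (r : nat) (x : nat -> R) Z := Kstr {
  ke : nat -> {linear Z -> Z};
  kF : nat -> Z -> Prop;
  ke_gr : forall i n z, (i < r)%N -> gr n z -> gr (n + 1) (ke i z);
  ke_htp : forall i z, (i < r)%N -> gd (ke i z) + ke i (gd z) = x i *: z;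
  kF_sub : forall s, submod (kF s);
  kF0 : forall z, kF 0 z;
  kFe : forall i s z, (i < r)%N -> kF s z -> kF s.+1 (ke i z)
}.

Section KTensor.
Variables (r : nat) (x : nat -> R) (P : pdat R) (Z : gcx R) (K : kstr r x Z).

Definition ktf i (w : {ffun P -> Z}) : {ffun P -> Z} :=
  [ffun a => sg (pdeg a) *: ke K i (w a)].
Fact ktf_linear i : linear (ktf i).
Proof. by move=> c y z; apply/ffunP => a; rewrite !ffunE linearP; lincomb R. Qed.
Definition kt i : {linear tcx P Z -> tcx P Z} := mklin (ktf_linear i).

Lemma kt_gr i n (w : tcx P Z) : (i < r)%N -> gr n w -> gr (n + 1) (kt i w).
Proof.
move=> ir [hw ew]; split.
  move=> a; rewrite ffunE addrAC; apply: (submodZ _ (@gr_sub _ _ _)).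
  exact: ke_gr.
apply/ffunP => a; rewrite !ffunE.
have -> : w a = \sum_b pe a b *: w b by rewrite -{1}ew ffunE.
rewrite linear_sum scaler_sumr; apply: eq_bigr => b _.
rewrite ffunE [ke _ _ (_ *: _)]linearZ /= !scalerA.
have [->|ne] := eqVneq (pdeg a) (pdeg b); first by rewrite mulrC.
by rewrite (pe_deg ne) mulr0 mul0r.
Qed.

Lemma kt_htp i (w : tcx P Z) : (i < r)%N -> gd (kt i w) + kt i (gd w) = x i *: w.
Proof.
move=> ir; apply/ffunP => a; rewrite !ffunE linearZ linearD linearZ /= linear_sum scalerDr.
rewrite -(ke_htp K _ ir) scaler_sumr.
have -> : \sum_b pb a b *: kt i w b = - \sum_b sg (pdeg a) *: ke K i (pb a b *: w b).
  rewrite -sumrN; apply: eq_bigr => b _; rewrite ffunE [ke _ _ (_ *: _)]linearZ /= !scalerA -scaleNr.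
  congr (_ *: _); have [<-|ne] := eqVneq (pdeg a + 1) (pdeg b); last by rewrite (pb_deg ne); ring.
  by rewrite sgSr; ring.
have E : sg (pdeg a) * sg (pdeg a) = 1 :> R by exact: sgK.
by rewrite [ke K i (sg _ *: _)]linearZ /= !scalerA E; lincomb R.
Qed.

Definition ktF s (w : tcx P Z) := forall a, kF K s (w a).

Fact ktF_sub s : submod (ktF s).
Proof.
split; first by move=> a; rewrite ffunE; exact: (submod0 (kF_sub K s)).
by move=> c y z hy hz a; rewrite !ffunE; apply: (kF_sub K s).2.
Qed.

Definition ktensor : kstr r x (tcx P Z).
Proof.
apply: (@Kstr _ _ _ kt ktF kt_gr kt_htp ktF_sub) => [w a|i s w ir hw a].
  exact: kF0.
by rewrite ffunE; apply: (submodZ _ (kF_sub K _)); apply: kFe.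
Defined.
End KTensor.

(* For z a cycle of Z, p (x) z = D w is a boundary of P (x) Z; applying a linear
   form s on P_0 with s p = 1 mod (x_i) and s d = sum_i x_i phi_i shows that z is
   homologous to sum_i e_i (phi_i d) w, where the part of w of degree at least 2
   is a cycle to which induction applies. *)
Section Claim.
Variables (r : nat) (x : nat -> R) (P : pdat R) (p s : P -> R) (phi : 'I_r -> P -> R).
Hypotheses (p_cyc : forall a, \sum_b pb a b * p b = 0)
  (p_e : forall a, \sum_b pe a b * p b = p a)
  (p_deg : forall a, pdeg a != 0 -> p a = 0)
  (s_deg : forall a, pdeg a != 0 -> s a = 0)
  (phi_deg : forall i a, pdeg a != 1 -> phi i a = 0)
  (s_phi : forall b, \sum_a s a * pb a b = \sum_(i < r) x i * phi i b).
Variable cp : 'I_r -> R.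
Hypothesis s_p : 1 - \sum_a s a * p a = \sum_(i < r) x i * cp i.

Lemma koszul_claim k Z (K : kstr r x Z) (b : int) : (forall n, n < b -> gvan (tcx P Z) n) ->
  forall n z, n < b -> gcyc n z -> exists2 y, gr (n + 1) y & kF K k (z - gd y).
Proof.
elim: k Z K b => [|k IHk] Z K b hZ n z nb [hz dz].
  by exists 0; [exact: (submod0 (@gr_sub _ _ _)) | exact: kF0].
have [|w [hw ew] dw] := hZ n nb [ffun a => p a *: z].
  split; [split|].
  - move=> a; rewrite ffunE; have [e|ne] := eqVneq (pdeg a) 0.
      by rewrite e subr0; apply: (submodZ _ (@gr_sub _ _ _)).
    by rewrite (p_deg ne) scale0r; apply: (submod0 (@gr_sub _ _ _)).
  - apply/ffunP => a; rewrite !ffunE -p_e scaler_suml; apply: eq_bigr => a' _.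
    by rewrite ffunE scalerA.
  - apply/ffunP => a; rewrite !ffunE linearZ /= dz !scaler0 add0r.
    under eq_bigr do rewrite ffunE scalerA.
    by rewrite -scaler_suml p_cyc scale0r.
have dwE a : sg (pdeg a) *: gd (w a) + \sum_b pb a b *: w b = p a *: z.
  by have := congr1 (fun f : {ffun P -> Z} => f a) dw; rewrite !ffunE.
(* [u i] and [L i] evaluate the form phi_i on P_1 at [w] and at d w, where d is the differential of
   P. As [p] lives in degree 0, the part of D w over P_1 vanishes, whence the equality [du] of the
   differential of u_i with L_i w. *)
pose u i := \sum_a phi i a *: w a.
pose L i (y : {ffun P -> Z}) := \sum_a phi i a *: \sum_a' pb a a' *: y a'.
have L_lin i : linear (L i).
  move=> e y y'; rewrite /L scaler_sumr -big_split; apply: eq_bigr => a _ /=.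
  rewrite scalerA mulrC -scalerA -scalerDr; congr (_ *: _).
  rewrite scaler_sumr -big_split; apply: eq_bigr => a' _ /=; rewrite !ffunE.
  by lincomb R.
have hu i : gr n (u i).
  apply: (submod_sum (@gr_sub _ _ _)) => a _; have [e|ne] := eqVneq (pdeg a) 1.
    by apply: (submodZ _ (@gr_sub _ _ _)); have := hw a; rewrite e addrK.
  by rewrite (phi_deg _ ne) scale0r; apply: (submod0 (@gr_sub _ _ _)).
have du i : gd (u i) = L i w.
  rewrite /u linear_sum; apply: eq_bigr => a _; rewrite linearZ /=.
  have [e|ne] := eqVneq (pdeg a) 1; last by rewrite (phi_deg _ ne) !scale0r.
  have := dwE a; rewrite p_deg ?e // scale0r sg1 scaleN1r => h; congr (_ *: _).
  by apply/esym/eqP; rewrite -subr_eq0 addrC h.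
pose w2 : {ffun P -> Z} := [ffun a => if t2 a then w a else 0].
have L2 i : L i w = L i w2.
  apply: eq_bigr => a _; have [e|ne] := eqVneq (pdeg a) 1; last by rewrite (phi_deg _ ne) !scale0r.
  congr (_ *: _); apply: eq_bigr => a' _; rewrite ffunE; case: ifP => // h.
  by rewrite pb_deg ?scale0r // e; apply: contraFneq h; rewrite /t2 => <-.
have hw2 : @gr _ (tcx (ptrunc P) Z) (n + 1) w2.
  split=> [a|]; rewrite ?ffunE /=.
    rewrite /tdeg2; case: ifP => // _; exact: (submod0 (@gr_sub _ _ _)).
  apply/ffunP => a; rewrite !ffunE /= /te2; case: ifP => ha; last first.
    by rewrite big1 // => a' _; rewrite scale0r.
  rewrite -[in RHS]ew ffunE; apply: eq_bigr => a' _; rewrite ffunE; case: ifP => // ha'.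
  by rewrite te2_alive ?ha' // !scale0r.
have dw2 : @gd _ (tcx (ptrunc P) Z) w2 = 0.
  apply/ffunP => a; rewrite !ffunE /= /tdeg2 /tb2; case: ifP => ha; last first.
    by rewrite linear0 scaler0 add0r big1 // => a' _; rewrite scale0r.
  transitivity (p a *: z); last first.
    by rewrite p_deg ?scale0r //; apply: contraTneq ha; rewrite /t2 => ->.
  rewrite -dwE.
  congr (_ + _); apply: eq_bigr => a' _; rewrite ffunE; case: ifP => // ha'.
  by rewrite tb2_alive ?ha' // !scale0r.
(* All indices of [ptrunc P] have degree at least 2, whence the bound [b + 2]; the degree [n + 1] of
   [w2] lies below it. *)
have [|||k2 [hk2 _] hF] := IHk _ (ktensor (ptrunc P) K) (b + 2) _ (n + 1) w2.
- move=> m mb; apply: swap_van; apply: tvan => a; apply: hZ => /=.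
  rewrite ltrBlDr; apply: lt_le_trans mb _; rewrite lerD2l /tdeg2.
  by case: ifP.
- exact: ltrD nb _.
- by split.
(* [L i] commutes with the differentials of the truncation and of Z because d d = 0 in P; only
   components of degree 2 enter, where the sign is 1. *)
have Lk i : gd (L i k2) + L i (w2 - @gd _ (tcx (ptrunc P) Z) k2) = L i w2.
  have -> : L i (w2 - @gd _ (tcx (ptrunc P) Z) k2) = L i w2 - L i (@gd _ (tcx (ptrunc P) Z) k2).
    exact: (linearB (mklin (L_lin i))).
  rewrite addrC -addrA -[RHS]addr0; congr (_ + _).
  apply/eqP; rewrite addrC subr_eq0; apply/eqP.
  rewrite /L linear_sum; apply: eq_bigr => a _; rewrite linearZ /=.
  have [e|ne] := eqVneq (pdeg a) 1; last by rewrite (phi_deg _ ne) !scale0r.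
  congr (_ *: _).
  rewrite linear_sum.
  transitivity (\sum_a' (pb a a' *: gd (k2 a') + \sum_b pb a a' *: (pb a' b *: k2 b))).
    rewrite big_split /= exchange_big /= [X in _ = _ + X]big1 ?addr0.
      by apply: eq_bigr => a' _; rewrite linearZ.
    move=> b' _; under eq_bigr do rewrite scalerA.
    by rewrite -scaler_suml pbb scale0r.
  apply: eq_bigr => a' _; rewrite !ffunE /= /tb2 /tdeg2.
  have [e'|ne'] := eqVneq (pdeg a + 1) (pdeg a'); last first.
    by rewrite (pb_deg ne') !scale0r big1 ?addr0 // => b' _; rewrite scale0r.
  have h2 : t2 a' by rewrite /t2 -e' e.
  rewrite h2 -e' e (_ : 1 + 1 = 2 :> int) // -scaler_sumr -scalerDr.
  by rewrite /sg expr2 mulrNN mul1r scale1r.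
(* The first sum accounts for 1 - s p and the second for s p, up to the sum of the x_i u_i. The
   third turns this error into the sum of the e_i L_i w2, and the last trades w2 for w2 - D k2, of
   weight [k], which e_i raises by one. *)
pose y := \sum_(i < r) cp i *: ke K i z + \sum_a s a *: w a + \sum_(i < r) ke K i (u i)
   - \sum_(i < r) ke K i (L i k2).
exists y.
  have h := @gr_sub _ Z (n + 1).
  apply: submodB => //; [apply: submodD => //; [apply: submodD => //|]|].
  - by apply: submod_sum => // i _; apply: submodZ => //; apply: ke_gr.
  - apply: submod_sum => // a _; have [e|ne] := eqVneq (pdeg a) 0.
      by apply: submodZ => //; have := hw a; rewrite e subr0.
    by rewrite (s_deg ne) scale0r; apply: submod0.
  - by apply: submod_sum => // i _; apply: ke_gr.
  - apply: submod_sum => // i _; apply: ke_gr => //.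
    apply: (submod_sum (@gr_sub _ _ _)) => a _; have [e|ne] := eqVneq (pdeg a) 1; last first.
      by rewrite (phi_deg _ ne) scale0r; apply: (submod0 (@gr_sub _ _ _)).
    apply: (submodZ _ (@gr_sub _ _ _)); apply: (submod_sum (@gr_sub _ _ _)) => a' _.
    have [e'|ne'] := eqVneq (pdeg a + 1) (pdeg a'); last first.
      by rewrite (pb_deg ne') scale0r; apply: (submod0 (@gr_sub _ _ _)).
    apply: (submodZ _ (@gr_sub _ _ _)); have := hk2 a'.
    by rewrite /= /tdeg2 /t2 -e' e (_ : 1 + 1 = 2) // -[2]/(1 + 1 : int) opprD addrA !addrK.
suff -> : z - gd y = \sum_(i < r) ke K i (L i (w2 - @gd _ (tcx (ptrunc P) Z) k2)).
  apply: (submod_sum (kF_sub K _)) => i _; apply: kFe => //.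
  apply: (submod_sum (kF_sub K _)) => a _; apply: (submodZ _ (kF_sub K _)).
  by apply: (submod_sum (kF_sub K _)) => a' _; apply: (submodZ _ (kF_sub K _)); apply: hF.
have E1 : gd (\sum_(i < r) cp i *: ke K i z) = (\sum_(i < r) x i * cp i) *: z.
  rewrite linear_sum scaler_suml; apply: eq_bigr => i _; rewrite linearZ /=.
  by have := ke_htp K z (ltn_ord i); rewrite dz linear0 addr0 => ->; rewrite scalerA mulrC.
have E2 : gd (\sum_a s a *: w a) = (\sum_a s a * p a) *: z - \sum_(i < r) x i *: u i.
  have -> : \sum_(i < r) x i *: u i = \sum_a s a *: \sum_b pb a b *: w b.
    transitivity (\sum_b (\sum_(i < r) x i * phi i b) *: w b).
      rewrite /u; under eq_bigr do rewrite sum_scale_scale.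
      by rewrite exchange_big; apply: eq_bigr => b' _; rewrite scaler_suml.
    under eq_bigr do rewrite -s_phi.
    under [RHS]eq_bigr do rewrite sum_scale_scale.
    by rewrite [RHS]exchange_big; apply: eq_bigr => b' _; rewrite scaler_suml.
  rewrite linear_sum scaler_suml -sumrB; apply: eq_bigr => a _; rewrite linearZ /=.
  have [e|ne] := eqVneq (pdeg a) 0; last by rewrite (s_deg ne) mul0r !scale0r subr0.
  by rewrite -scalerA -dwE e sg0; lincomb R.
have E3 : gd (\sum_(i < r) ke K i (u i)) = \sum_(i < r) x i *: u i - \sum_(i < r) ke K i (L i w2).
  rewrite linear_sum -sumrB; apply: eq_bigr => i _.
  by rewrite -(ke_htp K _ (ltn_ord i)) du L2 addrK.
have E4 : gd (\sum_(i < r) ke K i (L i k2)) = - \sum_(i < r) ke K i (gd (L i k2)).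
  have -> : \sum_(i < r) ke K i (gd (L i k2)) = \sum_(i < r) x i *: L i k2 - gd (\sum_(i < r) ke K i (L i k2)).
    rewrite linear_sum -sumrB; apply: eq_bigr => i _.
    by rewrite -(ke_htp K _ (ltn_ord i)) addrAC subrr add0r.
  rewrite (_ : \sum_(i < r) x i *: L i k2 = 0) ?sub0r ?opprK //.
  transitivity (\sum_a (\sum_(i < r) x i * phi i a) *: \sum_a' pb a a' *: k2 a').
    under eq_bigr do rewrite sum_scale_scale.
    by rewrite exchange_big; apply: eq_bigr => a _; rewrite scaler_suml.
  under eq_bigr do rewrite -s_phi scaler_suml.
  rewrite exchange_big big1 // => a _.
  under eq_bigr do rewrite -scalerA.
  rewrite -scaler_sumr; under eq_bigr do rewrite sum_scale_scale.
  rewrite exchange_big big1 ?scaler0 // => a' _.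
  by rewrite -scaler_suml pbb scale0r.
have E5 : \sum_(i < r) ke K i (L i w2) = \sum_(i < r) ke K i (gd (L i k2))
    + \sum_(i < r) ke K i (L i (w2 - @gd _ (tcx (ptrunc P) Z) k2)).
  by rewrite -big_split; apply: eq_bigr => i _ /=; rewrite -[in LHS]Lk linearD.
have -> : gd y = gd (\sum_(i < r) cp i *: ke K i z) + gd (\sum_a s a *: w a)
    + gd (\sum_(i < r) ke K i (u i)) - gd (\sum_(i < r) ke K i (L i k2)).
  by rewrite /y linearB !linearD.
rewrite E1 E2 E3 E4 -s_p E5.
move: (\sum_(i < r) x i *: u i) (\sum_(i < r) ke K i (gd (L i k2))) => q1 q2.
move: (\sum_(i < r) ke K i (L i _)) (\sum_a s a * p a) => q3 q4 {E1 E2 E3 E4 E5}.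
by lincomb R.
Qed.
End Claim.
End Koszul.

(** * Conservativity of P (x) - and Hom(P, -) *)

Section Conservative.
Variable R : comPzRingType.
Implicit Types (P : pdat R) (Z : gcx R) (n : int) (m : R -> Prop).

Section KoszulStep.
Variable y : R.

(** The Koszul complex of one element, with [true] for the generator of degree 1. *)
Definition k1_deg (a : bool) : int := if a then 1 else 0.
Definition k1_e (a b : bool) : R := (a == b)%:R.
Definition k1_b (a b : bool) : R := if ~~ a && b then y else 0.

Lemma k1_e_deg a b : k1_deg a != k1_deg b -> k1_e a b = 0.
Proof. by case: a; case: b. Qed.
Lemma k1_b_deg a b : k1_deg a + 1 != k1_deg b -> k1_b a b = 0.
Proof. by case: a; case: b. Qed.
Lemma k1_ee a c : \sum_b k1_e a b * k1_e b c = k1_e a c.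
Proof. by rewrite big_bool /k1_e; case: a; case: c => /=; ring. Qed.
Lemma k1_eb a c : \sum_b k1_e a b * k1_b b c = k1_b a c.
Proof. by rewrite big_bool /k1_e /k1_b; case: a; case: c => /=; ring. Qed.
Lemma k1_be a c : \sum_b k1_b a b * k1_e b c = k1_b a c.
Proof. by rewrite big_bool /k1_e /k1_b; case: a; case: c => /=; ring. Qed.
Lemma k1_bb a c : \sum_b k1_b a b * k1_b b c = 0.
Proof. by rewrite big_bool /k1_b; case: a; case: c => /=; ring. Qed.

Definition k1 : pdat R := Pdat k1_e_deg k1_b_deg k1_ee k1_eb k1_be k1_bb.

Lemma k1_act Z (w : {ffun k1 -> Z}) : act (@pe _ k1) w = w.
Proof.
apply/ffunP => a; rewrite ffunE big_bool /= /k1_e; case: a => /=;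
  by rewrite scale1r scale0r ?addr0 ?add0r.
Qed.

Lemma k1_dF Z (w : tcx k1 Z) : gd w false = gd (w false) + y *: w true.
Proof. by rewrite ffunE big_bool /= /k1_b /= sg0; lincomb R. Qed.
Lemma k1_dT Z (w : tcx k1 Z) : gd w true = - gd (w true).
Proof. by rewrite ffunE big_bool /= /k1_b /= sg1; lincomb R. Qed.
End KoszulStep.

Section KoszulStructure.
Variables (r : nat) (x : nat -> R) (Z : gcx R) (K : kstr r x Z).
Let T := tcx (k1 (x r)) Z.

(** Exterior multiplication by the new generator, a homotopy for the multiplication by [x r]. *)
Definition ktop_fun (w : T) : T := [ffun a => if a then w false else 0].
Fact ktop_linear : linear ktop_fun.
Proof. by move=> c w v; apply/ffunP => -[]; rewrite !ffunE ?scaler0 ?addr0. Qed.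
Definition ktop : {linear T -> T} := mklin ktop_linear.

Definition knext_e i : {linear T -> T} := if (i < r)%N then kt (k1 (x r)) K i else ktop.
(** The filtration by exterior weight: the new generator, at place [true], counts for one. *)
Definition knext_F s (w : T) :=
  kF K s (w false) /\ (if s is s'.+1 then kF K s' (w true) else True).

Lemma knext_gr i n (w : T) : (i < r.+1)%N -> gr n w -> gr (n + 1) (knext_e i w).
Proof.
rewrite /knext_e; case: ifP => [ir _|_ _]; first exact: kt_gr.
move=> [hw _]; split; last exact: k1_act.
move=> [] /=; rewrite ffunE; last exact: (submod0 (@gr_sub _ _ _)).
by rewrite addrK; have := hw false; rewrite subr0.
Qed.

Lemma knext_htp i (w : T) : (i < r.+1)%N -> gd (knext_e i w) + knext_e i (gd w) = x i *: w.
Proof.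
rewrite /knext_e; case: ifP => [ir _|]; first exact: kt_htp.
move=> ir; rewrite ltnS leq_eqVlt ir orbF => /eqP ->.
apply/ffunP => -[]; rewrite [LHS]ffunE [RHS]ffunE ?k1_dF ?k1_dT [ktop _ _]ffunE
  [ktop (gd w) _]ffunE.
  by rewrite k1_dF; lincomb R.
by rewrite ffunE linear0; lincomb R.
Qed.

Lemma knext_F_sub s : submod (knext_F s).
Proof.
split; first by split; rewrite ?ffunE; [|case: s => // s]; rewrite ?ffunE;
  exact: (submod0 (kF_sub K _)).
move=> c u v [hu hu'] [hv hv']; split; first by rewrite !ffunE; exact: (kF_sub K s).2.
by case: s hu' hv' {hu hv} => // s hu hv; rewrite !ffunE; exact: (kF_sub K s).2.
Qed.

Lemma knext_Fe i s (w : T) : (i < r.+1)%N -> knext_F s w -> knext_F s.+1 (knext_e i w).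
Proof.
rewrite /knext_e; case: ifP => [ir _|_ _] [hf ht]; split; rewrite ?ffunE //=.
- by apply: (submodZ _ (kF_sub K _)); exact: kFe.
- case: s ht {hf} => [_|s ht]; first exact: kF0.
  by apply: (submodZ _ (kF_sub K _)); exact: kFe.
- exact: (submod0 (kF_sub K _)).
Qed.

Definition knext : kstr r.+1 x T.
Proof.
apply: (Kstr knext_gr knext_htp knext_F_sub _ knext_Fe) => w.
by split=> //; exact: kF0.
Defined.
End KoszulStructure.

Section KoszulComplex.
Variables (x : nat -> R) (Y : gcx R).

Fixpoint kz (r : nat) : gcx R := if r is r'.+1 then tcx (k1 (x r')) (kz r') else Y.

(** With [r] generators the exterior weight is at most [r]. Hence a cycle pushed up to weight
    [r + 1] has become zero, and [koszul_claim] ends in an actual boundary. *)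
Lemma kz_struct r : exists K : kstr r x (kz r), forall s z, (r < s)%N -> kF K s z -> z = 0.
Proof.
elim: r => [|r [K hK]].
  pose F s (z : Y) := (0 < s)%N -> z = 0.
  have Fs s : submod (F s).
    split=> // c u v hu hv s0; rewrite hu // hv // scaler0 addr0 //.
  have F0 z : F 0 z by [].
  exists (@Kstr _ 0 x Y (fun=> \0) F (fun _ _ _ h _ => False_ind _ (Bool.diff_false_true h))
    (fun _ _ h => False_ind _ (Bool.diff_false_true h)) Fs F0
    (fun _ _ _ h _ => False_ind _ (Bool.diff_false_true h))).
  by move=> s z s0; apply.
exists (knext K) => -[//|s] w rs [hf ht]; apply/ffunP => -[]; rewrite ffunE.
  exact: (hK s).
by apply: (hK s.+1) => //; exact: ltnW.
Qed.

Lemma kz_van P (b : int) r : (forall n, n < b -> gvan (tcx P Y) n) ->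
  forall n, n < b -> gvan (tcx P (kz r)) n.
Proof.
move=> h; elim: r => [//|r IHr] n nb; apply: swap_van; apply: tvan => a; apply: IHr.
by apply: le_lt_trans nb; rewrite /= /k1_deg; case: a; rewrite ?subr0 // gerBl.
Qed.

Lemma kz_fg r : noetherian R -> (forall n, gfg Y n) -> forall n, gfg (kz r) n.
Proof. by move=> noeth h; elim: r => [//|r IHr] n; apply: tfg. Qed.
End KoszulComplex.

Definition lvan m Z (b : int) := forall n (z : Z), n < b -> gcyc n z -> exists2 s, ~ m s & gbd n (s *: z).

(** A cycle [v] of Z, put at place [false], is a cycle of the Koszul complex on [y]. If [s] times it
    is the boundary of [u], then s v - y (u true) is a boundary and [u true] is a cycle: at m the
    homology of Z equals [y] times itself, and Nakayama's lemma applies. *)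
Lemma lvan_step m Z y b : maximal_ideal m -> m y -> (forall n, gfg Z n) ->
  lvan m (tcx (k1 y) Z) b -> lvan m Z b.
Proof.
move=> hm my hfg h n z nb hz.
have [||v hv|s ms hs] := @local_nakayama R m Z (@gcyc _ Z n) (@gbd _ Z n) hm _ _ (hfg n).
- exact: gcyc_sub.
- exact: gbd_sub.
- pose w : tcx (k1 y) Z := [ffun a => if a then 0 else v].
  have hw : gcyc n w.
    split; [split; last exact: k1_act|].
      case; rewrite ffunE; first exact: (submod0 (@gr_sub _ _ _)).
      by rewrite /= subr0; case: hv.
    apply/ffunP => -[]; rewrite ?k1_dT ?k1_dF !ffunE ?linear0 ?oppr0 //.
    by rewrite addr0; case: hv.
  have [s ms [u [hu _] du]] := h n w nb hw.
  have hT : gcyc n (u true).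
    split; first by have := hu true; rewrite /= addrK.
    have := congr1 (fun f : {ffun k1 y -> Z} => f true) du; rewrite /= k1_dT !ffunE scaler0.
    by move/eqP; rewrite oppr_eq0 => /eqP.
  exists s => //; exists unit, (fun=> y), (fun=> u true); split=> //.
  exists (u false); first by have := hu false; rewrite subr0.
  have := congr1 (fun f : {ffun k1 y -> Z} => f false) du; rewrite /= k1_dF !ffunE => <-.
  by rewrite (big_pred1 tt) ?addrK // => -[].
by exists s => //; apply: hs.
Qed.

(* At every maximal ideal m, some cycle p of P_0 is nonzero in H_0(P (x) R/m), as
   witnessed by a linear form s on P_0. *)
Definition psupp P := forall m, maximal_ideal m -> exists p s : P -> R,
  [/\ (forall a, \sum_b pb a b * p b = 0),
      (forall a, \sum_b pe a b * p b = p a),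
      (forall a, pdeg a != 0 -> p a = 0) /\ (forall a, pdeg a != 0 -> s a = 0),
      (forall b, m (\sum_a s a * pb a b)) & m (1 - \sum_a s a * p a)].

Theorem tensor_conservative P Y (b : int) : noetherian R -> psupp P -> (forall n, gfg Y n) ->
  (forall n, n < b -> gvan (tcx P Y) n) -> forall n, n < b -> gvan Y n.
Proof.
move=> noeth supp fgY van n nb z hz.
apply: (local_global (@gbd_sub _ _ _)) => m hm.
have [p [s [p_cyc p_e [p_deg s_deg] ms mp]]] := supp m hm.
have [r [g em]] := noeth _ (maximal_is_ideal hm).
pose x i := if insub i is Some j then g j else 0 : R.
have xE (j : 'I_r) : x j = g j by rewrite /x valK.
have mE c : m c -> exists d : 'I_r -> R, c = \sum_(i < r) x i * d i.
  rewrite em => -[d ->]; exists d; apply: eq_bigr => i _; by rewrite xE mulrC.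
have mx i : m (x i).
  rewrite /x; case: insubP => [j _ _|_]; last exact: (ideal0 (maximal_is_ideal hm)).
  rewrite em; exists (fun l => (l == j)%:R); rewrite (bigD1 j) //= eqxx mul1r big1 ?addr0 //.
  by move=> l /negPf ->; rewrite mul0r.
have /choice[f hf] : forall a, exists d : 'I_r -> R,
    \sum_a' s a' * pb a' a = \sum_(i < r) x i * d i by move=> a; apply: mE.
(* Cutting down to degree 1 preserves the expansion of s d: as [s] sits in degree 0, s d vanishes at
   the other indices. *)
pose phi i a := if pdeg a == 1 then f a i else 0.
have phi_deg i a : pdeg a != 1 -> phi i a = 0 by rewrite /phi => /negPf ->.
have s_phi a : \sum_a' s a' * pb a' a = \sum_(i < r) x i * phi i a.
  rewrite /phi; case: eqP => [_|/eqP ne]; first exact: hf.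
  rewrite big1 => [|a' _]; first by rewrite big1 // => i _; rewrite mulr0.
  have [e|ne'] := eqVneq (pdeg a') 0; last by rewrite s_deg // mul0r.
  by rewrite pb_deg ?mulr0 // e add0r eq_sym.
have [cp s_p] := mE _ mp.
have key : lvan m (kz x Y r) b.
  move=> j w jb hw; exists 1; first by apply: (maximal_notin1 hm); rewrite subrr;
    exact: (ideal0 (maximal_is_ideal hm)).
  have [K hK] := kz_struct x Y r.
  have [u hu Fu] := koszul_claim p_cyc p_e p_deg s_deg phi_deg s_phi s_p r.+1 K
    (@kz_van x Y P b r van) jb hw.
  exists u => //; rewrite scale1r; apply/esym/eqP; rewrite -subr_eq0; apply/eqP.
  exact: (hK _ _ (ltnSn r) Fu).
(* The Koszul complex on all generators of m has no homology below [b]; its factors are now removed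
   one at a time. *)
suff h k : (k <= r)%N -> lvan m (kz x Y k) b -> lvan m Y b by exact: (h r (leqnn r) key).
elim: k => [//|k IHk] kr hk; apply: IHk; first exact: ltnW.
apply: (lvan_step hm (mx k)) hk => j; exact: kz_fg.
Qed.

Corollary hom_conservative P Y (b : int) : noetherian R -> psupp P -> (forall a : P, 0 <= pdeg a) ->
  (forall n, gfg Y n) -> (forall n, n < b -> gvan (tcx (pdual P) Y) n) ->
  forall n, n < b -> gvan Y n.
Proof.
move=> noeth supp P0 fgY van; apply: (tensor_conservative noeth supp fgY).
exact: dual_van_tensor.
Qed.

(* A vector p of P_d, d the length of P, with p outside m P_d and dp in m P_(d-1). *)
Lemma hom_bottom P Y (d c : int) m (p : P -> R) (a0 : P) : maximal_ideal m ->
  (forall a : P, pdeg a <= d) -> (forall a, pdeg a != d -> p a = 0) ->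
  (forall a, \sum_b pe a b * p b = p a) -> (forall a, m (\sum_b pb a b * p b)) ->
  ~ m (p a0) -> (forall n, n < c -> gvan Y n) -> gvan (tcx (pdual P) Y) (c - d) ->
  forall z, gcyc c z -> exists2 s, ~ m s & exists (T : finType) (f : T -> R) (y : T -> Y),
    (forall i, m (f i) /\ gcyc c (y i)) /\ gbd c (s *: z - \sum_i f i *: y i).
Proof.
move=> hm Pd p_deg p_e mdp mp vanY van z [hz dz].
have a0d : pdeg a0 = d by apply/eqP; apply: contra_notT mp => /p_deg ->;
  exact: (ideal0 (maximal_is_ideal hm)).
(* The map from P to Y multiplying [z] by the coordinate at [a0]; it is a cycle because P stops in
   degree [d]. *)
pose u : tcx (pdual P) Y := [ffun a => pe a0 a *: z].
have hu : gcyc (c - d) u.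
  split; [split|].
  - move=> a; rewrite ffunE /= opprK; have [e|ne] := eqVneq (pdeg a0) (@pdeg R P a).
      by rewrite -e a0d subrK; apply: (submodZ _ (@gr_sub _ _ _)).
    by rewrite (pe_deg ne) scale0r; apply: (submod0 (@gr_sub _ _ _)).
  - apply/ffunP => a; rewrite !ffunE -[in RHS]pee scaler_suml; apply: eq_bigr => a' _.
    by rewrite ffunE /= /dual_e scalerA mulrC.
  - apply/ffunP => a; rewrite !ffunE linearZ dz /= !scaler0 add0r big1 // => a' _.
    rewrite ffunE /= /dual_b scalerA; have [e|ne] := eqVneq (pdeg a0) (@pdeg R P a'); last first.
      by rewrite (pe_deg ne) mulr0 scale0r.
    rewrite pb_deg ?mulr0 ?mul0r ?scale0r // -e a0d; apply: contraTneq (Pd a) => <-.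
    by rewrite -ltNge ltrDl.
have [h [hh eh] dh] := van u hu.
(* the components of h of degree at most d - 2 can be removed *)
have [h1 [hh1 h1_low dh1]] : exists h1 : tcx (pdual P) Y,
    [/\ tgrf (c - d + 1) h1, forall a, @pdeg R P a < d - 1 -> h1 a = 0 & gd h1 = u].
  pose D (a : P) := d - 1 <= pdeg a.
  pose low (y : {ffun P -> Y}) : {ffun P -> Y} := [ffun a => if D a then 0 else y a].
  suff [k hk hlow] : exists2 k : {ffun P -> Y}, @tgrf _ (pdual P) Y (c - d + 1 + 1) k &
      low h = low (@td _ (pdual P) Y k).
    exists (h - @td _ (pdual P) Y k); split.
    - apply: (submodB (@tgrf_sub _ _ _ _)) => //.
      by have := tgrf_d hk; rewrite addrK.
    - move=> a; rewrite ltNge => /negPf ad; have := congr1 (fun f : {ffun P -> Y} => f a) hlow.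
      by rewrite ffunE [RHS]ffunE /D ad !ffunE => ->; rewrite subrr.
    - by rewrite linearB dh [X in _ - X]tdd subr0.
  pose low_b (a b : P) : R := if D a || D b then 0 else dual_b a b.
  (* The indices of degree at least d - 1 are made inert. The dual degrees of the others are at
     least 2 - d, so with this value only homology of Y below [c] is required to vanish. *)
  pose low_deg (a : P) : int := if D a then 2 - d else - pdeg a.
  have lowb_deg a b : low_deg a + 1 != low_deg b -> low_b a b = 0.
    rewrite /low_deg /low_b; case: ifP => // ha; case: ifP => //= hb; exact: dual_b_deg.
  have lowbb a b : \sum_c low_b a c * low_b c b = 0.
    rewrite /low_b; have [ha|ha] := boolP (D a); first by rewrite big1 // => b' _; rewrite mul0r.
    have [hb|hb] := boolP (D b); first by rewrite big1 // => b' _; rewrite orbT mulr0.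
    rewrite -[RHS](dual_bb a b); apply: eq_bigr => c' _; rewrite /= orbF; case: ifP => // hc.
    rewrite /dual_b (pb_deg (a := c')) ?(mulr0, mul0r) //.
    apply: contraNneq ha => e; rewrite /D -e; apply: le_trans (_ : _ <= pdeg c') _ => //.
    by rewrite lerDl.
  pose lowP := @Pdat R P low_deg (fun a b => (a == b)%:R) low_b.
  have del (M : P -> P -> R) a c' : \sum_b (a == b)%:R * M b c' = M a c'.
    rewrite (bigD1 a) //= eqxx mul1r big1 ?addr0 // => b'; rewrite eq_sym => /negPf ->.
    by rewrite mul0r.
  have del' (M : P -> P -> R) a c' : \sum_b M a b * (b == c')%:R = M a c'.
    rewrite (bigD1 c') //= eqxx mulr1 big1 ?addr0 // => b' /negPf ->.
    by rewrite mulr0.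
  have low_e a b : low_deg a != low_deg b -> (a == b)%:R = 0 :> R.
    by have [->|//] := eqVneq a b; rewrite eqxx.
  pose Q := lowP low_e lowb_deg
    (del _) (del _) (del' _) lowbb.
  have tdlow (y : {ffun P -> Y}) : low (@td _ (pdual P) Y y) = @td _ Q Y (low y).
    apply/ffunP => a; rewrite !ffunE /= /low_deg; case: ifP => ha.
      rewrite linear0 scaler0 add0r big1 // => b' _.
      by rewrite /low_b ha scale0r.
    congr (_ + _); apply: eq_bigr => b' _; rewrite ffunE /low_b ha /=; case: ifP => // hb.
    rewrite scale0r /dual_b (pb_deg (a := b')) ?mulr0 ?scale0r //.
    apply: contraFneq ha => e; rewrite /D -e; apply: le_trans (_ : _ <= pdeg b') _ => //.
    by rewrite lerDl.
  have [|||k hk dk] := @tvan_free _ Q Y (c - d + 1) (low h).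
  - move=> a; apply: vanY => /=; rewrite /low_deg.
    by case: ifP => ha; move: ha; rewrite /D; lia.
  - move=> a; rewrite ffunE /= /low_deg; case: ifP => ha; last exact: hh.
    exact: (submod0 (@gr_sub _ _ _)).
  - rewrite -tdlow dh; apply/ffunP => a; rewrite !ffunE; case: ifP => // ha.
    rewrite pe_deg ?scale0r // a0d; apply: contraFneq ha; rewrite /D => <-.
    by rewrite gerBl.
  exists (low k).
    move=> a; rewrite ffunE; case: ifP => ha; first exact: (submod0 (@gr_sub _ _ _)).
    by have := hk a; rewrite /= /low_deg ha.
  rewrite tdlow -dk; apply/ffunP => a; rewrite !ffunE /= /low_deg; case: (boolP (D a)) => ha.
    have := congr1 (fun f : {ffun P -> Y} => f a) dk; rewrite !ffunE /= /low_deg ha => ->.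
    by rewrite linear0 scaler0 add0r big1 // => b' _; rewrite /low_b ha scale0r.
  congr (_ + _); apply: eq_bigr => b' _; rewrite !ffunE /low_b (negPf ha) /=.
  by case: ifP => //; rewrite !scale0r.
have duE a : sg (@pdeg R P a) *: gd (h1 a) + \sum_b dual_b a b *: h1 b = pe a0 a *: z.
  have := congr1 (fun f : {ffun P -> Y} => f a) dh1; rewrite !ffunE /=.
  by rewrite sgN => <-.
(* Contract [duE] with [p]: the right side gives p(a0) z, the components of [h1] in degree [d] give
   a boundary, and those in degree d - 1 enter with the coordinates of dp up to sign, which lie in
   m. *)
exists (p a0) => //; exists P, (fun b : P => - sg (pdeg b) * \sum_a pb b a * p a),
  (fun b : P => if pdeg b == d - 1 then h1 b else 0); split=> [b|].
  split; first by apply: (idealM _ (maximal_is_ideal hm)).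
  case: eqP => [e|_]; last exact: (submod0 (@gcyc_sub _ _ _)).
  split; first by have := hh1 b; rewrite /= opprK e; congr gr; lia.
  have := duE b; rewrite pe_deg ?scale0r; last by rewrite a0d e; lia.
  rewrite big1 ?addr0 => [h0|b' _].
    by rewrite -[LHS]scale1r -(sgK R (pdeg b)) -scalerA h0 scaler0.
  have [e'|ne] := eqVneq (pdeg b' + 1) (pdeg b); last by rewrite /dual_b (pb_deg ne) mulr0 scale0r.
  by rewrite h1_low ?scaler0 //; lia.
exists (sg d *: \sum_a p a *: h1 a).
  apply: (submodZ _ (@gr_sub _ _ _)); apply: (submod_sum (@gr_sub _ _ _)) => a _.
  have [e|ne] := eqVneq (pdeg a) d; last first.
    by rewrite p_deg // scale0r; apply: (submod0 (@gr_sub _ _ _)).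
  apply: (submodZ _ (@gr_sub _ _ _)); have := hh1 a; rewrite /= opprK e; congr gr; lia.
have -> : p a0 *: z = \sum_a p a *: (pe a0 a *: z).
  rewrite -p_e scaler_suml; apply: eq_bigr => a _; by rewrite scalerA mulrC.
under [X in _ = X - _]eq_bigr do rewrite -duE scalerDr.
rewrite big_split /= linearZ linear_sum /= scaler_sumr -addrA.
rewrite [X in _ = _ + X](_ : _ = 0) ?addr0.
  apply: eq_bigr => a _; rewrite linearZ /= !scalerA mulrC.
  have [->//|ne] := eqVneq (pdeg a) d; by rewrite p_deg // !mul0r.
apply/eqP; rewrite subr_eq0; apply/eqP.
under eq_bigr do rewrite sum_scale_scale.
rewrite exchange_big /=; apply: eq_bigr => b _.
rewrite -scaler_suml; case: eqP => [e|/eqP ne].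
  congr (_ *: _); rewrite mulr_sumr; apply: eq_bigr => a _; rewrite /dual_b; ring.
rewrite scaler0 big1 ?scale0r // => a _.
have [e|ne'] := eqVneq (pdeg a) d; last by rewrite p_deg // mul0r.
rewrite /dual_b pb_deg ?mulr0 //; apply: contra ne; rewrite e => /eqP <-.
by rewrite addrK.
Qed.
End Conservative.

(** * Homology, Hom complexes and quasi-isomorphisms *)

Section Complexes.
Variable R : comPzRingType.
Implicit Types (X Y Z A B I : complex R) (i j k l m n p q : int).

Lemma linear_sub_comb (U V : lmodType R) (f : {linear U -> V}) (T : finType) (x : U)
    (a : T -> R) (g : T -> U) :
  f (x - \sum_k a k *: g k) = f x - \sum_k a k *: f (g k).
Proof.
by rewrite linearB linear_sum; congr (_ - _); apply: eq_bigr => k _; rewrite linearZ.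
Qed.

Definition hvan X i := forall z : X i, cycle z -> boundary z.

Lemma hvanP X i : hvan X i <-> ~ H_nonzero X i.
Proof.
split=> [h [z [cz]]|h z cz]; first by apply; exact: h.
by apply: contrapT => bz; apply: h; exists z.
Qed.

Lemma cycleE X i k (z : X i) : k = i - 1 -> cycle z <-> cd X i k z = 0.
Proof. by move=> ->. Qed.

Lemma cycle_sub X i : submod (@cycle R X i).
Proof.
split; first exact: linear0.
by move=> a x y hx hy; rewrite /cycle linearP hx hy scaler0 addr0.
Qed.

Lemma boundary_sub X i : submod (@boundary R X i).
Proof.
split; first by exists 0; exact: linear0.
by move=> a _ _ [x <-] [y <-]; exists (a *: x + y); rewrite linearP.
Qed.

Lemma boundary_cycle X i (z : X i) : boundary z -> cycle z.
Proof. by case=> y <-; exact: cdd. Qed.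

Lemma H_fgE X i : H_fg X i <-> fgq (@cycle R X i) (@boundary R X i).
Proof.
by split=> [[n [g h]]|/fgq_ord //]; exists 'I_n, g.
Qed.

Lemma hvan_fg X i : hvan X i -> H_fg X i.
Proof.
move=> h; exists 0%N, (fun=> 0); split=> [[]//|z /h bz]; exists (fun=> 0).
by rewrite big_ord0 subr0.
Qed.

Section QuasiIso.
Variables (X Y : complex R) (f : chain_map X Y).

Lemma cmap_cycle i (z : X i) : cycle z -> cycle (f i z).
Proof. by rewrite /cycle cmapd => ->; rewrite linear0. Qed.
Lemma cmap_boundary i (z : X i) : boundary z -> boundary (f i z).
Proof. by case=> y <-; exists (f _ y); rewrite cmapd. Qed.

Hypothesis qf : quasi_iso f.

Lemma qis_hvan i : hvan X i <-> hvan Y i.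
Proof.
have [inj surj] := qf i; split=> h z cz.
  have [x cx hx] := surj z cz; rewrite -(subrK (f i x) z).
  by apply: (submodD (@boundary_sub _ _)) => //; apply: cmap_boundary; exact: h.
by apply: inj => //; apply: h; apply: cmap_cycle.
Qed.

Lemma qis_fg i : H_fg X i <-> H_fg Y i.
Proof.
have [inj surj] := qf i; rewrite !H_fgE; split=> -[T [g [cg hg]]].
  exists T, (fun t => f i (g t)); split=> [t|z cz]; first exact: cmap_cycle.
  have [x cx hx] := surj z cz; have [a ha] := hg x cx; exists a.
  have -> : z - \sum_k a k *: f i (g k) = (z - f i x) + f i (x - \sum_k a k *: g k).
    by rewrite linear_sub_comb addrA subrK.
  by apply: (submodD (@boundary_sub _ _)) => //; apply: cmap_boundary.
have /choice[x hx] : forall t, exists x : X i, cycle x /\ boundary (g t - f i x).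
  by move=> t; have [x cx hx] := surj _ (cg t); exists x.
exists T, x; split=> [t|z cz]; first by case: (hx t).
have [a ha] := hg (f i z) (cmap_cycle cz); exists a; apply: inj.
  apply: (submodB (@cycle_sub _ _)) => //; apply: (submod_sum (@cycle_sub _ _)) => t _.
  by apply: (submodZ _ (@cycle_sub _ _)); case: (hx t).
have -> : f i (z - \sum_k a k *: x k) =
    (f i z - \sum_k a k *: g k) + \sum_k a k *: (g k - f i (x k)).
  under [X in _ = _ + X]eq_bigr do rewrite scalerBr.
  by rewrite linear_sub_comb sumrB addrA subrK.
apply: (submodD (@boundary_sub _ _)) => //; apply: (submod_sum (@boundary_sub _ _)) => t _.
by apply: (submodZ _ (@boundary_sub _ _)); case: (hx t).
Qed.
End QuasiIso.

(** * Maps of degree n *)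

(** The neighbouring degrees are variables tied by equations, so that indices such as [j + 1 - 1] do
    not block rewriting. *)
Lemma homdE X Y n m i j k l (f : hom_deg X Y n) x : m + 1 = n -> k = j + 1 -> l = i - 1 ->
  homd X Y n m f i j x = cd Y k j (f i k x) - sg n *: f l j (cd X i l x).
Proof. by move=> mn -> ->; rewrite /= /homd_map mn eqxx. Qed.

Lemma hom_deg_ext X Y n (f g : hom_deg X Y n) :
  (forall i j, j = i + n -> forall x, f i j x = g i j x) -> f = g.
Proof.
move=> h; apply: hom_deg_eq => i j x; have [e|ne] := eqVneq j (i + n); first exact: h.
by rewrite (hmap_shape f ne) (hmap_shape g ne).
Qed.

Lemma homcycleP X Y n (f : homc X Y n) : cycle f <->
  forall i j k l, k = j + 1 -> l = i - 1 -> forall x : X i,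
    cd Y k j ((f : hom_deg X Y n) i k x) = sg n *: (f : hom_deg X Y n) l j (cd X i l x).
Proof.
split=> [h i j k l hk hl x|h].
  apply/eqP; rewrite -subr_eq0 -(@homdE X Y n (n - 1) i j k l) ?subrK //.
  by rewrite -[homd _ _ _ _ _]/(cd (homc X Y) n (n - 1) f) h.
apply: hom_deg_eq => i j x; apply/eqP.
by rewrite [X in X == _](@homdE X Y n (n - 1) i j (j + 1) (i - 1)) ?subrK // subr_eq0 (h i j _ _ erefl erefl).
Qed.

Lemma hom_degN X Y n (f : hom_deg X Y n) i j x : (- f) i j x = - f i j x.
Proof. by rewrite -[LHS]/((-1) *: f i j x) scaleN1r. Qed.
Lemma hom_degB X Y n (f g : hom_deg X Y n) i j x : (f - g) i j x = f i j x - g i j x.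
Proof. by rewrite -[LHS]/(f i j x + (- g) i j x) hom_degN. Qed.

Definition idc X : chain_map X X :=
  @ChainMap R X X (fun i => mklin (f := idfun) (fun a x y => erefl)) (fun _ _ _ => erefl).

(** Transport between components without an equality proof as argument: the identity if [i = j] and
    zero otherwise, hence defined and linear for all [i] and [j]. *)
Definition ccast X i j : {linear X i -> X j} := diag_map (idc X) i j.

Lemma ccastE X i x : ccast X i i x = x. Proof. exact: diag_mapE. Qed.
Lemma ccast_ne X i j x : j != i -> ccast X i j x = 0.
Proof. by move=> ne; apply: diag_shape; rewrite addr0. Qed.
Lemma cd_ccast X i j k x : j = i -> cd X j k (ccast X i j x) = cd X i k x.
Proof. by move=> ->; rewrite ccastE. Qed.
Lemma ccast_cd X i j k x : k = j -> ccast X j k (cd X i j x) = cd X i k x.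
Proof. by move=> ->; rewrite ccastE. Qed.

Definition elt X Y (f : chain_map X Y) : hom_deg X Y 0 := HomDeg (diag_shape f).

Lemma eltE X Y (f : chain_map X Y) i x : elt f i i x = f i x.
Proof. exact: diag_mapE. Qed.

Lemma elt_cycle X Y (f : chain_map X Y) : @cycle R (homc X Y) 0 (elt f).
Proof.
apply/homcycleP => i j k l -> -> x; rewrite sg0 scale1r.
have [e|ne] := eqVneq (j + 1) i; last first.
  rewrite (@hmap_shape _ _ _ _ (elt f) i) ?addr0 //.
  rewrite (@hmap_shape _ _ _ _ (elt f) (i - 1)) ?addr0 ?linear0 //.
  by rewrite -(inj_eq (addIr 1)) subrK.
subst i; have e' : j + 1 - 1 = j by rewrite addrK.
by rewrite e' !eltE cmapd.
Qed.

Section ChainOfCycle.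
Variables (X Y : complex R) (g : homc X Y 0).
Hypothesis cg : cycle g.
Fact chain_of_subproof i j (x : X i) : cd Y i j ((g : hom_deg X Y 0) i i x) =
  (g : hom_deg X Y 0) j j (cd X i j x).
Proof.
have [e|ne] := eqVneq (j + 1) i; last by rewrite !cd_shape // linear0.
have ej : j = i - 1 by rewrite -e addrK.
by rewrite ((homcycleP g).1 cg i j i j (esym e) ej x) sg0 scale1r.
Qed.
Definition chain_of : chain_map X Y := ChainMap chain_of_subproof.
End ChainOfCycle.

Section Compose.
Variables (X Y Z : complex R) (m n p : int) (u : hom_deg Y Z m) (f : hom_deg X Y n).
Hypothesis e : p = n + m.

Fact hcomp_linear i j : linear (fun x => u (i + n) j (f i (i + n) x)).
Proof. by move=> a x y; rewrite !linearP. Qed.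
Fact hcomp_shape i j : j != i + p -> forall x, mklin (@hcomp_linear i j) x = 0.
Proof. by move=> ne x /=; rewrite hmap_shape // -addrA -e. Qed.
Definition hcomp : hom_deg X Z p := HomDeg hcomp_shape.
Lemma hcompE i j k x : k = i + n -> hcomp i j x = u k j (f i k x).
Proof. by move=> ->. Qed.
End Compose.

(** The Leibniz rule, whose second term drops because [f] is a cycle. *)
Lemma hcomp_d X Y Z m n p p' m' (u : hom_deg Y Z m) (f : hom_deg X Y n) (e : p = n + m)
    (e' : p' = n + m') :
  m' + 1 = m -> @cycle R (homc X Y) n f ->
  homd X Z p p' (hcomp u f e) = hcomp (homd Y Z m m' u) f e'.
Proof.
move=> mm cf; apply: hom_deg_ext => i j ej x.
rewrite (@homdE _ _ p p' i j (j + 1) (i - 1)) //; last by rewrite e e' -mm addrA.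
rewrite (@hcompE _ _ _ _ _ _ _ _ e' i j (i + n)) //.
rewrite (@homdE _ _ m m' (i + n) j (j + 1) (i - 1 + n)) //; last by rewrite addrAC.
congr (_ - _).
rewrite ((homcycleP f).1 cf i (i - 1 + n) (i + n) (i - 1)) //; last by rewrite addrAC subrK.
by rewrite [u _ _ (_ *: _)]linearZ /= scalerA -sgD e [m + n]addrC.
Qed.

Section PrePost.
Variables (X Y I : complex R) (f : chain_map X Y).

Fact pre_shape n (g : hom_deg Y I n) i j : j != i + n ->
  forall x, (g i j \o f i : {linear X i -> I j}) x = 0.
Proof. by move=> ne x /=; rewrite hmap_shape. Qed.
Fact pre_linear n : linear (fun g : hom_deg Y I n => HomDeg (pre_shape g)).
Proof. by move=> a g h; apply: hom_deg_eq. Qed.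
Fact pre_d n m g : homd X I n m (mklin (@pre_linear n) g) =
  mklin (@pre_linear m) (homd Y I n m g).
Proof.
apply: hom_deg_eq => i j x; rewrite /= /homd_map; case: eqP => // _.
by rewrite /= cmapd.
Qed.
Definition pre : chain_map (homc Y I) (homc X I) :=
  @ChainMap R (homc Y I) (homc X I) (fun n => mklin (@pre_linear n)) pre_d.
Lemma preE n (g : hom_deg Y I n) i j x : (pre n g : hom_deg X I n) i j x = g i j (f i x).
Proof. by []. Qed.

Fact post_shape n (g : hom_deg I X n) i j : j != i + n ->
  forall x, (f j \o g i j : {linear I i -> Y j}) x = 0.
Proof. by move=> ne x /=; rewrite hmap_shape // linear0. Qed.
Fact post_linear n : linear (fun g : hom_deg I X n => HomDeg (post_shape g)).
Proof. by move=> a g h; apply: hom_deg_eq => i j x /=; rewrite linearP. Qed.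
Fact post_d n m g : homd I Y n m (mklin (@post_linear n) g) =
  mklin (@post_linear m) (homd I X n m g).
Proof.
apply: hom_deg_eq => i j x; rewrite /= /homd_map; case: eqP => [_|_]; last by rewrite linear0.
by rewrite /= cmapd [RHS]linearB [f j (_ *: _)]linearZ.
Qed.
Definition post : chain_map (homc I X) (homc I Y) :=
  @ChainMap R (homc I X) (homc I Y) (fun n => mklin (@post_linear n)) post_d.
Lemma postE n (g : hom_deg I X n) i j x : (post n g : hom_deg I Y n) i j x = f j (g i j x).
Proof. by []. Qed.
End PrePost.

(** * Fibers *)

Section Fiber.
Variables (A B : complex R) (f : chain_map A B).

(** The mapping cone of [f] shifted down by one, with differential (a, b) |-> (d a, f a - d b); it
    is acyclic exactly if [f] is a quasi-isomorphism. *)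
Definition fib_obj i : lmodType R := (A i * B (i + 1)%R)%type.
Definition fib_fun i j (z : fib_obj i) : fib_obj j :=
  (cd A i j z.1, diag_map f i (j + 1) z.1 - cd B (i + 1) (j + 1) z.2).
Fact fib_linear i j : linear (@fib_fun i j).
Proof.
move=> a [x x'] [y y']; rewrite /fib_fun /=; congr pair; first by rewrite linearP.
by rewrite [diag_map f i _ _]linearP [cd B _ _ _]linearP /=; lincomb R.
Qed.
Fact fib_shape i j : j + 1 != i -> forall z, mklin (@fib_linear i j) z = 0.
Proof.
move=> ne [a b]; rewrite /= /fib_fun /= cd_shape // cd_shape ?(inj_eq (addIr 1)) //.
by rewrite (diag_shape f (i := i)) ?subr0 // addr0.
Qed.
Fact fib_dd i j k z : mklin (@fib_linear j k) (mklin (@fib_linear i j) z) = 0.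
Proof.
case: z => a b; rewrite /= /fib_fun /= cdd linearB cdd subr0.
suff -> : diag_map f j (k + 1) (cd A i j a) = cd B (j + 1) (k + 1) (diag_map f i (j + 1) a).
  by rewrite subrr.
have [<-|ne] := eqVneq (k + 1) j; last first.
  rewrite (@cd_shape _ B (j + 1)) ?(inj_eq (addIr 1)) //.
  by rewrite (diag_shape f (i := j)) ?addr0.
have [e|ne] := eqVneq (k + 1 + 1) i; first by subst i; rewrite !diag_mapE cmapd.
by rewrite cd_shape // (diag_shape f (i := i)) ?addr0 // linear0 linear0.
Qed.
Definition fib : complex R := Complex fib_shape fib_dd.

Lemma fib_cycle i (a : A i) (b : B (i + 1)) :
  @cycle R fib i (a, b) <-> cycle a /\ cd B (i + 1) i b = f i a.
Proof.
have h : diag_map f i (i - 1 + 1) a - cd B (i + 1) (i - 1 + 1) b = 0 <->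
    cd B (i + 1) i b = f i a.
  have e : i - 1 + 1 = i by rewrite subrK.
  move: (i - 1 + 1) e => k ek; subst k; rewrite diag_mapE; split=> [/eqP|->].
    by rewrite subr_eq0 => /eqP ->.
  by rewrite subrr.
split=> [[ha hb]|[ha /h hb]]; first by split=> //; apply/h.
by rewrite /cycle /= /fib_fun /= hb ha.
Qed.

Lemma fib_boundary i (a : A i) (b : B (i + 1)) : @boundary R fib i (a, b) <->
  exists (a' : A (i + 1)) (b' : B (i + 1 + 1)),
    cd A (i + 1) i a' = a /\ f (i + 1) a' - cd B (i + 1 + 1) (i + 1) b' = b.
Proof.
split=> [[[a' b']]|[a' [b' [<- <-]]]].
  by rewrite /= /fib_fun /= diag_mapE => -[<- <-]; exists a', b'.
by exists (a', b'); rewrite /= /fib_fun /= diag_mapE.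
Qed.

Lemma qis_fib : quasi_iso f -> acyclic fib.
Proof.
move=> qf i; apply/hvanP => -[a b] /fib_cycle[ca hb].
have [inj _] := qf i; have [_ surj] := qf (i + 1).
have [|a' ha'] := inj a ca; first by exists b.
have [|z cz [y hy]] := surj (f (i + 1) a' - b).
  by apply/(cycleE (k := i)); rewrite ?addrK // linearB cmapd ha' hb subrr.
apply/fib_boundary; exists (a' - z), y; split.
  by rewrite linearB ha' (cycleE (k := i)) ?addrK // in cz *; rewrite cz subr0.
by rewrite linearB hy; lincomb R.
Qed.

Lemma fib_qis : acyclic fib -> quasi_iso f.
Proof.
move=> ac i; split=> [z cz [y hy]|w cw].
  have /hvanP/(_ (z, y)) := ac i; rewrite fib_cycle => /(_ (conj cz hy))/fib_boundary.
  by move=> [a' [b' [<- _]]]; exists a'.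
have e : i - 1 + 1 = i by rewrite subrK.
have /hvanP h := ac (i - 1).
have : @boundary R fib (i - 1) (0, ccast B i (i - 1 + 1) w).
  apply: h; apply/fib_cycle; split; first exact: linear0.
  by rewrite cd_ccast // linear0.
move=> /fib_boundary[a' [b' []]].
move: (i - 1) e a' b' => k ek; subst i => a' b' ha hb; rewrite ccastE in hb.
exists a'; first by apply/(cycleE (k := k)); rewrite ?addrK.
by exists (- b'); rewrite linearN -hb; lincomb R.
Qed.

Lemma fib_van i : hvan A i -> hvan B (i + 1) -> hvan fib i.
Proof.
move=> hA hB [a b] /fib_cycle[ca hb]; have [a' ha'] := hA a ca.
have [|y hy] := hB (b - f (i + 1) a').
  by apply/(cycleE (k := i)); rewrite ?addrK // linearB cmapd ha' hb subrr.
apply/fib_boundary; exists a', (- y); split=> //.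
by rewrite linearN hy; lincomb R.
Qed.

Lemma fib_fg i : noetherian R -> H_fg A i -> H_fg B (i + 1) -> H_fg fib i.
Proof.
rewrite !H_fgE => noeth hA hB.
have p1 : linear (fun z : fib i => z.1) by [].
apply: (fgq_ext noeth (pi := mklin p1) (N' := @cycle R A i) (W' := @boundary R A i)) => //.
- exact: cycle_sub.
- exact: boundary_sub.
- exact: boundary_sub.
- by move=> [a b] /fib_cycle[].
case: hB => T [g [cg hg]].
exists T, (fun t => (0, g t) : fib i); split=> [t|[a b] [/fib_cycle[ca hb] [a' ha']]].
  split; last exact: (submod0 (@boundary_sub _ _)).
  apply/fib_cycle; split; first exact: linear0.
  rewrite linear0; apply/(cycleE (k := i)); last exact: cg.
  by rewrite addrK.
have [|c hc] := hg (b - f (i + 1) a').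
  by apply/(cycleE (k := i)); rewrite ?addrK // linearB cmapd ha' hb subrr.
exists c; have -> : (a, b) - \sum_k c k *: ((0, g k) : fib i) = (a, b - \sum_k c k *: g k) :> fib i.
  have -> : \sum_k c k *: ((0, g k) : fib i) = (0, \sum_k c k *: g k) :> fib i.
    have p2 : linear (fun b : B (i + 1) => (0, b) : fib i).
      by move=> r x y; congr pair; rewrite /= ?scaler0 ?addr0.
    rewrite -[RHS]/(mklin p2 _) linear_sum; apply: eq_bigr => k _.
    by rewrite linearZ.
  by congr pair; rewrite subr0.
apply/fib_boundary; case: hc => y hy; exists a', (- y); split=> //.
by rewrite linearN hy; lincomb R.
Qed.

Section FibHom.
Variable I : complex R.

Section FibIn.
Variables (n p : int) (u : hom_deg A I p) (g : hom_deg B I n).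
Hypothesis np : n + 1 = p.
Definition fib_in_fun i j (z : fib i) : I j := u i j z.1 + g (i + 1) j z.2.
Fact fib_in_linear i j : linear (@fib_in_fun i j).
Proof. by move=> a [x x'] [y y']; rewrite /fib_in_fun /= !linearP; lincomb R. Qed.
Fact fib_in_shape i j : j != i + p -> forall z, mklin (@fib_in_linear i j) z = 0.
Proof.
by move=> ne z; rewrite /= /fib_in_fun !hmap_shape ?addr0 // addrAC -addrA np.
Qed.
Definition fib_in : hom_deg fib I p := HomDeg fib_in_shape.
End FibIn.

Section FibOut.
Variables (p : int) (F : hom_deg fib I p).
Fact fib_out1_linear i j : linear (fun x : A i => F i j (x, 0)).
Proof.
move=> a x y; rewrite -linearP; congr (F i j _); congr pair.
by rewrite /= scaler0 addr0.
Qed.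
Fact fib_out1_shape i j : j != i + p -> forall z, mklin (@fib_out1_linear i j) z = 0.
Proof. by move=> ne z; rewrite /= hmap_shape. Qed.
Definition fib_out1 : hom_deg A I p := HomDeg fib_out1_shape.

Variable n : int.
Hypothesis np : n + 1 = p.
Fact fib_out2_linear i j : linear (fun x : B i => F (i - 1) j (0, ccast B i (i - 1 + 1) x)).
Proof.
move=> a x y; rewrite -linearP; congr (F _ j _); congr pair.
  by rewrite /= scaler0 addr0.
by rewrite linearP.
Qed.
Fact fib_out2_shape i j : j != i + n -> forall z, mklin (@fib_out2_linear i j) z = 0.
Proof. by move=> ne z; rewrite /= hmap_shape // -np [n + 1]addrC addrA subrK. Qed.
Definition fib_out2 : hom_deg B I n := HomDeg fib_out2_shape.
Lemma fib_out2E i j k x : i = k + 1 -> fib_out2 i j x = F k j (0, ccast B i (k + 1) x).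
Proof. by move=> e; subst i; rewrite /= addrK. Qed.
End FibOut.

Lemma fib_out2_in n p u g (np : n + 1 = p) : fib_out2 (fib_in u g np) np = g.
Proof.
apply: hom_deg_ext => i j _ x; rewrite /= /fib_in_fun /= linear0 add0r.
have e : i - 1 + 1 = i by rewrite subrK.
by move: (i - 1 + 1) e => k ek; subst k; rewrite ccastE.
Qed.

Lemma fib_out2_d n p n' p' (F : hom_deg fib I p) (np : n + 1 = p) (np' : n' + 1 = p') :
  p' + 1 = p -> homd B I n n' (fib_out2 F np) = fib_out2 (homd fib I p p' F) np'.
Proof.
move=> pp; apply: hom_deg_ext => i j _ x.
have nn : n' + 1 = n by apply: (addIr 1); rewrite np np'.
rewrite (@homdE _ _ n n' i j (j + 1) (i - 1)) // (@fib_out2E _ _ _ np' i j (i - 1)) ?subrK //.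
rewrite (@homdE _ _ p p' (i - 1) j (j + 1) (i - 1 - 1)) //.
rewrite (@fib_out2E _ _ _ np i _ (i - 1)) ?subrK // (@fib_out2E _ _ _ np (i - 1) _ (i - 1 - 1)) ?subrK //.
have -> : sg p = - sg n :> R by rewrite -np sgSr.
congr (_ - _); rewrite scaleNr -scalerN; congr (_ *: _); rewrite -linearN.
congr (F _ _ _); rewrite /= /fib_fun /=; congr pair; first by rewrite /= linear0 oppr0.
by rewrite /= linear0 sub0r opprK cd_ccast ?subrK // ccast_cd // subrK.
Qed.

(** Fibers represent null-homotopies: [u] is, up to sign, one of g f. *)
Lemma fib_in_cycle n p u g (np : n + 1 = p) : @cycle R (homc B I) n g ->
  homd A I p n u = - sg n *: (pre I f n g : hom_deg A I n) ->
  @cycle R (homc fib I) p (fib_in u g np).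
Proof.
move=> cg hu; apply/homcycleP => i j k l hk hl [a b].
rewrite /= /fib_in_fun /= linearD.
have : homd A I p n u i j a = - sg n *: g i j (f i a) by rewrite hu.
rewrite (@homdE _ _ p n i j k l) // => /eqP; rewrite subr_eq => /eqP ->.
rewrite ((homcycleP g).1 cg (i + 1) j k (l + 1)) ?hl ?subrK ?addrK //.
rewrite [g _ _ (_ - _)]linearB.
have -> : sg p = - sg n :> R by rewrite -np sgSr.
have e : i - 1 + 1 = i by rewrite subrK.
move: (i - 1 + 1) e => q eq; subst q; rewrite diag_mapE.
by lincomb R.
Qed.

Lemma fib_out1_d p n (F : hom_deg fib I p) (np : n + 1 = p) i j x :
  homd A I p n (fib_out1 F) i j x =
  homd fib I p n F i j (x, 0) + sg p *: fib_out2 F np i j (f i x).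
Proof.
rewrite (@homdE _ _ p n i j (j + 1) (i - 1)) // [X in _ = X + _](@homdE _ _ p n i j (j + 1) (i - 1)) //.
rewrite (@fib_out2E _ _ _ np i j (i - 1)) ?subrK //= /fib_fun /=.
have -> : (cd A i (i - 1) x, diag_map f i (i - 1 + 1) x - cd B (i + 1) (i - 1 + 1) 0) =
    (cd A i (i - 1) x, 0) + (0, ccast B i (i - 1 + 1) (f i x)) :> fib (i - 1).
  congr pair; first by rewrite addr0.
  rewrite linear0 subr0 add0r.
  have e : i - 1 + 1 = i by rewrite subrK.
  by move: (i - 1 + 1) e => k ek; subst k; rewrite diag_mapE ccastE.
by rewrite linearD; lincomb R.
Qed.
End FibHom.
End Fiber.
End Complexes.

(** * Submodules, subcomplexes and truncations *)

Section SubModule.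
Variables (R : comPzRingType) (V : lmodType R) (N : V -> Prop) (hN : submod N).

Record smod_rec : Type := SMod { sval_of : V; smodP : N sval_of }.
(** The vacuous [hN] makes the closure proof a parameter of the type, where the module instances
    find it. *)
Definition smod : Type := let _ := hN in smod_rec.
HB.instance Definition _ := gen_eqMixin smod.
HB.instance Definition _ := gen_choiceMixin smod.

Lemma smod_eq (x y : smod_rec) : sval_of x = sval_of y -> x = y.
Proof. by case: x y => x hx [y hy] /= e; subst y; congr SMod; apply: Prop_irrelevance. Qed.

Definition smod0 : smod := SMod (submod0 hN).
Definition smodD (x y : smod) : smod := SMod (submodD hN (smodP x) (smodP y)).
Definition smodN (x : smod) : smod := SMod (submodN hN (smodP x)).
Definition smodZ a (x : smod) : smod := SMod (submodZ a hN (smodP x)).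

Fact smodDA : associative smodD. Proof. by move=> x y z; apply: smod_eq; rewrite /= addrA. Qed.
Fact smodDC : commutative smodD. Proof. by move=> x y; apply: smod_eq; rewrite /= addrC. Qed.
Fact smod0D : left_id smod0 smodD. Proof. by move=> x; apply: smod_eq; rewrite /= add0r. Qed.
Fact smodND : left_inverse smod0 smodN smodD.
Proof. by move=> x; apply: smod_eq; rewrite /= addNr. Qed.
HB.instance Definition _ := GRing.isZmodule.Build smod smodDA smodDC smod0D smodND.
Fact smodZA a b x : smodZ a (smodZ b x) = smodZ (a * b) x.
Proof. by apply: smod_eq; rewrite /= scalerA. Qed.
Fact smod1Z : left_id 1 smodZ. Proof. by move=> x; apply: smod_eq; rewrite /= scale1r. Qed.
Fact smodZDr : right_distributive smodZ +%R.
Proof. by move=> a x y; apply: smod_eq; rewrite /= scalerDr. Qed.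
Fact smodZDl x : {morph smodZ^~ x : a b / a + b}.
Proof. by move=> a b; apply: smod_eq; rewrite /= scalerDl. Qed.
HB.instance Definition _ := GRing.Zmodule_isLmodule.Build R smod smodZA smod1Z smodZDr smodZDl.

Fact sval_linear : linear (sval_of : smod -> V). Proof. by []. Qed.
Definition smod_val : {linear smod -> V} := mklin sval_linear.

Section Corestrict.
Variables (U : lmodType R) (f : {linear U -> V}) (hf : forall x, N (f x)).
Fact smod_cor_linear : linear (fun x => SMod (hf x) : smod).
Proof. by move=> a x y; apply: smod_eq; rewrite /= linearP. Qed.
Definition smod_cor : {linear U -> smod} := mklin smod_cor_linear.
End Corestrict.
End SubModule.

Section SubComplex.
Variables (R : comPzRingType) (X : complex R) (N : forall i, X i -> Prop).
Hypotheses (hN : forall i, submod (@N i))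
  (dN : forall i j x, N x -> N (cd X i j x)).

Definition subc_d i j : {linear smod (hN i) -> smod (hN j)} :=
  smod_cor (hN j) (f := cd X i j \o smod_val (hN i)) (fun x => dN j (smodP x)).
Fact subc_shape i j : j + 1 != i -> forall x, subc_d i j x = 0.
Proof. by move=> ne x; apply: smod_eq; rewrite /= cd_shape. Qed.
Fact subc_dd i j k x : subc_d j k (subc_d i j x) = 0.
Proof. by apply: smod_eq; rewrite /= cdd. Qed.
Definition subc : complex R := Complex subc_shape subc_dd.

Definition subc_in : chain_map subc X :=
  @ChainMap R subc X (fun i => smod_val (hN i)) (fun _ _ _ => erefl).

Lemma subc_cycle i (z : subc i) : cycle z <-> cd X i (i - 1) (sval_of z) = 0.
Proof.
split=> [h|h]; first exact: (congr1 (@sval_of _ _ _) h).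
exact: smod_eq.
Qed.

Lemma subc_van i : (forall z : X i, N z -> cycle z -> exists2 y : X (i + 1), N y & cd X (i + 1) i y = z) ->
  hvan subc i.
Proof.
move=> h z /subc_cycle/(h _ (smodP z))[y Ny hy]; exists (SMod Ny); exact: smod_eq.
Qed.

Section HomIn.
Variables (W : complex R) (n : int) (g : hom_deg W X n).
Hypothesis gN : forall i j x, N (g i j x).
Fact hom_subc_shape (i j : int) : j != i + n -> forall x, smod_cor (hN j) (@gN i j) x = 0.
Proof. by move=> ne x; apply: smod_eq; rewrite /= hmap_shape. Qed.
Definition hom_subc : hom_deg W subc n :=
  @HomDeg R W subc n (fun i j => smod_cor (hN j) (@gN i j)) hom_subc_shape.
End HomIn.
End SubComplex.

Section Truncations.
Variables (R : comPzRingType) (X : complex R) (a : int).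

(** The soft truncation: keeping only cycles in degree [a] leaves the homology in degrees at least
    [a] unchanged. *)
Definition tr i (z : X i) : Prop := (i < a -> z = 0) /\ (i = a -> cycle z).
Lemma tr_sub i : submod (@tr i).
Proof.
split; first by split=> // _; exact: linear0.
move=> r x y [hx cx] [hy cy]; split=> h; first by rewrite hx // hy // scaler0 addr0.
by apply: (cycle_sub _ _).2; [exact: cx|exact: cy].
Qed.
Lemma tr_d i j x : @tr i x -> tr (cd X i j x).
Proof.
move=> [hx cx]; split=> [ja|_]; last exact: cdd.
have [e|ne] := eqVneq (j + 1) i; last exact: cd_shape.
have [ia|ia] := ltP i a; first by rewrite hx // linear0.
have /cx : i = a by apply/eqP; rewrite eq_le ia -e lezD1 ja.
by apply: (@cycleE R X i j x _).1; rewrite -e addrK.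
Qed.
Definition trunc : complex R := subc tr_sub tr_d.

Lemma trunc_qis : (forall i, i < a -> hvan X i) -> quasi_iso (subc_in tr_sub tr_d).
Proof.
move=> h i; split=> [z cz [y hy]|w cw].
  have [ia|ia] := ltP i a.
    have [z0 _] := smodP z; exists 0; apply: smod_eq; rewrite linear0 /=.
    exact/esym/z0.
  have ty : tr y.
    split; first by move=> h1; exfalso; move: h1 ia; lia.
    by move=> h1; exfalso; move: h1 ia; lia.
  by exists (SMod ty); apply: smod_eq.
have [ia|ia] := ltP i a.
  exists 0; first exact: linear0.
  by have -> : subc_in tr_sub tr_d i 0 = 0; [exact: linear0 | rewrite subr0; exact: h].
have tw : tr w by split=> // h1; exfalso; move: h1 ia; lia.
exists (SMod tw); first exact/subc_cycle.
by rewrite /= subrr; exact: (submod0 (@boundary_sub _ _ _)).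
Qed.

Lemma trunc_van t : (forall i, t <= i -> hvan X i) -> t <= a -> acyclic trunc.
Proof.
move=> h ta i; apply/hvanP; apply: subc_van => z [z0 zc] cz.
have [ia|ia] := ltP i a.
  by exists 0; [exact: (submod0 (@tr_sub _))|rewrite linear0 z0].
have [y hy] := h i (le_trans ta ia) z cz; exists y => //.
by split=> h1; exfalso; move: h1 ia; lia.
Qed.
End Truncations.

(** * K-injective complexes *)

Section KInjective.
Variable R : comPzRingType.
Implicit Types (X Y Z A B I W : complex R) (i j k l n : int).

(** Both halves come from the acyclicity of Hom(fib f, I). If g f = d u, then (u, g) is a cycle
    there up to a sign on u, and a primitive restricts on B to a primitive of [g]. A cycle [g] on A
    gives the cycle (g, 0), and a primitive of it restricts on B to a cycle whose composite with f
    is homologous to [g] up to sign. *)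
Lemma pre_qis A B I (f : chain_map A B) : K_injective I -> quasi_iso f -> quasi_iso (pre I f).
Proof.
move=> KI qf n; have ac := KI _ (qis_fib qf).
split=> [g cg [u hu]|g cg].
  have e : n + 1 = n + 1 by [].
  have cF : @cycle R (homc (fib f) I) (n + 1) (fib_in f (- sg n *: u) g e).
    apply: fib_in_cycle => //; have hu' : homd A I (n + 1) n u = pre I f n g by [].
    by rewrite [LHS]linearZ hu'.
  have [G hG] := (hvanP _ _).2 (ac _) _ cF.
  have e' : n + 1 + 1 = n + 1 + 1 by [].
  have hG' : homd (fib f) I (n + 1 + 1) (n + 1) G = fib_in f (- sg n *: u) g e by [].
  by exists (fib_out2 G e'); rewrite [LHS](fib_out2_d G e' e) // hG' fib_out2_in.
have e : n - 1 + 1 = n by rewrite subrK.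
pose F := fib_in f (g : hom_deg A I n) (0 : hom_deg B I (n - 1)) e.
have cF : @cycle R (homc (fib f) I) n F.
  apply: fib_in_cycle; first exact: (linear0 (cd (homc B I) _ _)).
  rewrite [LHS]cg; apply: hom_deg_eq => i j x /=.
  by rewrite scaler0.
have [G hG] := (hvanP _ _).2 (ac _) _ cF.
have e' : n + 1 = n + 1 by [].
pose h := fib_out2 G e'.
have ch : @cycle R (homc B I) n h.
  have hG' : homd (fib f) I (n + 1) n G = F by [].
  by rewrite /cycle [LHS](fib_out2_d G e' e) // hG' fib_out2_in.
exists (sg n *: h); first by apply: (submodZ _ (@cycle_sub _ _ _)).
exists (fib_out1 G); apply: hom_deg_eq => i j x.
have hG' : homd (fib f) I (n + 1) n G = F by [].
rewrite [LHS](@fib_out1_d _ _ _ _ _ _ _ G e' i j x) hG' sgSr scaleNr.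
rewrite [RHS]hom_degB -[(pre _ _ _ _ : hom_deg _ _ _) i j x]/(sg n *: h i j (f i x)).
by rewrite -[F i j _]/((g : hom_deg A I n) i j x + 0) addr0.
Qed.

(** A quasi-isomorphism of K-injective complexes is a homotopy equivalence: surjectivity of
    precomposition with [h] gives [g] and a homotopy [u] from g h to the identity; then h g h is
    homotopic to h, and injectivity gives the homotopy [v] for h g. *)
Lemma post_qis Y I I' (h : chain_map I I') : K_injective I -> K_injective I' ->
  quasi_iso h -> quasi_iso (post Y h).
Proof.
move=> KI KI' qh.
have [g cg [u hu]] := (pre_qis KI qh 0).2 (elt (idc I)) (elt_cycle (idc I)).
pose g' := chain_of cg.
have uE i x : (homd I I 1 0 u : hom_deg I I 0) i i x = x - g' i (h i x).
  by rewrite [homd _ _ _ _ _]hu [LHS]hom_degB eltE.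
have [v hv] : exists v : hom_deg I' I' 1, forall i x,
    (homd I' I' 1 0 v : hom_deg I' I' 0) i i x = x - h i (g' i x).
  pose w : hom_deg I' I' 0 := elt (idc I') - (post _ h 0 (elt g') : hom_deg _ _ 0).
  have wE i x : w i i x = x - h i (g' i x).
    by rewrite [LHS]hom_degB postE !eltE.
  have cw : @cycle R (homc I' I') 0 w.
    apply: (submodB (@cycle_sub _ _ _)); first exact: elt_cycle.
    by apply: cmap_cycle; exact: elt_cycle.
  have [|v hv] := (pre_qis KI' qh 0).1 w cw.
    exists (post _ h 1 u); rewrite [LHS](cmapd (post I h)).
    apply: hom_deg_ext => i j; rewrite addr0 => -> x.
    rewrite -[LHS]/(h i ((homd I I 1 0 u : hom_deg I I 0) i i x)) uE linearB.
    by rewrite -[RHS]/(w i i (h i x)) wE.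
  by exists v => i x; rewrite [homd _ _ _ _ _]hv.
move=> n; split=> [y cy [w hw]|y cy].
  have e1 : n + 1 = n + 1 by []; have e0 : n = n + 0 by rewrite addr0.
  exists ((post _ g' (n + 1) w : hom_deg Y I (n + 1)) + hcomp u y e1).
  rewrite linearD [X in X + _ = _](cmapd (post Y g')) hw.
  rewrite [X in _ + X = _](hcomp_d u e1 e0 erefl cy); apply: hom_deg_ext => i j ej x.
  rewrite -[LHS]/(g' j (h j (y i j x)) + (homd I I 1 0 u : hom_deg I I 0) (i + n) j (y i (i + n) x)).
  by subst j; rewrite uE; lincomb R.
exists (post _ g' n y); first exact: cmap_cycle.
have e1 : n + 1 = n + 1 by []; have e0 : n = n + 0 by rewrite addr0.
exists (hcomp v y e1); rewrite [LHS](hcomp_d v e1 e0 erefl cy); apply: hom_deg_ext => i j ej x.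
by rewrite -[LHS]/((homd I' I' 1 0 v : hom_deg I' I' 0) (i + n) j (y i (i + n) x)); subst j; rewrite hv [RHS]hom_degB.
Qed.

(** Hom(N, I) is acyclic, so the inclusion of N in I is null-homotopic; composing the homotopy with
    [g] gives a primitive. *)
Lemma K_inj_factor W I (N : forall i, I i -> Prop) (hN : forall i, submod (N i))
    (dN : forall i j x, N i x -> N j (cd I i j x)) n (g : homc W I n) :
  K_injective I -> acyclic (subc hN dN) -> cycle g ->
  (forall i j x, N j ((g : hom_deg W I n) i j x)) -> boundary g.
Proof.
move=> KI ac cg gN.
have [u hu] := (hvanP _ _).2 (KI _ ac 0) _ (elt_cycle (subc_in hN dN)).
pose g' := hom_subc hN dN gN.
have cg' : @cycle R (homc W (subc hN dN)) n g'.
  apply/homcycleP => i j k l hk hl x; apply: smod_eq.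
  exact: ((homcycleP g).1 cg i j k l hk hl x).
have e1 : n + 1 = n + 1 by []; have e0 : n = n + 0 by rewrite addr0.
exists (hcomp u g' e1); rewrite [LHS](hcomp_d u e1 e0 erefl cg'); apply: hom_deg_ext => i j ej x.
rewrite -[LHS]/((homd _ I 1 0 u : hom_deg _ I 0) (i + n) j (g' i (i + n) x)) [homd _ _ _ _ _]hu.
by subst j; rewrite eltE.
Qed.

(** Once W is replaced by its truncation at [a], a cycle of degree [n] takes values in the
    truncation of I at [a + n], which is acyclic because a + n > s. *)
Lemma homc_van_above W I (a s n : int) : K_injective I -> (forall i, i < a -> hvan W i) ->
  (forall i, s < i -> hvan I i) -> s - a < n -> hvan (homc W I) n.
Proof.
move=> KI hW hI nlt g cg.
apply: (pre_qis KI (trunc_qis hW) n).1 => //.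
have ac : acyclic (trunc I (a + n)).
  by apply: (@trunc_van _ _ _ (s + 1)) => [i|]; [rewrite lezD1; exact: hI|move: nlt; lia].
apply: (K_inj_factor KI ac); first exact: cmap_cycle.
move=> i j x; have [x0 xc] := smodP x; rewrite preE /=; split=> [ja|ja].
  have [e|ne] := eqVneq j (i + n); last exact: hmap_shape.
  by rewrite x0 ?linear0 // -(ltrD2r n) -e.
have [e|ne] := eqVneq j (i + n); last first.
  by rewrite hmap_shape //; exact: (submod0 (@cycle_sub _ _ _)).
have ia : i = a by apply: (addIr n); rewrite -e.
apply/(cycleE (k := j - 1)) => //.
rewrite ((homcycleP g).1 cg i (j - 1) j (i - 1)) ?subrK //.
by rewrite [cd _ _ _ _](xc ia) linear0 scaler0.
Qed.
End KInjective.

(** * Finite generation of the homology of Hom *)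

Section Sphere.
Variables (R : comPzRingType) (r : nat) (a : int).
Let V : lmodType R := {ffun 'I_r -> R^o}.

Definition const_d (i j : int) : {linear V -> V} :=
  mklin (f := fun=> 0) (fun b x y => esym (etrans (addr0 _) (scaler0 _ b))).
Definition const_complex : complex R :=
  @Complex R (fun=> V) const_d (fun _ _ _ _ => erefl) (fun _ _ _ _ => erefl).

(** R^r in degree [a], cut out of a constant complex: no type then depends on the test [i == a]. *)
Definition sph_pred (i : int) (v : const_complex i) : Prop := i != a -> v = 0.
Fact sph_sub i : submod (@sph_pred i).
Proof.
by split=> // c x y hx hy ne; rewrite hx // hy // scaler0 addr0.
Qed.
Fact sph_d i j x : @sph_pred i x -> @sph_pred j (cd const_complex i j x).
Proof. by []. Qed.
Definition sph : complex R := subc sph_sub sph_d.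

Lemma sph_cd i j (v : sph i) : cd sph i j v = 0.
Proof. exact: smod_eq. Qed.

Lemma sph_ne i (v : sph i) : i != a -> v = 0.
Proof. by move=> ne; apply: smod_eq; apply: (smodP v). Qed.

Definition sph_e (k : 'I_r) : sph a :=
  @SMod _ _ (@sph_pred a) [ffun l => (l == k)%:R]
    (fun ne => match negP ne (eqxx a) with end).

Lemma sph_expand (v : sph a) : v = \sum_k (sval_of v : V) k *: sph_e k.
Proof.
apply: smod_eq; rewrite -[RHS]/(smod_val (sph_sub a) _) linear_sum.
apply/ffunP => l; rewrite sum_ffunE (bigD1 l) //= big1 ?addr0 => [|k /negPf kl].
  by rewrite !ffunE eqxx [RHS]mulr1.
by rewrite !ffunE eq_sym kl scaler0.
Qed.

Section Out.
Variables (Y : complex R) (n p : int) (y : 'I_r -> Y p).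
Hypothesis ep : p = a + n.

Definition sph_fun i j (v : sph i) : Y j :=
  \sum_k (sval_of v : V) k *: ccast Y p j (y k).
Fact sph_linear i j : linear (@sph_fun i j).
Proof.
move=> c u v; rewrite /sph_fun scaler_sumr -big_split; apply: eq_bigr => k _ /=.
by rewrite !ffunE scalerDl; congr (_ + _); rewrite scalerA.
Qed.
Fact sph_shape i j : j != i + n -> forall v, mklin (@sph_linear i j) v = 0.
Proof.
move=> ne v; rewrite /= /sph_fun big1 // => k _.
have [ej|nj] := eqVneq j p; last by rewrite ccast_ne // scaler0.
have ia : i != a by apply: contra ne => /eqP ->; rewrite ej ep.
by rewrite (smodP v ia) ffunE scale0r.
Qed.
Definition sph_hom : hom_deg sph Y n := HomDeg sph_shape.

Lemma sph_hom_cycle : (forall k, cycle (y k)) -> @cycle R (homc sph Y) n sph_hom.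
Proof.
move=> cy; apply/homcycleP => i j k l -> _ v; rewrite sph_cd linear0 scaler0 /= /sph_fun.
rewrite linear_sum big1 // => t _; rewrite linearZ /=.
have [e|ne] := eqVneq (j + 1) p; last by rewrite ccast_ne // linear0 scaler0.
have ej : j = p - 1 by rewrite -e addrK.
by rewrite cd_ccast // ((cycleE (y t) ej).1 (cy t)) scaler0.
Qed.
End Out.

Lemma sph_hom_ext (Y : complex R) n p (g h : hom_deg sph Y n) : p = a + n ->
  (forall k, g a p (sph_e k) = h a p (sph_e k)) -> g = h.
Proof.
move=> ep e; apply: hom_deg_ext => i j ej v.
have [ia|ia] := eqVneq i a; last by rewrite (sph_ne v ia) !linear0.
have jp : j = p by rewrite ej ia -ep.
subst i j; rewrite -ep [v]sph_expand !linear_sum; apply: eq_bigr => k _.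
by rewrite !linearZ /= e.
Qed.

Lemma sph_fun_e (Y : complex R) p (y : 'I_r -> Y p) k : sph_fun y p (sph_e k) = y k.
Proof.
rewrite /sph_fun; under eq_bigr do rewrite ccastE.
rewrite (bigD1 k) //= big1 ?addr0 => [|l /negPf lk]; rewrite ffunE ?eqxx ?scale1r //.
by rewrite lk scale0r.
Qed.

Lemma sph_hom_e (Y : complex R) n p (y : 'I_r -> Y p) (ep : p = a + n) k :
  sph_hom y ep a p (sph_e k) = y k.
Proof. exact: sph_fun_e. Qed.

Lemma sph_fg i : H_fg sph i.
Proof.
have [ia|ia] := eqVneq i a; last first.
  by apply: hvan_fg => z _; rewrite (sph_ne z ia); exact: (submod0 (@boundary_sub _ _ _)).
subst i; exists r, sph_e; split=> [k|z _]; first exact: sph_cd.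
exists (sval_of z : V); rewrite [z in z - _]sph_expand subrr.
exact: (submod0 (@boundary_sub _ _ _)).
Qed.

Lemma homc_sph_fg (I : complex R) n : H_fg I (a + n) -> H_fg (homc sph I) n.
Proof.
move=> [q [w [cw hw]]]; apply/H_fgE.
exists ('I_r * 'I_q)%type, (fun kl => sph_hom (fun k => (k == kl.1)%:R *: w kl.2) (erefl _)).
split=> [[k l]|g cg].
  by apply: sph_hom_cycle => k'; apply: (submodZ _ (@cycle_sub _ _ _)).
have cgk k : cycle ((g : hom_deg sph I n) a (a + n) (sph_e k)).
  rewrite /cycle ((homcycleP g).1 cg a (a + n - 1) (a + n) (a - 1)) ?subrK //.
  by rewrite sph_cd linear0 scaler0.
have /choice[c hc] : forall k, exists c : 'I_q -> R,
   boundary ((g : hom_deg sph I n) a (a + n) (sph_e k) - \sum_l c l *: w l).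
  by move=> k; apply: hw.
have /choice[t ht] : forall k, exists t : I (a + n + 1), cd I (a + n + 1) (a + n) t =
   (g : hom_deg sph I n) a (a + n) (sph_e k) - \sum_l c k l *: w l.
  by move=> k; case: (hc k) => t; exists t.
exists (fun kl => c kl.1 kl.2).
have e1 : a + n + 1 = a + (n + 1) by rewrite addrA.
exists (sph_hom t e1); apply: (@sph_hom_ext _ _ (a + n)) => // k.
rewrite [LHS](@homdE _ sph I (n + 1) n a (a + n) (a + n + 1) (a - 1)) // sph_cd linear0.
rewrite scaler0 subr0 sph_hom_e ht [RHS]hom_degB; congr (_ - _).
have ev_lin : linear (fun h : homc sph I n => (h : hom_deg sph I n) a (a + n) (sph_e k)) by [].
rewrite -[RHS]/(mklin ev_lin _) linear_sum -(pair_bigA _ (fun k' l =>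
  mklin ev_lin (c k' l *: sph_hom (fun k0 => (k0 == k')%:R *: w l) (erefl (a + n))))) /=.
rewrite [RHS](bigD1 k) //= [X in _ = _ + X]big1 ?addr0 => [|k' /negPf kk].
  apply: eq_bigr => l _.
  by rewrite sph_fun_e eqxx scale1r.
by rewrite big1 // => l _; rewrite sph_fun_e eq_sym kk scale0r scaler0.
Qed.
End Sphere.

Section HomFinite.
Variable R : comPzRingType.
Hypothesis noethR : noetherian R.
Implicit Types (X Y W I : complex R) (a s n : int).

Section Attach.
Variables (W : complex R) (a : int) (r : nat) (y : 'I_r -> W a).
Hypotheses (cy : forall k, cycle (y k))
  (hy : forall z, cycle z -> exists c : 'I_r -> R, boundary (z - \sum_k c k *: y k)).

Let e0 : a = a + 0. Proof. by rewrite addr0. Qed.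
Definition attach : chain_map (sph R r a) W :=
  chain_of (g := sph_hom y e0) (sph_hom_cycle e0 cy).

Lemma attachE (c : 'I_r -> R) :
  attach a (\sum_k c k *: sph_e R a k) = \sum_k c k *: y k.
Proof.
rewrite linear_sum; apply: eq_bigr => k _; rewrite linearZ /=.
by rewrite sph_fun_e.
Qed.

(** The only homology that could appear below [a] is the cokernel of the map onto H_a(W), in degree
    a - 1, and the attached generators make it zero. *)
Lemma attach_van : (forall i, i < a -> hvan W i) -> forall i, i < a -> hvan (fib attach) i.
Proof.
move=> hW i ia; have ne : i != a by rewrite lt_eqF.
have [lt|ge] := ltP (i + 1) a.
  apply: fib_van; last exact: hW.
  by move=> z _; rewrite (sph_ne z ne); exact: (submod0 (@boundary_sub _ _ _)).
have ea : i + 1 = a by apply/eqP; rewrite eq_le ge andbT lezD1.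
move=> [x b] /fib_cycle[_]; rewrite (sph_ne x ne) linear0 => cb.
have [c [b' hb']] : exists c : sph R r a (i + 1), boundary (b - attach (i + 1) c).
  have {}cb : cycle b by apply/(cycleE b (k := i)); rewrite ?addrK.
  move: b cb; rewrite ea => b cb.
  have [c hc] := hy cb; exists (\sum_k c k *: sph_e R a k).
  by rewrite attachE.
apply/fib_boundary; exists c, (- b'); split; first by rewrite sph_cd.
by rewrite linearN hb'; lincomb R.
Qed.
End Attach.

(** Induction on [k] > s - a - n, the case k = 0 being [homc_van_above]. For a free module F in
    degree [a] mapping onto H_a(W), the homology of Hom(W, I) in degree [n] lies between that of
    Hom(fiber, I) in degree n + 1, covered by induction, and that of Hom(F, I). W may be unbounded
    above. *)
Lemma homc_fg W I (a s : int) : K_injective I -> (forall i, i < a -> hvan W i) ->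
  (forall i, H_fg W i) -> (forall i, s < i -> hvan I i) -> (forall i, H_fg I i) ->
  forall n, H_fg (homc W I) n.
Proof.
move=> KI hW fW hI fI n.
have [k hk] : exists k : nat, s - a - n < k%:Z by exists (absz (s - a - n)%R).+1; lia.
elim: k n W hk hW fW => [|k IHk] n W hk hW fW.
  by apply: hvan_fg; apply: (homc_van_above KI hW hI); move: hk; lia.
have [r [y [cy hy]]] := fW a.
pose f := attach cy.
have van : forall i : int, i < a -> hvan (fib f) i := attach_van hy hW.
have ff i : H_fg (fib f) i by apply: fib_fg => //; exact: sph_fg.
have : H_fg (homc (fib f) I) (n + 1) by apply: IHk => //; move: hk; lia.
rewrite !H_fgE => -[T [F [cF hF]]].
apply: (fgq_ext noethR (pi := pre I f n) (N' := @cycle R (homc (sph R r a) I) n)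
  (W' := @boundary R (homc (sph R r a) I) n)).
- exact: cycle_sub.
- exact: boundary_sub.
- exact: boundary_sub.
- by move=> z; exact: cmap_cycle.
- by apply/H_fgE; exact: homc_sph_fg.
have e : n + 1 = n + 1 by [].
have e' : n - 1 + 1 = n by rewrite subrK.
have out_lin : linear (fun G : homc (fib f) I (n + 1) => fib_out2 G e : homc W I n).
  by move=> c G G'; apply: hom_deg_eq => i j x.
exists T, (fun t => mklin out_lin (F t)); split=> [t|g [cg [u hu]]].
  have cFt : homd (fib f) I (n + 1) n (F t) = 0 by apply: (cycleE _ _).1 (cF t); rewrite addrK.
  split.
    rewrite /cycle [LHS](fib_out2_d (F t) e e') ?subrK // cFt.
    by apply: hom_deg_eq.
  have E : cd (homc (sph R r a) I) (n + 1) n (fib_out1 (F t)) =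
      - sg n *: pre I f n (mklin out_lin (F t)).
    apply: hom_deg_eq => i j x; rewrite [LHS](fib_out1_d _ e) cFt add0r sgSr.
    by [].
  rewrite -[pre _ _ _ _]scale1r -(sgK R n) -mulrNN -scalerA -E.
  by apply: (submodZ _ (@boundary_sub _ _ _)); exists (fib_out1 (F t)).
have cFg : @cycle R (homc (fib f) I) (n + 1) (fib_in f (- sg n *: u) g e).
  apply: fib_in_cycle => //; have hu' : homd (sph R r a) I (n + 1) n u = pre I f n g by [].
  by rewrite [LHS]linearZ hu'.
have [c [G hG]] := hF _ cFg; exists c.
have hG' : homd (fib f) I (n + 1 + 1) (n + 1) G =
   (fib_in f (- sg n *: u) g e : homc (fib f) I (n + 1)) - \sum_k c k *: F k by [].
have e2 : n + 1 + 1 = n + 1 + 1 by [].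
exists (fib_out2 G e2); rewrite [LHS](fib_out2_d G e2 e) // hG'.
rewrite -[LHS]/(mklin out_lin _) linear_sub_comb; congr (_ - _).
exact: fib_out2_in.
Qed.
End HomFinite.

Lemma dep_choice (T : Type) (U : T -> Type) (Q : forall t, U t -> Prop) :
  (forall t, exists u, Q t u) -> exists f : forall t, U t, forall t, Q t (f t).
Proof. by move=> h; exists (fun t => projT1 (cid (h t))) => t; case: cid. Qed.

(** * Comparison of resolutions and of biduality maps *)

Section QisCalculus.
Variable R : comPzRingType.
Implicit Types (X Y Z I : complex R) (i j n : int).

Lemma boundaryD X i (x y : X i) : boundary x -> boundary y -> boundary (x + y).
Proof. exact: (submodD (@boundary_sub _ _ _)). Qed.
Lemma boundaryB X i (x y : X i) : boundary x -> boundary y -> boundary (x - y).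
Proof. exact: (submodB (@boundary_sub _ _ _)). Qed.
Lemma boundary_trans X i (x y z : X i) :
  boundary (x - y) -> boundary (y - z) -> boundary (x - z).
Proof. by move=> h h'; rewrite -(subrK y x) -addrA; apply: boundaryD. Qed.
Lemma boundary_shift X i (x y : X i) : boundary (x - y) -> boundary y -> boundary x.
Proof. by move=> h h'; rewrite -(subrK y x); apply: boundaryD. Qed.
Lemma cmap_boundaryB X Y (f : chain_map X Y) i (x y : X i) :
  boundary (x - y) -> boundary (f i x - f i y).
Proof. by rewrite -linearB; exact: cmap_boundary. Qed.

Lemma qis_square X X' Y Y' (f : chain_map X Y) (f' : chain_map X' Y')
    (a : chain_map X X') (b : chain_map Y Y') :
  (forall i x, b i (f i x) = f' i (a i x)) -> quasi_iso a -> quasi_iso b ->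
  quasi_iso f <-> quasi_iso f'.
Proof.
move=> sq qa qb; split=> qf i; have [ia sa] := qa i; have [ib sb] := qb i;
  have [jf sf] := qf i; split.
- move=> z' cz' bz'; have [z cz hz] := sa z' cz'; apply: (boundary_shift hz).
  apply: cmap_boundary; apply: jf => //; apply: ib; first exact: cmap_cycle.
  by rewrite sq -[_ (_ z)](subKr (f' i z')); apply: boundaryB => //; apply: cmap_boundaryB.
- move=> w' cw'; have [w cw hw] := sb w' cw'; have [z cz hz] := sf w cw.
  exists (a i z); first exact: cmap_cycle.
  by apply: (boundary_trans hw); rewrite -sq; apply: cmap_boundaryB.
- move=> z cz bz; apply: ia => //; apply: jf; first exact: cmap_cycle.
  by rewrite -sq; apply: cmap_boundary.
- move=> w cw; have [z' cz' hz'] := sf _ (cmap_cycle b cw); have [z cz hz] := sa z' cz'.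
  exists z => //; apply: ib.
    by apply: (submodB (@cycle_sub _ _ _)) => //; exact: cmap_cycle.
  rewrite linearB sq; apply: (boundary_trans hz').
  exact: cmap_boundaryB.
Qed.

Lemma qis_id X : quasi_iso (idc X).
Proof.
move=> i; split=> // w cw; exists w => //; rewrite subrr.
exact: (submod0 (@boundary_sub _ _ _)).
Qed.

Lemma bij_qis X Y (f : chain_map X Y) : (forall i, injective (f i)) ->
  (forall i y, exists x, f i x = y) -> quasi_iso f.
Proof.
move=> inj surj i; split=> [z cz [y hy]|w cw].
  have [x hx] := surj _ y; exists x; apply: inj; by rewrite -cmapd hx.
have [x hx] := surj _ w; exists x.
  by apply: (inj (i - 1)); rewrite -cmapd hx cw linear0.
by rewrite hx subrr; exact: (submod0 (@boundary_sub _ _ _)).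
Qed.

Lemma qis_bounded X Y (f : chain_map X Y) : quasi_iso f ->
  homologically_bounded X <-> homologically_bounded Y.
Proof.
by move=> qf; split=> -[N h]; exists N => i /h; rewrite -!hvanP (qis_hvan qf).
Qed.

Lemma boundedP X : homologically_bounded X <->
  (exists a : int, forall i, i < a -> hvan X i) /\ (exists b : int, forall i, b < i -> hvan X i).
Proof.
split=> [[N h]|[[a ha] [b hb]]].
  by split; [exists (- N%:Z) | exists N%:Z] => i lt; apply/hvanP; apply: h; lia.
exists (absz a + absz b)%N => i lt; apply/hvanP; have [ia|ia] := ltP i a; first exact: ha.
by apply: hb; lia.
Qed.

Lemma hfiniteP X : homologically_finite X <->
  homologically_bounded X /\ forall i, H_fg X i.
Proof.
split=> [[n [g [cg hg]]]|[[N bX] fX]].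
  have sing_fs i (z : X i) : fin_supp (fun j => ccast X i j z).
    exists (absz i) => j lt; rewrite ccast_ne //; by apply: contraTneq lt => ->; rewrite ltnn.
  have sing_c i (z : X i) : cycle z -> forall j, cycle (ccast X i j z).
    move=> cz j; have [->|ne] := eqVneq j i; first by rewrite ccastE.
    by rewrite ccast_ne //; exact: (submod0 (@cycle_sub _ _ _)).
  split.
    have /choice[M hM] : forall k : 'I_n, exists M : nat, forall i : int, (M < `|i|)%N -> g k i = 0.
      by move=> k; case: (cg k).
    exists (\max_(k < n) M k)%N => i lt; apply/hvanP => z cz.
    have [a /(_ i)] := hg _ (sing_fs i z) (sing_c i z cz).
    rewrite ccastE big1 ?subr0 // => k _; rewrite hM ?scaler0 //.
    by apply: leq_ltn_trans lt; exact: leq_bigmax.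
  move=> i; exists n, (fun k => g k i); split=> [k|z cz]; first by case: (cg k).
  have [a /(_ i)] := hg _ (sing_fs i z) (sing_c i z cz).
  by rewrite ccastE; exists a.
have /dep_choice[rg hrg] : forall i, exists rg : {r : nat & 'I_r -> X i},
    (forall k, cycle (projT2 rg k)) /\ forall z : X i, cycle z ->
      exists a : 'I_(projT1 rg) -> R, boundary (z - \sum_k a k *: projT2 rg k).
  by move=> i; have [r [g h]] := fX i; exists (existT _ r g).
(* [ofi] enumerates the degrees from -N to N, outside of which the homology vanishes. *)
pose ofi (m : 'I_(N + N).+1) : int := m%:Z - N%:Z.
pose T := {m : 'I_(N + N).+1 & 'I_(projT1 (rg (ofi m)))}.
pose g (t : T) (j : int) : X j := ccast X (ofi (tag t)) j (projT2 (rg (ofi (tag t))) (tagged t)).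
have cgt t : fin_supp (g t) /\ forall j, cycle (g t j).
  split.
    exists (absz (ofi (tag t))) => j lt; rewrite /g ccast_ne //.
    by apply: contraTneq lt => ->; rewrite ltnn.
  move=> j; rewrite /g; have [->|ne] := eqVneq j (ofi (tag t)).
    by rewrite ccastE; case: (hrg (ofi (tag t))).
  by rewrite ccast_ne //; exact: (submod0 (@cycle_sub _ _ _)).
exists #|{: T}|, (fun k => g (enum_val k)); split=> [k|z _ cz]; first exact: cgt.
have /dep_choice[a ha] : forall i, exists a : 'I_(projT1 (rg i)) -> R,
   boundary (z i - \sum_k a k *: projT2 (rg i) k).
  by move=> i; case: (hrg i) => _; apply.
pose c (t : T) := a (ofi (tag t)) (tagged t).
exists (fun k => c (enum_val k)) => i.
have -> : \sum_(k < #|{: T}|) c (enum_val k) *: g (enum_val k) i = \sum_t c t *: g t i.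
  by rewrite [RHS](reindex _ (onW_bij _ (enum_val_bij _))).
have [lt|ge] := ltnP N `|i|%N.
  have /hvanP h := bX i lt; apply: h; apply: (submodB (@cycle_sub _ _ _)) => //.
  apply: (submod_sum (@cycle_sub _ _ _)) => t _; apply: (submodZ _ (@cycle_sub _ _ _)).
  by case: (cgt t).
have [m em] : exists m, ofi m = i.
  have hm : (absz (i + N%:Z)%R < (N + N).+1)%N by lia.
  by exists (Ordinal hm); rewrite /ofi /=; lia.
have -> : \sum_t c t *: g t i = \sum_(k < projT1 (rg i)) a i k *: projT2 (rg i) k; last exact: ha.
rewrite (eq_bigr (fun t : T => c (Tagged (fun m => 'I_(projT1 (rg (ofi m)))) (tagged t))
   *: g (Tagged (fun m => 'I_(projT1 (rg (ofi m)))) (tagged t)) i)); last by case.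
rewrite -(sig_big_dep (fun=> true) (fun _ _ => true) (fun m k =>
   c (Tagged (fun m => 'I_(projT1 (rg (ofi m)))) k) *: g (Tagged (fun m => 'I_(projT1 (rg (ofi m)))) k) i)) /=.
rewrite (bigD1 m) //= [X in _ + X]big1 ?addr0; last first.
  move=> m' ne; rewrite big1 // => k _; rewrite /g /= ccast_ne ?scaler0 // -em.
  by apply: contra ne => /eqP; rewrite /ofi => /addIr [] /ord_inj ->.
subst i; apply: eq_bigr => k _; by rewrite /c /g /= ccastE.
Qed.

Lemma pre_bidual X Y I (f : chain_map X Y) i (x : X i) :
  pre I (pre I f) i (biduality X I i x) = biduality Y I i (f i x).
Proof. by apply: hom_deg_eq. Qed.

Lemma bidual_qis_source X Y I (f : chain_map X Y) : K_injective I -> quasi_iso f ->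
  quasi_iso (biduality X I) <-> quasi_iso (biduality Y I).
Proof.
move=> KI qf; apply: (qis_square (a := f) (b := pre I (pre I f))) => //.
  exact: pre_bidual.
by apply: pre_qis => //; apply: pre_qis.
Qed.

Definition ccomp X Y Z (g : chain_map Y Z) (f : chain_map X Y) : chain_map X Z.
Proof.
exists (fun i => g i \o f i : {linear X i -> Z i}) => i j x /=.
by rewrite !cmapd.
Defined.

(** Both biduality maps are compared with X -> Hom(Hom(X, I), I'), where [h] acts on the outer
    target in one case and on the inner one in the other. *)
Lemma bidual_qis_target X I I' (h : chain_map I I') : K_injective I -> K_injective I' ->
  quasi_iso h -> quasi_iso (biduality X I) <-> quasi_iso (biduality X I').
Proof.
move=> KI KI' qh.
pose m := ccomp (post (homc X I) h) (biduality X I).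
transitivity (quasi_iso m).
  apply: (qis_square (a := idc X) (b := post (homc X I) h)) => //; first exact: qis_id.
  exact: post_qis.
symmetry; apply: (qis_square (a := idc X) (b := pre I' (post X h))); last 2 first.
- exact: qis_id.
- by apply: pre_qis => //; apply: post_qis.
move=> i x; apply: hom_deg_eq => n j g; rewrite preE postE /= /ev_map.
by rewrite [RHS]linearZ.
Qed.

(** The map from C to I' extends along the one to I up to homotopy, and the extension is a
    quasi-isomorphism by two out of three. *)
Lemma resolution_compare C (I I' : injective_resolution C) :
  exists h : chain_map I I', @quasi_iso R I I' h.
Proof.
have qi := ir_quasi_iso I; have qi' := ir_quasi_iso I'.
have [_ /(_ (elt (ir_map I')) (elt_cycle _))] := pre_qis (ir_K_injective (i := I')) qi 0.
move=> [g cg [u hu]]; exists (chain_of cg).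
have htp i (z : C i) : cycle z -> boundary (ir_map I' i z - chain_of cg i (ir_map I i z)).
  move=> cz; exists (u i (i + 1) z).
  have := congr1 (fun w : hom_deg C I' 0 => w i i z) hu.
  rewrite hom_degB eltE => <-.
  by rewrite (@homdE _ C I' 1 0 i i (i + 1) (i - 1)) // cz linear0 scaler0 subr0.
move=> i; have [ia sa] := qi i; have [ib sb] := qi' i; split.
  move=> w cw bw; have [z cz hz] := sa w cw; apply: (boundary_shift hz).
  apply: cmap_boundary; apply: ib => //; apply: (boundary_shift (htp i z cz)).
  by rewrite -[_ (_ z)](subKr (chain_of cg i w)); apply: boundaryB => //; apply: cmap_boundaryB.
move=> w' cw'; have [z cz hz] := sb w' cw'; exists (ir_map I i z); first exact: cmap_cycle.
exact: (boundary_trans hz (htp i z cz)).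
Qed.
End QisCalculus.

(** * From complexes to graded modules, and dual bases *)

Section ProductModule.
Variables (R : comPzRingType) (X : int -> lmodType R).

(** The product serves as ambient module of the graded form: only homogeneous elements matter, so no
    finiteness of supports is imposed. *)
Definition gprod : Type := forall i, X i.
HB.instance Definition _ := gen_eqMixin gprod.
HB.instance Definition _ := gen_choiceMixin gprod.
Implicit Types u v w : gprod.

Lemma gprod_ext u v : (forall i, u i = v i) -> u = v.
Proof. exact: functional_extensionality_dep. Qed.

Definition gprod0 : gprod := fun=> 0.
Definition gprodD u v : gprod := fun i => u i + v i.
Definition gprodN u : gprod := fun i => - u i.
Definition gprodZ (a : R) u : gprod := fun i => a *: u i.

Fact gprodDA : associative gprodD.
Proof. by move=> u v w; apply: gprod_ext => i; rewrite /gprodD addrA. Qed.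
Fact gprodDC : commutative gprodD.
Proof. by move=> u v; apply: gprod_ext => i; rewrite /gprodD addrC. Qed.
Fact gprod0D : left_id gprod0 gprodD.
Proof. by move=> u; apply: gprod_ext => i; rewrite /gprodD add0r. Qed.
Fact gprodND : left_inverse gprod0 gprodN gprodD.
Proof. by move=> u; apply: gprod_ext => i; rewrite /gprodD addNr. Qed.
HB.instance Definition _ := GRing.isZmodule.Build gprod gprodDA gprodDC gprod0D gprodND.

Fact gprodZA a b u : gprodZ a (gprodZ b u) = gprodZ (a * b) u.
Proof. by apply: gprod_ext => i; rewrite /gprodZ scalerA. Qed.
Fact gprod1Z : left_id 1 gprodZ.
Proof. by move=> u; apply: gprod_ext => i; rewrite /gprodZ scale1r. Qed.
Fact gprodZDr : right_distributive gprodZ +%R.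
Proof. by move=> a u v; apply: gprod_ext => i; rewrite /gprodZ scalerDr. Qed.
Fact gprodZDl u : {morph gprodZ^~ u : a b / a + b}.
Proof. by move=> a b; apply: gprod_ext => i; rewrite /gprodZ scalerDl. Qed.
HB.instance Definition _ := GRing.Zmodule_isLmodule.Build R gprod
  gprodZA gprod1Z gprodZDr gprodZDl.

Fact gproj_linear i : linear (fun u : gprod => u i). Proof. by []. Qed.
Definition gproj i : {linear gprod -> X i} := mklin (@gproj_linear i).
Lemma gprod_sumE (T : finType) (F : T -> gprod) i : (\sum_t F t) i = \sum_t F t i.
Proof. exact: (linear_sum (gproj i)). Qed.
End ProductModule.

Section Bridge.
Variable R : comPzRingType.
Implicit Types (X Y I : complex R) (Z : gcx R) (i j l m n q : int).

Section GcxOfComplex.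
Variable X : complex R.
Implicit Types u : gprod X.

Definition gcd_fun u : gprod X := fun i => cd X (i + 1) i (u (i + 1)).
Fact gcd_linear : linear gcd_fun.
Proof. by move=> a u v; apply: gprod_ext => i; rewrite /gcd_fun linearP. Qed.
Definition gcr n u := forall i, i != n -> u i = 0.
Fact gcr_sub n : submod (gcr n).
Proof.
split=> [//|a u v hu hv i ne].
by rewrite -[LHS]/(a *: u i + v i) hu // hv // scaler0 addr0.
Qed.
Fact gcr_d n u : gcr n u -> gcr (n - 1) (mklin gcd_linear u).
Proof.
move=> hu i ne /=; rewrite /gcd_fun hu ?linear0 //.
by apply: contra ne => /eqP <-; rewrite addrK.
Qed.
Fact gcdd u : mklin gcd_linear (mklin gcd_linear u) = 0.
Proof. by apply: gprod_ext => i; rewrite /= /gcd_fun cdd. Qed.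
Definition G : gcx R := Gcx gcr_sub gcr_d gcdd.

Lemma gdE u i k : k = i + 1 -> (gd (u : G) : gprod X) i = cd X k i (u k).
Proof. by move=> ->. Qed.
End GcxOfComplex.

(** [giso_fr] is linear on all of Z, so that it passes through sums, but it is inverted only on
    elements of degree [n]. *)
Record giso X Z := Giso {
  giso_fr n : {linear Z -> X n};
  giso_d m n z : m + 1 = n -> gr n z -> cd X n m (giso_fr n z) = giso_fr m (gd z);
  giso_to n : X n -> Z;
  giso_gr n x : gr n (@giso_to n x);
  giso_toK n x : giso_fr n (@giso_to n x) = x;
  giso_frK n z : gr n z -> @giso_to n (giso_fr n z) = z
}.
Arguments giso_to {X Z} g n x.

Section Giso.
Variables (X : complex R) (Z : gcx R) (f : giso X Z).

Lemma giso_inj n z : gr n z -> giso_fr f n z = 0 -> z = 0.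
Proof.
move=> hz fz; rewrite -(giso_frK f hz) fz -(linear0 (giso_fr f n)).
by rewrite giso_frK //; exact: (submod0 (@gr_sub _ _ _)).
Qed.

Lemma giso_cyc n z : gr n z -> cycle (giso_fr f n z) <-> gcyc n z.
Proof.
move=> hz; rewrite /cycle (@giso_d _ _ f (n - 1) n) ?subrK //; split=> [h|[_ ->]]; last exact: linear0.
by split=> //; apply: (giso_inj _ h); exact: gr_d.
Qed.

Lemma giso_bd n z : gr n z -> boundary (giso_fr f n z) <-> gbd n z.
Proof.
move=> hz; split=> [[y]|[y hy <-]]; last first.
  by exists (giso_fr f _ y); rewrite giso_d.
rewrite -[y](giso_toK f) giso_d //; last exact: giso_gr.
move=> e; exists (giso_to f _ y); first exact: giso_gr.
apply/eqP; rewrite -subr_eq0; apply/eqP; apply: (@giso_inj n); last by rewrite linearB e subrr.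
apply: (submodB (@gr_sub _ _ _)) => //.
by have := gr_d (giso_gr f y); rewrite addrK.
Qed.

Lemma giso_van n : hvan X n <-> gvan Z n.
Proof.
split=> [h z cz|h x cx].
  by apply/giso_bd; [case: cz|apply/h/giso_cyc => //; case: cz].
rewrite -(giso_toK f x); apply/(giso_bd (giso_gr f x))/h/giso_cyc; first exact: giso_gr.
by rewrite giso_toK.
Qed.

Lemma giso_fg n : H_fg X n <-> gfg Z n.
Proof.
rewrite H_fgE; split=> -[T [g [cg hg]]].
  have grg t : gr n (giso_to f n (g t)) by exact: giso_gr.
  exists T, (fun t => giso_to f n (g t)); split=> [t|z cz].
    by apply/giso_cyc => //; rewrite giso_toK.
  have [|a ha] := hg (giso_fr f n z); first by apply/giso_cyc => //; case: cz.
  exists a; apply/giso_bd.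
    apply: (submodB (@gr_sub _ _ _)); first by case: cz.
    by apply: (submod_sum (@gr_sub _ _ _)) => t _; apply: (submodZ _ (@gr_sub _ _ _)).
  rewrite linear_sub_comb; under eq_bigr do rewrite giso_toK.
  exact: ha.
exists T, (fun t => giso_fr f n (g t)); split=> [t|x cx].
  by have [h _] := cg t; apply/giso_cyc.
have [|a ha] := hg (giso_to f n x).
  by apply/giso_cyc; [exact: giso_gr|rewrite giso_toK].
exists a; rewrite -{1}(giso_toK f x) -linear_sub_comb; apply/giso_bd => //.
by case: (gbd_gcyc ha).
Qed.
End Giso.

Lemma G_giso X : giso X (G X).
Proof.
have fl n : linear (fun u : G X => (u : gprod X) n) by [].
apply: (@Giso X (G X) (fun n => mklin (fl n)) _ (fun n x => (fun j => ccast X n j x) : gprod X)).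
- by move=> m n z mn hz; rewrite /= -(@gdE X z m n).
- by move=> n x i ne; exact: ccast_ne.
- by move=> n x /=; rewrite ccastE.
- move=> n z hz; apply: gprod_ext => i; have [->|ne] := eqVneq i n; first exact: ccastE.
  by rewrite ccast_ne // hz.
Defined.

Lemma G_van X n : hvan X n <-> gvan (G X) n. Proof. exact: (giso_van (G_giso X)). Qed.
Lemma G_fg X n : H_fg X n <-> gfg (G X) n. Proof. exact: (giso_fg (G_giso X)). Qed.

(** * Bounded complexes with dual bases *)

(** By the dual basis lemma such a finite graded family exists exactly if P is a bounded complex of
    finitely generated projective modules. *)
Record dbasis (P : complex R) := Dbasis {
  dix :> finType;
  ddeg : dix -> int;
  dx : dix -> forall i, P i;
  dxi : dix -> forall i, {linear P i -> R^o};
  dx_ne : forall a i, i != ddeg a -> dx a i = 0;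
  dxi_ne : forall a i, i != ddeg a -> forall p, dxi a i p = 0;
  dbE : forall i (p : P i), p = \sum_a (dxi a i p : R) *: dx a i
}.

Section DualBasis.
Variables (P : complex R) (B : dbasis P).
Implicit Types a b c : B.

Definition de a b : R := dxi a (ddeg b) (dx b (ddeg b)).
Definition db a b : R := dxi a (ddeg b - 1) (cd P (ddeg b) (ddeg b - 1) (dx b (ddeg b))).

Lemma dxiP a i (c : R) (p p' : P i) : dxi a i (c *: p + p') = c * (dxi a i p : R) + dxi a i p'.
Proof. exact: linearP. Qed.

Lemma deE a b i : ddeg b = i -> dxi a i (dx b i) = de a b.
Proof. by move=> <-. Qed.
Lemma dbE' a b i j : ddeg b = i -> j + 1 = i -> dxi a j (cd P i j (dx b i)) = db a b.
Proof. by move=> <- e; have -> : j = ddeg b - 1 by rewrite -e addrK. Qed.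

Lemma dxi_cd a i j (p : P i) : j + 1 = i -> dxi a j (cd P i j p) = \sum_b db a b * (dxi b i p : R).
Proof.
move=> ij; rewrite {1}(dbE B p) !linear_sum; apply: eq_bigr => b _; rewrite !linearZ /= mulrC.
have [e|ne] := eqVneq i (ddeg b); first by rewrite (@dbE' a b i j) // mulrC.
by rewrite dxi_ne // !(mul0r, mulr0) scale0r.
Qed.

Lemma dxi_dx a i (p : P i) : dxi a i p = \sum_b de a b * (dxi b i p : R).
Proof.
rewrite {1}(dbE B p) !linear_sum; apply: eq_bigr => b _; rewrite !linearZ /=.
have [e|ne] := eqVneq i (ddeg b); first by rewrite deE // /GRing.scale /= mulrC.
by rewrite (dxi_ne ne) mulr0 scale0r.
Qed.

Lemma cd_dx b i j : j + 1 = i -> ddeg b = i -> cd P i j (dx b i) = \sum_a db a b *: dx a j.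
Proof.
move=> ij e; rewrite {1}(dbE B (cd P i j _)); apply: eq_bigr => a _; congr (_ *: _).
exact: dbE'.
Qed.

Fact de_deg a b : ddeg a != ddeg b -> de a b = 0.
Proof. by move=> ne; rewrite /de dxi_ne // eq_sym. Qed.
Fact db_deg a b : ddeg a + 1 != ddeg b -> db a b = 0.
Proof.
by move=> ne; rewrite /db dxi_ne //; apply: contra ne => /eqP <-; rewrite subrK.
Qed.
Fact dee a c : \sum_b de a b * de b c = de a c.
Proof. by rewrite [RHS]/de dxi_dx; apply: eq_bigr. Qed.
Fact deb a c : \sum_b de a b * db b c = db a c.
Proof. by rewrite [RHS]/db dxi_dx; apply: eq_bigr. Qed.
Fact dbe a c : \sum_b db a b * de b c = db a c.
Proof. by rewrite [RHS]/db dxi_cd ?subrK //; apply: eq_bigr. Qed.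
Fact dbb a c : \sum_b db a b * db b c = 0.
Proof.
have := @dxi_cd a (ddeg c - 1) (ddeg c - 1 - 1) (cd P (ddeg c) (ddeg c - 1) (dx c _)).
by move=> /(_ (subrK _ _)) h; apply: (etrans (esym h)); rewrite cdd linear0.
Qed.
Definition bpdat : pdat R := Pdat de_deg db_deg dee deb dbe dbb.

Section HomIso.
Variable Y : complex R.
Local Notation T := (tcx (pdual bpdat) (G Y)).

(** The sign moves an element of Y of degree j = i + n past [p]: i (i + n) and i (n + 1) have the
    same parity. *)
Definition hfr_fun n (z : T) i j (p : P i) : Y j :=
  if j == i + n then \sum_a (sg (i * (n + 1)) * (dxi a i p : R)) *: (z a : gprod Y) j else 0.
Fact hfr_linear n z i j : linear (@hfr_fun n z i j).
Proof.
move=> c p p'; rewrite /hfr_fun; case: eqP => _; last by rewrite scaler0 addr0.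
rewrite scaler_sumr -big_split; apply: eq_bigr => a _ /=.
by rewrite dxiP; lincomb R.
Qed.
Fact hfr_shape n z i j : j != i + n -> forall p, mklin (@hfr_linear n z i j) p = 0.
Proof. by rewrite /= /hfr_fun => /negPf ->. Qed.
Fact hfr_linear2 n : linear (fun z => HomDeg (@hfr_shape n z)).
Proof.
move=> c z z'; apply: hom_deg_ext => i j ej p; rewrite hom_degP /= /hfr_fun ej eqxx.
rewrite scaler_sumr -big_split; apply: eq_bigr => a _ /=.
have -> : ((c *: z + z') a : gprod Y) (i + n) = c *: (z a : gprod Y) (i + n) + (z' a : gprod Y) (i + n).
  by rewrite !ffunE.
by lincomb R.
Qed.
Definition hfr n : {linear T -> homc P Y n} := mklin (@hfr_linear2 n).

Lemma hfrE n z i j p : j = i + n -> (hfr n z : hom_deg P Y n) i j p =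
  \sum_a (sg (i * (n + 1)) * (dxi a i p : R)) *: (z a : gprod Y) j.
Proof. by rewrite /= /hfr_fun => ->; rewrite eqxx. Qed.

Definition hto n (g : homc P Y n) : T :=
  [ffun a => (fun j => sg (ddeg a * (n + 1)) *:
     (g : hom_deg P Y n) (ddeg a) j (dx a (ddeg a))) : gprod Y].

Lemma hom_giso : giso (homc P Y) T.
Proof.
apply: (@Giso _ _ hfr _ hto).
- move=> m n z mn [hz _]; apply: hom_deg_ext => i j ej p.
  rewrite [LHS](@homdE _ _ _ n m i j (j + 1) (i - 1)) // !hfrE //; last 2 first.
  + by rewrite ej -mn; ring.
  + by rewrite ej -mn addrA.
  rewrite linear_sum scaler_sumr.
  have E a : (gd z a : gprod Y) j = sg (ddeg a) *: cd Y (j + 1) j ((z a : gprod Y) (j + 1))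
      + \sum_b (- sg (ddeg b) * db b a) *: (z b : gprod Y) j.
    by rewrite ffunE -[LHS]/(_ + _) gprod_sumE /= sgN.
  under [X in _ = X]eq_bigr do rewrite E scalerDr.
  rewrite big_split /=; congr (_ + _).
    apply: eq_bigr => a _; rewrite linearZ scalerA; congr (_ *: _).
    have [e|ne] := eqVneq i (ddeg a); last by rewrite dxi_ne // !(mulr0, mul0r).
    by rewrite -e mn mulrDr mulr1 sgD; ring.
  rewrite -sumrN; under [X in _ = X]eq_bigr do rewrite scaler_sumr.
  rewrite exchange_big /=; apply: eq_bigr => b _.
  have -> : dxi b (i - 1) (cd P i (i - 1) p) = \sum_a db b a * (dxi a i p : R).
    by rewrite dxi_cd ?subrK.
  rewrite mulr_sumr scaler_suml scaler_sumr -sumrN; apply: eq_bigr => a _.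
  rewrite !scalerA -scaleNr; congr (_ *: _).
  have [e|ne] := eqVneq i (ddeg a); last by rewrite dxi_ne // !(mulr0, mul0r) ?oppr0.
  have [e'|ne'] := eqVneq (ddeg b + 1) (ddeg a); last by rewrite db_deg // !(mulr0, mul0r) ?oppr0.
  have -> : i - 1 = ddeg b by rewrite e -e' addrK.
  have -> : sg (i * (m + 1)) = sg (ddeg b * n + n) :> R by rewrite e -e' mn mulrDl mul1r.
  by rewrite mulrDr mulr1 !sgD; ring.
- move=> n g; split.
    move=> a i ne; rewrite ffunE /= hmap_shape ?scaler0 //.
    by apply: contra ne => /eqP ->; rewrite /= opprK addrC.
  apply/ffunP => a; rewrite !ffunE; apply: gprod_ext => j; rewrite gprod_sumE.
  rewrite [in RHS](dbE B (dx a _)) linear_sum scaler_sumr; apply: eq_bigr => b _.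
  rewrite -[LHS]/(pe a b *: (hto g b : gprod Y) j) ffunE [g _ _ (_ *: _)]linearZ /= !scalerA.
  have [e|ne] := eqVneq (ddeg b) (ddeg a); first by rewrite e mulrC.
  by rewrite -[dxi _ _ _]/(de b a) de_deg // !(mulr0, mul0r) !scale0r.
- move=> n g; apply: hom_deg_ext => i j ej p; rewrite hfrE // {2}(dbE B p) linear_sum.
  apply: eq_bigr => a _; rewrite linearZ ffunE /=.
  have [e|ne] := eqVneq i (ddeg a); last by rewrite dxi_ne // !mulr0 !scale0r.
  by subst i; rewrite scalerA mulrAC sgK mul1r.
move=> n z [hz ez]; apply/ffunP => a; rewrite ffunE; apply: gprod_ext => j.
have [ej|ne] := eqVneq j (ddeg a + n); last first.
  by rewrite /= /hfr_fun (negPf ne) scaler0 hz // /= opprK addrC.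
rewrite hfrE // scaler_sumr -{2}ez ffunE gprod_sumE; apply: eq_bigr => b _.
by rewrite scalerA mulrA sgK mul1r.
Qed.
End HomIso.
End DualBasis.
End Bridge.

(** * The dual and the bidual of Hom(P, Y) *)

Section HomPerfect.
Variable R : comPzRingType.
Implicit Types (X Y I : complex R) (i j l m n q r : int).

Lemma hom_deg_sumE X Y n (T : finType) (F : T -> hom_deg X Y n) i j x :
  (\sum_t F t) i j x = \sum_t F t i j x.
Proof.
have h : linear (fun f : hom_deg X Y n => f i j x) by [].
exact: (linear_sum (mklin h)).
Qed.

Lemma hom_degD X Y n (f g : hom_deg X Y n) i j x : (f + g) i j x = f i j x + g i j x.
Proof. by []. Qed.
Lemma hom_degZ X Y n c (f : hom_deg X Y n) i j x : (c *: f) i j x = c *: f i j x.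
Proof. by []. Qed.

(* Evaluation Y -> I followed after evaluation at p: the pairing of P and
   Hom(Y, I) with values in Hom(Hom(P, Y), I). *)
Section Alpha.
Variables (P Y I : complex R).

Section Pairing.
Variables (i m q : int) (e : q = m + i).

Section Map.
Variables (p : P i) (f : hom_deg Y I m).
(** The sign moves [p], of degree [i], past [f] and [g]. *)
Definition alpha_fun k l (g : homc P Y k) : I l :=
  sg (i * (k + m)) *: f (i + k) l ((g : hom_deg P Y k) i (i + k) p).
Fact alpha_linear k l : linear (@alpha_fun k l).
Proof.
by move=> c g h; rewrite /alpha_fun (hom_degP c g h) linearP; lincomb R.
Qed.
Fact alpha_shape k l : l != k + q -> forall g, mklin (@alpha_linear k l) g = 0.
Proof.
move=> ne g; rewrite /= /alpha_fun hmap_shape ?scaler0 //.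
by apply: contra ne => /eqP ->; apply/eqP; rewrite e; ring.
Qed.
Definition alpha : hom_deg (homc P Y) I q := HomDeg alpha_shape.
Lemma alphaE k l r (g : homc P Y k) : r = i + k ->
  alpha k l g = sg (i * (k + m)) *: f r l ((g : hom_deg P Y k) i r p).
Proof. by move=> ->. Qed.
End Map.

Fact alphap_linear f : linear (fun p => alpha p f).
Proof.
move=> c p p'; apply: hom_deg_eq => k l g; rewrite hom_degP !(@alphaE _ _ k l (i + k)) // !linearP /=.
by lincomb R.
Qed.
Fact alphaf_linear p : linear (alpha p).
Proof.
move=> c f f'; apply: hom_deg_eq => k l g; rewrite hom_degP !(@alphaE _ _ k l (i + k)) //.
by rewrite hom_degP; lincomb R.
Qed.
Definition alphap f := mklin (alphap_linear f).
Definition alphaf p := mklin (alphaf_linear p).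
End Pairing.

Lemma alpha_d i i' m m' q q' (e : q = m + i) (e1 : q' = m + i') (e2 : q' = m' + i) p f :
  q' + 1 = q -> homd (homc P Y) I q q' (alpha e p f) =
    alpha e1 (cd P i i' p) f + sg i *: alpha e2 p (homd Y I m m' f).
Proof.
move=> qq; have ii : i = i' + 1 by lia.
have mm : m' + 1 = m by lia.
apply: hom_deg_ext => k l el g; rewrite (@homdE _ _ _ q q' k l (l + 1) (k - 1)) //.
rewrite hom_degD hom_degZ !(@alphaE i _ _ _ _ _ k _ (i + k)) //.
rewrite (@alphaE i' _ _ _ _ _ k _ (i' + k)) // (@alphaE _ _ _ _ _ _ (k - 1) _ (i' + k)); last by rewrite ii; ring.
rewrite (@homdE _ Y I m m' (i + k) l (l + 1) (i' + k)) //; last by rewrite ii; ring.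
have E : (cd (homc P Y) k (k - 1) g : hom_deg P Y (k - 1)) i (i' + k) p =
    cd Y (i + k) (i' + k) ((g : hom_deg P Y k) i (i + k) p) -
    sg k *: (g : hom_deg P Y k) i' (i' + k) (cd P i i' p).
  by apply: homdE; rewrite ?subrK // ii; ring.
rewrite E linearB [f _ _ (_ *: _)]linearZ /= linearZ /=.
have -> : sg q = sg m * sg i :> R by rewrite e sgD.
have -> : sg (i * (k - 1 + m)) = sg (i * (k + m)) * sg i :> R.
  by have -> : i * (k - 1 + m) = i * (k + m) - i by [ring]; rewrite sgD sgN.
have -> : sg (i * (k + m')) = sg (i * (k + m)) * sg i :> R.
  by have -> : i * (k + m') = i * (k + m) - i by [rewrite -mm; ring]; rewrite sgD sgN.
have -> : sg (i' * (k + m)) = sg (i * (k + m)) * sg k * sg m :> R.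
  have -> : i' * (k + m) = i * (k + m) - k - m by rewrite ii; ring.
  by rewrite sgD [sg (_ - k)]sgD !sgN.
rewrite !scalerBr !scalerA; have E2 := sgK R i.
set s := sg (i * _).
have -> : sg m * sg i * (s * sg i) = s * sg m by ring: E2.
have -> : sg i * (s * sg i) = s by ring: E2.
by lincomb R.
Qed.

Section Gamma.
Variable n : int.

Section GammaFun.
Variable F : hom_deg (homc (homc P Y) I) I n.

Section GammaAt.
Variables (i j : int) (p : P i).
Definition gam_fun m l (f : homc Y I m) : I l :=
  if j == i + n then F (m + i) l (alpha erefl p f) else 0.
Fact gam_fun_linear m l : linear (@gam_fun m l).
Proof.
move=> c f g; rewrite /gam_fun; case: eqP => _; last by rewrite scaler0 addr0.
by rewrite -linearP; congr (F _ _ _); exact: alphaf_linear.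
Qed.
Fact gam_fun_shape m l : l != m + j -> forall f, mklin (@gam_fun_linear m l) f = 0.
Proof.
move=> ne f; rewrite /= /gam_fun; case: eqP => // e; rewrite hmap_shape //.
by apply: contra ne => /eqP ->; apply/eqP; rewrite e; ring.
Qed.
Definition gam_at : homc (homc Y I) I j := HomDeg gam_fun_shape.
Lemma gam_atE m l q (e : q = m + i) (f : homc Y I m) : j = i + n ->
  (gam_at : hom_deg (homc Y I) I j) m l f = F q l (alpha e p f).
Proof. by move=> ej; subst q; rewrite /= /gam_fun ej eqxx. Qed.
End GammaAt.

Fact gam_at_linear i j : linear (@gam_at i j).
Proof.
move=> c p p'; apply: hom_deg_eq => m l f; rewrite hom_degP /= /gam_fun.
case: eqP => _; last by rewrite scaler0 addr0.
by rewrite -linearP; congr (F _ _ _); exact: (alphap_linear erefl f).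
Qed.
Fact gam_shape i j : j != i + n -> forall p, mklin (@gam_at_linear i j) p = 0.
Proof.
by move=> /negPf ne p; apply: hom_deg_eq => m l f; rewrite /= /gam_fun ne.
Qed.
Definition gam : hom_deg P (homc (homc Y I) I) n := HomDeg gam_shape.
End GammaFun.

Lemma gamE F i j m l q (e : q = m + i) (p : P i) (f : homc Y I m) : j = i + n ->
  (gam F i j p : hom_deg (homc Y I) I j) m l f = F q l (alpha e p f).
Proof. exact: gam_atE. Qed.

Fact gam_linear : linear gam.
Proof.
move=> c F F'; apply: hom_deg_ext => i j ej p; apply: hom_deg_eq => m l f.
by rewrite (@gamE _ i j m l (m + i)) // !hom_degP !(@gamE _ i j m l (m + i)).
Qed.
End Gamma.

Fact gamma_d n n' F : homd P (homc (homc Y I) I) n n' (mklin (@gam_linear n) F) =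
  mklin (@gam_linear n') (homd (homc (homc P Y) I) I n n' F).
Proof.
have [nn|ne] := eqVneq (n' + 1) n; last by rewrite !homd_shape0 // linear0.
apply: hom_deg_ext => i j ej p; apply: hom_deg_ext => m l el f.
rewrite (@homdE _ _ _ n n' i j (j + 1) (i - 1)) // hom_degB hom_degZ.
rewrite [X in X - _](@homdE _ (homc Y I) I (j + 1) j m l (l + 1) (m - 1)) //.
have e0 : m + i - 1 = m + (i - 1) by ring.
have e1 : m + i - 1 = m - 1 + i by ring.
rewrite !(@gamE n F i _ m _ (m + i)) //; last by rewrite ej -nn; ring.
rewrite (@gamE n F i _ (m - 1) _ (m + i - 1)) //; last by rewrite ej -nn; ring.
rewrite (@gamE n F (i - 1) _ m _ (m + i - 1)) //; last by rewrite ej -nn; ring.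
rewrite [RHS](@gamE n' _ i _ m _ (m + i)) //.
rewrite (@homdE _ _ _ n n' (m + i) l (l + 1) (m + i - 1)) //.
have -> : cd (homc (homc P Y) I) (m + i) (m + i - 1) (alpha erefl p f) =
    alpha e0 (cd P i (i - 1) p) f + sg i *: alpha e1 p (homd Y I m (m - 1) f).
  by apply: alpha_d; rewrite subrK.
rewrite [F _ _ (_ + _)]linearD [F _ _ (_ *: _)]linearZ /=.
have -> : sg (j + 1) = sg i * sg n :> R by rewrite ej -addrA nn sgD.
by lincomb R.
Qed.
Definition gamma : chain_map (homc (homc (homc P Y) I) I) (homc P (homc (homc Y I) I)) :=
  @ChainMap R (homc (homc (homc P Y) I) I) (homc P (homc (homc Y I) I))
    (fun n => mklin (@gam_linear n)) gamma_d.

(** Evaluation at [g], applied to the pairing of [p] and [f], is evaluation of [f] at g(p). The two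
    signs agree since their exponents differ by the even number 2 k i. *)
Lemma gamma_bidual k (g : homc P Y k) :
  gamma k (biduality (homc P Y) I k g) = post P (biduality Y I) k g.
Proof.
apply: hom_deg_ext => i j ej p; apply: hom_deg_ext => m l el f.
subst j; rewrite [LHS](@gamE k _ i _ m l (m + i)) // postE /= /ev_map /= /alpha_fun.
rewrite scalerA; congr (_ *: _); rewrite -!abszM -/(sg (k * (m + i))) -/(sg ((i + k) * m)) -sgD.
have -> : k * (m + i) + i * (k + m) = (i + k) * m + (k * i + k * i) by ring.
by rewrite sgD [sg (k * i + _)]sgD sgK mulr1.
Qed.
End Alpha.
End HomPerfect.

Section DualIso.
Variable R : comPzRingType.
Implicit Types (i j l m n q r : int).

Section Tens.
Variables (P Y I : complex R) (B : dbasis P).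
Implicit Types a b : B.

Section TenMap.
Variables (a : B) (j k : int) (e : j = ddeg a + k).
Definition ten_fun (y : Y j) i l (p : P i) : Y l := (dxi a i p : R) *: ccast Y j l y.
Fact ten_linear y i l : linear (@ten_fun y i l).
Proof. by move=> c p p'; rewrite /ten_fun dxiP; lincomb R. Qed.
Fact ten_shape y i l : l != i + k -> forall p, mklin (@ten_linear y i l) p = 0.
Proof.
move=> ne p; rewrite /= /ten_fun; have [ei|nei] := eqVneq i (ddeg a).
  by rewrite ccast_ne ?scaler0 // e -ei.
by rewrite dxi_ne // scale0r.
Qed.
Definition ten y : hom_deg P Y k := HomDeg (ten_shape y).
Fact ten_linear2 : linear ten.
Proof.
by move=> c y y'; apply: hom_deg_eq => i l p; rewrite hom_degP /= /ten_fun linearP; lincomb R.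
Qed.
End TenMap.

Lemma ten_sum k (g : hom_deg P Y k) :
  g = \sum_a ten (erefl : ddeg a + k = _) (g (ddeg a) (ddeg a + k) (dx a (ddeg a))).
Proof.
apply: hom_deg_ext => i l el p; rewrite hom_deg_sumE {1}(dbE B p) linear_sum.
apply: eq_bigr => a _; rewrite linearZ /= /ten_fun.
have [ei|ne] := eqVneq i (ddeg a); last by rewrite dxi_ne // !scale0r.
by subst i; subst l; rewrite ccastE.
Qed.

Section Fa.
Variables (a : B) (q m : int) (e : q = m + ddeg a).

Fact fa_ten j : j = ddeg a + (j - ddeg a). Proof. by ring. Qed.
Definition fa_fun (f : homc (homc P Y) I q) j l (y : Y j) : I l :=
  sg (ddeg a * (j + q)) *: (f : hom_deg (homc P Y) I q) (j - ddeg a) l (ten (fa_ten j) y).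
Fact fa_linear f j l : linear (@fa_fun f j l).
Proof. by move=> c y y'; rewrite /fa_fun (ten_linear2 (fa_ten j)) linearP; lincomb R. Qed.
Fact fa_shape f j l : l != j + m -> forall y, mklin (@fa_linear f j l) y = 0.
Proof.
move=> ne y; rewrite /= /fa_fun hmap_shape ?scaler0 //.
by apply: contra ne => /eqP ->; apply/eqP; rewrite e; ring.
Qed.
(** The coordinate at [a] of [f] in P (x) Hom(Y, I): composition with y |-> (p |-> xi_a(p) y), up to
    sign. *)
Definition fa f : hom_deg Y I m := HomDeg (fa_shape f).
Lemma faE f j k l (ek : j = ddeg a + k) y :
  fa f j l y = sg (ddeg a * (j + q)) *: (f : hom_deg (homc P Y) I q) k l (ten ek y).
Proof.
have ek' : k = j - ddeg a by rewrite ek; ring.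
subst k; rewrite /= /fa_fun; congr (_ *: f _ _ _).
by apply: hom_deg_eq.
Qed.
Fact fa_linear2 : linear fa.
Proof.
move=> c f f'; apply: hom_deg_eq => j l y; rewrite hom_degP /= /fa_fun hom_degP.
by lincomb R.
Qed.
Definition fal := mklin fa_linear2.
End Fa.

Lemma fa_alpha a i m m' q (e : q = m + i) (e' : q = m' + ddeg a) p (f : homc Y I m) :
  fa e' (alpha e p f) = (dxi a i p : R) *: ccast (homc Y I) m m' f.
Proof.
have [ei|ne] := eqVneq i (ddeg a); last first.
  rewrite dxi_ne // scale0r; apply: hom_deg_eq => j l y.
  rewrite /= /fa_fun /= /alpha_fun [X in f _ _ X](_ : _ = 0) ?linear0 ?scaler0 //.
  by rewrite /= /ten_fun dxi_ne // scale0r.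
subst i; have em : m' = m by apply: (addIr (ddeg a)); rewrite -e.
subst m'; rewrite ccastE; apply: hom_deg_eq => j l y; rewrite (faE _ _ _ (fa_ten a j)).
rewrite (@alphaE _ _ _ _ _ _ _ _ _ _ _ _ j); last exact: fa_ten.
rewrite /= /ten_fun ccastE [f _ _ (_ *: _)]linearZ /= !scalerA.
rewrite -sgD; have -> : ddeg a * (j + q) + ddeg a * (j - ddeg a + m) = ddeg a * (j + m) + ddeg a * (j + m).
  by rewrite e; ring.
by rewrite sgD sgK mul1r.
Qed.

Fact alpha_faK a q : q = q - ddeg a + ddeg a. Proof. by ring. Qed.

Lemma alpha_fa q (f : homc (homc P Y) I q) :
  f = \sum_a alpha (alpha_faK a q) (dx a (ddeg a)) (fa (alpha_faK a q) f).
Proof.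
apply: hom_deg_ext => k l el g; rewrite hom_deg_sumE {1}(ten_sum g) linear_sum.
apply: eq_bigr => a _; rewrite (@alphaE _ _ _ _ _ _ _ _ _ _ _ _ (ddeg a + k)) //.
rewrite (faE _ _ _ (erefl : ddeg a + k = _)) scalerA -sgD.
have -> : ddeg a * (k + (q - ddeg a)) + ddeg a * (ddeg a + k + q) =
  ddeg a * (k + q) + ddeg a * (k + q) by ring.
by rewrite sgD sgK scale1r.
Qed.

(** Bijectivity in every degree: by [alpha_fa] the pairings of the x_a with maps from Y to I span
    Hom(Hom(P, Y), I), so [F] is determined by its values on them, and the coordinates [fa] define
    an [F] with prescribed values. *)
Lemma gamma_qis : quasi_iso (gamma P Y I).
Proof.
apply: bij_qis => n.
  suff h F : gamma P Y I n F = 0 -> F = 0.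
    by move=> F F' e; apply/eqP; rewrite -subr_eq0; apply/eqP/h; rewrite linearB e subrr.
  move=> F0; apply: hom_deg_ext => q l el f; rewrite [f]alpha_fa linear_sum big1 // => a _.
  rewrite -[LHS](@gamE _ P Y I n F (ddeg a) (ddeg a + n) (q - ddeg a) l) //.
  by have := congr1 (fun w : hom_deg P (homc (homc Y I) I) n =>
    (w (ddeg a) (ddeg a + n) (dx a (ddeg a)) : hom_deg (homc Y I) I (ddeg a + n)) (q - ddeg a) l (fa (alpha_faK a q) f)) F0.
move=> H; pose Fm q l (f : homc (homc P Y) I q) : I l := \sum_a
  ((H : hom_deg P (homc (homc Y I) I) n) (ddeg a) (ddeg a + n) (dx a (ddeg a)) :
     hom_deg (homc Y I) I (ddeg a + n))
   (q - ddeg a) l (fa (alpha_faK a q) f).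
have Fl q l : linear (@Fm q l).
  move=> c f f'; rewrite /Fm scaler_sumr -big_split; apply: eq_bigr => a _ /=.
  by rewrite fa_linear2 linearP.
have Fs q l : l != q + n -> forall f, mklin (Fl q l) f = 0.
  move=> ne f; rewrite /= /Fm big1 // => a _; rewrite hmap_shape //.
  by apply: contra ne => /eqP ->; apply/eqP; ring.
exists (HomDeg Fs); apply: hom_deg_ext => i j ej p; apply: hom_deg_ext => m l el f.
rewrite [LHS](@gamE _ _ _ _ n _ i j m l (m + i)) //= /Fm.
rewrite {2}(dbE B p) linear_sum hom_deg_sumE; apply: eq_bigr => a _.
rewrite fa_alpha linearZ [in RHS]linearZ hom_degZ /=.
have [ei|ne] := eqVneq i (ddeg a); last by rewrite dxi_ne // !scale0r.
subst i; subst j; congr (_ *: _).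
have em : m + ddeg a - ddeg a = m by ring.
by move: (m + ddeg a - ddeg a) em => m' em; subst m'; rewrite ccastE.
Qed.

Lemma bidual_hom : quasi_iso (biduality (homc P Y) I) <-> quasi_iso (post P (biduality Y I)).
Proof.
apply: (qis_square (a := idc _) (b := gamma P Y I)); last exact: gamma_qis.
  by move=> k g; exact: gamma_bidual.
exact: qis_id.
Qed.

Lemma ccast_trans (X : complex R) t t' j (x : X t) : t = t' -> ccast X t' j (ccast X t t' x) = ccast X t j x.
Proof. by move=> e; subst t'; rewrite ccastE. Qed.
Lemma ccast_at (X : complex R) t t' (u : gprod X) : t = t' -> ccast X t t' (u t) = u t'.
Proof. by move=> e; subst t'; rewrite ccastE. Qed.

Local Notation D := (homc Y I).
Local Notation T := (tcx (bpdat B) (G D)).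

Definition Dfr_fun n (z : T) : homc (homc P Y) I n :=
  \sum_a alpha (alpha_faK a n) (dx a (ddeg a)) ((z a : gprod D) (n - ddeg a)).
Fact Dfr_linear n : linear (@Dfr_fun n).
Proof.
move=> c z z'; rewrite /Dfr_fun scaler_sumr -big_split; apply: eq_bigr => a _.
rewrite -[RHS](alphaf_linear (alpha_faK a n)); congr (alpha _ _ _).
by rewrite !ffunE.
Qed.
Definition Dfr n : {linear T -> homc (homc P Y) I n} := mklin (@Dfr_linear n).

Lemma alpha_eq i i' m m' q (e : q = m + i) (e' : q = m' + i') a (u : gprod D) : m = m' ->
  alpha e (dx a i) (u m) = alpha e' (dx a i') (u m').
Proof.
move=> em; have ei : i = i' by apply: (addrI m); rewrite -e em.
by subst m' i'; apply: hom_deg_eq.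
Qed.

Lemma D_giso : giso (homc (homc P Y) I) T.
Proof.
apply: (@Giso _ _ _ Dfr _ (fun n f => [ffun a =>
   (fun j => ccast D (n - ddeg a) j (fa (alpha_faK a n) f)) : gprod D])).
- move=> m n z mn hz.
  have E a (e1 : m = n - ddeg a + (ddeg a - 1)) (e2 : m = n - ddeg a - 1 + ddeg a) :
     homd (homc P Y) I n m (alpha (alpha_faK a n) (dx a (ddeg a)) ((z a : gprod D) (n - ddeg a)))
    = \sum_b db b a *: alpha e1 (dx b (ddeg a - 1)) ((z a : gprod D) (n - ddeg a)) +
      sg (ddeg a) *: alpha e2 (dx a (ddeg a)) (cd D (n - ddeg a) (n - ddeg a - 1) ((z a : gprod D) (n - ddeg a))).
    rewrite (alpha_d _ e1 e2) // (@cd_dx _ _ B) ?subrK //; congr (_ + _).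
    rewrite -[LHS]/(@alphap _ _ _ _ _ _ _ e1 _ _) linear_sum; apply: eq_bigr => b _.
    by rewrite linearZ.
  have e1 a : m = n - ddeg a + (ddeg a - 1) by rewrite -mn; ring.
  have e2 a : m = n - ddeg a - 1 + ddeg a by rewrite -mn; ring.
  rewrite /= {1}/Dfr_fun -[LHS]/(homd (homc P Y) I n m _) linear_sum.
  under eq_bigr do rewrite (E _ (e1 _) (e2 _)).
  rewrite big_split /= exchange_big [LHS]addrC -big_split; apply: eq_bigr => b _ /=.
  have -> : (gd z b : gprod D) (m - ddeg b) = sg (ddeg b) *: (gd (z b) : gprod D) (m - ddeg b) +
      \sum_a db b a *: (z a : gprod D) (m - ddeg b).
    by rewrite ffunE -[LHS]/(_ + _) gprod_sumE.
  rewrite alphaf_linear; congr (_ *: _ + _).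
    rewrite -[homd_fun _ _]/(cd D (n - ddeg b) (n - ddeg b - 1) _).
    rewrite -(@gdE _ D (z b) (n - ddeg b - 1) (n - ddeg b)) ?subrK //.
    by apply: alpha_eq; rewrite -mn; ring.
  rewrite -[RHS]/(@alphaf _ _ _ _ _ _ _ (alpha_faK b m) _ _) linear_sum; apply: eq_bigr => a _; rewrite linearZ /=.
  have [e|ne] := eqVneq (ddeg b + 1) (ddeg a); last by rewrite db_deg // !scale0r.
  by congr (_ *: _); apply: alpha_eq; rewrite -e -mn; ring.
- move=> n f; split.
    move=> a j ne; rewrite ffunE ccast_ne //.
  apply/ffunP => a; rewrite !ffunE; apply: gprod_ext => j; rewrite gprod_sumE.
  rewrite [in RHS](alpha_fa f) -[fa _ _]/(fal _ _) !linear_sum; apply: eq_bigr => b _.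
  rewrite -[fal _ _]/(fa _ _) fa_alpha linearZ /= ffunE -[LHS]/(de a b *: ccast D (n - ddeg b) j (fa (alpha_faK b n) f)).
  have [e|ne] := eqVneq (ddeg a) (ddeg b); last by rewrite dxi_ne 1?eq_sym // de_deg // !scale0r.
  by congr (_ *: _); rewrite ccast_trans // e.
- move=> n f; rewrite [RHS]alpha_fa; apply: eq_bigr => a _; congr (alpha _ _ _).
  by rewrite ffunE ccastE.
move=> n z [hz ez]; apply/ffunP => a; rewrite ffunE; apply: gprod_ext => j.
have [->|ne] := eqVneq j (n - ddeg a); last by rewrite ccast_ne // hz.
rewrite ccastE /= /Dfr_fun -[LHS]/(fal _ _) linear_sum -ez ffunE gprod_sumE.
apply: eq_bigr => b _; rewrite -[fal _ _]/(fa _ _) fa_alpha ez.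
rewrite -[dxi _ _ _]/(de a b) -[RHS]/(de a b *: (z b : gprod D) (n - ddeg a)).
have [e|ne] := eqVneq (ddeg a) (ddeg b); last by rewrite de_deg // !scale0r.
by rewrite ccast_at // e.
Qed.
End Tens.

(* Hom(P, fib f) is the fiber of Hom(P, f) *)
Section FibPost.
Variables (P A C : complex R) (f : chain_map A C).

Section FibPostMap.
Variables (n : int) (z : fib (post P f) n).
Definition fpost_fun i j (p : P i) : fib f j :=
  ((z.1 : hom_deg P A n) i j p, (z.2 : hom_deg P C (n + 1)) i (j + 1) p).
Fact fpost_linear i j : linear (@fpost_fun i j).
Proof. by move=> c p p'; rewrite /fpost_fun !linearP. Qed.
Fact fpost_shape i j : j != i + n -> forall p, mklin (@fpost_linear i j) p = 0.
Proof.
by move=> ne p; rewrite /= /fpost_fun !hmap_shape // addrA (inj_eq (addIr 1)).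
Qed.
Definition fpost_map : homc P (fib f) n := HomDeg fpost_shape.
End FibPostMap.

Fact fpost_linear2 n : linear (@fpost_map n).
Proof. by move=> c z z'; apply: hom_deg_eq. Qed.
Fact fpost_d n m z : homd P (fib f) n m (mklin (@fpost_linear2 n) z) =
  mklin (@fpost_linear2 m) (cd (fib (post P f)) n m z).
Proof.
have [nn|ne] := eqVneq (m + 1) n; last by rewrite homd_shape0 // cd_shape // linear0.
apply: hom_deg_ext => i j ej p.
rewrite (@homdE _ P (fib f) n m i j (j + 1) (i - 1)) //; case: z => g g'.
subst n; rewrite /= /fib_fun /= /fpost_fun /= !diag_mapE; congr pair.
  by rewrite [RHS](@homdE _ P A (m + 1) m i j (j + 1) (i - 1)).
rewrite scaleN1r -[homd_map _ _ _ _]/(homd P C (m + 1 + 1) (m + 1) g' i (j + 1) p).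
rewrite (@homdE _ P C (m + 1 + 1) (m + 1) i (j + 1) (j + 1 + 1) (i - 1)) //.
by rewrite !sgSr postE /=; lincomb R.
Qed.
Definition fpost : chain_map (fib (post P f)) (homc P (fib f)) :=
  @ChainMap R (fib (post P f)) (homc P (fib f)) (fun n => mklin (@fpost_linear2 n)) fpost_d.

Lemma fpost_qis : quasi_iso fpost.
Proof.
apply: bij_qis => n.
  move=> [g1 g2] [h1 h2] e.
  have E i j p : ((g1 : hom_deg P A n) i j p, (g2 : hom_deg P C (n + 1)) i (j + 1) p) =
     ((h1 : hom_deg P A n) i j p, (h2 : hom_deg P C (n + 1)) i (j + 1) p).
    exact: (congr1 (fun w : hom_deg P (fib f) n => w i j p) e).
  congr pair; apply: hom_deg_ext => i j ej p; first by case: (E i j p).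
  have {}ej : j = i + n + 1 by rewrite ej addrA.
  by subst j; case: (E i (i + n) p).
move=> g.
have l1 i j : linear (fun p : P i => ((g : hom_deg P (fib f) n) i j p).1).
  by move=> c p p'; rewrite linearP.
have l2 i j : linear (fun p : P i => ccast C (j - 1 + 1) j ((g : hom_deg P (fib f) n) i (j - 1) p).2).
  by move=> c p p'; rewrite linearP -[in RHS]linearP.
have s1 i j : j != i + n -> forall p, mklin (l1 i j) p = 0.
  by move=> ne p; rewrite /= hmap_shape.
have s2 i j : j != i + (n + 1) -> forall p, mklin (l2 i j) p = 0.
  move=> ne p; rewrite /= hmap_shape ?linear0 //.
  by apply: contra ne => /eqP e; rewrite addrA -e subrK.
exists (HomDeg s1, HomDeg s2); apply: hom_deg_ext => i j ej p; rewrite /= /fpost_fun /=.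
rewrite [RHS]surjective_pairing; congr pair.
have e : j + 1 - 1 = j by rewrite addrK.
by move: (j + 1 - 1) e => k ek; subst k; rewrite ccastE.
Qed.
End FibPost.

Section HomAcyclic.
Variables (P : complex R) (B : dbasis P).

Lemma hom_dbasis_acyclic Y : acyclic Y -> acyclic (homc P Y).
Proof.
move=> aY n; apply/hvanP/(giso_van (hom_giso B Y)); apply: tvan => a.
by apply/G_van/hvanP; exact: aY.
Qed.

(** Turns the descent of quasi-isomorphisms along Hom(P, -) into that of acyclicity, to which
    conservativity applies. *)
Lemma post_qisE A C (f : chain_map A C) :
  quasi_iso (post P f) <-> acyclic (homc P (fib f)).
Proof.
have E n : hvan (fib (post P f)) n <-> hvan (homc P (fib f)) n := qis_hvan (@fpost_qis P A C f) n.
split=> [/qis_fib h n|h]; first by apply/hvanP/E/hvanP; exact: h.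
by apply: fib_qis => n; apply/hvanP/E/hvanP; exact: h.
Qed.

Lemma post_dbasis_qis A C (f : chain_map A C) : quasi_iso f -> quasi_iso (post P f).
Proof. by move=> /qis_fib h; apply/post_qisE/hom_dbasis_acyclic. Qed.
End HomAcyclic.
End DualIso.

(** * Restriction of scalars and coinduction *)

Section Restriction.
Variables (R S : comPzRingType) (phi : {rmorphism R -> S}).
Implicit Types (i j l m n : int).

Definition rst (V : lmodType S) : Type := let _ := phi in V.
Section RstModule.
Variable V : lmodType S.
HB.instance Definition _ := GRing.Zmodule.on (rst V).
Definition rst_scale (a : R) (v : rst V) : rst V := phi a *: (v : V).
Fact rst_scaleA a b v : rst_scale a (rst_scale b v) = rst_scale (a * b) v.
Proof. by rewrite /rst_scale rmorphM scalerA. Qed.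
Fact rst_scale1 : left_id 1 rst_scale.
Proof. by move=> v; rewrite /rst_scale rmorph1 scale1r. Qed.
Fact rst_scaleDr : right_distributive rst_scale +%R.
Proof. by move=> a v w; rewrite /rst_scale scalerDr. Qed.
Fact rst_scaleDl v : {morph rst_scale^~ v : a b / a + b}.
Proof. by move=> a b; rewrite /rst_scale rmorphD scalerDl. Qed.
HB.instance Definition _ := GRing.Zmodule_isLmodule.Build R (rst V)
  rst_scaleA rst_scale1 rst_scaleDr rst_scaleDl.
End RstModule.

Fact rst_linear (V W : lmodType S) (f : {linear V -> W}) : linear (f : rst V -> rst W).
Proof. by move=> a x y; rewrite [LHS](linearP f). Qed.
Definition rstl (V W : lmodType S) (f : {linear V -> W}) : {linear rst V -> rst W} :=
  mklin (rst_linear f).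

Section RstComplex.
Variable A : complex S.
Fact rstc_shape i j : j + 1 != i -> forall x, rstl (cd A i j) x = 0.
Proof. by move=> ne x; exact: cd_shape. Qed.
Fact rstc_dd i j k x : rstl (cd A j k) (rstl (cd A i j) x) = 0.
Proof. exact: cdd. Qed.
Definition rstc : complex R := Complex rstc_shape rstc_dd.

Lemma rstc_fg i : H_fg rstc i -> H_fg A i.
Proof.
move=> [n [g [cg hg]]]; exists n, g; split=> [k|z cz]; first exact: cg.
by have [a ha] := hg z cz; exists (fun k => phi (a k)).
Qed.
End RstComplex.

Fact rstm_subproof (A B : complex S) (f : chain_map A B) i j x :
  cd (rstc B) i j (rstl (f i) x) = rstl (f j) (cd (rstc A) i j x).
Proof. exact: (cmapd f). Qed.
Definition rstm A B (f : chain_map A B) : chain_map (rstc A) (rstc B) :=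
  @ChainMap R (rstc A) (rstc B) (fun i => rstl (f i)) (rstm_subproof f).

(** Cycles and boundaries do not involve scalars, so both sides are convertible. *)
Lemma rstm_qis A B (f : chain_map A B) : quasi_iso (rstm f) <-> quasi_iso f.
Proof. by []. Qed.
Lemma rstc_van A i : hvan (rstc A) i <-> hvan A i.
Proof. by []. Qed.

Section Coinduced.
Variable I : complex R.
Local Notation I' := (coindc phi I).

Lemma coind_sg n (V : lmodType R) (f : coind phi V) (t : restr phi) :
  coind_fun (sg n *: f) t = sg n *: coind_fun f t.
Proof.
rewrite /sg -!(signr_odd _ `|n|); case: odd; rewrite ?expr0 ?expr1 ?scale1r //.
by rewrite !scaleN1r -[LHS]/(-1 *: coind_fun f t) scaleN1r.
Qed.

Lemma coindE (V : lmodType R) (s : S) (f : coind phi V) (t : S) :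
  coind_fun (s *: f) t = coind_fun f (t * s).
Proof. by []. Qed.
Lemma coindBE (V : lmodType R) (f g : coind phi V) t :
  coind_fun (f - g) t = coind_fun f t - coind_fun g t.
Proof. by rewrite -[LHS]/(coind_fun f t + -1 *: coind_fun g t) scaleN1r. Qed.
Lemma coind_at1 (V : lmodType R) (a : R) (f : coind phi V) :
  coind_fun (phi a *: f) (1 : S) = a *: coind_fun f (1 : S).
Proof.
rewrite -linearZ coindE; congr (coind_fun _ _).
by rewrite mul1r -[RHS]/(phi a * 1) mulr1.
Qed.

Section Adjunction.
Variable A : complex S.

Section Kap.
Variables (n : int) (f : hom_deg A I' n).
(** The adjunction between restriction and coinduction: an S-linear map into Hom_R(S, I) is
    determined by its values evaluated at 1. *)
Definition kap_fun i j (x : rstc A i) : I j := coind_fun (f i j (x : A i) : coind phi (I j)) (1 : S).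
Fact kap_linear i j : linear (@kap_fun i j).
Proof.
move=> a x y; rewrite /kap_fun [f i j _]linearP -[LHS]/(_ + _); congr (_ + _).
exact: coind_at1.
Qed.
Fact kap_shape i j : j != i + n -> forall x, mklin (@kap_linear i j) x = 0.
Proof. by move=> ne x; rewrite /= /kap_fun hmap_shape. Qed.
Definition kap : hom_deg (rstc A) I n := HomDeg kap_shape.
End Kap.

Fact kap_linear2 n : linear (fun f : rstc (homc A I') n => kap f).
Proof.
move=> a f g; apply: hom_deg_eq => i j x; rewrite hom_degP /= /kap_fun.
rewrite -[LHS]/(coind_fun (phi a *: (f i j x : coind phi (I j))) (1 : S) + _).
by rewrite coind_at1.
Qed.
Fact kap_d n m f : homd (rstc A) I n m (mklin (@kap_linear2 n) f) =
  mklin (@kap_linear2 m) (cd (rstc (homc A I')) n m f).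
Proof.
have [nn|ne] := eqVneq (m + 1) n; last by rewrite homd_shape0 // cd_shape // linear0.
apply: hom_deg_ext => i j ej x.
rewrite (@homdE _ _ I n m i j (j + 1) (i - 1)) //.
rewrite [RHS]/= /kap_fun (@homdE _ A I' n m i j (j + 1) (i - 1)) //.
by rewrite coindBE coind_sg.
Qed.
Definition kappa : chain_map (rstc (homc A I')) (homc (rstc A) I) :=
  @ChainMap R (rstc (homc A I')) (homc (rstc A) I) (fun n => mklin (@kap_linear2 n)) kap_d.

Lemma kappa_qis : quasi_iso kappa.
Proof.
apply: bij_qis => n.
  suff h (f : rstc (homc A I') n) : kappa n f = 0 -> f = 0.
    by move=> f g e; apply/eqP; rewrite -subr_eq0; apply/eqP/h; rewrite linearB e subrr.
  move=> f0; apply: (@hom_deg_ext _ A I' n) => i j ej x; apply: linear_eq => t.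
  have := congr1 (fun w : hom_deg (rstc A) I n => w i j ((t : S) *: (x : A i))) f0.
  rewrite /= /kap_fun linearZ => e; rewrite -[RHS]e.
  by rewrite -[RHS]/(coind_fun _ ((1 : S) * t)) mul1r.
move=> g.
have l1 i j (x : A i) : linear (fun t : restr phi => (g : hom_deg (rstc A) I n) i j ((t : S) *: x)).
  by move=> a t u; rewrite -linearP; congr (hmap _ _ _ _); rewrite [LHS]scalerDl -scalerA.
have l2 i j : linear (fun x : A i => (mklin (l1 i j x) : coind phi (I j))).
  move=> s x y; apply: linear_eq => t.
  by rewrite [LHS]/= scalerDr scalerA [LHS]linearD.
have s1 i j : j != i + n -> forall x, mklin (l2 i j) x = 0.
  by move=> ne x; apply: linear_eq => t; rewrite /= hmap_shape.
exists (@HomDeg S A I' n (fun i j => mklin (l2 i j)) s1); apply: hom_deg_eq => i j x.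
by rewrite /= /kap_fun /= scale1r.
Qed.
End Adjunction.

Lemma coind_K_injective : K_injective I -> K_injective I'.
Proof.
move=> KI A aA n; apply/hvanP/rstc_van/(qis_hvan (kappa_qis A))/hvanP; apply: KI => m.
by apply/hvanP/rstc_van/hvanP; exact: aA.
Qed.

(** Both biduality maps are compared with A -> Hom_R(Hom_S(A, I'), I), which [kappa] relates to
    either bidual. *)
Lemma coind_bidual A : K_injective I ->
  quasi_iso (biduality A I') <-> quasi_iso (biduality (rstc A) I).
Proof.
move=> KI; pose f := ccomp (pre I (kappa A)) (biduality (rstc A) I).
transitivity (quasi_iso f).
  apply: (iff_trans (iff_sym (rstm_qis (biduality A I')))).
  apply: (qis_square (a := idc _) (b := kappa (homc A I'))); last exact: kappa_qis.
    move=> p x; apply: hom_deg_eq => n j g.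
    by rewrite /= /kap_fun /= /ev_map /= -abszM -coindE; exact: coind_sg.
  exact: qis_id.
symmetry; apply: (qis_square (a := idc _) (b := pre I (kappa A))) => //; first exact: qis_id.
by apply: pre_qis => //; exact: kappa_qis.
Qed.

Section ConcHom.
Variables (M : lmodType R).

Definition cfun (V : lmodType R) (g : {linear M -> V}) i : {linear conc M i -> V} :=
  match i with Posz 0 => g | i => \0 : {linear conc M i -> V} end.

Lemma cfun0 (V : lmodType R) (g : {linear M -> V}) i : i != 0 -> forall x, cfun g i x = 0.
Proof. by case: i => [[|k]|k]. Qed.

Lemma conc_eq0 i (x : conc M i) : i != 0 -> x = 0.
Proof. by case: i x => [[|k]|k] x // _; exact: thinmx0. Qed.
End ConcHom.

Section Theta.
Local Notation M := (restr phi).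

Fact th_shape n (f : coind phi (I n)) i j : j != i + n -> forall x : conc M i,
  cfun (ccast I n j \o coind_fun f : {linear M -> I j}) i x = 0.
Proof.
move=> ne x; have [i0|i0] := eqVneq i 0; last exact: cfun0.
by subst i; rewrite /= ccast_ne // -[n]add0r.
Qed.
Fact th_linear n : linear (fun f : rstc I' n => HomDeg (th_shape (f : coind phi (I n)))).
Proof.
move=> a f g; apply: hom_deg_eq => i j x; rewrite hom_degP /=.
have [i0|i0] := eqVneq i 0; last by rewrite !cfun0 // scaler0 addr0.
subst i; rewrite /= -linearP; congr (ccast _ _ _ _).
rewrite -[LHS]/(coind_fun (f : coind phi (I n)) ((x : S) * phi a) + _); congr (_ + _).
by rewrite -linearZ mulrC.
Qed.
Fact th_d n m f : homd (conc M) I n m (mklin (@th_linear n) f) =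
  mklin (@th_linear m) (cd (rstc I') n m f).
Proof.
have [nn|ne] := eqVneq (m + 1) n; last by rewrite homd_shape0 // cd_shape // linear0.
apply: hom_deg_ext => i j ej x.
rewrite (@homdE _ _ I n m i j (j + 1) (i - 1)) //= linear0 scaler0 subr0.
have [i0|i0] := eqVneq i 0; last by rewrite !cfun0 // linear0.
subst i; rewrite add0r in ej; subst j; subst n.
by rewrite /= !ccastE.
Qed.
Definition theta0 : chain_map (rstc I') (homc (conc M) I) :=
  @ChainMap R (rstc I') (homc (conc M) I) (fun n => mklin (@th_linear n)) th_d.

Lemma theta0_qis : quasi_iso theta0.
Proof.
apply: bij_qis => n.
  move=> f g e; apply: linear_eq => t.
  have := congr1 (fun w : hom_deg (conc M) I n => w 0 n (t : conc M 0)) e.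
  by rewrite /= !ccastE.
move=> g; exists (hmap (g : hom_deg (conc M) I n) 0 n).
apply: hom_deg_ext => i j ej x; have [i0|i0] := eqVneq i 0; last first.
  by rewrite (conc_eq0 x i0) !linear0.
by subst i; rewrite add0r in ej; subst j; rewrite /= ccastE.
Qed.

Variables (P : complex R) (e : chain_map P (conc M)).
(** The comparison Hom_R(S, I) -> Hom_R(P, I) induced by a resolution P -> S. *)
Definition theta : chain_map (rstc I') (homc P I) := ccomp (pre I e) theta0.
Lemma theta_qis : K_injective I -> quasi_iso e -> quasi_iso theta.
Proof.
move=> KI qe; apply/(qis_square (a := idc _) (b := pre I e) (f := theta0)) => //.
- exact: qis_id.
- exact: pre_qis.
- exact: theta0_qis.
Qed.
End Theta.
End Coinduced.
End Restriction.

(** * Resolutions by syzygies and Schanuel's lemma *)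

Section ShortExact.
Variable R : comPzRingType.
Implicit Types (U V K F M N L : lmodType R).

Definition ses K F M (i : {linear K -> F}) (p : {linear F -> M}) : Prop :=
  [/\ injective i, forall y, exists x, p x = y & forall x, p x = 0 <-> exists k, i k = x].

Lemma lin_inj U V (f : {linear U -> V}) : (forall x, f x = 0 -> x = 0) -> injective f.
Proof. by move=> h x y e; apply/eqP; rewrite -subr_eq0; apply/eqP/h; rewrite linearB e subrr. Qed.

Lemma lift_inj U K F (i : {linear K -> F}) (f : {linear U -> F}) : injective i ->
  (forall x, exists k, i k = f x) -> exists g : {linear U -> K}, forall x, i (g x) = f x.
Proof.
move=> inj /choice[g hg].
have gl : linear g by move=> a x y; apply: inj; rewrite linearP !hg linearP.
by exists (mklin gl) => x; exact: hg.
Qed.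

Lemma ses_ker F M (p : {linear F -> M}) : (forall y, exists x, p x = y) ->
  exists K (i : {linear K -> F}), ses i p.
Proof.
move=> surj; have hN : submod (fun x => p x = 0).
  by split=> [|a x y hx hy]; rewrite ?linear0 // linearP hx hy scaler0 addr0.
exists (smod hN), (smod_val hN); split=> //; first by move=> x y; exact: smod_eq.
by move=> x; split=> [e|[k <-]]; [exists (SMod (N := fun x => p x = 0) e)|exact: (smodP k)].
Qed.

Definition fmod r : lmodType R := {ffun 'I_r -> R^o}.

Lemma fmod_lin r M (g : 'I_r -> M) : linear (fun v : fmod r => \sum_k (v k : R) *: g k).
Proof.
move=> c v w; rewrite scaler_sumr -big_split; apply: eq_bigr => k _ /=.
by rewrite !ffunE -[(c *: v k + w k : R^o)]/(c * v k + w k) scalerDl scalerA.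
Qed.
Definition fmap r M (g : 'I_r -> M) : {linear fmod r -> M} := mklin (fmod_lin g).

Lemma fmap_basis r M (h : {linear fmod r -> M}) : exists g : 'I_r -> M, forall v, h v = fmap g v.
Proof.
pose b k : fmod r := [ffun l => (k == l)%:R]; exists (h \o b) => v.
rewrite {1}(_ : v = \sum_k (v k : R) *: b k) ?linear_sum.
  by apply: eq_bigr => k _; rewrite linearZ.
apply/ffunP => l; rewrite sum_ffunE (bigD1 l) //= big1 ?addr0 => [|k /negPf ne].
  by rewrite !ffunE eqxx -[RHS]/((v l : R) * 1) mulr1.
by rewrite !ffunE ne -[LHS]/((v k : R) * 0) mulr0.
Qed.

Section Class.
Variable Q : lmodType R -> Prop.
Hypothesis Qker : forall K F M (i : {linear K -> F}) (p : {linear F -> M}),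
  ses i p -> Q F -> Q M -> Q K.
Hypothesis Qfree : forall r, Q (fmod r).
Hypothesis Qsum : forall r F, Q F -> Q (F * fmod r)%type.

(** Existence of a resolution of length [n], syzygy by syzygy. [Q] stays abstract because the
    argument is run twice, for projective modules and for modules satisfying the equational
    criterion of flatness. *)
Fixpoint qdim n M : Prop := if n is n'.+1 then exists K F (i : {linear K -> F}) (p : {linear F -> M}),
  [/\ ses i p, Q F & qdim n' K] else Q M.

(** A module isomorphic to [F] is the kernel of F -> 0, so invariance under isomorphism follows from
    [Qker]. *)
Lemma Qbij F M (p : {linear F -> M}) : injective p -> (forall y, exists x, p x = y) -> Q F -> Q M.
Proof.
move=> inj surj QF; have [g hg] : exists g : {linear M -> F}, forall x, p (g x) = x.
  exact: (lift_inj (f := idfun)).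
apply: (Qker (i := g) (p := \0 : {linear F -> fmod 0})) => //; split.
- by move=> x y e; rewrite -[x]hg e hg.
- by move=> y; exists 0; apply/ffunP => -[].
- by move=> x; split=> // _; exists (p x); apply: inj; rewrite hg.
Qed.

Lemma qdim_sum n r K : qdim n K -> qdim n (K * fmod r)%type.
Proof.
case: n => [|n] /=; first exact: Qsum.
move=> [K' [F [i [p [[inj surj ex] QF hK']]]]].
have l1 : linear (fun k : K' => (i k, 0) : (F * fmod r)%type).
  by move=> a x y; congr pair; rewrite /= ?linearP // scaler0 addr0.
have l2 : linear (fun z : (F * fmod r)%type => (p z.1, z.2) : (K * fmod r)%type).
  by move=> a x y; congr pair; rewrite /= linearP.
exists K', (F * fmod r)%type, (mklin l1), (mklin l2); split=> //; last exact: Qsum.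
split.
- by move=> x y [/inj].
- by move=> [k v]; have [x <-] := surj k; exists (x, v).
- move=> [x v] /=; split=> [[/ex[k <-] ->]|[k [<- <-]]]; first by exists k.
  by congr pair; apply/ex; exists k.
Qed.

(** If [F1] covers [L], the kernel of F1 -> F is in [Q] and covers [N], with the same kernel as F1
    -> L. *)
Lemma qdim_ker n N L F (i : {linear N -> L}) (p : {linear L -> F}) :
  ses i p -> Q F -> qdim n L -> qdim n N.
Proof.
case: n => [|n] /=; first by move=> h QF QL; exact: (Qker h).
move=> [inj surj ex] QF [K [F1 [i1 [p1 [[inj1 surj1 ex1] QF1 hK]]]]].
have [|K' [i' hs]] := @ses_ker _ _ (p \o p1 : {linear F1 -> F}).
  by move=> y; have [x <-] := surj y; have [z <-] := surj1 x; exists z.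
have [inj' _ ex'] := hs.
have [|h hh] := lift_inj inj' (f := i1).
  move=> k; apply/ex'; rewrite /= (_ : p1 _ = 0) ?linear0 //; by apply/ex1; exists k.
have [|g hg] := lift_inj inj (f := p1 \o i' : {linear K' -> L}).
  by move=> x; apply/ex/ex'; exists x.
exists K, K', h, g; split=> //; last exact: (Qker hs).
split.
- by move=> x y e; apply: inj1; rewrite -!hh e.
- move=> y; have [x hx] := surj1 (i y).
  have [k hk] : exists k, i' k = x by apply/ex'; rewrite /= hx; apply/ex; exists y.
  by exists k; apply: inj; rewrite hg /= hk.
- move=> x; split=> [e|[k <-]].
    have /ex1[k hk] : p1 (i' x) = 0 by rewrite -[LHS]hg e linear0.
    by exists k; apply: inj'; rewrite hh.
  by apply: inj; rewrite hg /= hh linear0; apply/ex1; exists k.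
Qed.

(** [N] is the kernel of K (+) R^r -> F. Only the free module is lifted along the other cover, so
    [F] may be merely flat. *)
Lemma schanuel n r N M (j : {linear N -> fmod r}) (q : {linear fmod r -> M}) :
  ses j q -> qdim n.+1 M -> qdim n N.
Proof.
move=> [injj surjq exq] [K [F [i [p [[inj surj ex] QF hK]]]]].
have [g hg] := fmap_basis q; have /choice[t ht] : forall k, exists x, p x = g k by [].
pose s := fmap t.
have ps v : p (s v) = q v.
  by rewrite hg linear_sum; apply: eq_bigr => k _; rewrite linearZ /= ht.
have l : linear (fun z : (K * fmod r)%type => i z.1 + s z.2).
  by move=> a x y; rewrite !linearP scalerDr addrACA.
have [|u hu] := lift_inj inj (f := s \o j : {linear N -> F}).
  by move=> x; apply/ex; rewrite /= ps; apply/exq; exists x.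
have l' : linear (fun x : N => (- u x, j x) : (K * fmod r)%type).
  by move=> a x y; congr pair; rewrite /= linearP // opprD scalerN.
apply: (qdim_ker (i := mklin l') (p := mklin l)) QF (qdim_sum r hK); split.
- by move=> x y [_ /injj].
- move=> y; have [v hv] := surjq (p y).
  have /ex[k hk] : p (y - s v) = 0 by rewrite linearB ps hv subrr.
  by exists (k, v); rewrite /= hk subrK.
- move=> [k v]; split=> [/= e|[x [<- <-]]]; last by rewrite /= linearN hu /= addNr.
  have /exq[x hx] : q v = 0.
    by rewrite -ps -[LHS]add0r -{1}(ex (i k)).2 -?linearD ?e ?linear0 //; exists k.
  exists x; congr pair => //=; apply: inj; rewrite linearN hu /= hx.
  by apply/eqP; rewrite eq_sym -addr_eq0 e.
Qed.

Section Resolution.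
Variables (M : lmodType R) (F : complex R) (e : chain_map F (conc M)) (n : int).
Hypotheses (QF : forall i, Q (F i)) (F0 : forall i, (i < 0) || (n < i) -> forall x : F i, x = 0).
Hypothesis qe : quasi_iso e.

Lemma res_van (i : int) : 0 < i -> hvan F i.
Proof.
move=> i0; apply/(qis_hvan qe) => z _; exists 0; rewrite linear0.
by rewrite (conc_eq0 z) // gt_eqF.
Qed.

Lemma res_qdim_step (k : nat) : forall (i : int) N (p : {linear F i -> N}), 0 <= i -> i + k%:Z = n ->
  (forall y, exists x, p x = y) -> (forall x, p x = 0 <-> boundary x) -> qdim k N.
Proof.
elim: k => [|k IHk] i N p i0 ik surj ker.
  apply: (Qbij (p := p)) => //; apply: lin_inj => x /ker[y <-].
  by rewrite (F0 _ y) ?linear0 //; apply/orP; right; lia.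
have [K [j hs]] := ses_ker surj; have [injj _ exj] := hs.
exists K, (F i), j, p; split=> //.
have [|d hd] := lift_inj injj (f := cd F (i + 1) i).
  by move=> y; apply/exj/ker; exists y.
apply: (IHk (i + 1) K d); try lia.
  by move=> y; have /ker[x hx] : p (j y) = 0 by [apply/exj; exists y]; exists x; apply: injj; rewrite hd.
move=> x; split=> [e0|/boundary_cycle/(cycleE (k := i))].
  apply: res_van; first by lia.
  by apply/(cycleE (k := i)); rewrite ?addrK // -hd e0 linear0.
by rewrite addrK => /(_ erefl) h; apply: injj; rewrite hd h linear0.
Qed.

Lemma res_qdim : 0 <= n -> qdim (absz n) M.
Proof.
move=> n0; apply: (@res_qdim_step _ 0 M (e 0)) => //; first by lia.
  move=> y; have [_ /(_ y)] := qe 0.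
  move=> /(_ erefl) [x _ [z]] /=; rewrite /conc_d /= => h.
  by exists x; apply/eqP; rewrite eq_sym -subr_eq0 -h.
move=> x; split=> [e0|[y <-]]; last by rewrite -cmapd.
have [inj _] := qe 0; apply: inj; first by rewrite /cycle (F0 _ (cd _ _ _ _)).
by exists 0; rewrite linear0 e0.
Qed.
End Resolution.
End Class.

(** * Projective modules *)

Lemma projective_ker K F M (i : {linear K -> F}) (p : {linear F -> M}) :
  ses i p -> projective F -> projective M -> projective K.
Proof.
move=> [inj surj ex] PF PM.
have [s hs] := PM _ _ p (idfun : {linear M -> M}) surj.
have [|r hr] := lift_inj inj (f := idfun \- (s \o p) : {linear F -> F}).
  by move=> x; apply/ex; rewrite /= linearB hs subrr.
have ri k : r (i k) = k.
  have pk : p (i k) = 0 by apply/ex; exists k.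
  by apply: inj; rewrite hr /= pk linear0 subr0.
move=> A B q f sq; have [g hg] := PF A B q (f \o r : {linear F -> B}) sq.
by exists (g \o i : {linear K -> A}) => x; rewrite /= hg /= ri.
Qed.

Lemma projective_free r : projective (fmod r).
Proof.
move=> A B q f sq; have [g hg] := fmap_basis f.
have /choice[t ht] : forall k, exists x, q x = g k by [].
exists (fmap t) => v; rewrite hg linear_sum; apply: eq_bigr => k _.
by rewrite linearZ /= ht.
Qed.

Lemma projective_sum r F : projective F -> projective (F * fmod r)%type.
Proof.
move=> PF A B q f sq.
have l1 : linear (fun x : F => (x, 0) : (F * fmod r)%type).
  by move=> a x y; congr pair; rewrite /= scaler0 addr0.
have l2 : linear (fun x : fmod r => (0, x) : (F * fmod r)%type).
  by move=> a x y; congr pair; rewrite /= scaler0 addr0.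
have [g hg] := PF A B q (f \o mklin l1 : {linear F -> B}) sq.
have [h hh] := projective_free (f \o mklin l2 : {linear fmod r -> B}) sq.
have l : linear (fun z : (F * fmod r)%type => g z.1 + h z.2).
  by move=> a x y; rewrite !linearP scalerDr addrACA.
exists (mklin l) => -[x y]; rewrite /= linearD hg hh /= -[LHS](linearD f); congr (f _).
by congr pair; rewrite /= ?addr0 ?add0r.
Qed.

Definition has_dual_basis M := exists (m : nat) (x : 'I_m -> M) (xi : 'I_m -> {linear M -> R^o}),
  forall p, p = \sum_k (xi k p : R) *: x k.

Lemma projective_dual_basis M : projective M -> finitely_generated M -> has_dual_basis M.
Proof.
move=> PM [m [x hx]]; have [|s hs] := PM _ _ (fmap x) (idfun : {linear M -> M}).
  by move=> y; have [a ->] := hx y; exists [ffun k => a k]; apply: eq_bigr => k _; rewrite ffunE.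
have l k : linear (fun y => s y k : R^o) by move=> a y z; rewrite linearP !ffunE.
by exists m, x, (fun k => mklin (l k)) => p; rewrite -[LHS]hs.
Qed.
End ShortExact.

(** * Resolutions given by matrices *)

Section GradedComplex.
Variable R : comPzRingType.
Implicit Types (M N K : lmodType R) (P : pdat R) (i j n : int).

Section Cx.
Variable Z : gcx R.

Fact cx_gr i j (z : smod (@gr_sub R Z i)) :
  gr j (if j + 1 == i then gd (sval_of z) else 0).
Proof.
case: eqP => [e|_]; last exact: (submod0 (@gr_sub _ _ _)).
have -> : j = i - 1 by rewrite -e addrK.
exact: (gr_d (smodP z)).
Qed.
Fact cx_linear i j : linear (fun z : smod (@gr_sub R Z i) =>
  (SMod (N := gr j) (cx_gr j z) : smod (@gr_sub R Z j))).
Proof.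
move=> a x y; apply: smod_eq => /=; case: eqP => _; first by rewrite linearP.
by rewrite scaler0 addr0.
Qed.
Fact cx_shape i j : j + 1 != i -> forall z, mklin (@cx_linear i j) z = 0.
Proof. by move=> /negPf ne z; apply: smod_eq; rewrite /= ne. Qed.
Fact cx_dd i j k z : mklin (@cx_linear j k) (mklin (@cx_linear i j) z) = 0.
Proof.
apply: smod_eq => /=; case: eqP => // _; case: eqP => _; last exact: linear0.
exact: gdd.
Qed.
Definition cx : complex R := Complex cx_shape cx_dd.

Lemma cx_cycle i (z : cx i) : cycle z <-> gd (sval_of z) = 0.
Proof.
split=> [h|h]; last by apply: smod_eq; rewrite /= subrK eqxx.
by have := congr1 (fun w : cx (i - 1) => sval_of w) h; rewrite /= subrK eqxx.
Qed.

Lemma cx_boundary i (z : cx i) : boundary z <-> gbd i (sval_of z).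
Proof.
split=> [[y <-]|[y hy dy]]; last by exists (SMod (N := gr _) hy); apply: smod_eq; rewrite /= eqxx.
by exists (sval_of y); rewrite ?eqxx //=; [exact: (smodP y)|rewrite eqxx].
Qed.

Section Augmented.
Variables (M : lmodType R) (eps : {linear Z -> M}).
Hypotheses (eps_d : forall z, gr 1 z -> eps (gd z) = 0)
  (gr_neg : forall i (z : Z), i < 0 -> gr i z -> z = 0)
  (surj : forall y, exists2 z : Z, gr 0 z & eps z = y)
  (ex0 : forall z : Z, gr 0 z -> eps z = 0 -> gbd 0 z)
  (exn : forall i, 0 < i -> gvan Z i).

Definition aug_map i : {linear cx i -> conc M i} :=
  match i return {linear cx i -> conc M i} with
  | Posz 0 => eps \o smod_val (@gr_sub R Z 0) : {linear cx 0 -> M}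
  | i => \0 : {linear cx i -> conc M i} end.

Fact aug_subproof i j x : cd (conc M) i j (aug_map i x) = aug_map j (cd cx i j x).
Proof.
rewrite /=; case: j => [[|j]|j] //=; case: eqP => [e|_]; last by rewrite linear0.
by subst i; rewrite eps_d //; exact: (smodP x).
Qed.
Definition aug : chain_map cx (conc M) := ChainMap aug_subproof.

Lemma aug_qis : quasi_iso aug.
Proof.
move=> i; have [i0|i0] := eqVneq i 0.
  subst i; split=> [z _ [y hy]|w _].
    by apply/cx_boundary/ex0; [exact: (smodP z)|exact: esym hy].
  have [z hz ez] := surj w; exists (SMod (N := gr 0) hz).
    apply/cx_cycle/(gr_neg (i := 0 - 1)) => //; exact: gr_d.
  by rewrite /= ez subrr; exact: (submod0 (@boundary_sub _ _ _)).
split=> [z /cx_cycle cz _|w _]; last first.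
  exists 0; first exact: (submod0 (@cycle_sub _ _ _)).
  by rewrite (conc_eq0 w i0) linear0 subr0; exact: (submod0 (@boundary_sub _ _ _)).
apply/cx_boundary; have [lt|ge] := ltP i 0; last first.
  by apply: exn; [rewrite lt_neqAle eq_sym i0|split=> //; exact: (smodP z)].
rewrite (gr_neg lt (smodP z)); exact: (submod0 (@gbd_sub _ _ _)).
Qed.

Lemma cx_resolution (Q : lmodType R -> Prop) n :
  (forall i, Q (cx i)) -> (forall i (z : Z), n < i -> gr i z -> z = 0) -> has_resolution M Q n.
Proof.
move=> hQ hn; exists cx; last by exists aug; exact: aug_qis.
split=> // i /orP[lt|lt] x; apply: smod_eq => /=.
  exact: (gr_neg lt (smodP x)).
exact: (hn _ _ lt (smodP x)).
Qed.
End Augmented.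
End Cx.

Section FreeGcx.
Variable P : pdat R.
Local Notation V := {ffun P -> R^o}.

(** P itself as a graded module: coordinate vectors fixed by the idempotent, with [pb] as
    differential. *)
Definition fgr n (z : V) := (forall a, pdeg a != n -> z a = 0) /\ act (@pe _ P) z = z.
Fact fgr_sub n : submod (fgr n).
Proof.
split; first by split=> [a _|]; [rewrite ffunE|exact: act0].
move=> c x y [hx ex] [hy ey]; split=> [a ne|]; last by rewrite act_linear ex ey.
by rewrite !ffunE hx // hy // scaler0 addr0.
Qed.
Fact fgr_d n z : fgr n z -> fgr (n - 1) (mklin (act_linear (@pb _ P)) z).
Proof.
move=> [hz ez]; split=> [a ne|]; last exact: (act_mul _ (@peb _ P)).
rewrite ffunE big1 // => b _; have [e|ne'] := eqVneq (pdeg a + 1) (pdeg b).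
  by rewrite hz ?scaler0 // -e; apply: contra ne => /eqP <-; rewrite addrK.
by rewrite pb_deg // scale0r.
Qed.
Fact fgdd z : mklin (act_linear (@pb _ P)) (mklin (act_linear (@pb _ P)) z) = 0 :> V.
Proof.
rewrite /= (act_mul (L := fun _ _ => 0) _ (@pbb _ P)); apply/ffunP => a.
by rewrite !ffunE big1 // => b _; rewrite scale0r.
Qed.
Definition fgc : gcx R := Gcx fgr_sub fgr_d fgdd.

Definition pcol (a : P) : V := [ffun b => pe b a].
Lemma pcol_gr a : fgr (pdeg a) (pcol a).
Proof.
split=> [b ne|]; first by rewrite ffunE pe_deg.
by apply/ffunP => b; rewrite !ffunE -[RHS]pee; apply: eq_bigr => c _; rewrite ffunE.
Qed.
Lemma pcol_sum (z : V) : act (@pe _ P) z = \sum_a (z a : R) *: pcol a.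
Proof.
apply/ffunP => b; rewrite ffunE sum_ffunE; apply: eq_bigr => a _.
by rewrite !ffunE -[LHS]/(pe b a * z a) mulrC.
Qed.

Definition cxx (a : P) i : cx fgc i := if pdeg a =P i is ReflectT e then
  SMod (N := fgr i) (eq_ind _ (fun i => fgr i (pcol a)) (pcol_gr a) _ e) else 0.
Lemma cxxE a i : sval_of (cxx a i) = if pdeg a == i then pcol a else 0.
Proof. by rewrite /cxx; case: eqP. Qed.

Fact cxi_linear (a : P) i : linear (fun p : cx fgc i => (sval_of p : V) a : R^o).
Proof. by move=> c x y; rewrite /= !ffunE. Qed.

Definition cx_dbasis : dbasis (cx fgc).
Proof.
refine (@Dbasis R (cx fgc) P (@pdeg _ P) cxx (fun a i => mklin (cxi_linear a (i := i))) _ _ _).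
- by move=> a i ne; apply: smod_eq; rewrite cxxE eq_sym (negPf ne).
- by move=> a i ne p /=; have [+ _] := smodP p; apply; rewrite eq_sym.
- move=> i p; apply: smod_eq; have [hp ep] := smodP p.
  rewrite -[RHS]/(smod_val (@gr_sub R fgc i) _) linear_sum -{1}ep pcol_sum.
  apply: eq_bigr => a _; rewrite linearZ /= cxxE.
  by case: eqP => // /eqP ne; rewrite hp // !scale0r.
Defined.

Lemma cx_de (a b : cx_dbasis) : de a b = @pe _ P a b.
Proof. by rewrite /de /= cxxE eqxx ffunE. Qed.
Lemma cx_db (a b : cx_dbasis) : db a b = @pb _ P a b.
Proof.
rewrite /db /= subrK eqxx cxxE eqxx ffunE -[RHS]pbe.
by apply: eq_bigr => c _; rewrite ffunE.
Qed.
End FreeGcx.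

(** [e a] is the image of the generator [a] of P_0; together the fields say that P with this
    augmentation is a resolution of M of length at most [n]. *)
Record pres M P (e : P -> M) n : Prop := Pres {
  pr_ge0 : forall a : P, 0 <= pdeg a;
  pr_le : forall a : P, pdeg a <= n;
  pr_e0 : forall a, pdeg a != 0 -> e a = 0;
  pr_ee : forall b, \sum_a pe a b *: e a = e b;
  pr_eb : forall b, \sum_a pb a b *: e a = 0;
  pr_surj : forall y, exists2 z : fgc P, gr 0 z & \sum_a (z a : R) *: e a = y;
  pr_ex0 : forall z : fgc P, gr 0 z -> \sum_a (z a : R) *: e a = 0 -> gbd 0 z;
  pr_exn : forall i, 0 < i -> gvan (fgc P) i
}.

Section PresResolution.
Variables (M : lmodType R) (P : pdat R) (e : P -> M) (n : int) (h : pres e n).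

Fact peps_linear : linear (fun z : fgc P => \sum_a (z a : R) *: e a).
Proof.
move=> c x y; rewrite scaler_sumr -big_split; apply: eq_bigr => a _ /=.
by rewrite !ffunE -[(c *: x a + y a : R^o)]/(c * x a + y a) scalerDl scalerA.
Qed.
Definition peps : {linear fgc P -> M} := mklin peps_linear.

Lemma peps_d z : peps (gd z) = 0.
Proof.
rewrite /=; under eq_bigr do rewrite ffunE scaler_suml.
rewrite exchange_big big1 //= => b _.
under eq_bigr do rewrite -[(_ *: z b : R^o)]/(_ * z b) mulrC -scalerA.
by rewrite -scaler_sumr (pr_eb h) scaler0.
Qed.

Lemma pres_neg i (z : fgc P) : i < 0 -> gr i z -> z = 0.
Proof.
move=> i0 [hz _]; apply/ffunP => a; rewrite ffunE hz //.
by apply: contraTneq i0 => <-; rewrite -leNgt (pr_ge0 h).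
Qed.
Lemma pres_big i (z : fgc P) : n < i -> gr i z -> z = 0.
Proof.
move=> i0 [hz _]; apply/ffunP => a; rewrite ffunE hz //.
by apply: contraTneq i0 => <-; rewrite -leNgt (pr_le h).
Qed.

Lemma pres_qis : exists f : chain_map (cx (fgc P)) (conc M), quasi_iso f.
Proof.
exists (@aug _ M peps (fun z _ => peps_d z)); apply: aug_qis.
- by move=> i z; exact: pres_neg.
- exact: (pr_surj h).
- exact: (pr_ex0 h).
- exact: (pr_exn h).
Qed.

(* A contracting homotopy on the top module splits it off. *)
Lemma pres_shorten (r : P -> P -> R) :
  (forall a, pdeg a = n -> forall b, \sum_c r a c * pb c b = pe a b) ->
  has_resolution M (@projective R) (n - 1).
Proof.
move=> hr.
pose r' a b := if (pdeg a == n) && (pdeg b == n - 1) then r a b else 0.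
pose H (z : fgc P) : fgc P := act (@pe _ P) (act r' z).
have Hl : linear H by move=> c x y; rewrite /H !act_linear.
have r'n z a : pdeg a != n -> act r' z a = 0.
  by move=> /negPf ne; rewrite ffunE big1 // => b _; rewrite /r' ne scale0r.
have Hgr i z : gr i z -> gr (i + 1) (H z).
  move=> [hz ez]; split; last exact: (act_mul _ (@pee _ P)).
  move=> a ne; rewrite ffunE big1 // => b _; have [eb|nb] := eqVneq (pdeg a) (pdeg b); last first.
    by rewrite pe_deg // scale0r.
  rewrite ffunE big1 ?scaler0 // => c _; rewrite /r'; case: ifP => [/andP[/eqP b_n /eqP c_n]|_].
    by rewrite hz ?scaler0 //; apply: contra ne => /eqP <-; rewrite eb b_n c_n subrK.
  by rewrite scale0r.
have Hn z : gr n z -> H (gd z) = z.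
  move=> [hz ez]; rewrite -[RHS]ez; apply/ffunP => a; rewrite !ffunE; apply: eq_bigr => b _.
  have [eb|nb] := eqVneq (pdeg b) n; last by rewrite r'n // hz.
  congr (_ *: _); rewrite ffunE -[in RHS]ez [RHS]ffunE.
  transitivity (\sum_c r b c *: (gd z : {ffun P -> R^o}) c).
    apply: eq_bigr => c _; rewrite /r' eb eqxx /=; case: eqP => // /eqP nc.
    have [+ _] := @gr_d _ (fgc P) n z (conj hz ez).
    by move=> /(_ c nc) ->; rewrite !scaler0.
  under eq_bigr do rewrite ffunE scaler_sumr.
  rewrite exchange_big; apply: eq_bigr => c _; rewrite -(hr b eb) scaler_suml.
  by apply: eq_bigr => k _; rewrite scalerA.
have H0 i z : i != n - 1 -> gr i z -> H z = 0.
  move=> ne [hz _]; rewrite /H [act r' z](_ : _ = 0) ?act0 //; apply/ffunP => a.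
  rewrite !ffunE big1 // => b _; rewrite /r'; case: ifP => [/andP[_ /eqP eb]|_]; last exact: scale0r.
  by rewrite hz ?scaler0 // eb eq_sym.
have HH i z : gr i z -> H (H z) = 0.
  move=> hz; have [e0|ne] := eqVneq (i + 1) (n - 1); last exact: (H0 (i + 1) _ ne (Hgr _ _ hz)).
  rewrite (H0 i z) // ?[H 0](linear0 (mklin Hl)) //.
  by apply: contra (oner_neq0 int) => /eqP ie; rewrite -(subrr i) -{1}ie in e0 *; apply/eqP; lia.
have HdH i z : gr i z -> H (gd (H z)) = H z.
  move=> hz; have [e0|ne] := eqVneq i (n - 1); last by rewrite (H0 i z) // linear0 [H 0](linear0 (mklin Hl)).
  by apply: Hn; have := Hgr _ _ hz; rewrite e0 subrK.
(* The projection 1 - H d - d H onto the subcomplex where [H] and H d vanish. It is homotopic to the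
   identity, so homology and augmentation survive, and it is zero in degree [n], where H d = 1. *)
pose pr (z : fgc P) : fgc P := z - H (gd z) - gd (H z).
pose gr' i (z : fgc P) := [/\ gr i z, H z = 0 & H (gd z) = 0].
have prgr i z : gr i z -> gr' i (pr z).
  move=> hz; have hdz := gr_d hz; have hHz := Hgr _ _ hz.
  have hHd : gr i (H (gd z)) by have := Hgr _ _ hdz; rewrite subrK.
  have hdH : gr i (gd (H z)) by have := gr_d hHz; rewrite addrK.
  have HB x y : H (x - y) = H x - H y by exact: (linearB (mklin Hl)).
  split.
  - by apply: (submodB (@gr_sub _ _ _)) => //; apply: (submodB (@gr_sub _ _ _)).
  - by rewrite /pr !HB (HH _ _ hdz) (HdH _ _ hz) subr0 subrr.
  - by rewrite /pr !linearB gdd subr0 HB (HdH _ _ hdz) subrr.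
have prid i z : gr' i z -> pr z = z.
  by move=> [_ h1 h2]; rewrite /pr h1 h2 [gd 0]linear0 !subr0.
have gr'_sub i : submod (gr' i).
  have HP c x y : H (c *: x + y) = c *: H x + H y by exact: Hl.
  have H00 : H 0 = 0 by exact: (linear0 (mklin Hl)).
  split; first by split; rewrite ?linear0 //; exact: (submod0 (@gr_sub _ _ _)).
  move=> c x y [hx Hx Hdx] [hy Hy Hdy]; split.
  - exact: ((@gr_sub _ _ i).2 _ _ _ hx hy).
  - by rewrite HP Hx Hy scaler0 addr0.
  - by rewrite linearP HP Hdx Hdy scaler0 addr0.
have gr'_d i z : gr' i z -> gr' (i - 1) (gd z).
  by move=> [hz Hz Hdz]; split; rewrite ?gdd //; [exact: gr_d|exact: (linear0 (mklin Hl))].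
pose Z' := Gcx gr'_sub gr'_d (@gdd _ (fgc P)).
have eps_pr z : gr 0 z -> peps (pr z) = peps z.
  move=> hz; have d0 : gd z = 0 by apply: (pres_neg (i := 0 - 1)) => //; exact: gr_d.
  by rewrite /pr d0 [H 0](linear0 (mklin Hl)) subr0 linearB peps_d subr0.
have bd' i z : gr' i z -> gbd (Z := fgc P) i z -> gbd (Z := Z') i z.
  move=> [hz Hz _] [y hy dy]; exists (pr y); first exact: prgr.
  rewrite -[gd _]/(@gd _ (fgc P) (pr y)) /pr !linearB gdd dy subr0 Hz.
  by rewrite linear0 subr0.
apply: (@cx_resolution Z' M peps).
- by move=> z _; exact: peps_d.
- by move=> i z i0 [hz _ _]; exact: (pres_neg i0 hz).
- move=> y; have [z hz ez] := pr_surj h y; exists (pr z); first exact: prgr.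
  by rewrite eps_pr.
- by move=> z hz ez; apply: bd' => //; apply: (pr_ex0 h) => //; case: hz.
- move=> i i0 z [hz dz]; apply: bd' => //; apply: (pr_exn h) => //; split=> //; by case: hz.
- move=> i A B q f sq.
  have prl : linear pr.
    by move=> c x y; rewrite /pr ![gd (_ *: _ + _)]linearP ![H (_ *: _ + _)]Hl [gd (_ *: _ + _)]linearP; lincomb R.
  have /choice[w hw] : forall a, exists w : cx Z' i,
      sval_of w = if pdeg a == i then pr (pcol a) else 0 :> fgc P.
    move=> a; case: eqP => [e1|_]; last by exists 0.
    by subst i; exists (SMod (N := gr' _) (prgr _ _ (pcol_gr a))).
  have /choice[t ht] : forall a, exists x, q x = f (w a) by [].
  have gl : linear (fun z : cx Z' i => \sum_a ((sval_of z : {ffun P -> R^o}) a : R) *: t a).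
    move=> c x y; rewrite scaler_sumr -big_split; apply: eq_bigr => a _ /=.
    by rewrite !ffunE -[(c *: sval_of x a + sval_of y a : R^o)]/(c * sval_of x a + sval_of y a) scalerDl scalerA.
  exists (mklin gl) => z; rewrite /= linear_sum.
  rewrite [X in f X](_ : z = \sum_a ((sval_of z : {ffun P -> R^o}) a : R) *: w a).
    by rewrite linear_sum; apply: eq_bigr => a _; rewrite !linearZ /= ht.
  apply: smod_eq; have hz := smodP z; have [[hz0 ez] _ _] := hz.
  rewrite -[RHS]/(smod_val (@gr_sub R Z' i) _) linear_sum -{1}(prid _ _ hz) -{1}ez pcol_sum.
  rewrite -[LHS]/(mklin prl _) linear_sum; apply: eq_bigr => a _; rewrite !linearZ /= hw.
  by case: eqP => // /eqP ne; rewrite hz0 // !scale0r.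
- move=> i z lt [hz Hz Hdz]; have [lt'|le] := ltP n i; first exact: (pres_big lt' hz).
  have ei : i = n by lia.
  by subst i; rewrite -[LHS]Hn.
Qed.
End PresResolution.
End GradedComplex.

(** * Quotient modules, flatness and the equational criterion *)

Section Quotient.
Variables (R : comPzRingType) (V : lmodType R) (W : V -> Prop) (hW : submod W).

(** A chosen representative of each class; the quotient is then the type of fixed points of
    [qrep]. *)
Definition qrep (v : V) : V := xget 0 [set w | W (v - w)]%classic.
Lemma qrepP v : W (v - qrep v).
Proof.
by apply: (@xgetPex _ 0 [set w | W (v - w)]%classic); exists v; rewrite /= subrr; exact: submod0.
Qed.
Lemma qrep_eq v w : W (v - w) -> qrep v = qrep w.
Proof.
move=> h; rewrite /qrep; congr (xget _ _); apply/funext => u; apply/propext; split=> h' /=.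
  by rewrite (_ : w - u = (v - u) - (v - w)); [apply: submodB|lincomb R].
by rewrite (_ : v - u = (v - w) + (w - u)); [apply: submodD|lincomb R].
Qed.
Lemma qrepK v : qrep (qrep v) = qrep v.
Proof. by apply: qrep_eq; rewrite -opprB; apply: (submodN hW); exact: qrepP. Qed.

Record qmod_rec : Type := QMod { qval : V; qvalP : qrep qval = qval }.
Definition qmod : Type := let _ := hW in qmod_rec.
HB.instance Definition _ := gen_eqMixin qmod.
HB.instance Definition _ := gen_choiceMixin qmod.

Definition qcl v : qmod := QMod (qrepK v).
Lemma qmod_eq (x y : qmod_rec) : qval x = qval y -> x = y.
Proof. by case: x y => x hx [y hy] /= e; subst y; congr QMod; apply: Prop_irrelevance. Qed.
Lemma qcl_val (x : qmod) : qcl (qval x) = x.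
Proof. by apply: qmod_eq; exact: qvalP. Qed.
Lemma qclP v w : qcl v = qcl w <-> W (v - w).
Proof.
split=> [e|h]; last by apply: qmod_eq; exact: qrep_eq.
have e' : qrep v = qrep w := congr1 (fun x : qmod => qval x) e.
rewrite (_ : v - w = (v - qrep v) - (w - qrep w)); first by apply: submodB => //; exact: qrepP.
by rewrite e'; lincomb R.
Qed.

Definition q0 : qmod := qcl 0.
Definition qD (x y : qmod) : qmod := qcl (qval x + qval y).
Definition qN (x : qmod) : qmod := qcl (- qval x).
Definition qZ a (x : qmod) : qmod := qcl (a *: qval x).

Lemma qD_cl v w : qD (qcl v) (qcl w) = qcl (v + w).
Proof.
apply/qclP => /=; rewrite -opprB; apply: submodN => //.
rewrite (_ : _ - _ = (v - qrep v) + (w - qrep w)); last by lincomb R.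
by apply: submodD => //; exact: qrepP.
Qed.
Lemma qZ_cl a v : qZ a (qcl v) = qcl (a *: v).
Proof.
apply/qclP => /=; rewrite -opprB -scalerBr; apply: submodN => //; apply: submodZ => //.
exact: qrepP.
Qed.

Fact qDA : associative qD.
Proof. by move=> x y z; rewrite -[x]qcl_val -[y]qcl_val -[z]qcl_val !qD_cl addrA. Qed.
Fact qDC : commutative qD. Proof. by move=> x y; rewrite /qD addrC. Qed.
Fact q0D : left_id q0 qD.
Proof. by move=> x; rewrite -[x]qcl_val qD_cl add0r. Qed.
Fact qND : left_inverse q0 qN qD.
Proof. by move=> x; rewrite -{2}[x]qcl_val qD_cl addNr. Qed.
HB.instance Definition _ := GRing.isZmodule.Build qmod qDA qDC q0D qND.
Fact qZA a b x : qZ a (qZ b x) = qZ (a * b) x.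
Proof. by rewrite -[x]qcl_val !qZ_cl scalerA. Qed.
Fact q1Z : left_id 1 qZ.
Proof. by move=> x; rewrite /qZ scale1r qcl_val. Qed.
Fact qZDr : right_distributive qZ +%R.
Proof.
move=> a x y; rewrite -[x]qcl_val -[y]qcl_val -![_ + _]/(qD _ _) !(qD_cl, qZ_cl).
by rewrite scalerDr.
Qed.
Fact qZDl x : {morph qZ^~ x : a b / a + b}.
Proof.
by move=> a b; rewrite -[x]qcl_val -[RHS]/(qD _ _) !(qD_cl, qZ_cl) scalerDl.
Qed.
HB.instance Definition _ := GRing.Zmodule_isLmodule.Build R qmod qZA q1Z qZDr qZDl.

Fact qcl_linear : linear qcl.
Proof. by move=> a x y; rewrite -[RHS]/(qD (qZ _ _) _) qZ_cl qD_cl. Qed.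
End Quotient.

Section Equational.
Variable R : comPzRingType.
Implicit Types (M F K : lmodType R).

(** The equational criterion of flatness, for systems of relations rather than a single one: the
    passage to kernels in [eqcrit_ker] uses the system form. *)
Definition eqcrit M := forall n s (r : 'I_s -> 'I_n -> R) (m : 'I_n -> M),
  (forall t, \sum_i r t i *: m i = 0) -> exists k (a : 'I_n -> 'I_k -> R) (y : 'I_k -> M),
  (forall i, m i = \sum_j a i j *: y j) /\ forall t j, \sum_i r t i * a i j = 0.

Lemma sum_mul_scale M p q (c : 'I_p -> R) (a : 'I_p -> 'I_q -> R) (y : 'I_q -> M) :
  \sum_i c i *: \sum_j a i j *: y j = \sum_j (\sum_i c i * a i j) *: y j.
Proof.
under eq_bigr do rewrite scaler_sumr.
rewrite exchange_big; apply: eq_bigr => j _; rewrite scaler_suml.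
by apply: eq_bigr => i _; rewrite scalerA.
Qed.

Lemma sum_mul_mul p q (c : 'I_p -> R) (a : 'I_p -> 'I_q -> R) (y : 'I_q -> R) :
  \sum_i c i * \sum_j a i j * y j = \sum_j (\sum_i c i * a i j) * y j.
Proof.
under eq_bigr do rewrite mulr_sumr.
rewrite exchange_big; apply: eq_bigr => j _; rewrite mulr_suml.
by apply: eq_bigr => i _; rewrite mulrA.
Qed.

(** Once all relations but one are trivialized over new elements [y], the remaining one is a single
    relation among the [y]. *)
Lemma eqcrit_single M : (forall n (r : 'I_n -> R) (m : 'I_n -> M), \sum_i r i *: m i = 0 ->
    exists k (a : 'I_n -> 'I_k -> R) (y : 'I_k -> M),
    (forall i, m i = \sum_j a i j *: y j) /\ forall j, \sum_i r i * a i j = 0) -> eqcrit M.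
Proof.
move=> h n s; elim: s => [|s IHs] r m rm.
  exists n, (fun i j => (i == j)%:R), m; split=> [i|[]//].
  rewrite (bigD1 i) //= eqxx scale1r big1 ?addr0 // => j /negPf ne.
  by rewrite eq_sym ne scale0r.
have [k [a [y [my ra]]]] := IHs (fun t => r (lift ord0 t)) m (fun t => rm (lift ord0 t)).
have [|k' [b [z [yz rb]]]] := h k (fun j => \sum_i r ord0 i * a i j) y.
  by rewrite -sum_mul_scale -[RHS](rm ord0); apply: eq_bigr => i _; rewrite -my.
exists k', (fun i l => \sum_j a i j * b j l), z; split=> [i|t l].
  by rewrite my -sum_mul_scale; apply: eq_bigr => j _; rewrite -yz.
rewrite sum_mul_mul; have [t' ->|->] := unliftP ord0 t; last exact: rb.
by rewrite big1 // => j _; rewrite ra mul0r.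
Qed.

(** Trivialization in F writes i(m) = a y. As p i = 0, the rows of [a] form a system of relations
    among the p(y_j) in M; trivializing it corrects each y_j by an element of F so that it falls
    into K. *)
Lemma eqcrit_ker K F M (i : {linear K -> F}) (p : {linear F -> M}) :
  ses i p -> eqcrit F -> eqcrit M -> eqcrit K.
Proof.
move=> [inj surj ex] EF EM n s r m rm.
have [|k [a [y [my ra]]]] := EF n s r (i \o m).
  move=> t; rewrite -[RHS](linear0 i) -[in RHS](rm t) linear_sum.
  by apply: eq_bigr => l _; rewrite linearZ.
have [|k' [b [z [yz ab]]]] := EM k n a (p \o y).
  move=> l; have -> : \sum_j a l j *: (p \o y) j = p (i (m l)).
    by rewrite [i _]my linear_sum; apply: eq_bigr => j _; rewrite linearZ.
  by apply/ex; exists (m l).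
have /choice[w hw] : forall l, exists x, p x = z l by [].
have /choice[v hv] : forall j, exists x, i x = y j - \sum_l b j l *: w l.
  move=> j; apply/ex; rewrite linearB linear_sum -[p _]/((p \o y) j) yz.
  by rewrite -sumrB big1 // => l _; rewrite linearZ hw subrr.
exists k, a, v; split=> // l; apply: inj; rewrite linear_sum -[i _]/((i \o m) l) my.
under [RHS]eq_bigr do rewrite linearZ /= hv scalerBr.
by rewrite sumrB sum_mul_scale [X in _ - X]big1 ?subr0 // => j _; rewrite ab scale0r.
Qed.

Lemma eqcrit_sum r F : eqcrit F -> eqcrit (F * fmod R r)%type.
Proof.
move=> EF n s c m cm; have pl1 : linear (fun z : (F * fmod R r)%type => z.1) by [].
have pl2 : linear (fun z : (F * fmod R r)%type => z.2) by [].
have [|k [a [y [my ra]]]] := EF n s c (fun i => (m i).1).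
  move=> t; rewrite -[RHS]/((0 : (F * fmod R r)%type).1) -[in RHS](cm t).
  by rewrite -[RHS]/(mklin pl1 _) linear_sum; apply: eq_bigr.
have l1 : linear (fun x : F => (x, 0) : (F * fmod R r)%type).
  by move=> e x z; congr pair; rewrite /= scaler0 addr0.
have l2 : linear (fun x : fmod R r => (0, x) : (F * fmod R r)%type).
  by move=> e x z; congr pair; rewrite /= scaler0 addr0.
pose bas (l : 'I_r) : fmod R r := [ffun l' => (l == l')%:R].
exists (k + r)%N, (fun i j => match split j with inl j => a i j | inr l => (m i).2 l end),
  (fun j => match split j with inl j => mklin l1 (y j) | inr l => mklin l2 (bas l) end).
split=> [i|t j].
  rewrite big_split_ord /=.
  transitivity (mklin l1 (m i).1 + mklin l2 (m i).2).
    by case: (m i) => u v; congr pair; rewrite /= ?addr0 ?add0r.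
  congr (_ + _).
    rewrite my linear_sum; apply: eq_bigr => j _; rewrite linearZ.
    by rewrite (unsplitK (inl j)).
  rewrite {1}(_ : (m i).2 = \sum_l ((m i).2 l : R) *: bas l) ?linear_sum.
    by apply: eq_bigr => l _; rewrite linearZ (unsplitK (inr l)).
  apply/ffunP => l; rewrite sum_ffunE (bigD1 l) //= big1 ?addr0 => [|l' /negPf ne].
    by rewrite !ffunE eqxx -[RHS]/(((m i).2 l : R) * 1) mulr1.
  by rewrite !ffunE ne -[LHS]/(((m i).2 l' : R) * 0) mulr0.
case: (split j) => [j'|l]; first exact: ra.
transitivity (((\sum_i c t i *: m i).2 : {ffun 'I_r -> R^o}) l); last by rewrite cm ffunE.
rewrite -[RHS]/((mklin pl2 _ : {ffun 'I_r -> R^o}) l) linear_sum sum_ffunE.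
by apply: eq_bigr => i _; rewrite !ffunE.
Qed.

Lemma eqcrit_free r : eqcrit (fmod R r).
Proof.
have E0 : eqcrit (fmod R 0).
  move=> n s c m _; exists 0%N, (fun _ _ => 0), (fun=> 0); split=> [i|t []//].
  by apply/ffunP => -[].
have l : linear (fun x : fmod R r => (0, x) : (fmod R 0 * fmod R r)%type).
  by move=> e x z; congr pair; rewrite /= scaler0 addr0.
have l' : linear (fun x : (fmod R 0 * fmod R r)%type => x.1) by [].
apply: (eqcrit_ker (i := mklin l) (p := mklin l')) (eqcrit_sum E0) E0; split=> [x y []//|y|[x y]].
  by exists (y, 0).
split=> [_|_]; last by apply/ffunP => -[].
by exists y; congr pair; apply/ffunP => -[].
Qed.

Lemma noether_relations n M (g : 'I_n -> M) : noetherian R -> exists s (r : 'I_s -> 'I_n -> R),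
  (forall t, \sum_i r t i *: g i = 0) /\ forall c : 'I_n -> R, \sum_i c i *: g i = 0 ->
  exists b : 'I_s -> R, forall i, c i = \sum_t b t * r t i.
Proof.
move=> noeth; pose N (v : fmod R n) := fmap g v = 0.
have hN : submod N by split=> [|a x y hx hy]; rewrite /N ?linear0 // linearP hx hy scaler0 addr0.
pose bas (l : 'I_n) : fmod R n := [ffun l' => (l == l')%:R].
have : fgq N (fun v => v = 0).
  apply: (noether_sub noeth (g := bas)) => //.
    by split=> // a x y -> ->; rewrite scaler0 addr0.
  move=> z _; exists (fun k => z k); apply/ffunP => l; rewrite !ffunE sum_ffunE (bigD1 l) //=.
  rewrite big1 ?addr0 => [|l' /negPf ne]; first by rewrite !ffunE eqxx -[_ *: _]/((z l : R) * 1) mulr1 subrr.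
  by rewrite !ffunE ne -[LHS]/((z l' : R) * 0) mulr0.
move=> /fgq_ord[s [r [hr h]]]; exists s, (fun t i => r t i); split=> [t|c hc]; first exact: hr.
have [|b hb] := h [ffun i => c i].
  by rewrite /N /= -[RHS]hc; apply: eq_bigr => i _; rewrite ffunE.
exists b => i; have := congr1 (fun v : {ffun _ -> R^o} => v i) hb.
rewrite !ffunE sum_ffunE => /eqP; rewrite subr_eq0 => /eqP ->.
by apply: eq_bigr => t _; rewrite ffunE.
Qed.

(** Trivializing a generating set of the relations among [g] factors the identity of M through R^k:
    the coefficients [Af] of a combination of the g_i depend only on its value. *)
Lemma eqcrit_dual_basis M : noetherian R -> eqcrit M -> finitely_generated M -> has_dual_basis M.
Proof.
move=> noeth EM [n [g hg]]; have [s [r [hr hrel]]] := noether_relations g noeth.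
have [k [a [y [gy ra]]]] := EM n s r g hr.
pose Af (c : 'I_n -> R) j := \sum_i c i * a i j.
have Af0 c : \sum_i c i *: g i = 0 -> forall j, Af c j = 0.
  move=> /hrel[b hb] j; rewrite /Af; under eq_bigr do rewrite hb.
  under eq_bigr do rewrite mulr_suml; rewrite exchange_big big1 // => t _.
  by under eq_bigr do rewrite -mulrA; rewrite -mulr_sumr ra mulr0.
have /choice[c hc] := hg.
have l j : linear (fun x : M => Af (c x) j : R^o).
  move=> e x z; apply/eqP; rewrite -subr_eq0; apply/eqP.
  rewrite -(Af0 (fun i => c (e *: x + z) i - (e * c x i + c z i)) _ j).
    rewrite /Af -[e *: _ : R^o]/(e * _) mulr_sumr -big_split -sumrB; apply: eq_bigr => i _ /=; ring.
  under eq_bigr do rewrite scalerBl scalerDl -scalerA.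
  by rewrite sumrB big_split /= -scaler_sumr -!hc subrr.
exists k, y, (fun j => mklin (l j)) => p; rewrite {1}(hc p).
by under eq_bigr do rewrite gy; rewrite sum_mul_scale.
Qed.

Section Flat.
Variable (M : lmodType R).
Hypothesis FM : flat M.
Variables (n : nat) (r : 'I_n -> R).

Definition fl_ideal (x : R^o) := exists c : 'I_n -> R, x = \sum_i c i * r i.
Fact fl_ideal_sub : submod fl_ideal.
Proof.
split; first by exists (fun=> 0); rewrite big1 // => i _; rewrite mul0r.
move=> a _ _ [c ->] [d ->]; exists (fun i => a * c i + d i).
rewrite -[a *: _]/(a * _) mulr_sumr -big_split; apply: eq_bigr => i _ /=; ring.
Qed.
Local Notation J := (smod fl_ideal_sub).
Local Notation Mn := {ffun 'I_n -> M}.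

(** The quotient of M^n by these families is a model of J (x) M, for [J] the ideal of the r_i, the
    class of [v] being the sum of the r_i (x) v_i. Flatness is stated through universal properties,
    so an actual tensor product has to be exhibited. *)
Definition fl_rel (v : Mn) := exists k (a : 'I_n -> 'I_k -> R) (y : 'I_k -> M),
  (forall i, v i = \sum_j a i j *: y j) /\ forall j, \sum_i r i * a i j = 0.
Fact fl_rel_sub : submod fl_rel.
Proof.
split.
  exists 0%N, (fun _ _ => 0), (fun=> 0); split=> [i|[]//].
  by rewrite ffunE big_ord0.
move=> c u v [k [a [y [hu ra]]]] [k' [a' [y' [hv ra']]]].
exists (k + k')%N, (fun i j => match split j with inl j => c * a i j | inr j => a' i j end),
  (fun j => match split j with inl j => y j | inr j => y' j end); split=> [i|j].
  rewrite !ffunE hu hv big_split_ord scaler_sumr; congr (_ + _); apply: eq_bigr => j _.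
    by rewrite (unsplitK (inl j)) scalerA.
  by rewrite (unsplitK (inr j)).
case: (split j) => // {}j; under eq_bigr do rewrite mulrCA.
by rewrite -mulr_sumr ra mulr0.
Qed.
Local Notation T := (qmod fl_rel_sub).
Local Notation cl := (qcl fl_rel_sub).

Lemma fl_coef (x : J) : exists c : 'I_n -> R, sval_of x = \sum_i c i * r i.
Proof. exact: smodP x. Qed.
Definition fl_c x := projT1 (cid (fl_coef x)).
Lemma fl_cE x : sval_of x = \sum_i fl_c x i * r i.
Proof. by rewrite /fl_c; case: cid. Qed.

Definition fl_b (x : J) (m : M) : T := cl [ffun i => fl_c x i *: m].
Lemma fl_bE (x : J) (c : 'I_n -> R) m : sval_of x = \sum_i c i * r i -> fl_b x m = cl [ffun i => c i *: m].
Proof.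
move=> hx; apply/qclP; exists 1%N, (fun i _ => fl_c x i - c i), (fun=> m); split=> [i|_].
  by rewrite big_ord1 !ffunE scalerBl.
by under eq_bigr do rewrite mulrBr ![r _ * _]mulrC; rewrite sumrB -hx -fl_cE subrr.
Qed.

Fact fl_b_bilinear : bilinear fl_b.
Proof.
split=> [m a x y|x a m m'].
  rewrite (@fl_bE _ (fun i => a * fl_c x i + fl_c y i)).
    rewrite -[RHS](qcl_linear fl_rel_sub); congr (cl _); apply/ffunP => i.
    by rewrite !ffunE scalerDl scalerA.
  rewrite /= !fl_cE -[a *: _]/(a * _) mulr_sumr -big_split; apply: eq_bigr => i _ /=; ring.
rewrite -[RHS](qcl_linear fl_rel_sub); congr (cl _); apply/ffunP => i.
by rewrite !ffunE; lincomb R.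
Qed.

Fact fl_gen_proof i : fl_ideal (r i).
Proof.
exists (fun k => (i == k)%:R); rewrite (bigD1 i) //= eqxx mul1r big1 ?addr0 // => k /negPf ne.
by rewrite eq_sym ne mul0r.
Qed.
Definition fl_gen i : J := SMod (N := fl_ideal) (fl_gen_proof i).

Lemma fl_J_sum (x : J) (c : 'I_n -> R) : sval_of x = \sum_i c i * r i -> x = \sum_i c i *: fl_gen i.
Proof.
by move=> hx; apply: smod_eq; rewrite -[RHS]/(smod_val fl_ideal_sub _) linear_sum.
Qed.

Lemma fl_cl_sum (v : Mn) : cl v = \sum_i fl_b (fl_gen i) (v i).
Proof.
pose del i : Mn := [ffun k => (i == k)%:R *: v i].
rewrite (_ : v = \sum_i del i); last first.
  apply/ffunP => k; rewrite sum_ffunE (bigD1 k) //= ffunE eqxx scale1r big1 ?addr0 // => i /negPf ne.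
  by rewrite ffunE ne scale0r.
rewrite -[LHS]/(mklin (qcl_linear fl_rel_sub) _) linear_sum; apply: eq_bigr => i _.
rewrite (@fl_bE _ (fun k => (i == k)%:R)).
  rewrite /=; congr (cl _); apply/ffunP => k; rewrite !ffunE; congr (_ *: _).
  rewrite sum_ffunE (bigD1 i) //= ffunE eqxx scale1r big1 ?addr0 // => l /negPf ne.
  by rewrite ffunE ne scale0r.
rewrite /= (bigD1 i) //= eqxx mul1r big1 ?addr0 // => k /negPf ne.
by rewrite eq_sym ne mul0r.
Qed.

Fact fl_tensor : is_tensor fl_b.
Proof.
split; first exact: fl_b_bilinear.
move=> N c [c1 c2].
have cl1 i : linear (c (fl_gen i)) by exact: c2.
have hl : linear (fun v : Mn => \sum_i c (fl_gen i) (v i)).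
  move=> a u v; rewrite scaler_sumr -big_split; apply: eq_bigr => i _.
  by rewrite !ffunE (cl1 i).
have h0 v : fl_rel v -> \sum_i c (fl_gen i) (v i) = 0.
  move=> [k [a [y [hv ra]]]]; under eq_bigr do rewrite hv -[c _ _]/(mklin (cl1 _) _) linear_sum.
  rewrite exchange_big big1 // => j _; under eq_bigr do rewrite linearZ /=.
  rewrite -[RHS](linear0 (mklin (c1 (y j)))) -(_ : \sum_i a i j *: fl_gen i = 0).
    by rewrite linear_sum; apply: eq_bigr => i _; rewrite linearZ.
  by rewrite -(@fl_J_sum 0 (fun i => a i j)) //= -[LHS](ra j); apply: eq_bigr => i _; rewrite mulrC.
have tl : linear (fun t : T => \sum_i c (fl_gen i) (qval t i)).
  move=> a s t; rewrite -[RHS]hl; apply/eqP; rewrite -subr_eq0; apply/eqP.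
  rewrite -[LHS](linearB (mklin hl)); apply: h0; apply/(qclP fl_rel_sub).
  by rewrite qcl_val qcl_linear !qcl_val.
have he v : mklin tl (cl v) = \sum_i c (fl_gen i) (v i).
  rewrite /=; apply/eqP; rewrite -subr_eq0; apply/eqP; rewrite -[LHS](linearB (mklin hl)).
  apply: h0; rewrite -opprB; apply: (submodN fl_rel_sub); exact: (qrepP fl_rel_sub).
exists (mklin tl); split=> [x m|h hh].
  rewrite he [in RHS](fl_J_sum (fl_cE x)) -[RHS]/(mklin (c1 m) _) linear_sum; apply: eq_bigr => i _.
  by rewrite ffunE linearZ -[c _ (_ *: _)]/(mklin (cl1 i) _) linearZ.
apply: linear_eq => t; rewrite -[t]qcl_val he fl_cl_sum linear_sum.
by apply: eq_bigr => i _; rewrite hh.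
Qed.

Fact scale_tensor : is_tensor (fun (a : R^o) (m : M) => (a : R) *: m).
Proof.
split; first by split=> [m a x y|x a m m']; [rewrite scalerDl -scalerA|lincomb R].
move=> N c [c1 c2]; exists (mklin (c2 1)); split=> [a m|h hh].
  have e1 : a = (a : R) *: (1 : R^o) by rewrite -[RHS]/((a : R) * 1) mulr1.
  by rewrite linearZ /= [in RHS]e1 -[RHS]/(mklin (c1 m) _) linearZ.
by apply: linear_eq => m; rewrite /= -hh scale1r.
Qed.

(** The map J (x) M -> R (x) M = M is injective and sends the class of [m] to the given combination,
    which is zero. *)
Lemma flat_relation (m : 'I_n -> M) : \sum_i r i *: m i = 0 -> fl_rel [ffun i => m i].
Proof.
move=> rm; pose b0 := fun (a : R^o) (m : M) => (a : R) *: m.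
have [_ /(_ M (fun x m => b0 (sval_of x) m))] := fl_tensor.
have b0l : bilinear (fun (x : J) m => b0 (sval_of x) m).
  by split=> [m' a x y|x a m1 m2]; rewrite /b0 /=; [rewrite scalerDl -scalerA|lincomb R].
move=> /(_ b0l) [w [hw _]].
have inj := FM (u := smod_val fl_ideal_sub) (fun x y => @smod_eq _ _ _ x y) fl_tensor scale_tensor hw.
have /qclP : cl [ffun i => m i] = cl 0; last by rewrite subr0.
apply: inj; rewrite fl_cl_sum linear_sum.
rewrite -[cl 0]/(mklin (qcl_linear fl_rel_sub) 0) !linear0 -[RHS]rm.
by apply: eq_bigr => i _; rewrite hw ffunE.
Qed.
End Flat.

Lemma flat_eqcrit M : flat M -> eqcrit M.
Proof.
move=> FM; apply: eqcrit_single => n r m /(flat_relation FM) [k [a [y [h ra]]]].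
by exists k, a, y; split=> // i; rewrite -h ffunE.
Qed.
End Equational.

(** * Construction of finite projective resolutions *)

Section FiniteResolution.
Variable R : comPzRingType.
Implicit Types (M N : lmodType R) (P : pdat R) (i j n : int).

Section Base.
Variables (M : lmodType R) (m : nat) (x : 'I_m -> M) (xi : 'I_m -> {linear M -> R^o}).
Hypothesis hx : forall p, p = \sum_k (xi k p : R) *: x k.

Definition bs_e (a b : 'I_m) : R := xi a (x b).
Lemma bs_xi a p : (xi a p : R) = \sum_b bs_e a b * (xi b p : R).
Proof.
rewrite {1}(hx p) linear_sum; apply: eq_bigr => b _; rewrite linearZ.
by rewrite -[LHS]/((xi b p : R) * bs_e a b) mulrC.
Qed.
Definition bs : pdat R.
Proof.
refine (@Pdat R 'I_m (fun=> 0) bs_e (fun _ _ => 0) _ _ _ _ _ _) => //.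
- by move=> a c; rewrite [RHS]bs_xi.
- by move=> a c; rewrite big1 // => b _; rewrite mulr0.
- by move=> a c; rewrite big1 // => b _; rewrite mul0r.
- by move=> a c; rewrite big1 // => b _; rewrite mul0r.
Defined.

Lemma bs_pres (n : nat) : pres (P := bs) x n%:Z.
Proof.
have act_bs (z : fgc bs) a : act (@pe _ bs) z a = xi a (\sum_b (z b : R) *: x b).
  rewrite ffunE linear_sum; apply: eq_bigr => b _; rewrite linearZ.
  by rewrite -[LHS]/(bs_e a b * z b) mulrC.
split=> //.
- by move=> b; rewrite big1 // => a _; rewrite scale0r.
- move=> y; exists [ffun a => xi a y].
    split=> //.
    by apply/ffunP => a; rewrite act_bs ffunE; congr (xi a _); rewrite [RHS]hx; apply: eq_bigr => b _; rewrite ffunE.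
  by rewrite [RHS]hx; apply: eq_bigr => b _; rewrite ffunE.
- move=> z [_ ez] e0; rewrite (_ : z = 0); first exact: (submod0 (@gbd_sub _ _ _)).
  by apply/ffunP => a; rewrite -ez act_bs e0 linear0 ffunE.
- move=> i i0 z [[hz _] _]; rewrite (_ : z = 0); first exact: (submod0 (@gbd_sub _ _ _)).
  by apply/ffunP => a; rewrite ffunE hz // lt_eqF.
Qed.
End Base.

Section Splice.
Variables (M N : lmodType R) (r : nat) (g : 'I_r -> M) (jn : {linear N -> fmod R r}).
Hypothesis hs : ses jn (fmap g).
Variables (P : pdat R) (e : P -> N) (n : nat).
Hypothesis he : pres e n%:Z.

Local Notation A := ('I_r + P)%type.
Definition sp_deg (x : A) : int := if x is inr a then pdeg a + 1 else 0.
Definition sp_e (x y : A) : R := match x, y with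
  | inl k, inl l => (k == l)%:R | inr a, inr b => pe a b | _, _ => 0 end.
(** The resolution of N, shifted up by one without sign, is attached to R^r by its augmentation
    followed by [jn]. *)
Definition sp_b (x y : A) : R := match x, y with
  | inl k, inr b => jn (e b) k | inr a, inr b => pb a b | _, _ => 0 end.

Lemma sp_delta k (f : 'I_r -> R) : \sum_l (k == l)%:R * f l = f k.
Proof.
rewrite (bigD1 k) //= eqxx mul1r big1 ?addr0 // => l /negPf ne.
by rewrite eq_sym ne mul0r.
Qed.
Lemma sp_jn (k : 'I_r) (c : P -> R) : jn (\sum_a c a *: e a) k = \sum_a c a * jn (e a) k.
Proof. by rewrite linear_sum sum_ffunE; apply: eq_bigr => a _; rewrite linearZ !ffunE. Qed.

Definition sp : pdat R.
Proof.
refine (@Pdat R A sp_deg sp_e sp_b _ _ _ _ _ _).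
- by move=> [k|a] [l|b] //= ne; apply: pe_deg; move: ne; rewrite (inj_eq (addIr 1)).
- move=> [k|a] [l|b] //= ne; last by apply: pb_deg; move: ne; rewrite (inj_eq (addIr 1)).
  rewrite (pr_e0 he) ?linear0 ?ffunE //; apply: contra ne => /eqP ->; by rewrite add0r.
- move=> [k|a] [l|c]; rewrite big_sumType /=.
  + by rewrite sp_delta big1 ?addr0 // => b _; rewrite mul0r.
  + by rewrite !big1 ?addr0 // => b _; rewrite ?mul0r ?mulr0.
  + by rewrite !big1 ?addr0 // => b _; rewrite ?mul0r ?mulr0.
  + by rewrite big1 ?add0r ?pee // => b _; rewrite mul0r.
- move=> [k|a] [l|c]; rewrite big_sumType /=.
  + by rewrite !big1 ?addr0 // => b _; rewrite ?mul0r ?mulr0.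
  + by rewrite (sp_delta k (fun l => jn (e c) l)) big1 ?addr0 // => b _; rewrite mul0r.
  + by rewrite !big1 ?addr0 // => b _; rewrite ?mul0r ?mulr0.
  + by rewrite big1 ?add0r ?peb // => b _; rewrite mul0r.
- move=> [k|a] [l|c]; rewrite big_sumType /=.
  + by rewrite !big1 ?addr0 // => b _; rewrite ?mul0r ?mulr0.
  + rewrite big1 ?add0r => [|b _]; last by rewrite mul0r.
    by rewrite -(pr_ee he c) sp_jn; apply: eq_bigr => b _; rewrite mulrC.
  + by rewrite !big1 ?addr0 // => b _; rewrite ?mul0r ?mulr0.
  + by rewrite big1 ?add0r ?pbe // => b _; rewrite mul0r.
- move=> [k|a] [l|c]; rewrite big_sumType /=.
  + by rewrite !big1 ?addr0 // => b _; rewrite ?mul0r ?mulr0.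
  + rewrite big1 ?add0r => [|b _]; last by rewrite mul0r.
    transitivity (jn 0 k : R); last by rewrite linear0 ffunE.
    by rewrite -(pr_eb he c) sp_jn; apply: eq_bigr => b _; rewrite mulrC.
  + by rewrite !big1 ?addr0 // => b _; rewrite ?mul0r ?mulr0.
  + by rewrite big1 ?add0r ?pbb // => b _; rewrite mul0r.
Defined.

Definition sp_aug (x : sp) : M := if x is inl k then g k else 0.

Definition sp_l (z : fgc sp) : fmod R r := [ffun k => z (inl k)].
Definition sp_r (z : fgc sp) : fgc P := [ffun a => z (inr a)].
Definition sp_mk (v : fmod R r) (w : fgc P) : fgc sp := [ffun x => match x with inl k => v k | inr a => w a end].

Lemma sp_ext (z z' : fgc sp) : sp_l z = sp_l z' -> sp_r z = sp_r z' -> z = z'.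
Proof.
move=> hl hr; apply/ffunP => -[k|a].
  by have := congr1 (fun v : {ffun 'I_r -> R^o} => v k) hl; rewrite !ffunE.
by have := congr1 (fun v : {ffun P -> R^o} => v a) hr; rewrite !ffunE.
Qed.

Lemma sp_augE (z : fgc sp) : \sum_x (z x : R) *: sp_aug x = fmap g (sp_l z).
Proof.
rewrite big_sumType /= [X in _ + X]big1 ?addr0 => [|a _]; last by rewrite scaler0.
by apply: eq_bigr => k _; rewrite ffunE.
Qed.

Lemma sp_act_r (z : fgc sp) : sp_r (act (@pe _ sp) z) = act (@pe _ P) (sp_r z).
Proof.
apply/ffunP => a; rewrite !ffunE big_sumType /= big1 ?add0r => [|k _]; last exact: scale0r.
by apply: eq_bigr => b _; rewrite ffunE.
Qed.
Lemma sp_act_l (z : fgc sp) : sp_l (act (@pe _ sp) z) = sp_l z.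
Proof.
apply/ffunP => k; rewrite !ffunE big_sumType /= [X in _ + X]big1 ?addr0 => [|a _]; last exact: scale0r.
exact: (sp_delta k (fun l => z (inl l))).
Qed.

Lemma sp_d_r (z : fgc sp) : sp_r (gd z) = gd (sp_r z).
Proof.
apply/ffunP => a; rewrite !ffunE big_sumType /= big1 ?add0r => [|k _]; last exact: scale0r.
by apply: eq_bigr => b _; rewrite ffunE.
Qed.
Lemma sp_d_l (z : fgc sp) : sp_l (gd z) = jn (peps e (sp_r z)).
Proof.
apply/ffunP => k; rewrite sp_jn !ffunE big_sumType /= big1 ?add0r => [|l _]; last exact: scale0r.
by apply: eq_bigr => b _; rewrite ffunE -[LHS]/(_ * _) mulrC.
Qed.

Lemma sp_gr_r i (z : fgc sp) : gr i z -> gr (i - 1) (sp_r z).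
Proof.
move=> [hz ez]; split=> [a ne|]; last by rewrite -sp_act_r ez.
rewrite ffunE hz //; apply: contra ne => /eqP <-; by rewrite /= addrK.
Qed.
Lemma sp_gr_l i (z : fgc sp) : i != 0 -> gr i z -> sp_l z = 0.
Proof. by move=> ne [hz _]; apply/ffunP => k; rewrite !ffunE hz // eq_sym. Qed.
Lemma sp_gr_mk i (w : fgc P) : gr i w -> gr (i + 1) (sp_mk 0 w).
Proof.
move=> [hw ew]; split=> [[k|a] ne|]; rewrite ?ffunE //.
  by rewrite hw //; move: ne; rewrite (inj_eq (addIr 1)).
apply: sp_ext; first by rewrite sp_act_l.
rewrite sp_act_r; have -> : sp_r (sp_mk 0 w) = w by apply/ffunP => a; rewrite !ffunE.
exact: ew.
Qed.
Lemma sp_rK v w : sp_r (sp_mk v w) = w.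
Proof. by apply/ffunP => a; rewrite !ffunE. Qed.
Lemma sp_lK v w : sp_l (sp_mk v w) = v.
Proof. by apply/ffunP => a; rewrite !ffunE. Qed.

Lemma sp_pres : pres sp_aug n.+1%:Z.
Proof.
have [injj surjg exg] := hs.
have neg0 (w : fgc P) i : i < 0 -> gr i w -> w = 0 by exact: (pres_neg he).
have r0 (z : fgc sp) : gr 0 z -> sp_r z = 0 by move=> hz; apply: (neg0 _ (0 - 1)) => //; exact: sp_gr_r.
split.
- by move=> [k|a] //=; have := pr_ge0 he a; lia.
- by move=> [k|a] //=; have := pr_le he a; lia.
- by move=> [k|a] //=; rewrite eqxx.
- move=> [l|b]; rewrite big_sumType /= [X in _ + X]big1 ?addr0; try by move=> a _; rewrite scaler0.
    rewrite (bigD1 l) //= eqxx scale1r big1 ?addr0 // => k /negPf ->; exact: scale0r.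
  by rewrite big1 // => k _; exact: scale0r.
- move=> [l|b]; rewrite big_sumType /= [X in _ + X]big1 ?addr0; try by move=> a _; rewrite scaler0.
    by rewrite big1 // => k _; exact: scale0r.
  by rewrite -[LHS]/(fmap g (jn (e b))); apply/exg; exists (e b).
- move=> y; have [v hv] := surjg y; exists (sp_mk v 0); last by rewrite sp_augE sp_lK.
  split=> [[k|a] //= ne|]; rewrite ?ffunE //.
  by apply: sp_ext; rewrite ?sp_act_l // sp_act_r sp_rK act0.
- move=> z hz; rewrite sp_augE => /exg[y hy]; have [w hw ew] := pr_surj he y.
  exists (sp_mk 0 w); first exact: sp_gr_mk.
  have dw : gd w = 0 by apply: (neg0 _ (0 - 1)) => //; exact: gr_d.
  by apply: sp_ext; rewrite ?sp_d_l ?sp_d_r sp_rK ?dw ?r0 // -hy /= ew.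
- move=> i i0 z [hz dz]; have gw := sp_gr_r hz; have l0 := sp_gr_l (lt0r_neq0 i0) hz.
  have dw : gd (sp_r z) = 0 by rewrite -sp_d_r dz; apply/ffunP => a; rewrite !ffunE.
  have ew : peps e (sp_r z) = 0.
    by apply: injj; rewrite -sp_d_l dz linear0; apply/ffunP => a; rewrite !ffunE.
  have [y hy dy] : gbd (i - 1) (sp_r z).
    have [i1|ne] := eqVneq i 1; first by subst i; apply: (pr_ex0 he).
    by apply: (pr_exn he); [lia|].
  exists (sp_mk 0 y); first by rewrite -{1}(subrK 1 i); exact: sp_gr_mk.
  apply: sp_ext; rewrite ?sp_d_l ?sp_d_r sp_rK ?dy // l0 /= big1 ?linear0 // => a _.
  have [e0|ne] := eqVneq (pdeg a) 0; last by rewrite (pr_e0 he) ?scaler0.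
  by have [+ _] := hy; move=> /(_ a) ->; rewrite ?scale0r // subrK e0 eq_sym lt0r_neq0.
Qed.
End Splice.

Section Existence.
Variable Q : lmodType R -> Prop.
Hypothesis Qker : forall (K F M : lmodType R) (i : {linear K -> F}) (p : {linear F -> M}),
  ses i p -> Q F -> Q M -> Q K.
Hypothesis Qsum : forall r (F : lmodType R), Q F -> Q (F * fmod R r)%type.
Hypothesis Qbas : forall M, Q M -> finitely_generated M -> has_dual_basis M.
Hypothesis noeth : noetherian R.

(** The syzygy of a finite free cover is finitely generated, and of smaller length by [schanuel];
    the last one lies in [Q], where [Qbas] provides a dual basis. *)
Lemma qdim_pres (n : nat) M : finitely_generated M -> qdim Q n M -> exists P (e : P -> M), pres e n%:Z.
Proof.
elim: n M => [|n IHn] M fM hM.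
  have [m [x [xi hx]]] := Qbas hM fM.
  by exists (bs hx), x; exact: bs_pres.
have [r [g hg]] := fM; have surj y : exists x, fmap g x = y.
  by have [a ->] := hg y; exists [ffun k => a k]; apply: eq_bigr => k _; rewrite ffunE.
have [K [j hs]] := ses_ker surj; have [injj _ exj] := hs.
have [|P [e he]] := IHn K _ (schanuel Qker Qsum hs hM); last first.
  by do 2 eexists; exact: (sp_pres hs he).
have [s [c [hc hrel]]] := noether_relations g noeth.
have /choice[k hk] : forall t, exists k, j k = [ffun i => c t i].
  by move=> t; apply/exj; rewrite -[RHS](hc t); apply: eq_bigr => i _; rewrite ffunE.
exists s, k => x; have [|b hb] := hrel (fun i : 'I_r => j x i).
  by rewrite -[LHS]/(fmap g (j x)); apply/exj; exists x.
exists b; apply: injj; apply/ffunP => i; rewrite hb linear_sum sum_ffunE.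
by apply: eq_bigr => t _; rewrite linearZ !ffunE hk ffunE.
Qed.
End Existence.

Lemma sum_enum (V : nmodType) (B : finType) (f : B -> V) : \sum_(k < #|B|) f (enum_val k) = \sum_b f b.
Proof. by rewrite [RHS](reindex _ (onW_bij _ (enum_val_bij _))). Qed.

Lemma mod_dichotomy_fin (m : R -> Prop) (A B : finType) (Mx : A -> B -> R) : maximal_ideal m ->
  (exists2 p : B -> R, exists k, ~ m (p k) & forall a, m (\sum_k Mx a k * p k)) \/
  exists r : B -> A -> R, forall k l, m (\sum_a r k a * Mx a l - (k == l)%:R).
Proof.
move=> hm; have [[p [k pk] hp]|[r hr]] := mod_dichotomy hm (fun a (k : 'I_#|B|) => Mx a (enum_val k)).
  left; exists (fun b => p (enum_rank b)); first by exists (enum_val k); rewrite enum_valK.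
  move=> a; rewrite -sum_enum; under eq_bigr do rewrite enum_valK; exact: hp.
right; exists (fun b => r (enum_rank b)) => k l.
by have := hr (enum_rank k) (enum_rank l); rewrite (inj_eq enum_rank_inj) !enum_rankK.
Qed.

Lemma nakayama_fin (m : R -> Prop) (V : lmodType R) (B : finType) (g : B -> V) (W : V -> Prop) :
  is_ideal m -> submod W ->
  (forall k, exists2 a : B -> R, (forall l, m (a l)) & W (g k - \sum_l a l *: g l)) ->
  exists2 s, m (1 - s) & forall k, W (s *: g k).
Proof.
move=> hI hW h; have [k|s hs1 hs2] := @nakayama R m V #|B| (g \o enum_val) W hI hW.
  have [a ha hWa] := h (enum_val k); exists (a \o enum_val); first by move=> l; exact: ha.
  by rewrite (_ : \sum_l _ = \sum_l a l *: g l) //; exact: (sum_enum (fun l => a l *: g l)).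
by exists s => // k; have := hs2 (enum_rank k); rewrite /= enum_rankK.
Qed.

(* An injection of projective modules which stays injective modulo every
   maximal ideal splits. *)
Lemma kernel_or_split (A : finType) (E D : A -> A -> R) :
  (forall a c, \sum_b E a b * E b c = E a c) -> (forall a c, \sum_b D a b * E b c = D a c) ->
  (exists m (p : A -> R) (a0 : A), [/\ maximal_ideal m, forall a, \sum_b E a b * p b = p a,
     forall a, m (\sum_b D a b * p b) & ~ m (p a0)]) \/
  exists r : A -> A -> R, forall a b, \sum_c r a c * D c b = E a b.
Proof.
move=> EE DE; have [hno|hno] := pselect (exists m (p : A -> R) (a0 : A), [/\ maximal_ideal m,
  forall a, \sum_b E a b * p b = p a, forall a, m (\sum_b D a b * p b) & ~ m (p a0)]); first by left.
right.
have mulm (X Y Z : A -> A -> R) (q : A -> R) a : (forall a c, \sum_b X a b * Y b c = Z a c) ->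
    \sum_b X a b * \sum_c Y b c * q c = \sum_b Z a b * q b.
  move=> h; under eq_bigr do rewrite mulr_sumr; rewrite exchange_big; apply: eq_bigr => c _.
  by rewrite -h mulr_suml; apply: eq_bigr => b _; rewrite mulrA.
have del (a : A) (f : A -> R) : \sum_b (a == b)%:R * f b = f a.
  by rewrite (bigD1 a) //= eqxx mul1r big1 ?addr0 // => b /negPf ne; rewrite eq_sym ne mul0r.
(* The row space of D. A splitting amounts to the rows of E lying in it, which can be checked at
   each maximal ideal. *)
pose W (v : {ffun A -> R^o}) := exists c : A -> R, forall b, v b = \sum_a c a * D a b.
have hW : submod W.
  split; first by exists (fun=> 0) => b; rewrite ffunE big1 // => a _; rewrite mul0r.
  move=> s x y [c hc] [d hd]; exists (fun a => s * c a + d a) => b.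
  rewrite !ffunE hc hd -[s *: _]/(s * _) mulr_sumr -big_split; apply: eq_bigr => a _ /=; ring.
pose row a : {ffun A -> R^o} := [ffun b => E a b].
have rowW a : W (row a).
  apply: (local_global hW) => m hm; have hI := maximal_is_ideal hm.
  (* The rows of 1 - E stacked under D force a vector killed modulo m to lie in the image of E
     modulo m. *)
  pose Mx (t : (A + A)%type) k : R := match t with
    | inl c => D c k | inr c => (c == k)%:R - E c k end.
  have [[p [k pk] hp]|[r hr]] := mod_dichotomy_fin Mx hm.
    exfalso; apply: hno; exists m, (fun a => \sum_b E a b * p b), k; split=> //.
    - by move=> c; exact: mulm.
    - by move=> c; rewrite (mulm _ _ _ _ _ DE); exact: (hp (inl c)).
    - move=> mk; apply: pk; have := hp (inr k); rewrite /=.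
      under eq_bigr do rewrite mulrBl.
      rewrite sumrB del => h; rewrite -[p k](subrK (\sum_b E k b * p b)).
      exact: (idealD hI).
  (* N has its rows in [W] and turns out congruent to E modulo m. As E - N = (E - N) E, the rows of
     E satisfy modulo [W] the hypothesis of Nakayama's lemma. *)
  pose N k l := \sum_c r k (inl c) * D c l.
  have NE k l : \sum_b N k b * E b l = N k l.
    under eq_bigr do rewrite mulr_suml; rewrite exchange_big; apply: eq_bigr => c _ /=.
    by rewrite -DE mulr_sumr; apply: eq_bigr => b _; rewrite mulrA.
  have hN k l : m (E k l - N k l).
    have : m (\sum_b (\sum_t r k t * Mx t b - (k == b)%:R) * E b l).
      apply: (ideal_sum (P := predT) hI) => b _; rewrite mulrC; apply: (idealM _ hI); exact: hr.
    have -> : \sum_b (\sum_t r k t * Mx t b - (k == b)%:R) * E b l = N k l - E k l.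
      under eq_bigr do rewrite mulrBl big_sumType mulrDl.
      rewrite sumrB big_split /= del NE [X in _ + X - _](_ : _ = 0) ?addr0 //.
      under eq_bigr do rewrite mulr_suml; rewrite exchange_big big1 // => c _ /=.
      under eq_bigr do rewrite -mulrA mulrBl.
      by rewrite -mulr_sumr sumrB EE del subrr mulr0.
    by rewrite -opprB => h; rewrite -[_ - _]opprK; exact: (idealN hI).
  have [k|s hs1 hs2] := @nakayama_fin m _ A row W hI hW; last first.
    by exists s => //; exact: (maximal_notin1 hm).
  exists (fun l => E k l - N k l) => //; exists (fun c => r k (inl c)) => b.
  rewrite !ffunE sum_ffunE -/(N k b).
  have -> : \sum_l ((E k l - N k l) *: row l : {ffun A -> R^o}) b = E k b - N k b.
    rewrite -[in RHS]EE -[in RHS]NE -sumrB; apply: eq_bigr => l _.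
    by rewrite !ffunE -[LHS]/(_ * _) mulrBl.
  by rewrite subKr.
have /choice[r hr] := rowW.
by exists r => a b; rewrite -hr ffunE.
Qed.

Section Top.
Variables (M : lmodType R) (P : pdat R) (e : P -> M) (n : int).
Hypothesis he : pres e n.

(** [kernel_or_split] is applied to the differential out of the top module; a splitting would
    shorten the resolution. *)
Lemma pres_top : ~ has_resolution M (@projective R) (n - 1) ->
  exists m (p : P -> R) (a0 : P), [/\ maximal_ideal m, forall a, pdeg a != n -> p a = 0,
    forall a, \sum_b pe a b * p b = p a, forall a, m (\sum_b pb a b * p b) & ~ m (p a0)].
Proof.
move=> hn.
pose E (a b : P) := if pdeg a == n then pe a b else 0 : R.
pose D (a b : P) := if pdeg b == n then pb a b else 0 : R.
have Enb a b : pdeg b != n -> E a b = 0.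
  by move=> ne; rewrite /E; case: eqP => // an; rewrite pe_deg // an eq_sym.
have EE a c : \sum_b E a b * E b c = E a c.
  rewrite {1 3}/E; case: eqP => [an|_]; last by rewrite big1 // => b _; rewrite mul0r.
  rewrite -pee; apply: eq_bigr => b _; rewrite /E; case: eqP => // /eqP bn.
  by rewrite (@pe_deg _ _ a b) ?mul0r // an eq_sym.
have DE a c : \sum_b D a b * E b c = D a c.
  rewrite {2}/D; case: eqP => [cn|/eqP cn]; last by rewrite big1 // => b _; rewrite Enb ?mulr0.
  rewrite -pbe; apply: eq_bigr => b _; rewrite /D /E; case: eqP => // /eqP bn.
  by rewrite (@pe_deg _ _ b c) ?mulr0 // cn.
have [[m [p [a0 [hm pE pD pa]]]]|[r hr]] := kernel_or_split EE DE.
  have p0 a : pdeg a != n -> p a = 0.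
    by move=> an; rewrite -pE big1 // => b _; rewrite /E (negPf an) mul0r.
  exists m, p, a0; split=> // a.
    have [an|an] := eqVneq (pdeg a) n; first by rewrite -[RHS]pE; apply: eq_bigr => b _; rewrite /E an eqxx.
    rewrite p0 // big1 // => b _; have [bn|bn] := eqVneq (pdeg b) n; last by rewrite p0 ?mulr0.
    by rewrite pe_deg ?mul0r // bn.
  have := pD a; rewrite (eq_bigr (fun b => pb a b * p b)) // => b _; rewrite /D.
  by case: eqP => // /eqP bn; rewrite p0 // !mulr0.
exfalso; apply/hn/(pres_shorten he (r := fun a c => if pdeg c == n - 1 then r a c else 0)).
move=> a an b; have [bn|bn] := eqVneq (pdeg b) n.
  transitivity (E a b); last by rewrite /E an eqxx.
  rewrite -hr; apply: eq_bigr => c _; rewrite /D bn eqxx; case: eqP => // /eqP cn.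
  rewrite pb_deg ?mulr0 // bn; apply: contra cn => /eqP <-; by rewrite addrK.
rewrite pe_deg 1?eq_sym ?an // big1 // => c _; case: eqP => [cn|_]; last by rewrite mul0r.
by rewrite pb_deg ?mulr0 // cn subrK eq_sym.
Qed.
End Top.

Lemma pres_psupp (S : comPzRingType) (phi : {rmorphism R -> S}) P (e : P -> restr phi) n :
  mSpec_sub_image phi -> pres e n -> psupp P.
Proof.
move=> hphi he m hm; have [q [hq q1 _] mq] := hphi m hm; have hI := maximal_is_ideal hm.
have [p [p_deg p_e] ep] := pr_surj he (1 : S).
have dp : gd (p : fgc P) = 0.
  by apply: (pres_neg he (i := 0 - 1)) => //; exact: (@gr_d _ (fgc P) 0 p (conj p_deg p_e)).
(* The vectors that are boundaries modulo m. If [p], a lift of 1, were one of them, 1 would be a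
   combination of the [e a] with coefficients in m, and so lie in the prime [q] over m. *)
pose W (v : {ffun P -> R^o}) := exists2 y : fgc P, gr 1 y &
  forall a, m (v a - (gd y : {ffun P -> R^o}) a).
have hW : submod W.
  split.
    exists 0; first exact: (submod0 (@gr_sub _ _ _)).
    by move=> a; rewrite linear0 ffunE subr0; case: hI.
  move=> c u v [y hy hu] [z hz hv]; exists (c *: y + z); first exact: ((@gr_sub _ _ 1).2 _ _ _ hy hz).
  move=> a; rewrite linearP !ffunE.
  rewrite (_ : _ - _ = c * (u a - (gd y : {ffun P -> R^o}) a) + (v a - (gd z : {ffun P -> R^o}) a)).
    by apply: (idealD hI) => //; apply: (idealM _ hI).
  rewrite !ffunE -[c *: u a]/(c * u a) -[_ *: \sum_b _]/(c * _); ring.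
have Wm (v : {ffun P -> R^o}) : (forall a, m (v a)) -> W v.
  move=> hv; exists 0; first exact: (submod0 (@gr_sub _ _ _)).
  by move=> a; rewrite linear0 ffunE subr0.
have Wp : ~ W p.
  move=> [y hy h]; apply: q1.
  have -> : (1 : S) = \sum_a ((p a : R) - (gd y : {ffun P -> R^o}) a) *: e a.
    under eq_bigr do rewrite scalerBl.
    rewrite sumrB ep; have := peps_d he y; rewrite -[peps e _]/(\sum_a ((gd y : {ffun P -> R^o}) a : R) *: e a) => ->.
    by rewrite subr0.
  apply: (big_ind q); [by case: hq|by case: hq|move=> a _].
  rewrite -[_ *: e a]/(phi _ * (e a : S)) mulrC; case: hq => _ _; apply.
  by have := h a; rewrite mq.
have [s [sW sp']] := mod_separation hm hW Wm Wp.
exists p, (fun a => if pdeg a == 0 then s a else 0); split.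
- by move=> a; have := congr1 (fun v : {ffun P -> R^o} => v a) dp; rewrite !ffunE.
- by move=> a; rewrite -[RHS](congr1 (fun v : {ffun P -> R^o} => v a) p_e) ffunE.
- by split=> a ne; [exact: p_deg|rewrite (negPf ne)].
- move=> b; have [b1|b1] := eqVneq (pdeg b) 1; last first.
    rewrite big1 => [|a _]; first by case: hI.
    case: eqP => [a0|_]; last by rewrite mul0r.
    by rewrite pb_deg ?mulr0 // a0 eq_sym.
  have := sW (gd (pcol b : fgc P)) _; rewrite (eq_bigr (fun a => (if pdeg a == 0 then s a else 0) * pb a b)).
    apply; exists (pcol b); first by rewrite -b1; exact: pcol_gr.
    by move=> a; rewrite subrr; case: hI.
  move=> a _; rewrite ffunE (_ : \sum_c _ = pb a b); last first.
    by rewrite -pbe; apply: eq_bigr => c _; rewrite ffunE.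
  by case: eqP => // /eqP a0; rewrite pb_deg ?mulr0 ?mul0r // b1 -[1]add0r (inj_eq (addIr 1)).
- rewrite (eq_bigr (fun a => s a * p a)) // => a _; case: eqP => // /eqP a0.
  by rewrite p_deg // !mulr0.
Qed.
End FiniteResolution.

(** * Lowest homology and infima *)

Section InfimumBounds.
Local Open Scope classical_set_scope.
Local Open Scope order_scope.

Lemma infimum_lower (x0 c : \bar int) (A : set (\bar int)) :
  A !=set0 -> infimums A c -> infimum x0 A = c.
Proof.
move=> /set0P/negPf A0 hc; rewrite /infimum A0; apply: xget_unique => // y hy.
exact: (is_subset1_infimums hy hc).
Qed.

Lemma infimum_min (x0 c : \bar int) (A : set (\bar int)) :
  A c -> (forall y, A y -> c <= y) -> infimum x0 A = c.
Proof.
move=> Ac hc; apply: infimum_lower; first by exists c.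
by split=> // y; apply.
Qed.

Lemma supremum_max (x0 c : \bar int) (A : set (\bar int)) :
  A c -> (forall y, A y -> y <= c) -> supremum x0 A = c.
Proof.
move=> Ac hc; rewrite /supremum; have /set0P/negPf -> : A !=set0 by exists c.
apply: xget_unique => [|y hy]; first by split=> // y; apply.
by apply: is_subset1_supremums hy _; split=> // z; apply.
Qed.
End InfimumBounds.

Section HomologyBounds.
Variable R : comPzRingType.
Implicit Types (X Y : complex R) (c i n : int).

Definition hbot X c := (forall i, i < c -> hvan X i) /\ ~ hvan X c.

Lemma hbotE X c : hbot X c -> hinf X = (c%:E)%E.
Proof.
move=> [below nz]; apply: infimum_min.
  by exists c => //; apply: contrapT => h; apply/nz/hvanP.
move=> _ [i hi <-]; rewrite lee_fin leNgt; apply/negP => /below/hvanP; exact.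
Qed.

Lemma acyclic_hinf X : acyclic X -> hinf X = (+oo)%E.
Proof.
move=> h; rewrite /hinf (_ : [set _ | _ in _]%classic = set0); first by rewrite /infimum eqxx.
by rewrite predeqE => y; split=> // -[i /h].
Qed.

Lemma hbot_exists X a i : (forall j, j < a -> hvan X j) -> ~ hvan X i ->
  exists2 c, hbot X c & c <= i.
Proof.
move=> ha hi; have ai : a <= i by rewrite leNgt; apply/negP => /ha.
have hex : exists k : nat, `[< ~ hvan X (a + k%:Z) >].
  by exists (absz (i - a)); apply/asboolP; have -> : a + (absz (i - a))%:Z = i by lia.
case: (ex_minnP hex) => k /asboolP hk kmin; exists (a + k%:Z).
  split=> // j jk; have [ja|aj] := ltP j a; first exact: ha.
  apply: contrapT => hj; have := kmin (absz (j - a)).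
  have e : a + (absz (j - a))%:Z = j by lia.
  by rewrite e => /(_ (introT (asboolP _) hj)); lia.
have := kmin (absz (i - a)); have e : a + (absz (i - a))%:Z = i by lia.
by rewrite e => /(_ (introT (asboolP _) hi)); lia.
Qed.

Lemma acyclicP X : acyclic X <-> forall i, hvan X i.
Proof. by split=> h i; apply/hvanP; exact: h. Qed.

Lemma hbot_or_acyclic X : homologically_bounded X -> acyclic X \/ exists c, hbot X c.
Proof.
move=> /boundedP[[a ha] _]; have [/acyclicP h|/existsNP[i hi]] := pselect (forall i, hvan X i); first by left.
by right; have [c hc _] := hbot_exists ha hi; exists c.
Qed.

Lemma hamp0_van X c : homologically_bounded X -> hbot X c -> hamp X = 0%E ->
  forall i, i != c -> hvan X i.
Proof.
move=> /boundedP[_ [b hb]] hc; rewrite /hamp (hbotE hc) => hs i ne; apply: contrapT => hi.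
have ci : c <= i by rewrite leNgt; apply/negP => /hc.1.
have ib : i <= b by rewrite leNgt; apply/negP => /hb.
have hex : exists k : nat, `[< ~ hvan X (b - k%:Z) >].
  by exists (absz (b - i)); apply/asboolP; have -> : b - (absz (b - i))%:Z = i by lia.
case: (ex_minnP hex) => k /asboolP hk kmin.
have ubk j : ~ hvan X j -> j <= b - k%:Z.
  move=> hj; have jb : j <= b by rewrite leNgt; apply/negP => /hb.
  have := kmin (absz (b - j)); have e : b - (absz (b - j))%:Z = j by lia.
  by rewrite e => /(_ (introT (asboolP _) hj)); lia.
have sE : hsup X = ((b - k%:Z)%:E)%E.
  apply: supremum_max.
    by exists (b - k%:Z) => //; apply: contrapT => h; apply/hk/hvanP.
  by move=> _ [j hj <-]; rewrite lee_fin; apply: ubk => /hvanP.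
move: hs; rewrite sE -EFinB => -[e].
have := ubk _ hi; have := ubk _ hc.2; lia.
Qed.
End HomologyBounds.

Lemma hbot_eq (R S : comPzRingType) (X : complex R) (Y : complex S) c :
  (forall i, hvan X i <-> hvan Y i) -> hbot X c -> hbot Y c.
Proof. by move=> h [h1 h2]; split=> [i /h1/h|/h]. Qed.

Lemma hinf_eq (R S : comPzRingType) (X : complex R) (Y : complex S) :
  (forall i, hvan X i <-> hvan Y i) -> hinf X = hinf Y.
Proof.
move=> h; rewrite /hinf; congr (infimum _ _); rewrite predeqE => y.
by split=> -[i hi <-]; exists i => //; apply: contrapT => /hvanP/h/hvanP.
Qed.

(** * Reflexivity through a fixed resolution *)

Section ReflexiveResolution.
Variables (R : comPzRingType) (C : complex R) (I : injective_resolution C).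
Implicit Types X : complex R.

Lemma ir_compare_homc (I2 : injective_resolution C) X :
  (exists h : chain_map (homc X I) (homc X I2), quasi_iso h) /\
  (quasi_iso (biduality X I) <-> quasi_iso (biduality X I2)).
Proof.
have [h qh] := resolution_compare I I2.
have KI := @ir_K_injective _ _ I; have KI2 := @ir_K_injective _ _ I2.
split; first by exists (post X h); exact: post_qis.
exact: (bidual_qis_target X KI KI2 qh).
Qed.

Lemma reflexiveE X : reflexive C X <-> reflexive_via I X.
Proof.
split=> [[I2 [hX hb hq]]|h]; last by exists I.
have [[h qh] hbid] := ir_compare_homc I2 X.
by split=> //; [apply/(qis_bounded qh)|apply/hbid].
Qed.

Lemma GdimE X : reflexive C X -> Gdim C X = (hinf C - hinf (homc X I))%E.
Proof.
move=> hr; rewrite /Gdim; case: pselect => // hr'; congr (_ - _)%E.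
have [[h qh] _] := ir_compare_homc (projT1 (cid hr')) X.
by apply: hinf_eq => i; rewrite (qis_hvan qh).
Qed.

Lemma Gdim_infty X : ~ reflexive C X -> Gdim C X = (+oo)%E.
Proof. by move=> h; rewrite /Gdim; case: pselect. Qed.

Lemma reflexive_source X Y (f : chain_map X Y) : quasi_iso f ->
  reflexive_via I X <-> reflexive_via I Y.
Proof.
move=> qf; have KI := @ir_K_injective _ _ I.
have hfi : homologically_finite X <-> homologically_finite Y.
  rewrite !hfiniteP; split=> -[hb hg]; split.
  - exact/(qis_bounded qf).
  - by move=> i; apply/(qis_fg qf).
  - exact/(qis_bounded qf).
  - by move=> i; apply/(qis_fg qf).
have hb := qis_bounded (pre_qis KI qf); have hq := bidual_qis_source KI qf.
by split=> -[h1 h2 h3]; split; [exact/hfi|exact/hb|exact/hq|exact/hfi|exact/hb|exact/hq].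
Qed.
End ReflexiveResolution.

Section TensorBounds.
Variables (R : comPzRingType) (P : pdat R) (Z : gcx R).
Implicit Types (a b n : int).

Lemma pdeg_bound : exists N : nat, forall x : P, (absz (pdeg x) <= N)%N.
Proof.
exists (\max_(x : P) absz (pdeg x))%N => x.
exact: (leq_bigmax (F := fun x : P => absz (pdeg x))).
Qed.

Lemma tcx_below a : (forall n, n < a -> gvan Z n) -> exists a', forall n, n < a' -> gvan (tcx P Z) n.
Proof.
move=> h; have [N hN] := pdeg_bound; exists (a - N%:Z) => n hn; apply: tvan => x; apply: h.
by have := hN x; lia.
Qed.
Lemma tcx_above b : (forall n, b < n -> gvan Z n) -> exists b', forall n, b' < n -> gvan (tcx P Z) n.
Proof.
move=> h; have [N hN] := pdeg_bound; exists (b + N%:Z) => n hn; apply: tvan => x; apply: h.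
by have := hN x; lia.
Qed.
End TensorBounds.

(** * Scalars annihilating the bottom homology of C *)

Section BottomHomology.
Variables (R : comPzRingType) (C : complex R) (I : injective_resolution C) (c : int).
Hypotheses (qh : quasi_iso (homothety (ir_map I))) (bot : forall i, i < c -> hvan I i).

(* The multiplication by s on I is null-homotopic: its restriction to the
   truncation T of I at c takes values in the acyclic subcomplex of I which is
   zero below c and consists of the boundaries in degree c. *)
Lemma annihilator_zero (s : R) : (forall i, c < i -> hvan I i) ->
  (forall z : I c, cycle z -> boundary (s *: z)) -> s = 0.
Proof.
move=> above ann; have KI := @ir_K_injective _ _ I.
pose N i (z : I i) : Prop := (i < c -> z = 0) /\ (i = c -> boundary z).
have hN i : submod (@N i).
  split; first by split=> _ //; exact: (submod0 (@boundary_sub _ _ _)).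
  move=> r x y [hx bx] [hy b_y]; split=> h; first by rewrite hx // hy // scaler0 addr0.
  by apply: (boundary_sub _ _).2; [exact: bx|exact: b_y].
have dN i j (x : I i) : N i x -> N j (cd I i j x).
  move=> [hx bx]; have [ij|ne] := eqVneq (j + 1) i; last first.
    by rewrite cd_shape //; exact: (submod0 (hN j)).
  split=> hj; last by subst i; exists x.
  have [ic|ci] := ltP i c; first by rewrite hx ?linear0.
  have ec : i = c by lia.
  have /boundary_cycle/(cycleE (k := j)) := bx ec; apply; lia.
have aN : acyclic (subc hN dN).
  apply/acyclicP => i; apply: subc_van => z [hz bz] cz.
  have [ic|ci] := ltP i c.
    by exists 0; [exact: (submod0 (hN _))|rewrite linear0 hz].
  have [y hy] : boundary z.
    by have [/bz//|ne] := eqVneq i c; apply: above => //; lia.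
  by exists y => //; split; lia.
pose T := subc_in (@tr_sub R I c) (@tr_d R I c).
have qT : quasi_iso T by exact: trunc_qis.
pose g : hom_deg _ I 0 := s *: elt T.
have bg : @boundary R (homc _ I) 0 g.
  apply: (@K_inj_factor R _ I N hN dN 0 g KI aN).
    by apply: (submodZ s (@cycle_sub _ _ _)); exact: elt_cycle.
  move=> i j x; have [e|ne] := eqVneq j i; last first.
    by rewrite hmap_shape ?addr0 //; exact: (submod0 (hN j)).
  subst j; rewrite /g hom_degZ eltE /=; have [hx cx] := smodP x; split=> hi.
    by rewrite hx // scaler0.
  by subst i; apply: ann; exact: cx.
(* Restriction to the truncation is injective on homology, so [s] is null-homotopic on all of I.
   Composed with C -> I, it becomes the image of [s] under the homothety. *)
have bid : @boundary R (homc I I) 0 (s *: elt (idc I)).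
  have [inj _] := pre_qis KI qT 0; apply: inj.
    by apply: (submodZ s (@cycle_sub _ _ _)); exact: elt_cycle.
  rewrite (_ : pre _ _ _ _ = g) //; apply: hom_deg_ext => i j; rewrite addr0 => -> x.
  by rewrite preE hom_degZ /g hom_degZ !eltE.
have [inj0 _] := qh 0.
have [y hy] : @boundary R (conc R^o) 0 (s : R^o).
  apply: inj0 => //.
  have := cmap_boundary (pre I (ir_map I)) bid.
  rewrite (_ : pre _ _ _ _ = homothety (ir_map I) 0 s) //.
  apply: hom_deg_ext => i j; rewrite addr0 => -> x.
  by rewrite preE hom_degZ eltE /= -[RHS]/(s *: elt (ir_map I) i i x) eltE.
by rewrite -hy.
Qed.
End BottomHomology.

(** Lets the isomorphisms built on a dual basis be stated for [P] itself. *)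
Lemma bpdat_cx (R : comPzRingType) (P : pdat R) : bpdat (cx_dbasis P) = P.
Proof.
have he := @cx_de R P; have hb := @cx_db R P.
case: P he hb => A d e b h1 h2 h3 h4 h5 h6 he hb; rewrite /bpdat.
have ext (e1 e2 b1 b2 : A -> A -> R) g1 g2 g3 g4 g5 g6 k1 k2 k3 k4 k5 k6 :
    e1 = e2 -> b1 = b2 -> @Pdat R A d e1 b1 g1 g2 g3 g4 g5 g6 = @Pdat R A d e2 b2 k1 k2 k3 k4 k5 k6.
  by move=> E1 E2; subst e2 b2; congr Pdat; apply: Prop_irrelevance.
by apply: ext; apply/funext => x; apply/funext => y; [exact: he|exact: hb].
Qed.

Lemma fgc_projective (R : comPzRingType) (P : pdat R) i : projective (cx (fgc P) i).
Proof.
move=> A B q f sq; pose D := cx_dbasis P.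
have /choice[t ht] : forall a : D, exists x, q x = f (dx a i) by [].
have gl : linear (fun z : cx (fgc P) i => \sum_(a : D) (dxi a i z : R) *: t a).
  move=> c x y; rewrite scaler_sumr -big_split; apply: eq_bigr => a _.
  by rewrite -[RHS]/(_ + _) dxiP; lincomb R.
exists (mklin gl) => z; rewrite [in RHS](dbE D z) !linear_sum; apply: eq_bigr => a _.
by rewrite !linearZ /= ht.
Qed.

(** * From flat dimension to a minimal projective resolution *)

Section ProjectiveDimension.
Variables (R : comPzRingType) (M : lmodType R).
Hypotheses (noeth : noetherian R) (fgM : finitely_generated M) (M0 : exists x : M, x <> 0).

Lemma resolution_ge0 (Q : lmodType R -> Prop) (n : int) : has_resolution M Q n -> 0 <= n.
Proof.
move=> [F [_ F0] [e qe]]; rewrite leNgt; apply/negP => n0; have [x x0] := M0; apply: x0.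
have [_ /(_ x erefl) [z _ [y]]] := qe 0.
by rewrite (F0 0 _ z) ?n0 ?orbT // linear0 subr0 /= => <-.
Qed.

(** Flat modules satisfy the equational criterion, so [qdim_pres] replaces a flat resolution by a
    projective one without increasing its length. If the minimal length is 0, length -1 is excluded
    because M is nonzero. *)
Lemma flat_dim_resolution : (flat_dim M < +oo)%E ->
  exists2 n : nat, has_resolution M (@projective R) n%:Z &
    ~ has_resolution M (@projective R) (n%:Z - 1).
Proof.
move=> fd; have [k hk] : exists k, has_resolution M (@flat R) k.
  apply: contrapT => h; move: fd; rewrite /flat_dim (_ : [set _ | _ in _]%classic = set0).
    by rewrite /infimum eqxx.
  by rewrite predeqE => y; split=> // -[k hk]; case: h; exists k.
have k0 := resolution_ge0 hk; have [F [QF F0] [e qe]] := hk.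
have [P [e' he']] := @qdim_pres R (@eqcrit R) (@eqcrit_ker R) (@eqcrit_sum R)
  (fun M => @eqcrit_dual_basis R M noeth) noeth (absz k) M fgM
  (@res_qdim R (@eqcrit R) (@eqcrit_ker R) (@eqcrit_free R) M F e k (fun i => flat_eqcrit (QF i)) F0 qe k0).
have hp : has_resolution M (@projective R) k.
  have ek : (absz k)%:Z = k by lia.
  rewrite ek in he'; have [f qf] := pres_qis he'.
  exists (cx (fgc P)); last by exists f.
  split; first by move=> i; exact: fgc_projective.
  move=> i /orP[lt|lt] x; apply: smod_eq => /=; first exact: (pres_neg he' lt (smodP x)).
  exact: (pres_big he' lt (smodP x)).
have hex : exists n : nat, `[< has_resolution M (@projective R) n%:Z >].
  by exists (absz k); apply/asboolP; have -> : (absz k)%:Z = k by lia.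
case: (ex_minnP hex) => n /asboolP hn nmin; exists n => // hn'.
have n0 := resolution_ge0 hn'; have := nmin (absz (n%:Z - 1)).
have e1 : (absz (n%:Z - 1))%:Z = n%:Z - 1 by lia.
by rewrite e1 => /(_ (introT (asboolP _) hn')); lia.
Qed.

(** A resolution of length [k] < n gives one of length n - 1 by padding with zero modules, so
    excluding n - 1 excludes all smaller lengths. *)
Lemma proj_dimE (n : nat) : has_resolution M (@projective R) n%:Z ->
  ~ has_resolution M (@projective R) (n%:Z - 1) ->
  proj_dim M = (n%:Z%:E)%E /\ exists (P : pdat R) (e : P -> M), pres e n%:Z.
Proof.
move=> hn hn'.
have pr (k : int) : has_resolution M (@projective R) k -> exists (P : pdat R) (e : P -> M), pres e (absz k)%:Z.
  move=> hk; have [F [QF F0] [e qe]] := hk.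
  exact: (@qdim_pres R (@projective R) (@projective_ker R) (@projective_sum R)
    (@projective_dual_basis R) noeth (absz k) M fgM
    (@res_qdim R (@projective R) (@projective_ker R) (@projective_free R) M F e k QF F0 qe
      (resolution_ge0 hk))).
split; last exact: (pr _ hn).
apply: infimum_min; first by exists n%:Z.
move=> _ [k hk <-]; rewrite lee_fin leNgt; apply/negP => lt; apply: hn'.
have k0 := resolution_ge0 hk; have [P [e' he']] := pr k hk.
have [f qf] := pres_qis he'; exists (cx (fgc P)); last by exists f.
split; first by move=> i; exact: fgc_projective.
move=> i hi x; apply: smod_eq => /=; have [i0|i0] := ltP i 0; first exact: (pres_neg he' i0 (smodP x)).
have ik : (absz k)%:Z < i by lia.
exact: (pres_big he' ik (smodP x)).
Qed.
End ProjectiveDimension.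

(** * Transfer of reflexivity and dimension between R and S *)

Section Transfer.
Variables (R S : comPzRingType) (phi : {rmorphism R -> S}).
Variables (C X : complex R) (IC : injective_resolution C) (IX : injective_resolution X).
Hypotheses (noeth : noetherian R) (fgC : homologically_degreewise_finite C)
  (fgX : homologically_degreewise_finite X) (sdC : semidualizing C).
Variables (P : pdat R) (e : P -> restr phi) (n : nat).
Hypotheses (he : pres e n%:Z) (suppP : psupp P).
Hypothesis ntop : ~ has_resolution (restr phi) (@projective R) (n%:Z - 1).
Hypothesis R1 : (1 : R) <> 0.
Local Notation C' := (coindc phi IC).
Local Notation X' := (coindc phi IX).
Local Notation Pc := (cx (fgc P)).
Local Notation D := (homc IX IC).
Local Notation D' := (homc X' C').
Let KI := @ir_K_injective _ _ IC.
Let KJ := @ir_K_injective _ _ IX.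
Let pge0 := pr_ge0 he.

Lemma coind_hom_iso (I : complex R) : K_injective I ->
  exists2 f : chain_map (rstc phi (coindc phi I)) (homc Pc I), quasi_iso f & True.
Proof.
move=> KI'; have [ep qep] := pres_qis he; exists (theta I ep) => //.
exact: theta_qis.
Qed.

Lemma hom_van Y i : hvan (homc Pc Y) i <-> gvan (tcx (pdual P) (G Y)) i.
Proof. by have := giso_van (hom_giso (cx_dbasis P) Y) i; rewrite bpdat_cx. Qed.
Lemma hom_fg Y i : H_fg (homc Pc Y) i <-> gfg (tcx (pdual P) (G Y)) i.
Proof. by have := giso_fg (hom_giso (cx_dbasis P) Y) i; rewrite bpdat_cx. Qed.

Lemma coind_van (I : complex R) i : K_injective I ->
  hvan (coindc phi I) i <-> gvan (tcx (pdual P) (G I)) i.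
Proof.
move=> KI'; have [f qf _] := coind_hom_iso KI'.
by rewrite -hom_van -(qis_hvan qf).
Qed.

Lemma coind_fg (I : complex R) i : K_injective I -> (forall i, H_fg I i) -> H_fg (coindc phi I) i.
Proof.
move=> KI' h; have [f qf _] := coind_hom_iso KI'; apply: (@rstc_fg R S phi).
apply/(qis_fg qf)/hom_fg; apply: tfg => // a; exact/G_fg.
Qed.

(** RHom_S(RHom_R(S, X), RHom_R(S, C)) is RHom_R(RHom_R(S, X), C) by adjunction, and the latter is P
    (x) RHom_R(X, C). *)
Lemma D'_van i : hvan D' i <-> gvan (tcx P (G D)) i.
Proof.
have [f qf _] := coind_hom_iso KJ.
have h1 := qis_hvan (@kappa_qis R S phi IC X') i.
have h2 := qis_hvan (pre_qis KI qf) i.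
have h3 := giso_van (D_giso IX IC (cx_dbasis P)) i; rewrite bpdat_cx in h3.
exact: (iff_trans h1 (iff_trans (iff_sym h2) h3)).
Qed.

Lemma bid'_qis : quasi_iso (biduality X' C') <-> quasi_iso (post Pc (biduality IX IC)).
Proof.
have [f qf _] := coind_hom_iso KJ.
have h1 := @coind_bidual R S phi IC X' KI; have h2 := bidual_qis_source KI qf.
exact: (iff_trans h1 (iff_trans h2 (bidual_hom IX IC (cx_dbasis P)))).
Qed.

Lemma reflexive_D : reflexive C X <->
  [/\ homologically_finite IX, homologically_bounded D & quasi_iso (biduality IX IC)].
Proof. exact: (iff_trans (reflexiveE IC X) (reflexive_source IC (ir_quasi_iso IX))). Qed.

(** Coinduction preserves K-injectivity, so [C'] is its own resolution over S. *)
Definition coind_ir : injective_resolution C' :=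
  InjectiveResolution (coind_K_injective KI) (@qis_id _ C').

Lemma reflexive_D' : reflexive C' X' <->
  [/\ homologically_finite X', homologically_bounded D' & quasi_iso (biduality X' C')].
Proof. exact: (reflexiveE coind_ir X'). Qed.

Lemma Gdim_D : reflexive C X -> Gdim C X = (hinf C - hinf D)%E.
Proof.
move=> h; rewrite (GdimE IC h); congr (_ - _)%E; apply: hinf_eq => i.
by rewrite (qis_hvan (pre_qis KI (ir_quasi_iso IX))).
Qed.

Lemma Gdim_D' : reflexive C' X' -> Gdim C' X' = (hinf C' - hinf D')%E.
Proof. exact: (GdimE coind_ir). Qed.

Lemma fgI i : H_fg IC i. Proof. exact/(qis_fg (ir_quasi_iso IC)). Qed.
Lemma fgJ i : H_fg IX i. Proof. exact/(qis_fg (ir_quasi_iso IX)). Qed.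

Lemma boundI : homologically_bounded IC.
Proof. by apply/(qis_bounded (ir_quasi_iso IC)); case: sdC => /hfiniteP[]. Qed.

Lemma reflexive_forward : reflexive C X -> reflexive C' X'.
Proof.
move=> /reflexive_D[/hfiniteP[bJ _] bD qb]; apply/reflexive_D'; split.
- apply/hfiniteP; split; last by move=> i; apply: coind_fg => //; exact: fgJ.
  have [[a ha] [b hb]] := (boundedP _).1 bJ; apply/boundedP; split.
    have [a' h] := tcx_below (pdual P) (fun k hk => (G_van IX k).1 (ha k hk)).
    by exists a' => i /h/(coind_van _ KJ).
  have [b' h] := tcx_above (pdual P) (fun k hk => (G_van IX k).1 (hb k hk)).
  by exists b' => i /h/(coind_van _ KJ).
- have [[a ha] [b hb]] := (boundedP _).1 bD; apply/boundedP; split.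
    have [a' h] := tcx_below P (fun k hk => (G_van D k).1 (ha k hk)).
    by exists a' => i /h/D'_van.
  have [b' h] := tcx_above P (fun k hk => (G_van D k).1 (hb k hk)).
  by exists b' => i /h/D'_van.
- by apply/bid'_qis; exact: (post_dbasis_qis (cx_dbasis P)).
Qed.

(** The order matters. Conservativity of Hom(P, -) bounds X below, which makes RHom(X, C) degreewise
    finite; conservativity of P (x) - then bounds RHom(X, C) below, which makes the bidual
    degreewise finite. Now conservativity applies to the fiber of the biduality map, and X becomes
    bounded above as it is isomorphic to its bidual. *)
Lemma reflexive_backward : reflexive C' X' -> reflexive C X.
Proof.
move=> /reflexive_D'[/hfiniteP[bX' _] bD' /bid'_qis/post_qisE qb].
have [[aI haI] [bI hbI]] := (boundedP _).1 boundI.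
have [[a ha] _] := (boundedP _).1 bX'.
have hJ i : i < a -> hvan IX i.
  move=> ia; apply/G_van; apply: (hom_conservative (b := a) noeth suppP) => //.
    by move=> k; apply/G_fg; exact: fgJ.
  by move=> k ka; apply/coind_van => //; exact: ha.
have fgD := homc_fg noeth KI hJ fgJ hbI fgI.
have [[b hb] _] := (boundedP _).1 bD'.
have hD i : i < b -> hvan D i.
  move=> ib; apply/G_van; apply: (tensor_conservative (b := b) noeth suppP) => //.
    by move=> k; apply/G_fg; exact: fgD.
  by move=> k kb; apply/D'_van; exact: hb.
have fgDD := homc_fg noeth KI hD fgD hbI fgI.
pose F := fib (biduality IX IC).
have aF : acyclic F.
  apply/acyclicP => i; apply/G_van.
  apply: (hom_conservative (b := i + 1) noeth suppP) => //; last by rewrite ltrDl.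
    by move=> k; apply/G_fg/fib_fg => //; exact: fgJ.
  by move=> k _; apply/hom_van; move: (qb k) => /hvanP.
have qbid := fib_qis aF.
have bJ : homologically_bounded IX.
  apply/(qis_bounded qbid)/boundedP; split.
    by exists a => i ia; apply/(qis_hvan qbid); exact: hJ.
  by exists (bI - b) => i; exact: (homc_van_above KI hD hbI).
apply/reflexive_D; split=> //.
  by apply/hfiniteP; split=> // i; exact: fgJ.
apply/boundedP; split; first by exists b.
by exists (bI - a) => i; exact: (homc_van_above KI hJ hbI).
Qed.

(** P has nonnegative degrees, so P (x) D has no homology below the infimum [d] of D; if it had none
    in degree [d] either, conservativity with the bound d + 1 would make H_d(D) vanish. *)
Lemma hinf_D' : reflexive C X -> hinf D' = hinf D.
Proof.
move=> hr; have /reflexive_D[/hfiniteP[bJ _] bD _] := hr.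
have [[a ha] _] := (boundedP _).1 bJ; have [_ [bI hbI]] := (boundedP _).1 boundI.
have fgD := homc_fg noeth KI ha fgJ hbI fgI.
have [aD|[d hd]] := hbot_or_acyclic bD.
  rewrite !acyclic_hinf //; apply/acyclicP => i; apply/D'_van; apply: tvan => x.
  by apply/G_van/hvanP; exact: aD.
rewrite (hbotE hd); apply: hbotE; have [h1 h2] := hd; split.
  by move=> i id; apply/D'_van; apply: tvan => x; apply/G_van/h1; have := pge0 x; lia.
move=> h; apply: h2; apply/G_van; apply: (tensor_conservative (b := d + 1) noeth suppP).
- by move=> k; apply/G_fg; exact: fgD.
- move=> k kd; have [->|ne] := eqVneq k d; first exact/D'_van.
  by apply: tvan => x; apply/G_van/h1; have := pge0 x; lia.
- by rewrite ltrDl.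
Qed.

Lemma C_not_acyclic : ~ acyclic C.
Proof.
move=> aC; have [_ [I2 qh]] := sdC; apply: R1.
have a2 : acyclic (homc C I2) by exact: ir_K_injective.
have /hvanP/(qis_hvan qh) h := a2 0.
by have [y] := h (1 : R^o) erefl; rewrite /= => <-.
Qed.

Lemma hbot_C : exists2 c, hbot IC c & hinf C = (c%:E)%E.
Proof.
have [aI|[c hc]] := hbot_or_acyclic boundI; last first.
  by exists c => //; rewrite -(hbotE hc); apply: hinf_eq => i; exact: (qis_hvan (ir_quasi_iso IC)).
exfalso; apply: C_not_acyclic => i; apply/hvanP/(qis_hvan (ir_quasi_iso IC))/hvanP; exact: aI.
Qed.

Lemma C'_van_below c : hbot IC c -> forall i, i < c - n%:Z -> hvan C' i.
Proof.
move=> [h _] i ic; apply/coind_van => //; apply: tvan => x; apply/G_van/h.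
by have := pr_le he x; rewrite /=; lia.
Qed.

(** The lower bound comes from the length of P, the upper one from conservativity with the bound c +
    1. *)
Lemma hbot_C' c : hbot IC c -> exists2 c', hbot C' c' & c - n%:Z <= c' <= c.
Proof.
move=> hc; have [i ic hi] : exists2 i, i <= c & ~ hvan C' i.
  apply: contrapT => hno; apply: hc.2; apply/G_van.
  apply: (hom_conservative (b := c + 1) noeth suppP) => //.
  - by move=> k; apply/G_fg; exact: fgI.
  - move=> k kc; apply/coind_van => //; apply: contrapT => hk; apply: hno.
    by exists k => //; lia.
  - by rewrite ltrDl.
have [c' hc' c'i] := hbot_exists (C'_van_below hc) hi.
exists c' => //; apply/andP; split; last exact: le_trans c'i ic.
by rewrite leNgt; apply/negP => /(C'_van_below hc); exact: hc'.2.
Qed.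

Lemma C'_bottom c : hbot IC c -> local_ring R \/ hamp C = 0%E -> ~ hvan C' (c - n%:Z).
Proof.
move=> hc hcase hv; have [m [p [a0 [hm p_deg p_e mp pa]]]] := pres_top he ntop.
have bot := @hom_bottom R P (G IC) n%:Z c m p a0 hm (pr_le he) p_deg p_e mp pa
  (fun k kc => (G_van IC k).1 (hc.1 k kc)) ((coind_van _ KI).1 hv).
have [s ms sz] := local_nakayama hm (@gcyc_sub _ (G IC) c) (@gbd_sub _ (G IC) c)
  ((G_fg IC c).1 (fgI c)) bot.
have ann (z : IC c) : cycle z -> boundary (s *: z).
  move=> cz; pose f := G_giso IC; have gz := giso_gr f z.
  have := sz (giso_to f z) _; rewrite -(giso_bd f); last exact: (submodZ _ (@gr_sub _ _ _)).
  rewrite linearZ giso_toK; apply; apply/(giso_cyc f gz); by rewrite giso_toK.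
have [hl|hamp0] := hcase.
  have [m0 [hm0 uniq]] := hl.
  have [u su] : exists u, u * s = 1.
    apply: contrapT => hno; pose J x := exists u, x = u * s.
    have hJ : is_ideal J.
      split; first by exists 0; rewrite mul0r.
      - by move=> _ _ [u ->] [v ->]; exists (u + v); rewrite mulrDl.
      - by move=> a _ [u ->]; exists (a * u); rewrite mulrA.
    have [|m1 hm1 J1] := exists_maximal hJ; first by move=> [u hu]; apply: hno; exists u.
    apply: ms; rewrite -(uniq _ hm) (uniq _ hm1); apply: J1; by exists 1; rewrite mul1r.
  apply: hc.2 => z cz; rewrite -[z]scale1r -su -scalerA.
  by apply: (submodZ _ (@boundary_sub _ _ _)); exact: ann.
have [_ [I2 qh]] := sdC.
have van2 i : hvan IC i <-> hvan I2 i.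
  exact: (iff_trans (iff_sym (qis_hvan (ir_quasi_iso IC) i)) (qis_hvan (ir_quasi_iso I2) i)).
have hcC : hbot C c by apply: hbot_eq hc => i; rewrite (qis_hvan (ir_quasi_iso IC)).
have bC : homologically_bounded C by case: sdC => /hfiniteP[].
have above i : c < i -> hvan I2 i.
  move=> ci; apply/van2/(qis_hvan (ir_quasi_iso IC)).
  by apply: (hamp0_van bC hcC hamp0); rewrite gt_eqF.
have ann2 (z : I2 c) : cycle z -> boundary (s *: z).
  move=> cz; have [h qh'] := resolution_compare IC I2; have [_ surj] := qh' c.
  have [w cw hw] := surj z cz.
  have -> : s *: z = s *: (z - h c w) + h c (s *: w) by rewrite linearZ /= -scalerDr subrK.
  apply: boundaryD; first by apply: (submodZ _ (@boundary_sub _ _ _)).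
  by apply: cmap_boundary; exact: ann.
have s0 := annihilator_zero qh (fun i ic => (van2 i).1 (hc.1 i ic)) above ann2.
by apply: ms; rewrite s0; case: (maximal_is_ideal hm).
Qed.

Lemma transfer :
  [/\ (Gdim C' X' <= Gdim C X)%E, (Gdim C X <= Gdim C' X' + n%:Z%:E)%E,
      reflexive C' X' <-> reflexive C X
    & local_ring R \/ hamp C = 0%E -> Gdim C X = (Gdim C' X' + n%:Z%:E)%E].
Proof.
have hiff : reflexive C' X' <-> reflexive C X.
  by split; [exact: reflexive_backward|exact: reflexive_forward].
have [hr|hr] := pselect (reflexive C X); last first.
  have hr' : ~ reflexive C' X' by move=> /hiff.
  by rewrite !Gdim_infty.
have hr' := hiff.2 hr; rewrite (Gdim_D hr) (Gdim_D' hr') (hinf_D' hr).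
have [c hc ->] := hbot_C; have [c' hc' /andP[c1 c2]] := hbot_C' hc; rewrite (hbotE hc').
have ceq : local_ring R \/ hamp C = 0%E -> c' = c - n%:Z.
  move=> /(C'_bottom hc) h; apply/eqP; rewrite eq_le c1 andbT leNgt; apply/negP => lt.
  by apply: h; exact: hc'.1.
(* The infimum is +oo if RHom(X, C) is acyclic; both dimensions are then -oo. *)
have [bD] : exists d : \bar int, hinf D = d /\ (d = +oo%E \/ exists k, d = (k%:E)%E).
  have /reflexive_D[_ bD _] := hr; have [aD|[d hd]] := hbot_or_acyclic bD.
    by exists +oo%E; split; [exact: acyclic_hinf|left].
  by exists (d%:E)%E; split; [exact: hbotE|right; exists d].
move=> [-> [->|[d ->]]]; first by split.
rewrite -!EFinB -!EFinD; split=> //.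
- by rewrite lee_fin; lia.
- by rewrite lee_fin; lia.
- by move=> /ceq ->; congr (_%:E)%E; lia.
Qed.
End Transfer.

(** * The zero ring *)

Section TrivialRing.
Variables (R : comPzRingType).
Hypothesis R0 : (1 : R) = 0.

Lemma trivial_eq0 (V : lmodType R) (x : V) : x = 0.
Proof. by rewrite -[x]scale1r R0 scale0r. Qed.
Lemma trivial_acyclic (X : complex R) : acyclic X.
Proof.
move=> i [z [_ bz]]; apply: bz; rewrite (trivial_eq0 z).
exact: (submod0 (@boundary_sub _ _ _)).
Qed.
Lemma trivial_bounded (X : complex R) : homologically_bounded X.
Proof. by exists 0%N => i _; exact: trivial_acyclic. Qed.
Lemma trivial_reflexive (C X : complex R) (I : injective_resolution C) : reflexive C X.
Proof.
exists I; split; last 2 first.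
- exact: trivial_bounded.
- by apply: bij_qis => i; [move=> x y _; rewrite [x]trivial_eq0 [y]trivial_eq0|
    move=> y; exists 0; rewrite [y]trivial_eq0 linear0].
apply/hfiniteP; split; first exact: trivial_bounded.
by move=> i; apply: hvan_fg; apply/hvanP; exact: trivial_acyclic.
Qed.
(** Both infima are +oo, and their difference is -oo by the convention of [\bar int]. *)
Lemma trivial_Gdim (C X : complex R) (I : injective_resolution C) : Gdim C X = (-oo)%E.
Proof.
rewrite (GdimE I (trivial_reflexive X I)) !acyclic_hinf //; exact: trivial_acyclic.
Qed.
End TrivialRing.

Theorem theorem5p8 (R S : comPzRingType) (phi : {rmorphism R -> S})
    (C X : complex R) (IC : injective_resolution C)
    (IX : injective_resolution X) :
  noetherian R -> noetherian S ->
  homologically_degreewise_finite C -> homologically_degreewise_finite X ->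
  semidualizing C ->
  module_finite phi -> (flat_dim (restr phi) < +oo)%E -> mSpec_sub_image phi ->
  let C' := coindc phi IC in
  let X' := coindc phi IX in
  [/\ (Gdim C' X' <= Gdim C X)%E,
      (Gdim C X <= Gdim C' X' + proj_dim (restr phi))%E,
      reflexive C' X' <-> reflexive C X
    & local_ring R \/ hamp C = 0%E ->
      Gdim C X = (Gdim C' X' + proj_dim (restr phi))%E].
Proof.
move=> noeth _ fgC fgX sdC mf fd hspec.
(* If R is zero, so is S, and both dimensions are -oo, which absorbs the projective dimension. *)
have [R0|R1] := eqVneq (1 : R) 0.
  have S0 : (1 : S) = 0 by rewrite -(rmorph1 phi) R0 rmorph0.
  have KI' := coind_ir phi IC.
  rewrite /= (trivial_Gdim R0 X IC) (trivial_Gdim S0 _ KI').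
  by split=> //; split=> _; [exact: (trivial_reflexive R0 X IC)|exact: (trivial_reflexive S0 _ KI')].
have R1' : (1 : R) <> 0 by apply/eqP.
(* R has a maximal ideal, and the prime of S lying over it omits 1. *)
have S1 : exists x : restr phi, x <> 0.
  have [||m hm _] := @exists_maximal R (fun x => x = 0); last first.
    have [q [[q0 _ _] q1 _] _] := hspec m hm; exists (1 : S) => s0.
    by apply: q1; rewrite s0.
  - exact: R1'.
  by split=> [//|x y -> ->|a x ->]; rewrite ?addr0 ?mulr0.
have [n hn hn'] := flat_dim_resolution noeth mf S1 fd.
have [-> [P [e he]]] := proj_dimE noeth mf S1 hn hn'.
exact: (transfer IC IX noeth fgC fgX sdC he (pres_psupp hspec he) hn' R1').
Qed.
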